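(* The $\mathbb{T}_{>0}$-algebra $\mathbb{M}$ of $A$-modular forms is finitely generated of dimension three. Moreover, $\mathbb{M}=\mathbb{T}_{>0}[g,\boldsymbol h_0,\boldsymbol h_1,\ldots,\boldsymbol h_q]$.
   Context: Basic setting. Let $q=p^e$ be a power of a prime $p$, $A=\mathbb{F}_q[\theta]$, $K=\mathbb{F}_q(\theta)$, $|x|=q^{\deg_\theta x}$ on $K$, $K_\infty=\mathbb{F}_q((1/\theta))$, $C$ the completion of an algebraic closure of $K_\infty$. Let $\Omega=C\setminus K_\infty$ and $\Gamma=\mathbf{GL}_2(A)$ (determinant in $\mathbb{F}_q^*$), acting on $\Omega$ by $\gamma(z)=\frac{az+b}{cz+d}$. Let $e_{\mathrm{Car}}(z)=\sum_{i\ge0}z^{q^i}/d_i$ with $d_0=1$, $d_i=[i][i-1]^q\cdots[1]^{q^{i-1}}$, $[i]=\theta^{q^i}-\theta$ (Carlitz exponential); fix $\tilde\pi$ with $\ker e_{\mathrm{Car}}=\tilde\pi A$; put $u=u(z)=1/e_{\mathrm{Car}}(\tilde\pi z)$. A Drinfeld modular form of weight $w\ge 0$ and type $m\in\mathbb{Z}/(q-1)\mathbb{Z}$ is a rigid analytic $f:\Omega\to C$ with $f(\gamma(z))=(cz+d)^w(\det\gamma)^{-m}f(z)$ for all $\gamma=\begin{pmatrix}a&b\\c&d\end{pmatrix}\in\Gamma$, holomorphic at infinity (i.e. $A$-periodic and equal to a convergent series $\sum_{n\ge0}f_nu^n$ for $|u(z)|$ small). Classical forms. For $z\in\Omega$ let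 $\Lambda_z=A+zA$ and $e_z=e_{\Lambda_z}$ its exponential function, $e_z(\zeta)=\zeta\prod_{0\ne\lambda\in\Lambda_z}(1-\zeta/\lambda)$. The associated Drinfeld module satisfies $\Phi_z(\theta)=\theta\tau^0+\tilde\pi^{q-1}g(z)\tau+\tilde\pi^{q^2-1}\Delta(z)\tau^2$ ($\tau:x\mapsto x^q$), which defines $g,\Delta$. The function $h$ is the unique Drinfeld modular form of weight $q+1$ and type $1$ with $u$-expansion $-u+\cdots$; one has $\Delta=-h^{q-1}$. Series. Let $t$ be an indeterminate; $\mathbb{T}_{>0}\subset C[[t]]$ is the $C$-algebra of series with positive convergence radius. For $f=\sum_i f_it^i\in C[[t]]$ and $k\in\mathbb{Z}$, $f^{(k)}=\sum_i f_i^{q^k}t^i$; for $\boldsymbol f:\Omega\to C[[t]]$, $\boldsymbol f^{(k)}(z)=\boldsymbol f(z)^{(k)}$, and $\boldsymbol f(z)$ is also written $\boldsymbol f(z,t)$. Put $$\boldsymbol s_{\mathrm{Car}}=\sum_{i\ge0}e_{\mathrm{Car}}(\tilde\pi/\theta^{i+1})t^i,\quad \boldsymbol s_1(z)=\sum_{i\ge0}e_z(z/\theta^{i+1})t^i,\quad \boldsymbol s_2(z)=\sum_{i\ge0}e_z(1/\theta^{i+1})t^i,$$ which are units in $\mathbb{T}_{>0}$. For $i=0,\ldots,q$ define $\boldsymbol h_i=\tilde\pi^i\boldsymbol s_{\mathrm{Car}}^{-i}\,h\,\boldsymbol s_2^i$ (so $\boldsymbol h_0=h$). For $a=a(\theta)\in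 A$ write $\overline a=a(t)\in\mathbb{F}_q[t]$. For $\gamma=\begin{pmatrix}a&b\\c&d\end{pmatrix}\in\Gamma$ and $z\in\Omega$ let $$J_\gamma=cz+d,\quad \boldsymbol J_\gamma=\overline c\,\frac{\boldsymbol s_1}{\boldsymbol s_2}+\overline d,\quad \boldsymbol L_\gamma=\frac{\overline c}{(\theta-t)(\overline c\,\boldsymbol s_1+\overline d\,\boldsymbol s_2)}.$$ Regular functions. $\boldsymbol f:\Omega\to C[[t]]$ is regular if: (1) there is $r>0$ such that for all $z\in\Omega$ the series $\boldsymbol f(z,t)$ converges at all $t_0\in C$, $|t_0|<r$; (2) there is $\varepsilon>0$ such that for all $t_0\in C$ with $|t_0|<\varepsilon$, $z\mapsto\boldsymbol f(z,t_0)$ is holomorphic on $\Omega$; (3) $\boldsymbol f(z+a)=\boldsymbol f(z)$ for all $a\in A$, and there is $c>0$ such that for $|u(z)|<c$ and $|t|<c$ there is a convergent expansion $\boldsymbol f(z,t)=\sum_{n,m\ge0}c_{n,m}t^nu^m$, $c_{n,m}\in C$. The set $\boldsymbol{\mathcal O}$ of regular functions is a $\mathbb{T}_{>0}$-algebra. $A$-modular forms. For $(\mu,\nu,m)\in\mathbb{Z}^2\times\mathbb{Z}/(q-1)\mathbb{Z}$ and $l\ge0$, $\widehat{\mathcal M}^{\le l}_{\mu,\nu,m}$ is the $\mathbb{T}_{>0}$-module of regular functions $\boldsymbol f$ for which there exist $\boldsymbol f_0,\dots,\boldsymbol f_l\in\boldsymbol{\mathcal O}$ with $$\boldsymbol f(\gamma(z),t)=\det(\gamma)^{-m}J_\gamma^\mu\boldsymbol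 J_\gamma^\nu\sum_{i\le l}\boldsymbol f_i\boldsymbol L_\gamma^i\qquad(\gamma\in\Gamma,\ z\in\Omega).$$ $\widehat{\mathcal M}$ is the $\mathbb{T}_{>0}$-algebra generated by all the modules $\widehat{\mathcal M}^{\le l}_{\mu,\nu,m}$. An $A$-modular form of weight $(\mu,\nu)$ and type $m$ is an element $\boldsymbol f\in\widehat{\mathcal M}^{\le 0}_{\mu,\nu,m}$ such that $\boldsymbol f^{(k)}\in\widehat{\mathcal M}$ for all $k\ge0$. $\mathbb{M}$ is the $\mathbb{T}_{>0}$-algebra generated by all $A$-modular forms. The dimension of such a $\mathbb{T}_{>0}$-algebra is the maximal number of elements algebraically independent over $\mathbb{T}_{>0}$. *)

(* Defs.v *)
From HB Require Import structures.
From mathcomp Require Import all_boot all_order all_algebra.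
From mathcomp Require Import finmap.
(* mpoly's notations clash with those of MathComp-Analysis. *)
From mathcomp Require Import -(notations) mpoly.
From mathcomp Require Import all_classical all_reals all_analysis.
From mathcomp Require summability.

Set Implicit Arguments.
Unset Strict Implicit.
Unset Printing Implicit Defensive.
Import Order.TTheory GRing.Theory Num.Theory.
Import numFieldNormedType.Exports.
Local Open Scope classical_set_scope.
Local Open Scope ring_scope.

(* The ring K[[t]].  It is wrapped in a record because [nat -> K] already
   carries the pointwise product. *)
Record fps (K : Type) := Fps { fcoef : nat -> K }.

Section FpsRing.
Variable K : fieldType.
Implicit Types f g h : fps K.

Lemma fps_coefK : cancel (@fcoef K) (@Fps K).
Proof. by case. Qed.

HB.instance Definition _ := Choice.copy (fps K) (can_type fps_coefK).

Lemma fpsP f g : fcoef f =1 fcoef g -> f = g.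
Proof. by case: f g => [f] [g] /= /funext ->. Qed.

Definition fpsC (c : K) : fps K := Fps (fun i => c *+ (i == 0)%N).
Definition fpsX : fps K := Fps (fun i => (i == 1)%:R).

Definition fps_add f g := Fps (fun i => fcoef f i + fcoef g i).
Definition fps_opp f := Fps (fun i => - fcoef f i).
Definition fps_mul f g :=
  Fps (fun n => \sum_(i < n.+1) fcoef f i * fcoef g (n - i)%N).

Let trunc n f : {poly K} := \poly_(i < n.+1) fcoef f i.

Lemma fps_addA : associative fps_add.
Proof. by move=> f g h; apply: fpsP => i /=; rewrite addrA. Qed.
Lemma fps_addC : commutative fps_add.
Proof. by move=> f g; apply: fpsP => i /=; rewrite addrC. Qed.
Lemma fps_add0 : left_id (fpsC 0) fps_add.
Proof. by move=> f; apply: fpsP => i /=; rewrite mul0rn add0r. Qed.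
Lemma fps_addN : left_inverse (fpsC 0) fps_opp fps_add.
Proof. by move=> f; apply: fpsP => i /=; rewrite mul0rn addNr. Qed.

HB.instance Definition _ :=
  GRing.isZmodule.Build (fps K) fps_addA fps_addC fps_add0 fps_addN.

Let coef_trunc n f i : (i <= n)%N -> (trunc n f)`_i = fcoef f i.
Proof. by move=> le_in; rewrite coef_poly ltnS le_in. Qed.

Let coef_truncM n f g i : (i <= n)%N ->
  fcoef (fps_mul f g) i = (trunc n f * trunc n g)`_i.
Proof.
move=> le_in; rewrite coefM; apply: eq_bigr => j _.
by rewrite !coef_trunc // (leq_trans _ le_in) ?leq_subr // leq_ord.
Qed.

Lemma fps_mulA : associative fps_mul.
Proof.
move=> f g h; apply: fpsP => n.
transitivity ((trunc n f * (trunc n g * trunc n h))`_n).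
  rewrite coefM; apply: eq_bigr => i _.
  by rewrite (coef_trunc _ (leq_ord i)) -(coef_truncM _ _ (leq_subr i n)).
rewrite mulrA coefM; apply: eq_bigr => i _.
by rewrite -(coef_truncM _ _ (leq_ord i)) (coef_trunc _ (leq_subr i n)).
Qed.

Lemma fps_mulC : commutative fps_mul.
Proof.
by move=> f g; apply: fpsP => n; rewrite !(coef_truncM _ _ (leqnn n)) mulrC.
Qed.

Lemma fps_mul1 : left_id (fpsC 1) fps_mul.
Proof.
move=> f; apply: fpsP => n /=; rewrite big_ord_recl /= mul1r subn0.
by rewrite big1 ?addr0 // => i _; rewrite mul0r.
Qed.

Lemma fps_mulDl : left_distributive fps_mul fps_add.
Proof.
move=> f g h; apply: fpsP => n /=; rewrite -big_split /=.
by apply: eq_bigr => i _; rewrite mulrDl.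
Qed.

Lemma fps_1neq0 : fpsC 1 != 0.
Proof. by apply/eqP => /(congr1 (fun f => fcoef f 0)) /eqP /=; rewrite oner_eq0. Qed.

HB.instance Definition _ := GRing.Zmodule_isComNzRing.Build (fps K)
  fps_mulA fps_mulC fps_mul1 fps_mulDl fps_1neq0.

(* The first [n] coefficients of the inverse of [f]. *)
Fixpoint fps_inv_seq f n : seq K :=
  if n is m.+1 then
    let s := fps_inv_seq f m in
    rcons s ((fcoef f 0)^-1 *
             ((m == 0)%:R - \sum_(j < m) fcoef f (m - j)%N * s`_j))
  else [::].

Definition fps_unit : pred (fps K) := fun f => fcoef f 0 != 0.
Definition fps_inv f :=
  if fps_unit f then Fps (fun n => (fps_inv_seq f n.+1)`_n) else f.

Let size_inv_seq f n : size (fps_inv_seq f n) = n.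
Proof. by elim: n => //= n IHn; rewrite size_rcons IHn. Qed.

Let nth_inv_seq f n i : (i < n)%N ->
  (fps_inv_seq f n)`_i = (fps_inv_seq f i.+1)`_i.
Proof.
elim: n => // n IHn; rewrite ltnS leq_eqVlt => /predU1P[-> //|lt_in].
by rewrite [in LHS]/= nth_rcons size_inv_seq lt_in IHn.
Qed.

Lemma fps_mulVr : {in fps_unit, left_inverse 1 fps_inv *%R}.
Proof.
move=> f uf; have f0 : fcoef f 0 != 0 by [].
apply: fpsP => n; rewrite /fps_inv ifT // mulrC.
change (\sum_(i < n.+1) fcoef f i * (fps_inv_seq f (n - i).+1)`_(n - i) =
        1 *+ (n == 0)%N).
rewrite big_ord_recl subn0 [X in _ * X + _]/= nth_rcons size_inv_seq ltnn eqxx.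
rewrite mulVKf //; suff -> : \sum_(j < n) fcoef f (n - j) * (fps_inv_seq f n)`_j
  = \sum_(i < n) fcoef f (lift ord0 i) *
      (fps_inv_seq f (n - lift ord0 i).+1)`_(n - lift ord0 i) by rewrite subrK.
rewrite (reindex_inj rev_ord_inj) /=; apply: eq_bigr => i _.
by rewrite nth_inv_seq ?subKn ?lift0 // rev_ord_proof.
Qed.

Lemma fps_unitP f g : g * f = 1 -> fps_unit f.
Proof.
move=> /(congr1 (fun h => fcoef h 0)) /=; rewrite big_ord_recl big_ord0 addr0 /=.
move=> gf1; apply/eqP => f0; move/eqP: gf1.
by rewrite f0 mulr0 eq_sym oner_eq0.
Qed.

Lemma fps_inv_out : {in [predC fps_unit], fps_inv =1 id}.
Proof. by move=> f /negbTE nuf; rewrite /fps_inv [fps_unit f]nuf. Qed.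

HB.instance Definition _ :=
  GRing.ComNzRing_hasMulInverse.Build (fps K) fps_mulVr fps_unitP fps_inv_out.

End FpsRing.

(* A field extending A = F_q[theta] (with F = F_q) together with a
   multiplicative non-archimedean absolute value such that
   |a| = q ^ deg_theta a on A. *)
Record valuedField (F : finFieldType) (R : realType) := ValuedField {
  vf_car :> fieldType;
  vf_scal : {rmorphism F -> vf_car};
  theta : vf_car;
  absv : vf_car -> R;
  absv_ge0 : forall x, 0 <= absv x;
  absv_eq0 : forall x, (absv x == 0) = (x == 0);
  absvM : forall x y, absv (x * y) = absv x * absv y;
  absv_ultra : forall x y, absv (x + y) <= Num.max (absv x) (absv y);
  absv_poly : forall a : {poly F}, a != 0 ->
    absv (map_poly vf_scal a).[theta] = #|F|%:R ^+ (size a).-1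
}.
Arguments theta {F R} _.
Arguments absv {F R} [_] _.

Section Drinfeld.
Variables (F : finFieldType) (R : realType) (C : valuedField F R).

Local Notation q := #|F|.
Local Notation theta := (theta C).

Definition evA (a : {poly F}) : C := (map_poly (@vf_scal F R C) a).[theta].

Definition limto {T : Type} (G : set_system T) (f : T -> C) (l : C) : Prop :=
  (fun x => absv (f x - l)) @ G --> (0 : R).

Definition has_sum (a : nat -> C) (l : C) : Prop :=
  limto \oo (fun n => \sum_(i < n) a i) l.
(* 0 if the series diverges *)
Definition Csum (a : nat -> C) : C := xget 0 [set l | has_sum a l].

(* K_infty = F_q((1/theta)) *)
Definition Kinf : set C := [set x | exists (N : nat) (a : nat -> F),
  has_sum (fun i => @vf_scal F R C (a i) * (theta ^+ N / theta ^+ i)) x].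

Definition alg_over_Kinf : set C := [set x | exists P : {poly C},
  [/\ P != 0, forall i, Kinf P`_i & root P x]].

Definition Ccomplete : Prop := forall v : nat -> C,
  (forall eps : R, 0 < eps -> exists N, forall m n, (N <= m)%N -> (N <= n)%N ->
     absv (v m - v n) < eps) ->
  exists l, limto \oo v l.

(* C is the completion of an algebraic closure of K_infty; the algebraic
   closure is the field of the elements of C algebraic over K_infty.  This
   determines C up to isometric isomorphism. *)
Definition is_completed_closure : Prop :=
  [/\ Ccomplete, GRing.closed_field_axiom C &
      forall (x : C) (eps : R), 0 < eps ->
        exists2 y, alg_over_Kinf y & absv (x - y) < eps].

Definition Omega : Type := {z : C | ~ Kinf z}.

(* [i] and d_i = [i] [i-1]^q ... [1]^(q^(i-1)) *)
Definition bracket (i : nat) : C := theta ^+ (q ^ i) - theta.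
Definition dcar (i : nat) : C := \prod_(j < i) bracket (i - j)%N ^+ (q ^ j).
Definition eCar (x : C) : C := Csum (fun i => x ^+ (q ^ i) / dcar i).

Definition is_period (pi : C) : Prop :=
  forall x, eCar x = 0 <-> exists a : {poly F}, x = pi * evA a.

Definition lattice_elt (z : C) (ab : {poly F} * {poly F}) : C :=
  evA ab.1 + evA ab.2 * z.

(* The product over Lambda_z \ {0} is unordered: a limit along the finite
   subsets of A x A, which parametrizes Lambda_z bijectively. *)
Definition eLat (z : Omega) (x : C) : C :=
  x * xget 0 [set l | limto summability.totally
    (fun S : {fset {poly F} * {poly F}} =>
       \prod_(ab <- S | lattice_elt (sval z) ab != 0) (1 - x / lattice_elt (sval z) ab)) l].

Definition upar (pi : C) (z : Omega) : C := (eCar (pi * sval z))^-1.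

(* The affinoids |z| <= q^n, inf_{k in K_infty} |z - k| >= q^(-n) form an
   admissible covering of Omega. *)
Definition affinoid (n : nat) : set Omega :=
  [set z | absv (sval z) <= q%:R ^+ n /\
           forall k, Kinf k -> q%:R ^- n <= absv (sval z - k)].

(* Rigid analytic: on each affinoid of the covering, a uniform limit of
   rational functions without poles there. *)
Definition holomorphic (f : Omega -> C) : Prop :=
  forall (n : nat) (eps : R), 0 < eps -> exists P Q : {poly C},
    forall z, affinoid n z -> Q.[sval z] != 0 /\ absv (f z - P.[sval z] / Q.[sval z]) < eps.

(* Gamma = GL_2(A) acting on Omega.  [moebius_rel gam z w] says
   w = gam(z); Omega being stable, such a w exists for all gam and z. *)
Definition autJ (gam : 'M[{poly F}]_2) (z : Omega) : C :=
  evA (gam 1 0) * sval z + evA (gam 1 1).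
Definition moebius_rel (gam : 'M[{poly F}]_2) (z w : Omega) : Prop :=
  sval w = (evA (gam 0 0) * sval z + evA (gam 0 1)) / autJ gam z.

Definition A_periodic (T : Type) (f : Omega -> T) : Prop :=
  forall (a : {poly F}) (z w : Omega), sval w = sval z + evA a -> f w = f z.

Definition u_expansion (pi : C) (f : Omega -> C) (a : nat -> C) : Prop :=
  exists2 c : R, 0 < c & forall z, absv (upar pi z) < c ->
    has_sum (fun n => a n * upar pi z ^+ n) (f z).

(* A type in Z/(q-1)Z is given by any integer m representing it: det gam lies
   in F_q^*, so its power -m only depends on the class of m. *)
Definition modular_form (pi : C) (w : nat) (m : int) (f : Omega -> C) : Prop :=
  [/\ holomorphic f,
      forall gam z z', gam \in unitmx -> moebius_rel gam z z' ->
        f z' = autJ gam z ^+ w * evA (\det gam) ^ (- m) * f z,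
      A_periodic f &
      exists a, u_expansion pi f a].

(* g and Delta are the coefficients of Phi_z(theta), where Phi_z is the
   Drinfeld module of Lambda_z: e_z(theta x) = Phi_z(theta)(e_z(x)). *)
Definition is_g_Delta (pi : C) (g Delta : Omega -> C) : Prop :=
  forall (z : Omega) (x : C),
    eLat z (theta * x) = theta * eLat z x
      + pi ^+ (q - 1) * g z * eLat z x ^+ q
      + pi ^+ (q ^ 2 - 1) * Delta z * eLat z x ^+ (q ^ 2).

Definition is_h (pi : C) (h : Omega -> C) : Prop :=
  modular_form pi q.+1 1 h /\
  exists a, [/\ u_expansion pi h a, a 0%N = 0 & a 1%N = -1].

Definition has_eval (f : fps C) (t : C) (l : C) : Prop :=
  has_sum (fun i => fcoef f i * t ^+ i) l.
Definition eval (f : fps C) (t : C) : C :=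
  Csum (fun i => fcoef f i * t ^+ i).

Definition Tpos : set (fps C) := [set f | exists2 r : R, 0 < r &
  forall t, absv t < r -> exists l, has_eval f t l].

Definition twist (k : nat) (f : fps C) : fps C :=
  Fps (fun i => fcoef f i ^+ (q ^ k)).

Definition bar (a : {poly F}) : fps C := Fps (fun i => @vf_scal F R C a`_i).

Definition sCar (pi : C) : fps C := Fps (fun i => eCar (pi / theta ^+ i.+1)).
Definition s1 (z : Omega) : fps C := Fps (fun i => eLat z (sval z / theta ^+ i.+1)).
Definition s2 (z : Omega) : fps C := Fps (fun i => eLat z (1 / theta ^+ i.+1)).

Definition hvec (pi : C) (h : Omega -> C) (i : nat) (z : Omega) : fps C :=
  fpsC pi ^+ i * sCar pi ^- i * fpsC (h z) * s2 z ^+ i.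

Definition bJ (gam : 'M[{poly F}]_2) (z : Omega) : fps C :=
  bar (gam 1 0) * (s1 z / s2 z) + bar (gam 1 1).
Definition bL (gam : 'M[{poly F}]_2) (z : Omega) : fps C :=
  bar (gam 1 0) / ((fpsC theta - fpsX C) *
                   (bar (gam 1 0) * s1 z + bar (gam 1 1) * s2 z)).

(* The double series in the last condition is summed unordered, i.e. along
   the finite sets of pairs (n, m). *)
Definition regular (pi : C) : set (Omega -> fps C) := [set f |
  [/\ exists2 r : R, 0 < r & forall z t, absv t < r ->
        exists l, has_eval (f z) t l,
      exists2 eps : R, 0 < eps & forall t, absv t < eps ->
        holomorphic (fun z => eval (f z) t),
      A_periodic f &
      exists (c : R) (a : nat -> nat -> C), 0 < c /\
        forall z t, absv (upar pi z) < c -> absv t < c ->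
          limto summability.totally (fun S : {fset nat * nat} =>
            \sum_(nm <- S) a nm.1 nm.2 * t ^+ nm.1 * upar pi z ^+ nm.2)
            (eval (f z) t)]].

Definition Mhat_le (pi : C) (l : nat) (mu nu m : int) : set (Omega -> fps C) :=
  [set f | regular pi f /\
    exists fs : 'I_l.+1 -> Omega -> fps C,
      (forall i, regular pi (fs i)) /\
      forall gam z z', gam \in unitmx -> moebius_rel gam z z' ->
        f z' = fpsC (evA (\det gam)) ^ (- m) * fpsC (autJ gam z) ^ mu *
               bJ gam z ^ nu * \sum_(i < l.+1) fs i z * bL gam z ^+ i].

Definition Tsubalgebra (B : set (Omega -> fps C)) : Prop :=
  [/\ forall c, Tpos c -> B (cst c),
      forall f g, B f -> B g -> B (f + g) &
      forall f g, B f -> B g -> B (f * g)].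

Definition Talg (S : set (Omega -> fps C)) : set (Omega -> fps C) :=
  smallest Tsubalgebra S.

Definition Mhat (pi : C) : set (Omega -> fps C) :=
  Talg [set f | exists l mu nu m, Mhat_le pi l mu nu m f].

Definition A_modular_form (pi : C) (mu nu m : int) : set (Omega -> fps C) :=
  [set f | Mhat_le pi 0 mu nu m f /\
           forall k, Mhat pi (fun z => twist k (f z))].

Definition MM (pi : C) : set (Omega -> fps C) :=
  Talg [set f | exists mu nu m, A_modular_form pi mu nu m f].

Definition alg_indep (n : nat) (x : 'I_n -> Omega -> fps C) : Prop :=
  forall P : mpoly.mpoly n (fps C),
    (forall mon, Tpos (mpoly.mcoeff mon P)) ->
    (forall z, mpoly.meval (fun i => x i z) P = 0) -> P = 0.

Definition has_dim (B : set (Omega -> fps C)) (d : nat) : Prop :=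
  (exists x : 'I_d -> Omega -> fps C, (forall i, B (x i)) /\ alg_indep x) /\
  (forall n (x : 'I_n -> Omega -> fps C),
     (forall i, B (x i)) -> alg_indep x -> (n <= d)%N).

Definition Tfin_gen (B : set (Omega -> fps C)) : Prop :=
  exists2 S, finite_set S & B = Talg S.

End Drinfeld.

(* Main.v *)
(** Write e_z for the lattice exponential and psi = s_1 s_2^(1) - s_1^(1) s_2, a
    Moore determinant whose constant term M is, up to a factor, 1/h: a rigid
    analytic function invariant up to units under GL_2(A) and bounded near the
    cusp is constant (compare its sup norms on the annuli |z| = q^n), so h M and
    h psi do not depend on z.  The recursion (t - theta) s_2 = pi^(q-1) g s_2^(1)
    + pi^(q^2-1) Delta s_2^(2) and the cocycle of s_2^(1) show that g and the h_i
    are A-modular forms.  Conversely, let f be A-modular of weight (mu, nu).  The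
    pairs (J, bold J), for a fixed z and varying gamma, are algebraically
    independent, so f^(1) in Mhat forces nu >= 0 (or f = 0) and (psi / s_2^(1))^nu
    f^(1) regular.  Then f / s_2^nu is a regular form of weight (mu + nu, 0) which
    vanishes at the cusp to an order N with q N >= nu; dividing by h^N and
    subtracting multiples of powers of g one reaches negative weights, where all
    forms vanish.  Hence f lies in the algebra spanned by g and by the h^N s_2^nu
    with nu <= q N, which is generated by g, h_0, ..., h_q. *)
Require Import Defs.
From HB Require Import structures.
From mathcomp Require Import all_boot all_order all_algebra all_field.
From mathcomp Require Import finmap.
From mathcomp Require Import -(notations) mpoly.
From mathcomp Require Import all_classical all_reals all_analysis.
From mathcomp Require summability.
From mathcomp Require Import ring lra zify.

Set Implicit Arguments.
Unset Strict Implicit.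
Unset Printing Implicit Defensive.
Import Order.TTheory GRing.Theory Num.Theory.
Import numFieldNormedType.Exports.
Local Open Scope classical_set_scope.
Local Open Scope ring_scope.

(** The comparison of sup norms is a convexity argument on the Bruhat-Tits tree. The norm of a
    linear factor is, in the multiplicative sense, subharmonic at each vertex. Hence the (q+1)-st
    power of the norm of an analytic function at a vertex is at most the product of the norms at its
    q + 1 neighbours, with an extra factor q if the function has a zero there. Modulo GL_2(A) the
    tree is a half-line on which q of the neighbours coincide; the norms are then nondecreasing, and
    a zero at the origin forces geometric growth. Additivity of e_z is drawn from the equation
    defining g and Delta rather than from its product: an error term divided by powers of theta
    shrinks faster than the equation can enlarge it again. Regularity asks for one radius in t valid
    for all z, and none is at hand for s_2^-1; this is why division by s_2^nu passes through z ->
    1/z and a power of psi. The factor q in q N >= nu comes from the twist, which raises every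
    coefficient to its q-th power. *)

Section Ultrametric.
Variables (F : finFieldType) (R : realType) (C : valuedField F R).
Local Notation q := #|F|.
Local Notation th := (theta C).
Local Notation scal := (@vf_scal F R C).
Local Notation evA := (@evA F R C).
Implicit Types (x y z : C) (a b : {poly F}).

(** * Ultrametric absolute values and the q-Frobenius of C *)

Lemma q_gt1 : (1 < q)%N.
Proof. exact: finRing_gt1. Qed.

Lemma q_gt0 : (0 < q)%N.
Proof. exact: ltnW q_gt1. Qed.

Lemma qR_gt1 : 1 < q%:R :> R.
Proof. by rewrite ltr1n q_gt1. Qed.

Lemma qR_gt0 : 0 < q%:R :> R.
Proof. by rewrite ltr0n q_gt0. Qed.

Lemma absv0 : absv (0 : C) = 0.
Proof. by apply/eqP; rewrite absv_eq0. Qed.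

Lemma absv_gt0 x : (0 < absv x) = (x != 0).
Proof. by rewrite lt_def absv_ge0 absv_eq0 andbT. Qed.

Lemma absv1 : absv (1 : C) = 1.
Proof.
have : absv (1 : C) * absv (1 : C) = absv (1 : C) * 1 by rewrite -absvM !mulr1.
by apply: mulfI; rewrite absv_eq0 oner_eq0.
Qed.

Lemma absvX x n : absv (x ^+ n) = absv x ^+ n.
Proof. by elim: n => [|n IHn]; rewrite ?expr0 ?absv1 // !exprS absvM IHn. Qed.

Lemma absvN x : absv (- x) = absv x.
Proof.
suff N1 : absv (- 1 : C) = 1 by rewrite -mulN1r absvM N1 mul1r.
have : absv (- 1 : C) ^+ 2 = 1 by rewrite -absvX sqrrN expr1n absv1.
by move=> /eqP; rewrite pexpr_eq1 ?absv_ge0 // => /eqP.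
Qed.

Lemma absvV x : absv x^-1 = (absv x)^-1.
Proof.
have [->|x0] := eqVneq x 0; first by rewrite invr0 absv0 invr0.
apply: (mulfI (_ : absv x != 0)); first by rewrite absv_eq0.
by rewrite -absvM !divff ?absv_eq0 // absv1.
Qed.

Lemma absvXz x (n : int) : absv (x ^ n) = absv x ^ n.
Proof. by case: n => n /=; rewrite ?NegzE -?exprnN ?exprnP ?absvV absvX. Qed.

Lemma absv_distC x y : absv (x - y) = absv (y - x).
Proof. by rewrite -absvN opprB. Qed.

Lemma absv_prod (I : Type) (r : seq I) (P : pred I) (f : I -> C) :
  absv (\prod_(i <- r | P i) f i) = \prod_(i <- r | P i) absv (f i).
Proof. exact: (big_morph (@absv F R C) (@absvM F R C) absv1). Qed.

Lemma absvD_le x y (B : R) : absv x <= B -> absv y <= B -> absv (x + y) <= B.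
Proof. by move=> xB yB; apply: le_trans (absv_ultra _ _) _; rewrite ge_max xB. Qed.

Lemma absvB_le x y (B : R) : absv x <= B -> absv y <= B -> absv (x - y) <= B.
Proof. by move=> xB yB; apply: absvD_le; rewrite ?absvN. Qed.

Lemma absvD_lt x y (B : R) : absv x < B -> absv y < B -> absv (x + y) < B.
Proof. by move=> xB yB; apply: le_lt_trans (absv_ultra _ _) _; rewrite gt_max xB. Qed.

Lemma absvB_lt x y (B : R) : absv x < B -> absv y < B -> absv (x - y) < B.
Proof. by move=> xB yB; apply: absvD_lt; rewrite ?absvN. Qed.

Lemma absv_sum_le (I : Type) (r : seq I) (P : pred I) (f : I -> C) (B : R) :
  0 <= B -> (forall i, P i -> absv (f i) <= B) ->
  absv (\sum_(i <- r | P i) f i) <= B.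
Proof.
move=> B0 fB; apply: (big_ind (fun x => absv x <= B)) => //.
- by rewrite absv0.
- by move=> x y; apply: absvD_le.
Qed.

Lemma absv_sum_lt (I : Type) (r : seq I) (P : pred I) (f : I -> C) (B : R) :
  0 < B -> (forall i, P i -> absv (f i) < B) ->
  absv (\sum_(i <- r | P i) f i) < B.
Proof.
move=> B0 fB; apply: (big_ind (fun x => absv x < B)) => //.
- by rewrite absv0.
- by move=> x y; apply: absvD_lt.
Qed.

Lemma absvD_eqr x y : absv x < absv y -> absv (x + y) = absv y.
Proof.
move=> xy; apply/eqP; rewrite eq_le absvD_le ?(ltW xy) //=.
rewrite leNgt; apply/negP => lt.
have : absv (- x + (x + y)) < absv y by apply: absvD_lt; rewrite ?absvN.
by rewrite addKr ltxx.
Qed.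

Lemma absvD_eql x y : absv y < absv x -> absv (x + y) = absv x.
Proof. by rewrite addrC; apply: absvD_eqr. Qed.

Lemma absvB_eqr x y : absv x < absv y -> absv (x - y) = absv y.
Proof. by rewrite -[absv y]absvN; apply: absvD_eqr. Qed.

Lemma absvB_eql x y : absv y < absv x -> absv (x - y) = absv x.
Proof. by rewrite -[absv y]absvN; apply: absvD_eql. Qed.

Lemma evA_is_zmod_morphism : zmod_morphism evA.
Proof. by move=> a b; rewrite /Defs.evA rmorphB hornerD hornerN. Qed.
Lemma evA_is_monoid_morphism : monoid_morphism evA.
Proof. by split=> [|a b]; rewrite /Defs.evA ?rmorph1 ?hornerC // rmorphM hornerM. Qed.
HB.instance Definition _ := GRing.isZmodMorphism.Build {poly F} C evA evA_is_zmod_morphism.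
HB.instance Definition _ := GRing.isMonoidMorphism.Build {poly F} C evA evA_is_monoid_morphism.

Lemma evAC (c : F) : evA c%:P = scal c.
Proof. by rewrite /Defs.evA map_polyC hornerC. Qed.
Lemma evAX : evA 'X = th.
Proof. by rewrite /Defs.evA map_polyX hornerX. Qed.

Lemma absv_evA a : a != 0 -> absv (evA a) = q%:R ^+ (size a).-1.
Proof. exact: absv_poly. Qed.

Lemma absv_evA_ge1 a : a != 0 -> 1 <= absv (evA a).
Proof. by move=> a0; rewrite absv_evA // exprn_ege1 // ltW ?qR_gt1. Qed.

Lemma evA_eq0 a : (evA a == 0) = (a == 0).
Proof.
have [->|a0] := eqVneq a 0; first by rewrite rmorph0 eqxx.
by rewrite -absv_eq0 gt_eqF // (lt_le_trans ltr01) ?absv_evA_ge1.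
Qed.

Lemma evA_inj : injective evA.
Proof.
by move=> a b /eqP; rewrite -subr_eq0 -rmorphB evA_eq0 subr_eq0 => /eqP.
Qed.

Lemma absv_th : absv th = q%:R.
Proof. by rewrite -evAX absv_evA ?polyX_eq0 // size_polyX. Qed.

Lemma th_neq0 : th != 0.
Proof. by rewrite -absv_eq0 absv_th gt_eqF ?qR_gt0. Qed.

Lemma absv_scal (c : F) : absv (scal c) = (c != 0)%:R.
Proof.
have [->|c0] := eqVneq c 0; first by rewrite rmorph0 absv0.
by rewrite -evAC absv_evA ?polyC_eq0 // size_polyC c0.
Qed.

Lemma absv_scal_le1 (c : F) : absv (scal c) <= 1.
Proof. by rewrite absv_scal; case: eqP. Qed.

Lemma pchar_vf p : (p \in [pchar C]) = (p \in [pchar F]).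
Proof. by rewrite (fmorph_pchar scal). Qed.

Lemma q_pchar (k : nat) : [pchar C].-nat (q ^ k)%N.
Proof.
have [p pr_p chF] := finPcharP F.
rewrite (card_pprimeChar chF) -expnM (eq_pnat _ (pcharf_eq (_ : p \in [pchar C]))).
  by rewrite pnatX pnat_id.
by rewrite pchar_vf.
Qed.

Lemma FrobD k x y : (x + y) ^+ (q ^ k) = x ^+ (q ^ k) + y ^+ (q ^ k).
Proof. exact/exprDn_pchar/q_pchar. Qed.

Lemma FrobqD x y : (x + y) ^+ q = x ^+ q + y ^+ q.
Proof. by have := FrobD 1 x y; rewrite expn1. Qed.

Lemma qk_gt0 k : (0 < q ^ k)%N.
Proof. by rewrite expn_gt0 q_gt0. Qed.

Lemma Frob0 k : (0 : C) ^+ (q ^ k) = 0.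
Proof. by rewrite expr0n eqn0Ngt qk_gt0. Qed.

Lemma FrobN k x : (- x) ^+ (q ^ k) = - x ^+ (q ^ k).
Proof. by apply/eqP; rewrite -subr_eq0 opprK -FrobD addNr Frob0. Qed.

Lemma FrobB k x y : (x - y) ^+ (q ^ k) = x ^+ (q ^ k) - y ^+ (q ^ k).
Proof. by rewrite FrobD FrobN. Qed.

Lemma Frob_sum k (I : Type) (r : seq I) (P : pred I) (f : I -> C) :
  (\sum_(i <- r | P i) f i) ^+ (q ^ k) = \sum_(i <- r | P i) f i ^+ (q ^ k).
Proof. by apply: (big_morph (fun x => x ^+ (q ^ k))) => [x y|]; rewrite ?FrobD ?Frob0. Qed.

Lemma scal_Frob k (c : F) : scal c ^+ (q ^ k) = scal c.
Proof. by rewrite -rmorphXn; congr (scal _); elim: k => [|k IHk]; rewrite ?expr1 // expnS exprM expf_card IHk. Qed.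

Lemma scal_Frobq (c : F) : scal c ^+ q = scal c.
Proof. by have := scal_Frob 1 c; rewrite expn1. Qed.

(* Homogenized form of X^q - X = prod_(c in F) (X - c) *)
Lemma prod_scal x y : \prod_(c : F) (x - scal c * y) = x ^+ q - y ^+ (q - 1) * x.
Proof.
have [->|y0] := eqVneq y 0.
  rewrite (eq_bigr (fun=> x)) => [|c _]; last by rewrite mulr0 subr0.
  by rewrite prodr_const expr0n subn_eq0 leqNgt q_gt1 mul0r subr0.
have := finField_genPoly F => /(congr1 (fun P => (map_poly scal P).[x / y])).
rewrite rmorphB rmorphXn /= map_polyX rmorph_prod horner_prod !hornerE => /esym E.
have -> : \prod_(c : F) (x - scal c * y) = y ^+ q * \prod_(c : F) (x / y - scal c).
  rewrite -[y ^+ q]prodr_const -big_split /=; apply: eq_bigr => c _.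
  by rewrite mulrBr [y * (_ / _)]mulrC divfK // [y * _]mulrC.
have -> : \prod_(c : F) (x / y - scal c) = \prod_(c : F) (map_poly scal ('X - c%:P)).[x / y].
  by apply: eq_bigr => c _; rewrite rmorphB /= map_polyX map_polyC !hornerE.
rewrite E mulrBr expr_div_n mulrC divfK ?expf_neq0 //; congr (_ - _).
by rewrite -{1}(subnK q_gt0) exprD expr1 -mulrA [y * _]mulrC divfK.
Qed.

End Ultrametric.

#[local] Existing Instance summability.totally_filter.

(** * Limits and convergent series *)

Section Limits.
Variables (F : finFieldType) (R : realType) (C : valuedField F R).
Local Notation q := #|F|.
Local Notation th := (theta C).
Implicit Types (a b : nat -> C) (x y l m : C).

Lemma limto_seqP (v : nat -> C) l : limto \oo v l <->
  forall eps : R, 0 < eps -> exists N, forall n, (N <= n)%N -> absv (v n - l) < eps.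
Proof.
split=> [/cvgrPdist_lt H eps e0|H].
  have [N _ HN] := H _ e0; exists N => n /HN.
  by rewrite sub0r normrN ger0_norm ?absv_ge0.
apply/cvgrPdist_lt => eps e0; have [N HN] := H _ e0.
by exists N => // n /HN; rewrite sub0r normrN ger0_norm ?absv_ge0.
Qed.

Lemma limto_totP (T : choiceType) (v : {fset T} -> C) l :
  limto summability.totally v l <->
  forall eps : R, 0 < eps -> exists S0 : {fset T}, forall S : {fset T},
    (S0 `<=` S)%fset -> absv (v S - l) < eps.
Proof.
split=> [/cvgrPdist_lt H eps e0|H].
  have [N _ HN] := H _ e0; exists N => n /HN.
  by rewrite /= sub0r normrN ger0_norm ?absv_ge0.
apply/cvgrPdist_lt => eps e0; have [N HN] := H _ e0.
by exists N => // n /HN; rewrite /= sub0r normrN ger0_norm ?absv_ge0.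
Qed.

Lemma absv_small x : (forall eps : R, 0 < eps -> absv x < eps) -> x = 0.
Proof.
move=> H; apply/eqP/negPn/negP => x0.
by have := H (absv x); rewrite absv_gt0 ltxx => /(_ x0).
Qed.

Lemma limto_seq_unique (v : nat -> C) l m : limto \oo v l -> limto \oo v m -> l = m.
Proof.
move=> /limto_seqP Hl /limto_seqP Hm; apply/eqP; rewrite -subr_eq0; apply/eqP.
apply: absv_small => eps e0; have [N HN] := Hl _ e0; have [M HM] := Hm _ e0.
have -> : l - m = (v (maxn N M) - m) - (v (maxn N M) - l) by ring.
by apply: absvB_lt; [apply: HM|apply: HN]; rewrite ?leq_maxl ?leq_maxr.
Qed.

Lemma limto_tot_unique (T : choiceType) (v : {fset T} -> C) l m :
  limto summability.totally v l -> limto summability.totally v m -> l = m.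
Proof.
move=> /limto_totP Hl /limto_totP Hm; apply/eqP; rewrite -subr_eq0; apply/eqP.
apply: absv_small => eps e0; have [N HN] := Hl _ e0; have [M HM] := Hm _ e0.
have -> : l - m = (v (N `|` M)%fset - m) - (v (N `|` M)%fset - l) by ring.
by apply: absvB_lt; [apply: HM|apply: HN]; rewrite ?fsubsetUl ?fsubsetUr.
Qed.

End Limits.

Section Sums.
Variables (F : finFieldType) (R : realType) (C : valuedField F R).
Local Notation q := #|F|.
Local Notation th := (theta C).
Implicit Types (a b : nat -> C) (x y l m : C).

Definition nullseq a := forall eps : R, 0 < eps ->
  exists N, forall n, (N <= n)%N -> absv (a n) < eps.

Lemma has_sumP a l : has_sum a l <-> forall eps : R, 0 < eps ->
  exists N, forall n, (N <= n)%N -> absv (\sum_(i < n) a i - l) < eps.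
Proof. exact: limto_seqP. Qed.

Lemma has_sum_unique a l m : has_sum a l -> has_sum a m -> l = m.
Proof. exact: limto_seq_unique. Qed.

Lemma has_sum_Csum a l : has_sum a l -> Csum a = l.
Proof.
move=> al; apply: (has_sum_unique _ al).
exact: (xgetPex 0 (ex_intro [set l | has_sum a l] l al)).
Qed.

Lemma has_sum_null a l : has_sum a l -> nullseq a.
Proof.
move=> /has_sumP al eps e0; have [N HN] := al _ e0; exists N => n Nn.
have -> : a n = (\sum_(i < n.+1) a i - l) - (\sum_(i < n) a i - l).
  by rewrite big_ord_recr /=; ring.
by apply: absvB_lt; apply: HN => //; apply: leqW.
Qed.

Lemma nullseq_bounded a : nullseq a -> exists2 B : R, 0 < B & forall n, absv (a n) <= B.
Proof.
move=> /(_ 1 ltr01) [N HN].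
exists (1 + \sum_(i < N) absv (a i)).
  by rewrite ltr_pwDl // sumr_ge0 // => i _; apply: absv_ge0.
move=> n; have [Nn|nN] := leqP N n.
  by rewrite (le_trans (ltW (HN _ Nn))) // lerDl sumr_ge0 // => i _; apply: absv_ge0.
rewrite (bigD1 (Ordinal nN)) //= addrCA lerDl addr_ge0 // sumr_ge0 // => i _.
exact: absv_ge0.
Qed.

Lemma has_sum_tail a l N (B : R) : has_sum a l -> 0 <= B ->
  (forall n, (N <= n)%N -> absv (a n) <= B) -> absv (l - \sum_(i < N) a i) <= B.
Proof.
move=> /has_sumP al B0 aB; apply/ler_addgt0Pr => eps e0.
have [M HM] := al _ e0.
pose K := (N + M)%N.
have -> : l - \sum_(i < N) a i =
   - (\sum_(i < K) a i - l) + (\sum_(i < K) a i - \sum_(i < N) a i) by ring.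
apply: absvD_le; first by rewrite absvN (le_trans (ltW (HM _ (leq_addl _ _)))) // lerDr.
rewrite /K big_split_ord /= addrAC subrr add0r (le_trans _ (_ : B <= _)) ?lerDl ?(ltW e0) //.
by apply: absv_sum_le => // i _; rewrite aB ?leq_addr.
Qed.

Lemma has_sum_le a l (B : R) : has_sum a l -> 0 <= B ->
  (forall n, absv (a n) <= B) -> absv l <= B.
Proof.
by move=> al B0 aB; have := @has_sum_tail a l 0 B al B0 (fun n _ => aB n);
  rewrite big_ord0 subr0.
Qed.

Lemma has_sum_ext a b l : a =1 b -> has_sum a l -> has_sum b l.
Proof. by move=> /funext ->. Qed.

Lemma has_sumD a b l m : has_sum a l -> has_sum b m -> has_sum (fun n => a n + b n) (l + m).
Proof.
move=> /has_sumP al /has_sumP bm; apply/has_sumP => eps e0.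
have [N HN] := al _ e0; have [M HM] := bm _ e0; exists (maxn N M) => n.
rewrite geq_max => /andP[Nn Mn]; rewrite big_split /= opprD addrACA.
by apply: absvD_lt; [apply: HN|apply: HM].
Qed.

Lemma has_sumZ x a l : has_sum a l -> has_sum (fun n => x * a n) (x * l).
Proof.
have [->|x0] := eqVneq x 0.
  move=> _; apply/has_sumP => eps e0; exists 0%N => n _.
  by rewrite big1 ?mul0r ?subrr ?absv0 // => i _; rewrite mul0r.
move=> /has_sumP al; apply/has_sumP => eps e0.
have x0' : 0 < absv x by rewrite absv_gt0.
have [N HN] := al (eps / absv x) (divr_gt0 e0 x0'); exists N => n /HN.
by rewrite -mulr_sumr -mulrBr absvM ltr_pdivlMr // mulrC.
Qed.

Lemma has_sumN a l : has_sum a l -> has_sum (fun n => - a n) (- l).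
Proof.
by move=> /(has_sumZ (-1)); rewrite mulN1r; apply: has_sum_ext => n; rewrite mulN1r.
Qed.

Lemma has_sumB a b l m : has_sum a l -> has_sum b m -> has_sum (fun n => a n - b n) (l - m).
Proof. by move=> al bm; apply: has_sumD => //; apply: has_sumN. Qed.

Lemma has_sum_fin N a : (forall n, (N <= n)%N -> a n = 0) -> has_sum a (\sum_(i < N) a i).
Proof.
move=> a0; apply/has_sumP => eps e0; exists N => n /subnKC <-.
rewrite big_split_ord /= addrAC subrr add0r big1 ?absv0 // => i _.
by rewrite a0 ?leq_addr.
Qed.

Lemma has_sumS a l : has_sum (fun n => a n.+1) l -> has_sum a (a 0%N + l).
Proof.
move=> /has_sumP al; apply/has_sumP => eps e0; have [N HN] := al _ e0.
exists N.+1 => [[|n]] //; rewrite ltnS => /HN.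
by rewrite big_ord_recl /= opprD addrACA subrr add0r.
Qed.

Lemma has_sum_Frob k a l : has_sum a l ->
  has_sum (fun n => a n ^+ (q ^ k)) (l ^+ (q ^ k)).
Proof.
move=> /has_sumP al; apply/has_sumP => eps e0.
have e0' : 0 < Num.min eps 1 by rewrite lt_min e0 ltr01.
have [N HN] := al _ e0'; exists N => n /HN; rewrite lt_min => /andP[lt_e lt_1].
rewrite -Frob_sum -FrobB absvX (le_lt_trans _ lt_e) //.
by rewrite -[leRHS]expr1 ler_wiXn2l ?absv_ge0 ?qk_gt0 // ltW.
Qed.

(** No absolute convergence is required: the terms of both series tend to zero, and the square and
    triangular partial sums differ only by products with i + j >= n, in which one factor is small
    and the other bounded. *)
Lemma has_sum_mul a b l m : has_sum a l -> has_sum b m ->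
  has_sum (fun n => \sum_(i < n.+1) a i * b (n - i)%N) (l * m).
Proof.
move=> al bm.
have [A A0 HA] := nullseq_bounded (has_sum_null al).
have [B B0 HB] := nullseq_bounded (has_sum_null bm).
have lm : limto \oo (fun N => (\sum_(i < N) a i) * (\sum_(j < N) b j)) (l * m).
  apply/limto_seqP => eps e0.
  have eA : 0 < eps / (A + B + 1) by rewrite divr_gt0 // ltr_wpDl // addr_ge0 ?ltW.
  have [N HN] := (has_sumP a l).1 al _ eA; have [M HM] := (has_sumP b m).1 bm _ eA.
  exists (maxn N M) => n; rewrite geq_max => /andP[Nn Mn].
  set s := \sum_(i < n) a i; set t := \sum_(i < n) b i.
  have -> : s * t - l * m = s * (t - m) + m * (s - l) by ring.
  have lte (x y X : R) : 0 <= x -> 0 <= y -> x <= X -> X < A + B + 1 ->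
      y < eps / (A + B + 1) -> x * y < eps.
    move=> x0 y0 xX XAB yy; have [->|xn0] := eqVneq x 0; first by rewrite mul0r.
    have xp : 0 < x by rewrite lt_def xn0.
    rewrite (lt_trans (_ : _ < x * (eps / (A + B + 1)))) ?ltr_pM2l //.
    rewrite mulrCA -[ltRHS]mulr1 ltr_pM2l // ltr_pdivrMr ?mul1r ?(le_lt_trans xX) //.
    by rewrite ltr_wpDl // addr_ge0 ?ltW.
  apply: absvD_lt; rewrite absvM.
    apply: (lte _ _ A); rewrite ?absv_ge0 ?HM //; last by lra.
    by apply: absv_sum_le; rewrite ?ltW.
  apply: (lte _ _ B); rewrite ?absv_ge0 ?HN //; last by lra.
  by apply: (has_sum_le bm); rewrite ?ltW.
apply/has_sumP => eps e0; have [N0 HN0] := (limto_seqP _ _).1 lm _ e0.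
have eA : 0 < eps / (A + B + 1) by rewrite divr_gt0 // ltr_wpDl // addr_ge0 ?ltW.
have [N HN] := has_sum_null al eA; have [M HM] := has_sum_null bm eA.
exists (maxn N0 (N + M)) => n; rewrite geq_max => /andP[N0n NMn].
have -> x : x - l * m = (((\sum_(i < n) a i) * \sum_(j < n) b j) - l * m) -
   (((\sum_(i < n) a i) * \sum_(j < n) b j) - x) by ring.
apply: absvB_lt; first exact: HN0.
(* Reindexing by k = i - j turns the Cauchy partial sum into a sum over the triangle i + j < n, a
   part of the square. *)
have -> : \sum_(i < n) \sum_(j < i.+1) a j * b (i - j)%N =
          \sum_(i < n) \sum_(j < n | (i + j < n)%N) a i * b j.
  transitivity (\sum_(i < n) \sum_(j < n | (j <= i)%N) a j * b (i - j)%N).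
    apply: eq_bigr => i _; rewrite (big_ord_widen n (fun j => a j * b (i - j)%N)) //.
  rewrite (exchange_big_dep predT) //=; apply: eq_bigr => j _.
  pose f (i : 'I_n) : 'I_n := Ordinal (leq_ltn_trans (leq_subr j i) (ltn_ord i)).
  rewrite -[LHS](big_mkord (fun i => (j <= i)%N) (fun i => a j * b (i - j)%N)).
  rewrite -[RHS](big_mkord (fun k => (j + k < n)%N) (fun k => a j * b k)).
  rewrite (@big_cat_nat _ _ _ j) ?leq0n ?(ltnW (ltn_ord j)) //=.
  rewrite [X in X + _]big_nat_cond big1 ?add0r; last first.
    by move=> i H; exfalso; move: H; lia.
  rewrite -{1}[val j]add0n big_addn big_nat_cond [RHS](@big_cat_nat _ _ _ (n - j)) ?leq_subr //=.
  rewrite [X in _ = _ + X]big_nat_cond [X in _ = _ + X]big1 ?addr0; last first.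
    by move=> i H; exfalso; move: H; lia.
  rewrite [RHS]big_nat_cond; apply: eq_big => [i|i _]; first by lia.
  by rewrite addnK.
rewrite mulr_suml -sumrB; apply: absv_sum_lt => // i _.
rewrite mulr_sumr [X in X - _](bigID (fun j : 'I_n => (i + j < n)%N)) /= addrAC subrr add0r.
apply: absv_sum_lt => // j; rewrite -leqNgt => nij; rewrite absvM.
have [Ni|iN] := leqP N i.
  rewrite (le_lt_trans (_ : _ <= absv (a i) * B)) ?ler_wpM2l ?absv_ge0 //.
  rewrite (lt_trans (_ : _ < eps / (A + B + 1) * B)) ?ltr_pM2r ?HN //.
  by rewrite mulrAC -mulrA -[ltRHS]mulr1 ltr_pM2l // ltr_pdivrMr; lra.
rewrite (le_lt_trans (_ : _ <= A * absv (b j))) ?ler_wpM2r ?absv_ge0 //.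
rewrite (lt_trans (_ : _ < A * (eps / (A + B + 1)))) ?ltr_pM2l ?HM //; first by lia.
by rewrite mulrCA -[ltRHS]mulr1 ltr_pM2l // ltr_pdivrMr; lra.
Qed.

Hypothesis Ccomp : Ccomplete C.

Lemma has_sum_ex a : nullseq a -> exists l, has_sum a l.
Proof.
move=> a0; apply: Ccomp => eps e0; have [N HN] := a0 _ e0; exists N.
have main (m n : nat) : (N <= m)%N -> (m <= n)%N ->
    absv (\sum_(i < n) a i - \sum_(i < m) a i) < eps.
  move=> Nm /subnKC <-; rewrite big_split_ord /= addrAC subrr add0r.
  by apply: absv_sum_lt => // i _; rewrite HN // (leq_trans Nm) ?leq_addr.
by move=> m n Nm Nn; case/orP: (leq_total m n) => le; [rewrite absv_distC|]; apply: main.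
Qed.

End Sums.

(** * Power series in t: integrality, Gauss norms, evaluation, twists *)

Section FpsDomain.
Variable K : fieldType.
Implicit Types (f g : fps K) (c : K) (i n : nat).

Lemma fcoefD f g i : fcoef (f + g) i = fcoef f i + fcoef g i. Proof. by []. Qed.
Lemma fcoefN f i : fcoef (- f) i = - fcoef f i. Proof. by []. Qed.
Lemma fcoefB f g i : fcoef (f - g) i = fcoef f i - fcoef g i. Proof. by []. Qed.
Lemma fcoefM f g n : fcoef (f * g) n = \sum_(i < n.+1) fcoef f i * fcoef g (n - i)%N.
Proof. by []. Qed.
Lemma fcoef0 i : fcoef (0 : fps K) i = 0. Proof. by rewrite /= mul0rn. Qed.
Lemma fcoef1 i : fcoef (1 : fps K) i = (i == 0%N)%:R. Proof. by []. Qed.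
Lemma fcoefC c i : fcoef (fpsC c) i = c *+ (i == 0%N). Proof. by []. Qed.
Lemma fcoefX i : fcoef (@fpsX K) i = (i == 1%N)%:R. Proof. by []. Qed.
Lemma fcoef_sum (I : Type) (r : seq I) (P : pred I) (f : I -> fps K) i :
  fcoef (\sum_(j <- r | P j) f j) i = \sum_(j <- r | P j) fcoef (f j) i.
Proof. exact: (big_morph (fun f : fps K => fcoef f i) (fun x y => fcoefD x y i) (fcoef0 i)). Qed.

Lemma fcoefM0 f g : fcoef (f * g) 0 = fcoef f 0 * fcoef g 0.
Proof. by rewrite fcoefM big_ord_recl big_ord0 addr0. Qed.

Lemma fcoefCM c f i : fcoef (fpsC c * f) i = c * fcoef f i.
Proof. by rewrite fcoefM big_ord_recl subn0 big1 ?addr0 // => j _; rewrite fcoefC mul0r. Qed.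

Lemma fcoefXM f i : fcoef (@fpsX K * f) i = if i is j.+1 then fcoef f j else 0.
Proof.
rewrite fcoefM; case: i => [|i]; first by rewrite big_ord_recl big_ord0 fcoefX mul0r addr0.
rewrite 2!big_ord_recl /= mul0r add0r mul1r subn1 big1 ?addr0 // => j _.
by rewrite mul0r.
Qed.

Lemma fpsC_is_zmod_morphism : zmod_morphism (@fpsC K).
Proof. by move=> a b; apply: fpsP => i; rewrite fcoefB !fcoefC mulrnBl. Qed.
Lemma fpsC_is_monoid_morphism : monoid_morphism (@fpsC K).
Proof. by split=> // a b; apply: fpsP => i; rewrite fcoefCM !fcoefC mulrnAr. Qed.
HB.instance Definition _ := GRing.isZmodMorphism.Build K (fps K) (@fpsC K) fpsC_is_zmod_morphism.
HB.instance Definition _ := GRing.isMonoidMorphism.Build K (fps K) (@fpsC K) fpsC_is_monoid_morphism.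

Lemma fps_unitE f : (f \is a GRing.unit) = (fcoef f 0 != 0).
Proof. by []. Qed.

Lemma fcoefV0 f : fcoef f 0 != 0 -> fcoef f^-1 0 = (fcoef f 0)^-1.
Proof.
move=> f0; apply: (mulfI f0); rewrite divff // -fcoefM0 divrr ?fps_unitE //.
Qed.

Lemma fps_neq0P f : f != 0 -> exists2 n, fcoef f n != 0 & forall i, (i < n)%N -> fcoef f i = 0.
Proof.
move=> f0; have ex : exists n, fcoef f n != 0.
  apply: contra_neqP f0 => nex; apply: fpsP => i; rewrite fcoef0.
  by apply/eqP/negPn/negP => fi; apply: nex; exists i.
exists (ex_minn ex); first by case: ex_minnP.
case: ex_minnP => n fn nmin i lt_in; apply/eqP/negPn/negP => /nmin.
by rewrite leqNgt lt_in.
Qed.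

Lemma fps_mulf_eq0 : GRing.integral_domain_axiom (fps K).
Proof.
move=> f g fg0; apply/norP => -[/fps_neq0P[n fn ltn] /fps_neq0P[m gm ltm]].
have : fcoef (f * g) (n + m) = 0 by rewrite fg0 fcoef0.
rewrite fcoefM (bigD1 (Ordinal (leq_addr m n : (n < (n + m).+1)%N))) //= addKn.
rewrite big1 => [/eqP|i ni]; first by rewrite addr0 mulf_eq0 (negPf fn) (negPf gm).
have [/ltn->|ni'] := ltnP i n; first by rewrite mul0r.
have lt : (n < i)%N by rewrite ltn_neqAle ni' andbT eq_sym; move: ni; rewrite -val_eqE.
by rewrite ltm ?mulr0 //; have := ltn_ord i; lia.
Qed.
HB.instance Definition _ := GRing.ComUnitRing_isIntegral.Build (fps K) fps_mulf_eq0.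

End FpsDomain.

Section FpsAnalysis.
Variables (F : finFieldType) (R : realType) (C : valuedField F R).
Local Notation q := #|F|.
Local Notation th := (theta C).
Local Notation eval := Defs.eval.
Implicit Types (f g : fps C) (x y l m t : C) (c B : R).

Lemma twist_is_zmod_morphism k : zmod_morphism (@twist F R C k).
Proof. by move=> f g; apply: fpsP => i; rewrite fcoefB /= FrobB. Qed.
Lemma twist_is_monoid_morphism k : monoid_morphism (@twist F R C k).
Proof.
split=> [|f g]; apply: fpsP => i /=.
  by case: (i == 0%N); rewrite ?mulr1n ?mulr0n ?expr1n ?Frob0.
by rewrite Frob_sum; apply: eq_bigr => j _; rewrite exprMn.
Qed.
HB.instance Definition _ k := GRing.isZmodMorphism.Build _ _ (@twist F R C k) (twist_is_zmod_morphism k).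
HB.instance Definition _ k := GRing.isMonoidMorphism.Build _ _ (@twist F R C k) (twist_is_monoid_morphism k).

Lemma twistC k x : twist k (fpsC x : fps C) = fpsC (x ^+ (q ^ k)).
Proof. by apply: fpsP => i /=; case: (i == 0%N); rewrite ?mulr1n ?mulr0n ?Frob0. Qed.

Lemma twist_twist k (l : nat) f : twist k (twist l f) = twist (l + k) f.
Proof. by apply: fpsP => i /=; rewrite -exprM expnD. Qed.

Lemma twist0 f : twist 0 f = f.
Proof. by apply: fpsP => i /=; rewrite expr1. Qed.

Lemma twist_inj k : injective (@twist F R C k).
Proof.
move=> f g /(congr1 (@fcoef _)) E; apply: fpsP => i; apply/eqP; rewrite -subr_eq0.
have /= /eqP := congr1 (fun h => h i) E.
by rewrite -subr_eq0 -FrobB expf_eq0 => /andP[].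
Qed.

Lemma twist_unit k f : (twist k f \is a GRing.unit) = (f \is a GRing.unit).
Proof. by rewrite !fps_unitE /= expf_eq0 qk_gt0. Qed.

Lemma has_eval_unique f t l m : has_eval f t l -> has_eval f t m -> l = m.
Proof. exact: has_sum_unique. Qed.

Lemma has_eval_eval f t l : has_eval f t l -> eval f t = l.
Proof. exact: has_sum_Csum. Qed.

Lemma has_evalD f g t l m : has_eval f t l -> has_eval g t m -> has_eval (f + g) t (l + m).
Proof. by move=> fl gm; apply: has_sum_ext (has_sumD fl gm) => i; rewrite fcoefD mulrDl. Qed.

Lemma has_evalN f t l : has_eval f t l -> has_eval (- f) t (- l).
Proof. by move=> fl; apply: has_sum_ext (has_sumN fl) => i; rewrite fcoefN mulNr. Qed.

Lemma has_evalB f g t l m : has_eval f t l -> has_eval g t m -> has_eval (f - g) t (l - m).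
Proof. by move=> fl gm; apply: has_evalD => //; apply: has_evalN. Qed.

Lemma has_evalM f g t l m : has_eval f t l -> has_eval g t m -> has_eval (f * g) t (l * m).
Proof.
move=> fl gm; apply: has_sum_ext (has_sum_mul fl gm) => n; rewrite fcoefM mulr_suml.
by apply: eq_bigr => i _; rewrite mulrACA -exprD subnKC ?leq_ord.
Qed.

Lemma has_evalC x t : has_eval (fpsC x) t x.
Proof.
have := @has_sum_fin _ _ _ 1 (fun i => fcoef (fpsC x) i * t ^+ i).
rewrite big_ord_recl big_ord0 addr0 /= mulr1; apply.
by case=> // n _; rewrite mul0r.
Qed.

Lemma has_eval1 t : has_eval (1 : fps C) t 1.
Proof. exact: has_evalC. Qed.

Lemma has_eval_0 f : has_eval f 0 (fcoef f 0).
Proof.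
have := @has_sum_fin _ _ _ 1 (fun i => fcoef f i * (0 : C) ^+ i).
rewrite big_ord_recl big_ord0 addr0 /= expr0 mulr1; apply.
by case=> // n _; rewrite exprS mul0r mulr0.
Qed.

Lemma has_evalX t : has_eval (@fpsX C) t t.
Proof.
have := @has_sum_fin _ _ _ 2 (fun i => fcoef (@fpsX C) i * t ^+ i).
rewrite !big_ord_recl big_ord0 addr0 /= mul0r add0r mul1r; apply.
by case=> [|[|n]] // _; rewrite mul0r.
Qed.

Lemma has_evalXn f t l n : has_eval f t l -> has_eval (f ^+ n) t (l ^+ n).
Proof.
move=> fl; elim: n => [|n IHn]; first exact: has_eval1.
by rewrite !exprS; apply: has_evalM.
Qed.

Lemma has_eval_twist k f t l : has_eval f t l ->
  has_eval (twist k f) (t ^+ (q ^ k)) (l ^+ (q ^ k)).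
Proof.
by move=> /(has_sum_Frob k); apply: has_sum_ext => i /=; rewrite exprMn -!exprM mulnC.
Qed.

(** The Gauss norm of [f] on the disc of radius [c] is at most [B]. Unlike mere convergence, such
    bounds are stable under products, inversion and coefficientwise limits. *)
Definition pbound c B f := forall i, absv (fcoef f i) * c ^+ i <= B.

Lemma pbound_ge0 c B f : pbound c B f -> 0 <= B.
Proof. by move=> /(_ 0%N); rewrite expr0 mulr1; apply: le_trans; apply: absv_ge0. Qed.

Lemma pbound_le c c' B B' f : 0 <= c' -> c' <= c -> B <= B' -> pbound c B f -> pbound c' B' f.
Proof.
move=> c0 cc' BB' fB i; apply: le_trans BB'; apply: le_trans (fB i).
by rewrite ler_wpM2l ?absv_ge0 // lerXn2r // nnegrE // (le_trans c0).
Qed.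

Lemma pboundD c B f g : 0 <= c -> pbound c B f -> pbound c B g -> pbound c B (f + g).
Proof.
move=> c0 fB gB i; rewrite fcoefD.
rewrite (le_trans (ler_wpM2r _ (absv_ultra _ _))) ?exprn_ge0 //.
by rewrite maxr_pMl ?exprn_ge0 // ge_max fB gB.
Qed.

Lemma pboundN c B f : pbound c B f -> pbound c B (- f).
Proof. by move=> fB i; rewrite fcoefN absvN. Qed.

Lemma pboundM c A B f g : 0 < c -> pbound c A f -> pbound c B g -> pbound c (A * B) (f * g).
Proof.
move=> c0 fA gB n; rewrite fcoefM -ler_pdivlMr ?exprn_gt0 //.
apply: absv_sum_le => [|i _].
  by rewrite divr_ge0 ?exprn_ge0 ?(ltW c0) // mulr_ge0 ?(pbound_ge0 fA) ?(pbound_ge0 gB).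
rewrite absvM ler_pdivlMr ?exprn_gt0 //.
have -> : c ^+ n = c ^+ i * c ^+ (n - i) by rewrite -exprD subnKC // leq_ord.
rewrite mulrACA.
by apply: ler_pM; rewrite ?mulr_ge0 ?absv_ge0 ?exprn_ge0 ?(ltW c0).
Qed.

Lemma pboundC c x : pbound c (absv x) (fpsC x).
Proof. by case=> [|i] /=; rewrite ?mulr1 // absv0 mul0r absv_ge0. Qed.

(** When the constant term realizes the Gauss norm, the identity f^-1 f = 1 expresses each
    coefficient of the inverse by products that the reciprocal norm already bounds. *)
Lemma pbound_inv c f : 0 < c -> fcoef f 0 != 0 -> pbound c (absv (fcoef f 0)) f ->
  pbound c (absv (fcoef f 0))^-1 f^-1.
Proof.
move=> c0 f0 fB; have uf : f \is a GRing.unit by [].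
have af : 0 < absv (fcoef f 0) by rewrite absv_gt0.
elim/ltn_ind => -[|n] IHn; first by rewrite expr0 mulr1 fcoefV0 // absvV.
have := congr1 (fun h => fcoef h n.+1) (mulVr uf).
rewrite fcoefM big_ord_recr /= subnn => /eqP; rewrite addr_eq0 => /eqP E.
rewrite -(ler_pM2r af) mulVf ?gt_eqF // mulrAC -absvM.
have -> : fcoef f^-1 n.+1 * fcoef f 0 =
    - \sum_(i < n.+1) fcoef f^-1 i * fcoef f (n.+1 - i) by rewrite E opprK.
rewrite absvN -ler_pdivlMr ?exprn_gt0 //.
apply: absv_sum_le => [|i _]; first by rewrite divr_ge0 // exprn_ge0 // ltW.
rewrite absvM ler_pdivlMr ?exprn_gt0 //.
have -> : c ^+ n.+1 = c ^+ i * c ^+ (n.+1 - i) by rewrite -exprD subnKC // ltnW.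
rewrite mulrACA.
rewrite -[leRHS](mulVf (lt0r_neq0 af)).
by apply: ler_pM; rewrite ?mulr_ge0 ?absv_ge0 ?exprn_ge0 ?(ltW c0) // IHn.
Qed.

(** Brings a series with nonzero constant term into the situation of [pbound_inv]: scaling the
    radius by |f_0| / B <= 1 pushes every later term below |f_0|. *)
Lemma pbound_shrink c B f : 0 < c -> fcoef f 0 != 0 -> pbound c B f ->
  exists2 c', 0 < c' <= c & pbound c' (absv (fcoef f 0)) f.
Proof.
move=> c0 f0 fB; have af : 0 < absv (fcoef f 0) by rewrite absv_gt0.
have B0 : 0 < B by apply: lt_le_trans af _; have := fB 0%N; rewrite expr0 mulr1.
pose s := absv (fcoef f 0) / B.
have s0 : 0 < s by rewrite divr_gt0.
have s1 : s <= 1 by rewrite ler_pdivrMr // mul1r; have := fB 0%N; rewrite expr0 mulr1.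
exists (c * s); first by rewrite mulr_gt0 //= ger_pMr.
case=> [|i]; first by rewrite expr0 mulr1.
rewrite exprMn mulrA (le_trans (_ : _ <= B * s ^+ i.+1)) //.
  by rewrite ler_wpM2r ?fB // exprn_ge0 // ltW.
rewrite (le_trans (_ : _ <= B * s)) //; last by rewrite /s mulrC divfK ?gt_eqF.
by rewrite ler_pM2l // exprS ger_pMr // exprn_ile1 // ltW.
Qed.

Lemma geom_small (x B eps : R) : 0 <= x < 1 -> 0 <= B -> 0 < eps ->
  exists N, forall n, (N <= n)%N -> B * x ^+ n < eps.
Proof.
move=> /andP[x0 x1] B0 e0.
have /cvgrPdist_lt/(_ (eps / (B + 1))) : (fun n => x ^+ n) @ \oo --> (0 : R).
  by apply: cvg_expr; rewrite ger0_norm.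
case=> [|N _ HN]; first by rewrite divr_gt0 // ltr_wpDl.
exists N => n /HN; rewrite /= sub0r normrN ger0_norm ?exprn_ge0 //.
rewrite ltr_pdivlMr ?ltr_wpDl // => le; apply: le_lt_trans le.
by rewrite mulrC ler_wpM2l ?exprn_ge0 // lerDl.
Qed.

Lemma pbound_null c B f t : absv t < c -> pbound c B f -> nullseq (fun i => fcoef f i * t ^+ i).
Proof.
move=> tc fB eps e0; have c0 : 0 < c := le_lt_trans (absv_ge0 t) tc.
have tc1 : 0 <= absv t / c < 1 by rewrite divr_ge0 ?absv_ge0 ?(ltW c0) // ltr_pdivrMr // mul1r.
have [N HN] := geom_small tc1 (pbound_ge0 fB) e0; exists N => n /HN; apply: le_lt_trans.
rewrite absvM absvX expr_div_n mulrA mulrAC ler_wpM2r ?exprn_ge0 ?absv_ge0 //.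
by rewrite ler_pdivlMr ?exprn_gt0.
Qed.

Lemma has_eval_le f t l c B : has_eval f t l -> absv t <= c -> pbound c B f -> absv l <= B.
Proof.
move=> fl tc fB; apply: (has_sum_le fl (pbound_ge0 fB)) => n.
by rewrite absvM absvX (le_trans _ (fB n)) // ler_wpM2l ?absv_ge0 // lerXn2r // nnegrE
  ?(le_trans _ tc) ?absv_ge0.
Qed.

Lemma has_eval_le_t f t l c B : has_eval f t l -> absv t <= c -> 0 < c -> pbound c B f ->
  fcoef f 0 = 0 -> absv l <= B / c * absv t.
Proof.
move=> fl tc c0 fB f0; apply: (has_sum_le fl) => [|[|n]].
- by rewrite mulr_ge0 ?absv_ge0 // divr_ge0 ?(pbound_ge0 fB) // ltW.
- by rewrite f0 mul0r absv0 mulr_ge0 ?absv_ge0 // divr_ge0 ?(pbound_ge0 fB) // ltW.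
rewrite absvM absvX exprSr mulrA ler_wpM2r ?absv_ge0 // ler_pdivlMr //.
rewrite (le_trans _ (fB n.+1)) // exprSr mulrA ler_wpM2r ?(ltW c0) //.
by rewrite ler_wpM2l ?absv_ge0 // lerXn2r // nnegrE ?absv_ge0 // ltW.
Qed.

Lemma has_eval_pbound f t l : has_eval f t l -> exists B, pbound (absv t) B f.
Proof.
move=> /has_sum_null/nullseq_bounded[B _ HB]; exists B => i.
by rewrite -absvX -absvM.
Qed.

Lemma ex_small c : 0 < c -> exists2 t : C, t != 0 & absv t < c.
Proof.
move=> c0; have q1 : 0 <= (q%:R : R)^-1 < 1.
  by rewrite invr_ge0 ltW ?qR_gt0 //= invf_lt1 ?qR_gt0 // qR_gt1.
have [N HN] := geom_small q1 ler01 c0.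
exists (th^-1 ^+ N); first by rewrite expf_neq0 // invr_neq0 ?th_neq0.
by rewrite absvX absvV absv_th -[ltLHS]mul1r; exact: HN.
Qed.

(* A convergent power series vanishing at points accumulating at 0 is zero. *)
Lemma fps_identity c B f : 0 < c -> pbound c B f ->
  (forall eps : R, 0 < eps -> exists t : C, [/\ t != 0, absv t < eps & has_eval f t 0]) ->
  f = 0.
Proof.
move=> c0 fB H; apply/eqP/negPn/negP => /fps_neq0P[n fn ltn].
pose D := B / c ^+ n.+1 + 1.
have B0 := pbound_ge0 fB.
have D0 : 0 < D by rewrite ltr_wpDl // divr_ge0 // exprn_ge0 // ltW.
have e0 : 0 < Num.min c (absv (fcoef f n) / D).
  by rewrite lt_min c0 divr_gt0 // absv_gt0.
have [t [t0 + ft]] := H _ e0; rewrite lt_min => /andP[tc].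
rewrite ltr_pdivlMr // ltNge => /negP; apply.
have at0 : 0 < absv t by rewrite absv_gt0.
have bd i : (n.+1 <= i)%N -> absv (fcoef f i * t ^+ i) <= B / c ^+ n.+1 * absv t ^+ n.+1.
  move=> ni; rewrite absvM absvX mulrAC ler_pdivlMr ?exprn_gt0 //.
  have le1 : absv t ^+ i <= absv t ^+ n.+1 * c ^+ (i - n.+1).
    rewrite -{1}(subnKC ni) exprD ler_wpM2l ?exprn_ge0 ?(ltW at0) //.
    by rewrite lerXn2r ?nnegrE ?(ltW at0) ?(ltW c0) ?(ltW tc).
  rewrite (le_trans (_ : _ <= absv (fcoef f i) * (absv t ^+ n.+1 * c ^+ (i - n.+1)) * c ^+ n.+1)) //.
    by rewrite ler_wpM2r ?exprn_ge0 ?(ltW c0) // ler_wpM2l ?absv_ge0.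
  rewrite -!mulrA -exprD subnK // mulrCA mulrC ler_wpM2r ?exprn_ge0 ?(ltW at0) //.
have E0 : 0 <= B / c ^+ n.+1 * absv t ^+ n.+1.
  by rewrite mulr_ge0 ?exprn_ge0 ?(ltW at0) // divr_ge0 ?exprn_ge0 // ltW.
have := has_sum_tail ft E0 bd.
rewrite sub0r absvN big_ord_recr /= big1 => [|i _]; last by rewrite ltn // mul0r.
rewrite add0r absvM absvX [absv t ^+ n.+1]exprSr mulrA [leRHS]mulrAC ler_pM2r ?exprn_gt0 // => le.
by rewrite mulrDr mulr1 mulrC ler_wpDr // ltW.
Qed.

Hypothesis Ccomp : Ccomplete C.

Lemma pbound_eval c B f t : absv t < c -> pbound c B f -> exists l, has_eval f t l.
Proof. by move=> tc fB; apply: has_sum_ex => //; apply: pbound_null tc fB. Qed.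

Lemma pbound_has_eval c B f t : absv t < c -> pbound c B f -> has_eval f t (eval f t).
Proof. by move=> tc fB; have [l fl] := pbound_eval tc fB; rewrite (has_eval_eval fl). Qed.

(** Convergence at one nonzero point already bounds the coefficients geometrically, so a positive
    radius of convergence and a finite Gauss norm on some disc are the same. *)
Lemma TposP f : Tpos f <-> exists c B, 0 < c /\ pbound c B f.
Proof.
split=> [[r r0 H]|[c [B [c0 fB]]]].
  have [t t0 /H[l /has_eval_pbound[B fB]]] := ex_small r0.
  by exists (absv t), B; rewrite absv_gt0.
by exists c => // t tc; apply: pbound_eval tc fB.
Qed.

Lemma TposD f g : Tpos f -> Tpos g -> Tpos (f + g).
Proof.
move=> [r r0 Hr] [s s0 Hs]; exists (Num.min r s); first by rewrite lt_min r0.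
move=> t; rewrite lt_min => /andP[/Hr[l fl] /Hs[m gm]].
by exists (l + m); apply: has_evalD.
Qed.

Lemma TposM f g : Tpos f -> Tpos g -> Tpos (f * g).
Proof.
move=> [r r0 Hr] [s s0 Hs]; exists (Num.min r s); first by rewrite lt_min r0.
move=> t; rewrite lt_min => /andP[/Hr[l fl] /Hs[m gm]].
by exists (l * m); apply: has_evalM.
Qed.

Lemma TposN f : Tpos f -> Tpos (- f).
Proof. by move=> [r r0 Hr]; exists r => // t /Hr[l fl]; exists (- l); apply: has_evalN. Qed.

Lemma TposC x : Tpos (fpsC x : fps C).
Proof. by exists 1 => // t _; exists x; apply: has_evalC. Qed.

Lemma Tpos0 : Tpos (0 : fps C). Proof. exact: TposC. Qed.
Lemma Tpos1 : Tpos (1 : fps C). Proof. exact: TposC. Qed.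

Lemma TposX : Tpos (@fpsX C).
Proof. by exists 1 => // t _; exists t; apply: has_evalX. Qed.

Lemma TposXn f n : Tpos f -> Tpos (f ^+ n).
Proof.
by move=> fT; elim: n => [|n IHn]; [apply: Tpos1|rewrite exprS; apply: TposM].
Qed.

Lemma Tpos_sum (I : Type) (r : seq I) (P : pred I) (f : I -> fps C) :
  (forall i, P i -> Tpos (f i)) -> Tpos (\sum_(i <- r | P i) f i).
Proof. by move=> H; apply: big_ind => //; [apply: Tpos0|apply: TposD]. Qed.

Lemma TposV f : Tpos f -> Tpos f^-1.
Proof.
have [f0|nf] := boolP (f \is a GRing.unit); last by rewrite invr_out.
move=> /TposP[c [B [c0 fB]]]; have [c' /andP[c'0 _] fB'] := pbound_shrink c0 f0 fB.
by apply/TposP; exists c', (absv (fcoef f 0))^-1; split=> //; apply: pbound_inv.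
Qed.

Hypothesis Cclosed : GRing.closed_field_axiom C.

(** A twist is only known at q^k-th powers, where its value is the q^k-th power of a value of the
    series; evaluating it at an arbitrary point requires a root of that point. *)
Lemma Froot k t : exists s, s ^+ (q ^ k) = t.
Proof.
have [s Es] := @Cclosed (q ^ k)%N (fun i => if i == 0%N then t else 0) (@qk_gt0 F k).
exists s; rewrite Es; have := @qk_gt0 F k; case: (q ^ k)%N => // n _.
by rewrite big_ord_recl /= mulr1 big1 ?addr0 // => i _; rewrite mul0r.
Qed.

Lemma Tpos_twist k f : Tpos f -> Tpos (twist k f).
Proof.
move=> [r r0 Hr]; exists (Num.min r 1 ^+ (q ^ k)).
  by rewrite exprn_gt0 // lt_min r0 ltr01.
have m0 : 0 <= Num.min r 1 by rewrite le_min (ltW r0) ler01.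
move=> t; have [s <-] := Froot k t; rewrite absvX => lt.
have : absv s < Num.min r 1.
  by rewrite ltNge; apply: contraL lt => le; rewrite -leNgt lerXn2r // nnegrE absv_ge0.
rewrite lt_min => /andP[/Hr[l fl] _].
by exists (l ^+ (q ^ k)); apply: has_eval_twist.
Qed.

End FpsAnalysis.

(** * Unordered infinite products *)

Section InfiniteProducts.
Variables (F : finFieldType) (R : realType) (C : valuedField F R).
Variable T : choiceType.
Implicit Types (y : T -> C) (S : {fset T}).

Definition cofinite_null y := forall eps : R, 0 < eps ->
  exists S, forall i, i \notin S -> absv (y i) < eps.

Definition tprod y S := \prod_(i <- S) (1 + y i).

Lemma prod1_le (r : seq T) y (eps : R) : 0 <= eps <= 1 ->
  {in r, forall i, absv (y i) <= eps} -> absv (\prod_(i <- r) (1 + y i) - 1) <= eps.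
Proof.
move=> /andP[e0 e1]; elim: r => [|i r IHr] yr; first by rewrite big_nil subrr absv0.
rewrite big_cons; set P := \prod_(j <- r) _.
have -> : (1 + y i) * P - 1 = (P - 1) + y i * P by ring.
have HP : absv (P - 1) <= eps by apply: IHr => j jr; rewrite yr // inE jr orbT.
apply: absvD_le => //; rewrite absvM -[leRHS]mulr1 ler_pM ?absv_ge0 ?yr ?mem_head //.
rewrite -(subrK 1 P); apply: absvD_le; rewrite ?absv1 //; exact: le_trans e1.
Qed.

Lemma tprodU y S S' : [disjoint S & S']%fset ->
  tprod y (S `|` S')%fset = tprod y S * tprod y S'.
Proof.
move=> dis; rewrite /tprod -big_cat /=; apply: perm_big; apply: uniq_perm.
- exact: fset_uniq.
- rewrite cat_uniq !fset_uniq andbT /=; apply/hasPn => i iS'.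
  by apply/negP => iS; move/fdisjointP: dis => /(_ i iS); rewrite iS'.
- by move=> i; rewrite mem_cat inE.
Qed.

Lemma fsetU_sub S S' : (S `<=` S')%fset -> (S `|` (S' `\` S))%fset = S'.
Proof.
move=> /fsubsetP sub; apply/fsetP => i; rewrite !inE.
by case: (boolP (i \in S)) => //= /sub ->.
Qed.

Lemma fdisjointUD S S' : [disjoint S & S' `\` S]%fset.
Proof. by apply/fdisjointP => i iS; rewrite inE iS. Qed.

Lemma tprod_sub_le y S S' (eps : R) : 0 <= eps <= 1 -> (S `<=` S')%fset ->
  (forall i, i \notin S -> absv (y i) <= eps) ->
  absv (tprod y S' - tprod y S) <= absv (tprod y S) * eps.
Proof.
move=> e01 sub yS; rewrite -(fsetU_sub sub) tprodU ?fdisjointUD //.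
rewrite -{2}[tprod y S]mulr1 -mulrBr absvM ler_wpM2l ?absv_ge0 //.
by apply: prod1_le => // i; rewrite inE => /andP[/yS].
Qed.

Lemma tprod_tail y S l (eps : R) : 0 <= eps <= 1 -> limto summability.totally (tprod y) l ->
  (forall i, i \notin S -> absv (y i) <= eps) ->
  absv (l - tprod y S) <= absv (tprod y S) * eps.
Proof.
move=> e01 /limto_totP yl yS; apply/ler_addgt0Pr => d d0.
have [S0 HS0] := yl _ d0.
have -> : l - tprod y S = (tprod y (S0 `|` S)%fset - tprod y S) - (tprod y (S0 `|` S)%fset - l).
  by ring.
apply: absvB_le.
  rewrite (le_trans (tprod_sub_le e01 (fsubsetUr S0 S) yS)) // lerDl ltW //.
rewrite (le_trans (ltW (HS0 _ (fsubsetUl S0 S)))) // lerDr mulr_ge0 ?absv_ge0 //.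
by case/andP: e01.
Qed.

(** The tail estimate needs a bound uniformly below one, hence the enlarged set outside which |y| <=
    1/2; the factors added to [S] have absolute value one. *)
Lemma tprod_absv y S l : cofinite_null y -> limto summability.totally (tprod y) l ->
  (forall i, i \notin S -> absv (y i) < 1) -> absv l = absv (tprod y S).
Proof.
move=> y0 yl yS; have [S1 HS1] := y0 2^-1 ltac:(lra).
set S2 := (S `|` S1)%fset.
have e01 : 0 <= (2^-1 : R) <= 1 by lra.
have HS2 i : i \notin S2 -> absv (y i) <= 2^-1.
  by rewrite inE negb_or => /andP[_ /HS1/ltW].
have -> : absv (tprod y S) = absv (tprod y S2).
  rewrite /S2 -(fsetU_sub (fsubsetUl S S1)) [in RHS]tprodU ?fdisjointUD // absvM.
  rewrite [X in _ = _ * X]absv_prod [X in _ = _ * X]big_seq big1 ?mulr1 // => i.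
  by rewrite inE => /andP[/yS lt1 _]; rewrite absvD_eql absv1.
have := tprod_tail e01 yl HS2.
have [->|P0] := eqVneq (tprod y S2) 0.
  rewrite absv0 mul0r subr0 => le; apply/eqP.
  by rewrite eq_le le absv_ge0.
move=> le; rewrite -{1}(subrK (tprod y S2) l) absvD_eqr // (le_lt_trans le) //.
by rewrite gtr_pMr ?absv_gt0 //; lra.
Qed.

Lemma limto_tot_seq (v : {fset T} -> C) l (s : nat -> {fset T}) :
  limto summability.totally v l ->
  (forall S, exists N, forall n, (N <= n)%N -> (S `<=` s n)%fset) ->
  limto \oo (fun n => v (s n)) l.
Proof.
move=> /limto_totP vl sS; apply/limto_seqP => eps /vl[S0 HS0].
by have [N HN] := sS S0; exists N => n /HN/HS0.
Qed.

Hypothesis Ccomp : Ccomplete C.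

(** Along increasing finite sets outside which |y| <= 2^-n the partial products are Cauchy. Every
    larger finite set stays within the same distance, so the limit of this sequence is the limit
    along all finite sets. *)
Lemma tprod_ex y : cofinite_null y -> exists l, limto summability.totally (tprod y) l.
Proof.
move=> y0.
have e0 n : 0 < (2^-1 : R) ^+ n by rewrite exprn_gt0 //; lra.
have /boolp.choice[s Hs] : forall n, exists S, forall i, i \notin S -> absv (y i) < 2^-1 ^+ n.
  by move=> n; apply: y0.
pose S (n : nat) : {fset T} := \big[@fsetU T/fset0]_(i <- iota 0 n.+1) s i.
have sS m n : (m <= n)%N -> (s m `<=` S n)%fset.
  by move=> mn; apply: bigfcup_sup => //; rewrite mem_iota.
have S1 i n : i \notin S n -> absv (y i) <= 2^-1 ^+ n.
  by move=> iS; apply/ltW/Hs; apply: contra iS; apply/fsubsetP/sS.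
pose B := absv (tprod y (S 0%N)).
have bd S' : (S 0%N `<=` S')%fset -> absv (tprod y S') <= B.
  move=> sub; rewrite -(subrK (tprod y (S 0%N)) (tprod y S')).
  apply: absvD_le => //; rewrite -[leRHS]mulr1.
  apply: tprod_sub_le => //; first by rewrite ler01 lexx.
  by move=> i /S1; rewrite expr0.
have half01 n : 0 <= (2^-1 : R) ^+ n <= 1.
  by rewrite (ltW (e0 n)) exprn_ile1 //; lra.
have S0S n : (S 0%N `<=` S n)%fset.
  by rewrite /S [in X in (X `<=` _)%fset]big_seq1 sS.
have dist n S' : (S n `<=` S')%fset -> absv (tprod y S' - tprod y (S n)) <= B * 2^-1 ^+ n.
  move=> sub; apply: (le_trans (tprod_sub_le (half01 n) sub (fun i => S1 i n))).
  by rewrite ler_wpM2r ?(ltW (e0 n)) // bd.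
have B0 : 0 <= B by apply: absv_ge0.
have h01 : 0 <= (2^-1 : R) < 1 by lra.
have mono m n : (m <= n)%N -> (S m `<=` S n)%fset.
  move=> mn; apply/bigfcupsP => i; rewrite mem_iota ltnS => /andP[_ im] _.
  by apply: sS; apply: leq_trans mn.
have [l Hl] : exists l, limto \oo (fun n => tprod y (S n)) l.
  apply: Ccomp => eps eps0; have [N HN] := geom_small h01 B0 eps0.
  exists N; have main (m n : nat) : (N <= m)%N -> (m <= n)%N ->
      absv (tprod y (S n) - tprod y (S m)) < eps.
    by move=> Nm mn; apply: le_lt_trans (dist m _ (mono m n mn)) _; apply: HN.
  by move=> m n Nm Nn; case/orP: (leq_total m n) => le; [rewrite absv_distC|]; apply: main.
exists l; apply/limto_totP => eps eps0.
have [N HN] := geom_small h01 B0 eps0; have [M HM] := (limto_seqP _ _).1 Hl _ eps0.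
exists (S (maxn N M)) => S' sub.
have -> : tprod y S' - l = (tprod y S' - tprod y (S (maxn N M))) + (tprod y (S (maxn N M)) - l).
  by ring.
apply: absvD_lt; last by apply: HM; apply: leq_maxr.
by apply: le_lt_trans (dist _ _ sub) _; apply: HN; apply: leq_maxl.
Qed.

End InfiniteProducts.

(** * Polynomials of bounded degree and their additive polynomials *)

Section PolyBoxes.
Variables (F : finFieldType) (R : realType) (C : valuedField F R).
Local Notation q := #|F|.
Local Notation th := (theta C).
Local Notation scal := (@vf_scal F R C).
Local Notation evA := (@evA F R C).

Fixpoint polys n : seq {poly F} :=
  if n is m.+1 then [seq (c *: 'X^m + a : {poly F}) | c <- enum F, a <- polys m] else [:: 0].

Lemma mem_polys n (a : {poly F}) : (a \in polys n) = (size a <= n)%N.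
Proof.
elim: n a => [|n IHn] a /=; first by rewrite inE leqn0 size_poly_eq0.
apply/allpairsP/idP => [[[c b] /= [_ +] ->]|sa].
  rewrite IHn => sb; rewrite (leq_trans (size_polyD _ _)) // geq_max.
  by rewrite (leq_trans (size_scale_leq _ _)) ?size_polyXn //= leqW.
exists (a`_n, a - a`_n *: 'X^n); split; rewrite ?mem_enum ?subrKC //=.
rewrite IHn; apply/leq_sizeP => j nj; rewrite coefB coefZ coefXn.
have [->|jn] := eqVneq j n; first by rewrite mulr1 subrr.
by rewrite mulr0 subr0; move/leq_sizeP: sa; apply; rewrite ltn_neqAle eq_sym jn.
Qed.

Lemma polys_uniq n : uniq (polys n).
Proof.
elim: n => //= n IHn; apply: allpairs_uniq => //; first exact: enum_uniq.
move=> [c a] [d b] /= /allpairsP[[c' a'] /= [_ +] [-> ->]].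
rewrite mem_polys => sa' /allpairsP[[d' b'] /= [_ +] [-> ->]] E.
rewrite mem_polys => sb'.
have cd : c' = d'.
  have := congr1 (fun p : {poly F} => p`_n) E.
  by rewrite /= !coefD !coefZ !coefXn eqxx !mulr1 (leq_sizeP _ _ sa') // (leq_sizeP _ _ sb') // !addr0.
by move: E; rewrite cd => /addrI ->.
Qed.

Definition fpolys n : {fset {poly F}} := [fset a in polys n]%fset.

Lemma in_fpolys n a : (a \in fpolys n) = (size a <= n)%N.
Proof. by rewrite inE mem_polys. Qed.

Lemma big_fpolys (V : Type) (idx : V) (op : Monoid.com_law idx) n (f : {poly F} -> V) :
  \big[op/idx]_(a <- fpolys n) f a = \big[op/idx]_(a <- polys n) f a.
Proof.
apply: perm_big; apply: uniq_perm; rewrite ?fset_uniq ?polys_uniq //.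
by move=> a; rewrite in_fpolys mem_polys.
Qed.

Lemma fpolys_exhaust (S : {fset {poly F}}) :
  exists N, forall n, (N <= n)%N -> (S `<=` fpolys n)%fset.
Proof.
exists (\max_(a <- S) size a) => n Nn; apply/fsubsetP => a aS.
by rewrite in_fpolys (leq_trans _ Nn) // (big_rem a) //= leq_maxl.
Qed.

(** The additive polynomial whose roots are the elements of A of degree less than n. *)
Definition psub n (x : C) := \prod_(a <- polys n) (x + evA a).

Lemma psubS n x : psub n.+1 x = \prod_(c : F) psub n (x + scal c * th ^+ n).
Proof.
rewrite /psub /= big_allpairs_dep big_enum; apply: eq_bigr => c _; apply: eq_bigr => a _.
by rewrite rmorphD /= -mul_polyC rmorphM rmorphXn /= evAC evAX addrA.
Qed.

(** Linearity and recursion feed each other: linearity at level [n] gives the recursion through the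
    factorization of x^q - y^(q-1) x over F_q, and the recursion gives linearity at level n + 1. *)
Lemma psub_lin n : (forall x y, psub n (x + y) = psub n x + psub n y) *
  (forall (c : F) x, psub n (scal c * x) = scal c * psub n x) *
  (forall x, psub n.+1 x = psub n x ^+ q - psub n (th ^+ n) ^+ (q - 1) * psub n x).
Proof.
suff key m : (forall x y, psub m (x + y) = psub m x + psub m y) *
  (forall (c : F) x, psub m (scal c * x) = scal c * psub m x) ->
  (forall x, psub m.+1 x = psub m x ^+ q - psub m (th ^+ m) ^+ (q - 1) * psub m x).
  have lin : (forall x y, psub n (x + y) = psub n x + psub n y) *
    (forall (c : F) x, psub n (scal c * x) = scal c * psub n x).
    elim: n => [|n IHn].
      have p0 x : psub 0 x = x by rewrite /psub big_seq1 rmorph0 addr0.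
      by split=> *; rewrite !p0.
    split=> *; rewrite !(key _ IHn).
      by rewrite IHn FrobqD; ring.
    by rewrite IHn exprMn scal_Frobq; ring.
  by split=> //; apply: key.
move=> [pD pZ] x; rewrite psubS -prod_scal (reindex_inj (@oppr_inj F)) /=.
by apply: eq_bigr => c _; rewrite pD pZ rmorphN mulNr.
Qed.

Lemma psubD n x y : psub n (x + y) = psub n x + psub n y.
Proof. by rewrite (psub_lin n). Qed.

Lemma psub0 n : psub n 0 = 0.
Proof. by apply: (addrI (psub n 0)); rewrite -psubD !addr0. Qed.

Lemma psubN n x : psub n (- x) = - psub n x.
Proof. by apply/eqP; rewrite -subr_eq0 opprK -psubD addNr psub0. Qed.

Lemma psubB n x y : psub n (x - y) = psub n x - psub n y.
Proof. by rewrite psubD psubN. Qed.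

Lemma psub_eq0 n x : (psub n x == 0) = [exists a : 'I_(size (polys n)), x == - evA (polys n)`_a].
Proof.
rewrite /psub prodf_seq_eq0; apply/hasP/existsP => [[a an /= x0]|[i /eqP xE]].
  have ia : (index a (polys n) < size (polys n))%N by rewrite index_mem.
  by exists (Ordinal ia); rewrite /= nth_index // -addr_eq0.
by exists (polys n)`_i; rewrite ?mem_nth //= xE addNr.
Qed.

End PolyBoxes.

(** * Factorization over an algebraically closed field *)

Section ClosedField.
Variables (K : fieldType) (Kclosed : GRing.closed_field_axiom K).

Lemma closed_root (P : {poly K}) : (1 < size P)%N -> exists x, root P x.
Proof.
move=> sP; have sP0 : (0 < (size P).-1)%N by case: (size P) sP => [|[]].
have lP : lead_coef P != 0 by rewrite lead_coef_eq0 -size_poly_gt0 ltnW.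
have [x xE] := Kclosed (fun i => - P`_i / lead_coef P) sP0.
exists x; rewrite /root horner_coef -(prednK (ltnW sP)) big_ord_recr /= xE.
rewrite mulr_sumr -big_split /= big1 // => i _.
by rewrite mulrA [_ * (_ / _)]mulrCA divff // mulr1 mulNr subrr.
Qed.

Lemma closed_factor (P : {poly K}) : P != 0 ->
  exists r : seq K, P = lead_coef P *: \prod_(a <- r) ('X - a%:P).
Proof.
have [n] := ubnP (size P); elim: n P => // n IHn P; rewrite ltnS => sP P0.
have [sP1|sP1] := leqP (size P) 1.
  exists [::]; rewrite big_nil alg_polyC.
  by rewrite [P in LHS](size1_polyC sP1) [in RHS](size1_polyC sP1) lead_coefC.
have [x /factor_theorem[Q PE]] := closed_root sP1.
have Q0 : Q != 0 by apply: contra_neq P0 => Q0; rewrite PE Q0 mul0r.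
have sQ : (size Q < n)%N by rewrite (leq_trans _ sP) // PE size_Mmonic ?monicXsubC // size_XsubC addn2.
have [r QE] := IHn Q sQ Q0; exists (x :: r).
rewrite big_cons {1}PE {1}QE PE lead_coef_Mmonic ?monicXsubC // -scalerAl mulrC.
by rewrite [_ * \prod_(a <- r) _]mulrC.
Qed.

End ClosedField.

(** * The field K_infty as a closure *)

Section Kinfty.
Variables (F : finFieldType) (R : realType) (C : valuedField F R).
Local Notation q := #|F|.
Local Notation th := (theta C).
Local Notation scal := (@vf_scal F R C).
Local Notation evA := (@evA F R C).
Implicit Types (x y z k s : C) (a b : {poly F}).

Lemma absv_evA_lt a D : (size a <= D)%N -> absv (evA a) < q%:R ^+ D.
Proof.
have [-> _|a0 sa] := eqVneq a 0; first by rewrite rmorph0 absv0 exprn_gt0 ?qR_gt0.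
rewrite absv_evA // ltr_eXn2l ?qR_gt1 // (leq_trans _ sa) // prednK //.
by rewrite lt0n size_poly_eq0.
Qed.

Lemma absv_evA_ge a D : (D < size a)%N -> q%:R ^+ D <= absv (evA a).
Proof.
move=> Da; have a0 : a != 0 by rewrite -size_poly_gt0 (leq_ltn_trans _ Da).
rewrite absv_evA // ler_weXn2l ?ltW ?qR_gt1 //; lia.
Qed.

Lemma size_absv_lt a D : absv (evA a) < q%:R ^+ D -> (size a <= D)%N.
Proof. by move=> lt; rewrite leqNgt; apply: contraL lt => /absv_evA_ge; rewrite leNgt. Qed.

Lemma absv_th_neq0 n : 0 < (q%:R : R) ^+ n. Proof. by rewrite exprn_gt0 ?qR_gt0. Qed.

(** The closure of F_q[theta, 1/theta] in C. In this form the field operations are density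
    arguments; [KinfE] identifies it with the digit expansions of the definition. *)
Definition Kc : set C := [set x | forall eps : R, 0 < eps ->
  exists a M, absv (x - evA a / th ^+ M) < eps].

Lemma thX_neq0 n : th ^+ n != 0. Proof. by rewrite expf_neq0 ?th_neq0. Qed.

Lemma Kc_approx x : (forall eps : R, 0 < eps -> exists2 y, Kc y & absv (x - y) < eps) -> Kc x.
Proof.
move=> H eps e0; have [y /(_ _ e0)[a [M aM]] xy] := H _ e0.
exists a, M; have -> : x - evA a / th ^+ M = (x - y) + (y - evA a / th ^+ M) by ring.
exact: absvD_lt.
Qed.

Lemma Kc_evA a : Kc (evA a).
Proof. by move=> eps e0; exists a, 0%N; rewrite expr0 divr1 subrr absv0. Qed.

Lemma Kc_frac a M : Kc (evA a / th ^+ M).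
Proof. by move=> eps e0; exists a, M; rewrite subrr absv0. Qed.

Lemma KcB x y : Kc x -> Kc y -> Kc (x - y).
Proof.
move=> Kx Ky eps e0; have [a [M aM]] := Kx _ e0; have [b [N bN]] := Ky _ e0.
exists (a * 'X^N - b * 'X^M), (M + N)%N.
have -> : evA (a * 'X^N - b * 'X^M) / th ^+ (M + N) = evA a / th ^+ M - evA b / th ^+ N.
  rewrite rmorphB !rmorphM !rmorphXn /= !evAX exprD.
  by field; rewrite !thX_neq0.
have -> : x - y - (evA a / th ^+ M - evA b / th ^+ N) =
  (x - evA a / th ^+ M) - (y - evA b / th ^+ N) by ring.
exact: absvB_lt.
Qed.

Lemma Kc0 : Kc 0. Proof. by rewrite -(rmorph0 evA); apply: Kc_evA. Qed.
Lemma Kc1 : Kc 1. Proof. by rewrite -(rmorph1 evA); apply: Kc_evA. Qed.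
Lemma KcN x : Kc x -> Kc (- x). Proof. by rewrite -sub0r; apply: KcB Kc0. Qed.
Lemma KcD x y : Kc x -> Kc y -> Kc (x + y).
Proof. by move=> Kx /KcN; rewrite -{2}[y]opprK; apply: KcB. Qed.

Lemma KcM x y : Kc x -> Kc y -> Kc (x * y).
Proof.
move=> Kx Ky eps e0.
have dy : 0 < eps / (absv y + 1) by rewrite divr_gt0 // ltr_wpDl ?absv_ge0.
have [a [M aM]] := Kx _ dy.
set p := evA a / th ^+ M in aM.
have dp : 0 < eps / (absv p + 1) by rewrite divr_gt0 // ltr_wpDl ?absv_ge0.
have [b [N bN]] := Ky _ dp; exists (a * b), (M + N)%N.
have -> : evA (a * b) / th ^+ (M + N) = p * (evA b / th ^+ N).
  by rewrite rmorphM exprD /p; field; rewrite !thX_neq0.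
have -> : x * y - p * (evA b / th ^+ N) = y * (x - p) + p * (y - evA b / th ^+ N) by ring.
have lem (u v : C) : absv v < eps / (absv u + 1) -> absv (u * v) < eps.
  rewrite absvM ltr_pdivlMr ?ltr_wpDl ?absv_ge0 // => lt; apply: le_lt_trans lt.
  by rewrite mulrC ler_wpM2l ?absv_ge0 // lerDl.
by apply: absvD_lt; apply: lem.
Qed.

Lemma KcX x n : Kc x -> Kc (x ^+ n).
Proof. by move=> Kx; elim: n => [|n IHn]; rewrite ?expr0 ?exprS; [apply: Kc1|apply: KcM]. Qed.

Lemma Kc_thV : Kc th^-1.
Proof. by have := Kc_frac 1 1; rewrite rmorph1 expr1 div1r. Qed.

Lemma KcV1 x : Kc x -> absv x < 1 -> Kc (1 - x)^-1.
Proof.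
move=> Kx x1; have Nx : 1 - x != 0.
  by rewrite -absv_eq0 absvB_eql absv1 ?oner_eq0.
apply: Kc_approx => eps e0.
have x01 : 0 <= absv x < 1 by rewrite absv_ge0.
have [N HN] := geom_small x01 ler01 e0.
exists (\sum_(i < N) x ^+ i); first by apply: big_ind => [|*|i _]; [apply: Kc0|apply: KcD|apply: KcX].
have E := subrX1 x N.
have -> : (1 - x)^-1 - \sum_(i < N) x ^+ i = x ^+ N / (1 - x).
  apply: (mulfI Nx); rewrite mulrBr divff // mulrCA divff // mulr1.
  by rewrite -[X in X * _]opprB mulNr -E opprB; ring.
by rewrite absvM absvV absvX absvB_eql absv1 // invr1 mulr1 -[ltLHS]mul1r; exact: HN.
Qed.

(** Writing a = c theta^d (1 - w) with |w| < 1 reduces the inverse to the geometric series of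
    [KcV1]. *)
Lemma Kc_evAV a : Kc (evA a)^-1.
Proof.
have [->|a0] := eqVneq a 0; first by rewrite rmorph0 invr0; apply: Kc0.
set c := lead_coef a; set d := (size a).-1.
have c0 : c != 0 by rewrite lead_coef_eq0.
have sc0 : scal c != 0 by rewrite fmorph_eq0.
have sza : size a = d.+1 by rewrite prednK // lt0n size_poly_eq0.
pose w := - (evA (a - c *: 'X^d) / (scal c * th ^+ d)).
have sr : (size (a - c *: 'X^d)%R <= d)%N.
  apply/leq_sizeP => j dj; rewrite coefB coefZ coefXn.
  have [->|jd] := eqVneq j d; first by rewrite mulr1 subrr.
  by rewrite mulr0 subr0 nth_default // sza ltn_neqAle eq_sym jd.
have Kw : Kc w.
  apply: KcN; rewrite invfM mulrCA -fmorphV -evAC; apply: KcM (Kc_evA _) _.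
  exact: Kc_frac.
have w1 : absv w < 1.
  rewrite absvN !absvM absvV absvM absv_scal c0 mul1r absvX absv_th.
  by rewrite ltr_pdivrMr ?absv_th_neq0 // mul1r absv_evA_lt.
have Ea : evA a = evA (a - c *: 'X^d) + scal c * th ^+ d.
  by rewrite rmorphB /= -[c *: _]mul_polyC rmorphM rmorphXn /= evAC evAX subrK.
have -> : (evA a)^-1 = (scal c)^-1 * (th^-1 ^+ d * (1 - w)^-1).
  rewrite exprVn -!invfM; congr (_^-1); rewrite Ea /w opprK.
  by field; rewrite sc0 thX_neq0.
apply: KcM; first by rewrite -fmorphV -evAC; apply: Kc_evA.
by apply: KcM (KcX _ Kc_thV) (KcV1 Kw w1).
Qed.

Lemma KcV x : Kc x -> Kc x^-1.
Proof.
have [->|x0] := eqVneq x 0; first by rewrite invr0.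
move=> Kx; apply: Kc_approx => eps e0.
have ax : 0 < absv x by rewrite absv_gt0.
have : 0 < Num.min (absv x) (eps * absv x ^+ 2).
  by rewrite lt_min ax mulr_gt0 // exprn_gt0.
move=> /Kx[a [M]]; set p := _ / _; rewrite lt_min => /andP[lt1 lt2].
have Ep : absv p = absv x by rewrite -(subrK x p) absvD_eqr // absv_distC.
have p0 : p != 0 by rewrite -absv_gt0 Ep.
exists p^-1.
  by rewrite /p invf_div; apply: KcM (Kc_evAV _); rewrite -evAX -rmorphXn; apply: Kc_evA.
have -> : x^-1 - p^-1 = (p - x) / (x * p) by field; rewrite x0 p0.
by rewrite absvM absvV absvM Ep absv_distC ltr_pdivrMr ?mulr_gt0 // -expr2.
Qed.

Lemma Kc_round x : Kc x -> exists a, absv (x - evA a) < 1.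
Proof.
move=> /(_ 1 ltr01)[b [M bM]]; exists (drop_poly M b).
have -> : x - evA (drop_poly M b) = (x - evA b / th ^+ M) + evA (take_poly M b) / th ^+ M.
  rewrite -{2}(poly_take_drop M b) rmorphD rmorphM rmorphXn /= evAX.
  by field; rewrite thX_neq0.
apply: absvD_lt => //; rewrite absvM absvV absvX absv_th ltr_pdivrMr ?absv_th_neq0 // mul1r.
by rewrite absv_evA_lt ?size_take_poly.
Qed.

Lemma Kc_digit1 x : Kc x -> absv x <= 1 -> exists c, absv (x - scal c) < 1.
Proof.
move=> Kx x1; have [a xa] := Kc_round Kx.
have a1 : absv (evA a) < q%:R ^+ 1.
  rewrite -(subrK x (evA a)); apply: le_lt_trans (_ : 1 < _); last by rewrite expr1 qR_gt1.
  by apply: absvD_le => //; rewrite absv_distC ltW.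
have /size1_polyC aE := size_absv_lt a1.
by exists a`_0; rewrite -evAC -aE.
Qed.

(** Nonzero elements of F_q[theta, 1/theta] have integral powers of q as absolute values, and this
    discreteness passes to the closure. *)
Lemma Kc_lt1 x : Kc x -> absv x < 1 -> absv (th * x) <= 1.
Proof.
move=> Kx x1; have [a [M aM]] : exists a M, absv (x - evA a / th ^+ M) < q%:R^-1.
  by apply: Kx; rewrite invr_gt0 qR_gt0.
have qi1 : (q%:R : R)^-1 < 1 by rewrite invf_lt1 ?qR_gt0 ?qR_gt1.
have a1 : absv (evA a / th ^+ M) < 1.
  rewrite -(subrK x (evA a / th ^+ M)); apply: absvD_lt => //.
  by rewrite absv_distC (lt_trans aM).
have -> : th * x = th * (x - evA a / th ^+ M) + th * (evA a / th ^+ M) by ring.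
apply: absvD_le; rewrite absvM absv_th.
  by rewrite -ler_pdivlMl ?qR_gt0 // mulr1 ltW.
move: a1; rewrite absvM absvV absvX absv_th ltr_pdivrMr ?absv_th_neq0 // mul1r.
move=> /size_absv_lt; have [->|a0 sa] := eqVneq a 0.
  by rewrite rmorph0 absv0 mul0r mulr0 ler01.
rewrite absv_evA // mulrA -exprS ler_pdivrMr ?absv_th_neq0 // mul1r.
by rewrite ler_weXn2l ?ltW ?qR_gt1 // prednK // lt0n size_poly_eq0.
Qed.

Lemma ex_expq (B : R) : exists N, B <= q%:R ^+ N.
Proof.
have [B0|B0] := lerP B 0; first by exists 0%N; rewrite expr0 (le_trans B0).
have qi : 0 <= (q%:R : R)^-1 < 1.
  by rewrite invr_ge0 ltW ?qR_gt0 //= invf_lt1 ?qR_gt0 // qR_gt1.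
have [N /(_ N (leqnn N))] := geom_small qi (ltW B0) ltr01.
by rewrite exprVn ltr_pdivrMr ?absv_th_neq0 // mul1r => /ltW; exists N.
Qed.

(** For the nontrivial inclusion the digits are extracted greedily: after division by a power of
    theta the element lies in the unit disc, and each step subtracts its residue in F_q and
    multiplies by theta, which by discreteness stays in that disc. *)
Lemma KinfE : @Kinf F R C = Kc.
Proof.
apply/seteqP; split=> x.
  move=> [N [a /has_sumP H]]; apply: Kc_approx => eps e0; have [M HM] := H _ e0.
  exists (\sum_(i < M) scal (a i) * (th ^+ N / th ^+ i)); last by rewrite absv_distC HM.
  apply: big_ind => [|*|i _]; [apply: Kc0|apply: KcD => //|].
  rewrite -evAC mulrA -evAX -rmorphXn -rmorphM /= [evA 'X in X in _ / X]evAX.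
  exact: Kc_frac.
move=> Kx; have [N xN] := ex_expq (absv x).
have /boolp.choice[dig Hdig] : forall y, exists c, Kc y -> absv y <= 1 -> absv (y - scal c) < 1.
  move=> y; have [Ky|nKy] := pselect (Kc y); last by exists 0.
  have [y1|y1] := lerP (absv y) 1; last by exists 0.
  by have [c Hc] := Kc_digit1 Ky y1; exists c.
pose Y i := iter i (fun y => th * (y - scal (dig y))) (x / th ^+ N).
have HY i : Kc (Y i) /\ absv (Y i) <= 1.
  elim: i => [|i [KY Y1]] /=.
    split; first by apply: KcM => //; rewrite -exprVn; apply: KcX Kc_thV.
    by rewrite absvM absvV absvX absv_th ler_pdivrMr ?absv_th_neq0 // mul1r.
  have KY' : Kc (Y i - scal (dig (Y i))) by apply: KcB => //; rewrite -evAC; apply: Kc_evA.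
  split; first by apply: KcM => //; rewrite -evAX; apply: Kc_evA.
  by apply: Kc_lt1 => //; apply: Hdig.
exists N, (fun i => dig (Y i)); apply/has_sumP => eps e0.
have E n : \sum_(i < n) scal (dig (Y i)) * (th ^+ N / th ^+ i) - x = - (th ^+ N * Y n / th ^+ n).
  elim: n => [|n IHn]; first by rewrite big_ord0 /= expr0 divr1 sub0r mulrCA divff ?thX_neq0 // mulr1.
  rewrite big_ord_recr /= -addrAC IHn exprS.
  by field; rewrite thX_neq0 th_neq0.
have qi : 0 <= (q%:R : R)^-1 < 1.
  by rewrite invr_ge0 ltW ?qR_gt0 //= invf_lt1 ?qR_gt0 // qR_gt1.
have [M HM] := geom_small qi (ltW (absv_th_neq0 N)) e0.
exists M => n /HM; rewrite E absvN !absvM absvV !absvX absv_th exprVn; apply: le_lt_trans.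
apply: ler_wpM2r; first by rewrite invr_ge0 ltW ?absv_th_neq0.
rewrite -[leRHS]mulr1; apply: ler_wpM2l; first by rewrite ltW ?absv_th_neq0.
by case: (HY n).
Qed.

End Kinfty.

Arguments Kc {F R C}.
Arguments Kc_evA {F R C} a.
Arguments Kc_evAV {F R C} a.
Arguments Kc_frac {F R C} a M.
Arguments Kc0 {F R C}.
Arguments Kc1 {F R C}.
Arguments Kc_thV {F R C}.
Arguments KinfE {F R C}.

Lemma det_mx22 (A : comNzRingType) (M : 'M[A]_2) :
  \det M = M 0 0 * M 1 1 - M 0 1 * M 1 0.
Proof.
rewrite (expand_det_row _ 0) !big_ord_recl big_ord0 addr0 /cofactor !det_mx11 !mxE.
rewrite expr0 mul1r /= expr1 mulN1r mulrN.
by congr (_ * M _ _ - M _ _ * M _ _); apply: val_inj.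
Qed.

Lemma prod_ge_exp (R : realFieldType) (T : eqType) (r : seq T) (e : R) (f : T -> R) :
  0 <= e -> {in r, forall a, e <= f a} -> e ^+ size r <= \prod_(a <- r) f a.
Proof.
move=> e0; elim: r => [|a r IHr] H; first by rewrite big_nil.
rewrite big_cons exprS ler_pM ?exprn_ge0 ?H ?mem_head //.
by apply: IHr => b br; rewrite H // inE br orbT.
Qed.

(** * Geometry of Omega and of its affinoid covering *)

Section OmegaGeometry.
Variables (F : finFieldType) (R : realType) (C : valuedField F R).
Local Notation q := #|F|.
Local Notation th := (theta C).
Local Notation scal := (@vf_scal F R C).
Local Notation evA := (@evA F R C).
Local Notation Omega := (Omega C).
Implicit Types (x y k s : C) (a b c d : {poly F}) (z w : Omega).

Lemma notKc z : ~ Kc (sval z).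
Proof. by rewrite -KinfE; case: z. Qed.

Lemma KinfP k : Kinf k <-> Kc k. Proof. by rewrite KinfE. Qed.

Lemma Kinf_ratio a b : Kinf (evA a / evA b).
Proof. by rewrite KinfE; apply: KcM (Kc_evA _) (Kc_evAV _). Qed.

Lemma lattice_eq0 z a b : (evA a + evA b * sval z == 0) = (a == 0) && (b == 0).
Proof.
have [->|b0] /= := eqVneq b 0; first by rewrite rmorph0 mul0r addr0 evA_eq0 andbT.
rewrite andbF; apply/eqP => E; apply: (@notKc z).
have -> : sval z = - (evA a / evA b).
  by apply: (mulfI (_ : evA b != 0)); rewrite ?evA_eq0 // mulrN mulrCA divff ?evA_eq0 // mulr1;
     apply/eqP; rewrite -addr_eq0 addrC E.
by apply: KcN; apply: KcM (Kc_evA _) (Kc_evAV _).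
Qed.

Lemma sval_neq0 z : sval z != 0.
Proof. by apply/eqP => z0; apply: (@notKc z); rewrite z0; apply: Kc0. Qed.

Definition mkO x (nx : ~ Kinf x) : Omega := exist _ x nx.

Lemma moebius_ex (gam : 'M[{poly F}]_2) z : gam \in unitmx -> exists w, moebius_rel gam z w.
Proof.
rewrite unitmxE poly_unitE => /andP[/eqP sd _].
set x := (evA (gam 0 0) * sval z + evA (gam 0 1)) / autJ gam z.
suff nx : ~ Kinf x by exists (mkO nx).
have detE : \det gam = gam 0 0 * gam 1 1 - gam 0 1 * gam 1 0 by rewrite det_mx22.
have det0 : evA (\det gam) != 0 by rewrite evA_eq0 -size_poly_gt0 sd.
have J0 : autJ gam z != 0.
  rewrite /autJ addrC lattice_eq0; apply: contraNN det0 => /andP[/eqP E1 /eqP E2].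
  by rewrite detE E1 E2 !mulr0 subrr rmorph0.
move=> /KinfP Kx; apply: (@notKc z).
have E : (x * evA (gam 1 0) - evA (gam 0 0)) * sval z = evA (gam 0 1) - x * evA (gam 1 1).
  apply/eqP; rewrite -subr_eq0.
  have -> : (x * evA (gam 1 0) - evA (gam 0 0)) * sval z - (evA (gam 0 1) - x * evA (gam 1 1)) =
    x * autJ gam z - (evA (gam 0 0) * sval z + evA (gam 0 1)) by rewrite /autJ; ring.
  by rewrite divfK // subrr.
have [E0|n0] := eqVneq (x * evA (gam 1 0) - evA (gam 0 0)) 0.
  move: E; rewrite E0 mul0r => /esym E1.
  case/negP: det0; rewrite detE rmorphB !rmorphM /=.
  have -> : evA (gam 0 0) = x * evA (gam 1 0) by apply/eqP; rewrite eq_sym -subr_eq0 E0.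
  have -> : evA (gam 0 1) = x * evA (gam 1 1) by apply/eqP; rewrite -subr_eq0 E1.
  by apply/eqP; ring.
have -> : sval z = (evA (gam 0 1) - x * evA (gam 1 1)) / (x * evA (gam 1 0) - evA (gam 0 0)).
  by rewrite -E mulrC mulKf.
by apply: KcM; [|apply: KcV]; apply: KcB; rewrite ?(KcM _ _) //; try apply: KcM => //; apply: Kc_evA.
Qed.

Lemma affinoid_ex z : exists n, affinoid n z.
Proof.
have /boolp.existsNP[eps /boolp.not_implyP[e0 H]] := @notKc z.
have [N HN] := ex_expq F (absv (sval z)).
have [M HM] := ex_expq F eps^-1.
have leq1 m n : (m <= n)%N -> q%:R ^+ m <= q%:R ^+ n :> R.
  by move=> mn; rewrite ler_weXn2l ?ltW ?qR_gt1.
exists (maxn N M); split; first by rewrite (le_trans HN) // leq1 ?leq_maxl.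
move=> k /KinfP Kk.
rewrite (le_trans (_ : _ <= eps)) //.
  rewrite -[eps]invrK lef_pV2 ?posrE ?invr_gt0 ?absv_th_neq0 //.
  by rewrite (le_trans HM) // leq1 ?leq_maxr.
rewrite leNgt; apply/negP => lt; apply: H.
have [a [n an]] := Kk _ e0; exists a, n.
by rewrite -(subrK k (sval z)) -addrA; apply: absvD_lt.
Qed.

Lemma affinoid_le n m z : (n <= m)%N -> affinoid n z -> affinoid m z.
Proof.
move=> nm [z1 z2]; have le : q%:R ^+ n <= q%:R ^+ m :> R by rewrite ler_weXn2l ?ltW ?qR_gt1.
split=> [|k Kk]; first exact: le_trans le.
by apply: le_trans (z2 k Kk); rewrite lef_pV2 ?posrE ?absv_th_neq0.
Qed.

Lemma lattice_ge n z a b : affinoid n z -> absv (evA b) * q%:R ^- n <= absv (evA a + evA b * sval z).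
Proof.
move=> [_ zn]; have [->|b0] := eqVneq b 0; first by rewrite rmorph0 absv0 mul0r absv_ge0.
have -> : evA a + evA b * sval z = evA b * (sval z - evA (- a) / evA b).
  by rewrite rmorphN; field; rewrite evA_eq0.
by rewrite absvM ler_wpM2l ?absv_ge0 //; apply: zn; apply: Kinf_ratio.
Qed.

(** This is what makes estimates of e_z uniform: over one affinoid, the lattice points of bounded
    absolute value come from a finite box of coefficients that does not depend on z. *)
Lemma lattice_small n N z a b : affinoid n z -> absv (evA a + evA b * sval z) < q%:R ^+ N ->
  (size b <= N + n)%N /\ (size a <= N + n + n)%N.
Proof.
move=> zn lt; have bN : absv (evA b) < q%:R ^+ (N + n).
  have := le_lt_trans (lattice_ge a b zn) lt.
  by rewrite ltr_pdivrMr ?absv_th_neq0 // exprD.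
split; apply: (@size_absv_lt _ R C) => //.
have -> : evA a = (evA a + evA b * sval z) - evA b * sval z by rewrite addrK.
apply: absvB_lt.
  by rewrite (lt_le_trans lt) // ler_weXn2l ?ltW ?qR_gt1 // -addnA leq_addr.
rewrite absvM exprD (le_lt_trans (_ : _ <= absv (evA b) * q%:R ^+ n)) //.
  by rewrite ler_wpM2l ?absv_ge0 //; case: zn.
by rewrite ltr_pM2r ?absv_th_neq0.
Qed.

End OmegaGeometry.

(** * Rigid analytic functions on Omega *)

Section Holomorphic.
Variables (F : finFieldType) (R : realType) (C : valuedField F R).
Local Notation q := #|F|.
Local Notation th := (theta C).
Local Notation scal := (@vf_scal F R C).
Local Notation evA := (@evA F R C).
Local Notation Omega := (Omega C).
Implicit Types (x y k s : C) (z w : Omega) (f g : Omega -> C) (P Q : {poly C}).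

Lemma hol_lim f : (forall n (eps : R), 0 < eps -> exists2 g, holomorphic g &
  forall z, affinoid n z -> absv (f z - g z) < eps) -> holomorphic f.
Proof.
move=> H n eps e0; have [g hg fg] := H n _ e0; have [P [Q HPQ]] := hg n _ e0.
exists P, Q => z zn; have [Q0 gPQ] := HPQ z zn; split=> //.
by rewrite -(subrK (g z) (f z)) -addrA; apply: absvD_lt => //; apply: fg.
Qed.

Lemma hol_ext f g : f =1 g -> holomorphic f -> holomorphic g.
Proof. by move=> /funext ->. Qed.

Lemma hol_rat P Q : (forall z, Q.[sval z] != 0) -> holomorphic (fun z => P.[sval z] / Q.[sval z]).
Proof. by move=> H n eps e0; exists P, Q => z _; rewrite subrr absv0. Qed.

Lemma hol_poly P : holomorphic (fun z => P.[sval z]).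
Proof.
apply: hol_ext (@hol_rat P 1 _) => z; rewrite hornerC ?divr1 //; exact: oner_neq0.
Qed.

Lemma hol_const x : holomorphic (fun=> x).
Proof. by apply: hol_ext (hol_poly x%:P) => z; rewrite hornerC. Qed.

Lemma hol_id : holomorphic (fun z => sval z).
Proof. by apply: hol_ext (hol_poly 'X) => z; rewrite hornerX. Qed.

Lemma holD f g : holomorphic f -> holomorphic g -> holomorphic (fun z => f z + g z).
Proof.
move=> hf hg n eps e0; have [P [Q H]] := hf n _ e0; have [P' [Q' H']] := hg n _ e0.
exists (P * Q' + P' * Q), (Q * Q') => z zn; have [Q0 le] := H z zn; have [Q0' le'] := H' z zn.
rewrite !hornerE; split; first by rewrite mulf_neq0.
have -> : f z + g z - (P.[sval z] * Q'.[sval z] + P'.[sval z] * Q.[sval z]) / (Q.[sval z] * Q'.[sval z])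
  = (f z - P.[sval z] / Q.[sval z]) + (g z - P'.[sval z] / Q'.[sval z]).
  by field; rewrite Q0 Q0'.
exact: absvD_lt.
Qed.

Lemma poly_bounded P (B : R) : exists D, forall x, absv x <= B -> absv P.[x] <= D.
Proof.
exists (\sum_(i < size P) absv P`_i * `|B| ^+ i) => x xB; rewrite horner_coef.
apply: absv_sum_le => [|i _]; first by apply: sumr_ge0 => i _; rewrite mulr_ge0 ?absv_ge0 ?exprn_ge0.
rewrite (bigD1 i) //= absvM absvX (le_trans (_ : _ <= absv P`_i * `|B| ^+ i)) //.
  rewrite ler_wpM2l ?absv_ge0 // lerXn2r ?nnegrE ?absv_ge0 ?normr_ge0 //.
  by rewrite (le_trans xB) // ler_norm.
by rewrite lerDl sumr_ge0 // => j _; rewrite mulr_ge0 ?absv_ge0 ?exprn_ge0.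
Qed.

(** A point outside the affinoid is too large or too close to K_infty, while points of the affinoid
    are neither. Zeros of denominators thus stay at a uniform distance, which replaces a compactness
    argument. *)
Lemma outside_affinoid n x : (forall z, affinoid n z -> sval z <> x) ->
  forall z, affinoid n z -> q%:R ^- n <= absv (sval z - x).
Proof.
move=> out z [z1 z2]; have qn := absv_th_neq0 F R n.
have qn1 : q%:R ^- n <= q%:R ^+ n :> R.
  have q1 : 1 <= q%:R ^+ n :> R by rewrite exprn_ege1 // ltW ?qR_gt1.
  by rewrite (le_trans _ q1) // invf_le1.
have [xn|xn] := lerP (absv x) (q%:R ^+ n); last first.
  by rewrite absvB_eqr ?(le_lt_trans z1) // (le_trans _ (ltW xn)).
have [k Kk xk] : exists2 k : C, Kinf k & absv (x - k) < q%:R ^- n.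
  apply: contrapT => nex; have far k : Kinf k -> q%:R ^- n <= absv (x - k).
    by move=> Kk; rewrite leNgt; apply/negP => lt; apply: nex; exists k.
  have nx : ~ Kinf x by move=> /far; rewrite subrr absv0 leNgt invr_gt0 qn.
  by apply: (out (mkO nx)).
have -> : sval z - x = (sval z - k) - (x - k) by ring.
by rewrite absvB_eql ?z2 // (lt_le_trans xk) ?z2.
Qed.

Hypothesis Cclosed : GRing.closed_field_axiom C.

Lemma poly_affinoid_ge n Q : (forall z, affinoid n z -> Q.[sval z] != 0) ->
  exists2 d : R, 0 < d & forall z, affinoid n z -> d <= absv Q.[sval z].
Proof.
move=> Qn; have [Q0|Q0] := eqVneq Q 0.
  by exists 1 => // z /Qn; rewrite Q0 horner0 eqxx.
have [r QE] := closed_factor Cclosed Q0.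
have lQ : 0 < absv (lead_coef Q) by rewrite absv_gt0 lead_coef_eq0.
exists (absv (lead_coef Q) * (q%:R ^- n) ^+ size r).
  by rewrite mulr_gt0 // exprn_gt0 // invr_gt0 absv_th_neq0.
move=> z zn; rewrite {2}QE hornerZ horner_prod absvM absv_prod ler_pM2l //.
apply: prod_ge_exp => [|a ar]; first by rewrite invr_ge0 ltW ?absv_th_neq0.
rewrite hornerXsubC.
apply: outside_affinoid => // w /Qn + wa; rewrite QE hornerZ horner_prod mulf_eq0 negb_or => /andP[_].
by rewrite prodf_seq_neq0 => /allP/(_ a ar); rewrite /= hornerXsubC wa subrr eqxx.
Qed.

Lemma hol_bounded f n : holomorphic f -> exists B : R, forall z, affinoid n z -> absv (f z) <= B.
Proof.
move=> hf; have [P [Q H]] := hf n 1 ltr01.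
have [d d0 Hd] : exists2 d : R, 0 < d & forall z, affinoid n z -> d <= absv Q.[sval z].
  by apply: poly_affinoid_ge => z /H[].
have [D HD] := poly_bounded P (q%:R ^+ n).
exists (Num.max 1 (D / d)) => z zn; have [Q0 lt] := H z zn.
rewrite -(subrK (P.[sval z] / Q.[sval z]) (f z)); apply: absvD_le; rewrite le_max ?(ltW lt) //.
apply/orP; right; rewrite absvM absvV ler_pM ?invr_ge0 ?absv_ge0 ?HD ?lef_pV2 ?posrE ?absv_gt0 ?Hd //.
by case: zn.
Qed.

Lemma hol_gbounded f n : holomorphic f -> exists2 B : R, 0 < B & forall z, affinoid n z -> absv (f z) <= B.
Proof.
move=> /(hol_bounded n)[B HB]; exists (Num.max 1 B); first by rewrite lt_max ltr01.
by move=> z /HB le; rewrite le_max le orbT.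
Qed.

Lemma holM f g : holomorphic f -> holomorphic g -> holomorphic (fun z => f z * g z).
Proof.
move=> hf hg n eps e0.
have [A A0 HA] := hol_gbounded n hf; have [B B0 HB] := hol_gbounded n hg.
have e1 : 0 < Num.min A (eps / (A + B)).
  by rewrite lt_min A0 divr_gt0 // addr_gt0.
have [P [Q H]] := hf n _ e1; have [P' [Q' H']] := hg n _ e1.
exists (P * P'), (Q * Q') => z zn; have [Q0 le] := H z zn; have [Q0' le'] := H' z zn.
rewrite !hornerE; split; first by rewrite mulf_neq0.
set x := P.[sval z] / Q.[sval z] in le; set y := P'.[sval z] / Q'.[sval z] in le'.
have -> : P.[sval z] * P'.[sval z] / (Q.[sval z] * Q'.[sval z]) = x * y.
  by rewrite /x /y; field; rewrite Q0 Q0'.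
have -> : f z * g z - x * y = g z * (f z - x) + x * (g z - y) by ring.
move: le le'; rewrite !lt_min => /andP[xA le] /andP[_ le'].
have xA' : absv x <= A.
  by rewrite -(subrK (f z) x); apply: absvD_le; rewrite ?HA // absv_distC ltW.
have lem (u v : C) (D : R) : 0 < D -> absv u <= D -> D <= A + B -> absv v < eps / (A + B) -> absv (u * v) < eps.
  move=> D0 uD DAB vlt; rewrite absvM (le_lt_trans (_ : _ <= D * absv v)) ?ler_wpM2r ?absv_ge0 //.
  rewrite -ltr_pdivlMl // (lt_le_trans vlt) // mulrC ler_pM2r // lef_pV2 ?posrE ?addr_gt0 //.
apply: absvD_lt; [apply: (lem _ _ B)|apply: (lem _ _ A)]; rewrite ?HB ?lerDl ?lerDr //; exact: ltW.
Qed.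

Lemma holZ x f : holomorphic f -> holomorphic (fun z => x * f z).
Proof. by apply: holM; apply: hol_const. Qed.

Lemma holN f : holomorphic f -> holomorphic (fun z => - f z).
Proof. by move=> /(holZ (-1)); apply: hol_ext => z; rewrite mulN1r. Qed.

Lemma holB f g : holomorphic f -> holomorphic g -> holomorphic (fun z => f z - g z).
Proof. by move=> hf hg; apply: holD => //; apply: holN. Qed.

Lemma holX f n : holomorphic f -> holomorphic (fun z => f z ^+ n).
Proof.
move=> hf; elim: n => [|n IHn]; first exact: hol_const.
by apply: hol_ext (holM hf IHn) => z; rewrite exprS.
Qed.

Lemma hol_sum (I : Type) (r : seq I) (P : pred I) (f : I -> Omega -> C) :
  (forall i, P i -> holomorphic (f i)) -> holomorphic (fun z => \sum_(i <- r | P i) f i z).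
Proof.
move=> hf; elim: r => [|i r IHr].
  by apply: hol_ext (hol_const 0) => z; rewrite big_nil.
case Pi: (P i); last by apply: hol_ext IHr => z; rewrite big_cons Pi.
by apply: hol_ext (holD (hf i Pi) IHr) => z; rewrite big_cons Pi.
Qed.

Lemma hol_prod (I : Type) (r : seq I) (P : pred I) (f : I -> Omega -> C) :
  (forall i, P i -> holomorphic (f i)) -> holomorphic (fun z => \prod_(i <- r | P i) f i z).
Proof.
move=> hf; elim: r => [|i r IHr].
  by apply: hol_ext (hol_const 1) => z; rewrite big_nil.
case Pi: (P i); last by apply: hol_ext IHr => z; rewrite big_cons Pi.
by apply: hol_ext (holM (hf i Pi) IHr) => z; rewrite big_cons Pi.
Qed.

(** An approximation closer than the lower bound has the same absolute value as [f]; its numerator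
    has no zero on the affinoid, and the reciprocal fraction approximates the inverse. *)
Lemma holV f : holomorphic f ->
  (forall n, exists2 d : R, 0 < d & forall z, affinoid n z -> d <= absv (f z)) ->
  holomorphic (fun z => (f z)^-1).
Proof.
move=> hf fd n eps e0; have [d d0 Hd] := fd n.
have e1 : 0 < Num.min d (eps * d ^+ 2) by rewrite lt_min d0 mulr_gt0 // exprn_gt0.
have [P [Q H]] := hf n _ e1; exists Q, P => z zn; have [Q0] := H z zn.
set x := _ / _; rewrite lt_min => /andP[lt1 lt2]; have fz := Hd z zn.
have fz0 : f z != 0 by rewrite -absv_gt0 (lt_le_trans d0).
have xE : absv x = absv (f z).
  by rewrite -(subrK (f z) x) absvD_eqr // absv_distC (lt_le_trans lt1).
have x0 : x != 0 by rewrite -absv_gt0 xE absv_gt0.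
split; first by apply: contra_neq x0 => P0; rewrite /x P0 mul0r.
have -> : Q.[sval z] / P.[sval z] = x^-1 by rewrite /x invf_div.
have -> : (f z)^-1 - x^-1 = (x - f z) / (f z * x) by field; rewrite fz0 x0.
rewrite absvM absvV absvM xE absv_distC -expr2 ltr_pdivrMr ?exprn_gt0 ?absv_gt0 //.
rewrite (lt_le_trans lt2) // ler_pM2l // lerXn2r ?nnegrE ?absv_ge0 //; exact: ltW.
Qed.

Lemma Oinv_subproof z : ~ Kinf (sval z)^-1.
Proof. by move=> /KinfP/KcV; rewrite invrK; apply: notKc. Qed.
Definition Oinv z : Omega := mkO (@Oinv_subproof z).

(** For |k| >= |1/z| one has |1/z - k| = |k| |1/z| |z - 1/k| with three factors at least q^-n,
    whence the index 3 n. *)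
Lemma affinoid_Oinv n z : affinoid n z -> affinoid (3 * n) (Oinv z).
Proof.
move=> zn; have [z1 z2] := zn; have z0 : 0 < absv (sval z) by rewrite absv_gt0 sval_neq0.
have qn := absv_th_neq0 F R n.
have q1 : 1 <= q%:R ^+ n :> R by rewrite exprn_ege1 // ltW ?qR_gt1.
have qi1 : q%:R ^- n <= 1 :> R by rewrite invf_le1.
have qz : q%:R ^- n <= absv (sval z).
  by rewrite -[sval z]subr0; apply: z2; apply/KinfP; apply: Kc0.
have zi : q%:R ^- n <= absv (sval z)^-1 by rewrite absvV lef_pV2 ?posrE.
have q3 : q%:R ^- (3 * n) = q%:R ^- n * (q%:R ^- n * q%:R ^- n) :> R.
  by rewrite -!exprVn -!exprD; congr (_ ^+ _); lia.
have q3n : q%:R ^- (3 * n) <= q%:R ^- n :> R.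
  rewrite q3 ger_pMr ?invr_gt0 // mulr_ile1 ?invr_ge0 ?(ltW qn) //.
split=> [|k Kk] /=.
  rewrite absvV -[leRHS]invrK lef_pV2 ?posrE ?invr_gt0 ?absv_th_neq0 //.
  exact: le_trans qz.
have [k0|k0] := eqVneq k 0; first by rewrite k0 subr0 (le_trans q3n).
have [lt|le] := ltrP (absv k) (absv (sval z)^-1).
  by rewrite absvB_eql // (le_trans q3n).
have -> : (sval z)^-1 - k = - (k / sval z * (sval z - k^-1)).
  by field; rewrite k0 sval_neq0.
rewrite absvN !absvM q3 mulrA.
have qi0 : 0 <= q%:R ^- n :> R by rewrite invr_ge0 ltW.
apply: ler_pM => //.
  by apply: ler_pM => //; apply: le_trans le.
by apply: z2; apply/KinfP; apply: KcV; apply/KinfP.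
Qed.

Lemma poly_rev P N : (size P <= N)%N -> exists P', forall x, x != 0 -> P'.[x] = x ^+ N * P.[x^-1].
Proof.
move=> sP; exists (\sum_(i < size P) P`_i *: 'X^(N - i)) => x x0.
rewrite horner_sum horner_coef mulr_sumr; apply: eq_bigr => i _.
rewrite hornerZ hornerXn mulrCA; congr (_ * _).
by rewrite exprVn -exprB ?unitfE // (leq_trans (ltnW (ltn_ord i))).
Qed.

Lemma hol_Oinv f : holomorphic f -> holomorphic (fun z => f (Oinv z)).
Proof.
move=> hf n eps e0; have [P [Q H]] := hf (3 * n)%N _ e0.
have [P' HP] := @poly_rev P (maxn (size P) (size Q)) (leq_maxl _ _).
have [Q' HQ] := @poly_rev Q (maxn (size P) (size Q)) (leq_maxr _ _).
exists P', Q' => z /affinoid_Oinv/H; rewrite HP ?HQ ?sval_neq0 //= => -[Q0 lt].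
have zN : sval z ^+ maxn (size P) (size Q) != 0 by rewrite expf_neq0 ?sval_neq0.
split; first by rewrite mulf_neq0.
by rewrite invfM mulrACA divff // mul1r.
Qed.

End Holomorphic.

(** * Norms of rational functions at the vertices of the tree *)

Section GaussNorms.
Variables (F : finFieldType) (R : realType) (C : valuedField F R).
Local Notation q := #|F|.
Local Notation th := (theta C).
Local Notation scal := (@vf_scal F R C).
Local Notation evA := (@evA F R C).
Local Notation Omega := (Omega C).
Implicit Types (x y k s : C) (z w : Omega) (f g : Omega -> C) (P Q : {poly C}).

Lemma Kc_scal (c : F) : Kc (scal c). Proof. by rewrite -evAC; apply: Kc_evA. Qed.

Lemma Kc_th : Kc th. Proof. by rewrite -evAX; apply: Kc_evA. Qed.

Lemma Kc_digit k s : Kc s -> s != 0 -> Kc k -> absv k <= absv s ->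
  exists c, absv (k - scal c * s) <= absv s / q%:R.
Proof.
move=> Ks s0 Kk ks; have as0 : 0 < absv s by rewrite absv_gt0.
have Kks : Kc (k / s) by apply: KcM => //; apply: KcV.
have [|c Hc] := Kc_digit1 Kks; first by rewrite absvM absvV ler_pdivrMr // mul1r.
exists c; have := Kc_lt1 (KcB Kks (Kc_scal c)) Hc.
have -> : k - scal c * s = (k / s - scal c) * s by rewrite mulrBl divfK.
rewrite !absvM absv_th [absv _ * absv s]mulrC => le.
by rewrite ler_pM2l // -[leRHS]mulr1 ler_pdivlMl ?qR_gt0.
Qed.

Lemma Kc_jump k s : Kc s -> s != 0 -> Kc k -> absv s < absv k -> q%:R * absv s <= absv k.
Proof.
move=> Ks s0 Kk sk; have k0 : 0 < absv k by rewrite (le_lt_trans (absv_ge0 s)).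
have Kks : Kc (s / k) by apply: KcM => //; apply: KcV.
have := Kc_lt1 Kks; rewrite !absvM absvV absv_th mulrA => le.
rewrite -[leRHS]mul1r -ler_pdivrMr //; apply: le.
by rewrite ltr_pdivrMr // mul1r.
Qed.

(* The points of the disc of center c0 and radius |s| whose reduction avoids
   the rational directions of the corresponding vertex of the tree. *)
Definition Gs (c0 s x : C) := forall c : F, absv (x - c0 - scal c * s) = absv s.

Lemma Gs0 c0 s x : Gs c0 s x -> absv (x - c0) = absv s.
Proof. by move=> /(_ 0); rewrite rmorph0 mul0r subr0. Qed.

Lemma Gs_dist c0 s x k : Kc s -> s != 0 -> Kc c0 -> Gs c0 s x -> Kc k -> absv s <= absv (x - k).
Proof.
move=> Ks s0 K0 Gx Kk; have as0 : 0 < absv s by rewrite absv_gt0.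
have Kk0 : Kc (k - c0) by apply: KcB.
have -> : x - k = (x - c0) - (k - c0) by ring.
have [le|lt] := lerP (absv (k - c0)) (absv s).
  have [c Hc] := Kc_digit Ks s0 Kk0 le.
  have -> : x - c0 - (k - c0) = (x - c0 - scal c * s) - (k - c0 - scal c * s) by ring.
  rewrite absvB_eql Gx // (le_lt_trans Hc) // ltr_pdivrMr ?qR_gt0 //.
  by rewrite ltr_pMr // qR_gt1.
by rewrite absvB_eqr ?(Gs0 Gx) // ltW.
Qed.

(** The right side does not involve [x]: a denominator with roots off the vertex has constant
    absolute value on it, which is what [rfun_le] uses. *)
Lemma Gs_absv c0 s x k : Kc s -> s != 0 -> Kc c0 -> Gs c0 s x -> ~ Gs c0 s k ->
  absv (x - k) = Num.max (absv s) (absv (k - c0)).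
Proof.
move=> Ks s0 K0 Gx nGk; have -> : x - k = (x - c0) - (k - c0) by ring.
have [lt|lt|eq] := ltgtP (absv s) (absv (k - c0)).
- by rewrite absvB_eqr ?(Gs0 Gx) //.
- by rewrite absvB_eql (Gs0 Gx).
have /boolp.existsNP[c /eqP nc] := nGk.
have lt : absv (k - c0 - scal c * s) < absv s.
  rewrite lt_neqAle nc; apply: absvB_le; rewrite ?eq // absvM -eq.
  by rewrite -[leRHS]mul1r ler_wpM2r ?absv_ge0 ?absv_scal_le1.
have -> : x - c0 - (k - c0) = (x - c0 - scal c * s) - (k - c0 - scal c * s) by ring.
by rewrite absvB_eql Gx.
Qed.

Lemma ex_affinoid (B d : R) : 0 < d -> exists N, forall z, absv (sval z) <= B ->
  (forall k, Kc k -> d <= absv (sval z - k)) -> affinoid N z.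
Proof.
move=> d0; have [n Hn] := ex_expq F B; have [m Hm] := ex_expq F d^-1.
have le (i j : nat) : (i <= j)%N -> q%:R ^+ i <= q%:R ^+ j :> R.
  by move=> ij; rewrite ler_weXn2l ?ltW ?qR_gt1.
exists (maxn n m) => z zB zd; split; first by rewrite (le_trans zB) // (le_trans Hn) // le ?leq_maxl.
move=> k /KinfP/zd; apply: le_trans; rewrite -[d]invrK lef_pV2 ?posrE ?invr_gt0 ?absv_th_neq0 //.
by rewrite (le_trans Hm) // le ?leq_maxr.
Qed.

Lemma Gs_affinoid c0 s : Kc s -> s != 0 -> Kc c0 ->
  exists N, forall z, Gs c0 s (sval z) -> affinoid N z.
Proof.
move=> Ks s0 K0; have as0 : 0 < absv s by rewrite absv_gt0.
have [N HN] := ex_affinoid (Num.max (absv s) (absv c0)) as0.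
exists N => z Gz; apply: HN => [|k Kk]; last exact: Gs_dist Gz Kk.
rewrite -(subrK c0 (sval z)); apply: (le_trans (absv_ultra _ _)).
by rewrite (Gs0 Gz).
Qed.

Lemma Gs_notKinf c0 s x : Kc s -> s != 0 -> Kc c0 -> Gs c0 s x -> ~ Kinf x.
Proof.
move=> Ks s0 K0 Gx /KinfP Kx; have := Gs_dist Ks s0 K0 Gx Kx.
by rewrite subrr absv0 leNgt absv_gt0 s0.
Qed.

Definition gn (r : seq C) c0 (rho : R) : R := \prod_(a <- r) Num.max rho (absv (a - c0)).

Lemma gn_ge0 r c0 rho : 0 <= gn r c0 rho.
Proof. by apply: prodr_ge0 => a _; rewrite le_max absv_ge0 orbT. Qed.

Lemma gn_gt0 r c0 rho : 0 < rho -> 0 < gn r c0 rho.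
Proof. by move=> r0; apply: prodr_gt0 => a _; rewrite lt_max r0. Qed.

Hypothesis Cclosed : GRing.closed_field_axiom C.

(** The point is a root of prod (X - a) = s^N over the centre and the given points of the disc. Each
    distance is at most |s| and their product is |s|^N, so none is smaller; points outside the disc
    are at the right distance automatically. *)
Lemma generic_point (r : seq C) c0 s : s != 0 ->
  exists x, absv (x - c0) <= absv s /\
    {in r, forall a, absv (x - a) = Num.max (absv s) (absv (a - c0))}.
Proof.
move=> s0; have as0 : 0 < absv s by rewrite absv_gt0.
(* Including the centre keeps the list nonempty, so that the equation has a root. *)
pose r' := c0 :: [seq a <- r | absv (a - c0) <= absv s].
pose P := \prod_(a <- r') ('X - a%:P) - (s ^+ size r')%:P.
have sP : size P = (size r').+1.
  by rewrite size_polyDl size_prod_XsubC // size_polyN size_polyC; case: eqP.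
have [x /rootP] : exists x, root P x by apply: closed_root => //; rewrite sP.
rewrite !hornerE horner_prod => /eqP; rewrite subr_eq0 => /eqP Ex.
have Ea : \prod_(a <- r') absv (x - a) = absv s ^+ size r'.
  rewrite -absvX -Ex absv_prod; apply: eq_bigr => a _; by rewrite !hornerE.
have xs : absv (x - c0) <= absv s.
  rewrite leNgt; apply/negP => lt; move: Ea; apply/eqP; rewrite gt_eqF //.
  have Ex' a : a \in r' -> absv (x - a) = absv (x - c0).
    rewrite inE mem_filter => /predU1P[->//|/andP[le _]].
    have -> : x - a = (x - c0) - (a - c0) by ring.
    by apply: absvB_eql; apply: le_lt_trans lt.
  rewrite big_seq (eq_bigr (fun=> absv (x - c0))) // -big_seq big_const_seq count_predT.
  by rewrite iter_mulr_1 ltrXn2r ?nnegrE ?absv_ge0 //.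
exists x; split=> // a ar.
have -> : x - a = (x - c0) - (a - c0) by ring.
have [lt|le] := ltrP (absv s) (absv (a - c0)).
  by apply: absvB_eqr; apply: le_lt_trans lt.
have ar' : a \in r' by rewrite inE mem_filter le ar orbT.
have le' : absv (x - c0 - (a - c0)) <= absv s by apply: absvB_le.
apply/eqP; rewrite eq_le le' /= leNgt; apply/negP => lt.
move: Ea; apply/eqP; rewrite lt_eqF // (perm_big _ (perm_to_rem ar')) big_cons /=.
set n := size [seq b <- r | absv (b - c0) <= absv s].
have Er : size (rem a r') = n by rewrite size_rem.
have Hr : \prod_(b <- rem a r') absv (x - b) <= absv s ^+ n.
  rewrite -Er -iter_mulr_1 -(count_predT (rem a r')) -big_const_seq big_seq [leRHS]big_seq.
  apply: ler_prod => b /mem_rem; rewrite absv_ge0 /= inE mem_filter => /predU1P[->//|/andP[bs _]].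
  have -> : x - b = (x - c0) - (b - c0) by ring.
  exact: absvB_le.
move: lt; have -> : x - c0 - (a - c0) = x - a by ring.
move=> lt; rewrite exprS (le_lt_trans (_ : _ <= absv (x - a) * absv s ^+ n)) ?ler_wpM2l ?absv_ge0 //.
by rewrite ltr_pM2r // exprn_gt0.
Qed.

(** Adding the points c0 + c s, with c in F_q, to the list of points to avoid forces the generic
    point into [Gs c0 s]. *)
Lemma generic_Gs (r : seq C) c0 s : s != 0 ->
  exists x, Gs c0 s x /\ {in r, forall a, absv (x - a) = Num.max (absv s) (absv (a - c0))}.
Proof.
move=> s0; have [x [xs Hx]] := generic_point (r ++ [seq c0 + scal c * s | c <- enum F]) c0 s0.
exists x; split=> [c|a ar]; last by rewrite Hx // mem_cat ar.
have -> : x - c0 - scal c * s = x - (c0 + scal c * s) by ring.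
rewrite Hx ?mem_cat; last by apply/orP; right; apply/mapP; exists c; rewrite ?mem_enum.
have -> : c0 + scal c * s - c0 = scal c * s by ring.
apply/max_idPl; rewrite absvM -[leRHS]mul1r ler_wpM2r ?absv_ge0 //.
exact: absv_scal_le1.
Qed.

(* Norm of lP prod (X - a) / (lQ prod (X - b)) at the vertex (c0, s) *)
Definition rn (lP lQ : C) (rP rQ : seq C) c0 s : R :=
  absv lP / absv lQ * (gn rP c0 (absv s) / gn rQ c0 (absv s)).

Definition rfun (lP lQ : C) (rP rQ : seq C) x : C :=
  lP / lQ * ((\prod_(a <- rP) (x - a)) / \prod_(b <- rQ) (x - b)).

Lemma rfun_le lP lQ rP rQ c0 s x : Kc s -> s != 0 -> Kc c0 -> Gs c0 s x ->
  {in rQ, forall b, ~ Gs c0 s b} -> absv (rfun lP lQ rP rQ x) <= rn lP lQ rP rQ c0 s.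
Proof.
move=> Ks s0 K0 Gx nQ; rewrite /rfun /rn !absvM !absvV !absv_prod.
have -> : \prod_(b <- rQ) absv (x - b) = gn rQ c0 (absv s).
  by rewrite /gn big_seq [RHS]big_seq; apply: eq_bigr => b /nQ; apply: Gs_absv.
apply: ler_wpM2l; first by rewrite divr_ge0 ?absv_ge0.
apply: ler_wpM2r; first by rewrite invr_ge0 gn_ge0.
apply: ler_prod => a _; rewrite absv_ge0 /=.
have -> : x - a = (x - c0) - (a - c0) by ring.
by rewrite (le_trans (absv_ultra _ _)) // absvN (Gs0 Gx).
Qed.

Lemma rfun_attained lP lQ rP rQ c0 s : Kc s -> s != 0 -> Kc c0 ->
  exists x, Gs c0 s x /\ absv (rfun lP lQ rP rQ x) = rn lP lQ rP rQ c0 s.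
Proof.
move=> Ks s0 K0; have [x [Gx Hx]] := generic_Gs (rP ++ rQ) c0 s0.
exists x; split=> //; rewrite /rfun /rn !absvM !absvV !absv_prod /gn.
congr (_ * (_ / _)); rewrite big_seq [RHS]big_seq; apply: eq_bigr => a ar;
  by rewrite Hx // mem_cat ar ?orbT.
Qed.

(** The vertex (0, s) has the q + 1 neighbours (0, theta s) and (c s, s / theta) with c in F_q. The
    norm of the factor X - a is multiplicatively subharmonic at the vertex, harmonic as soon as [a]
    lies at or beyond a neighbour, and gains a factor q when [a] belongs to the vertex itself. *)
Lemma star_factor (s a : C) : s != 0 ->
  Num.max (absv s) (absv (a - 0)) ^+ q.+1 <=
  Num.max (absv (th * s)) (absv (a - 0)) *
  \prod_(c : F) Num.max (absv (s / th)) (absv (a - scal c * s)) /\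
  (((q%:R * absv s <= absv a) \/ exists c, absv (a - scal c * s) <= absv s / q%:R) ->
  Num.max (absv s) (absv (a - 0)) ^+ q.+1 =
  Num.max (absv (th * s)) (absv (a - 0)) *
  \prod_(c : F) Num.max (absv (s / th)) (absv (a - scal c * s))) /\
  (Gs 0 s a -> q%:R * Num.max (absv s) (absv (a - 0)) ^+ q.+1 <=
  Num.max (absv (th * s)) (absv (a - 0)) *
  \prod_(c : F) Num.max (absv (s / th)) (absv (a - scal c * s))).
Proof.
move=> s0; have as0 : 0 < absv s by rewrite absv_gt0.
have q1 := qR_gt1 F R; have q0 := qR_gt0 F R.
rewrite subr0 !absvM absvV absv_th.
have sq : absv s / q%:R < absv s by rewrite ltr_pdivrMr // ltr_pMr.
have qs : absv s < q%:R * absv s by rewrite ltr_pMl.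
have cs (c : F) : absv (scal c * s) <= absv s.
  by rewrite absvM -[leRHS]mul1r ler_wpM2r ?absv_ge0 ?absv_scal_le1.
have prodc (x : R) : \prod_(c : F) x = x ^+ q by rewrite prodr_const.
have [le|lt] := lerP (absv a) (absv s); last first.
  have E (c : F) : absv (a - scal c * s) = absv a by rewrite absvB_eql // (le_lt_trans (cs c)).
  rewrite [X in _ * X](eq_bigr (fun=> absv a)) => [|c _]; last first.
    by rewrite E; apply/max_idPr; rewrite ltW // (lt_trans sq).
  rewrite prodc; split; [|split].
  - by rewrite exprS ler_wpM2r ?exprn_ge0 ?absv_ge0 // le_max lexx orbT.
  - case=> [le|[c]]; first by rewrite (max_idPr le) exprS.
    by rewrite E leNgt (lt_trans sq).
  - by move=> /Gs0; rewrite subr0 => E'; rewrite E' ltxx in lt.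
rewrite (max_idPl (ltW (le_lt_trans le qs))).
have lea (c : F) : absv (a - scal c * s) <= absv s by apply: absvB_le.
have [/existsP[c ltc]|nex] := boolP [exists c : F, absv (a - scal c * s) < absv s].
  have E (d : F) : d != c -> absv (a - scal d * s) = absv s.
    move=> dc; have -> : a - scal d * s = (a - scal c * s) - scal (d - c) * s.
      by rewrite rmorphB /=; ring.
    by rewrite absvB_eqr absvM absv_scal subr_eq0 dc ?mul1r.
  have PE : \prod_(d : F) Num.max (absv s / q%:R) (absv (a - scal d * s)) =
    Num.max (absv s / q%:R) (absv (a - scal c * s)) * absv s ^+ q.-1.
    rewrite (bigD1 c) //= (eq_bigr (fun=> absv s)); last first.
      by move=> d dc; rewrite E //; apply/max_idPr; rewrite ltW.
    by rewrite prodr_const cardC1.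
  have E1 : absv s ^+ q.+1 = q%:R * absv s * (absv s / q%:R * absv s ^+ q.-1).
    rewrite -{1}(prednK (q_gt0 F)) !exprS; field; by rewrite gt_eqF.
  rewrite PE; split; [|split].
  - rewrite E1 ler_pM2l ?mulr_gt0 // ler_wpM2r ?exprn_ge0 ?absv_ge0 //.
    by rewrite le_max lexx.
  - case=> [le'|[d led]]; first by rewrite leNgt (le_lt_trans le) in le'.
    have dc : d = c by apply/eqP/negPn/negP => /E Ed; rewrite Ed leNgt sq in led.
    by rewrite -dc (max_idPl led) E1.
  - by move=> /(_ c); rewrite subr0 => E'; rewrite E' ltxx in ltc.
have E (c : F) : Num.max (absv s / q%:R) (absv (a - scal c * s)) = absv s.
  have -> : absv (a - scal c * s) = absv s.
    apply/eqP; rewrite eq_le lea /= leNgt; apply: contra nex => lt.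
    by apply/existsP; exists c.
  by apply/max_idPr; rewrite ltW.
rewrite (eq_bigr (fun=> absv s)) // prodc exprS -mulrA; split; [|split].
- by rewrite ler_peMl ?ltW // mulr_gt0 ?exprn_gt0.
- case=> [le'|[d led]]; first by rewrite leNgt (le_lt_trans le) in le'.
  by case/negP: nex; apply/existsP; exists d; apply: le_lt_trans led sq.
- by [].
Qed.

(** Zeros contribute inequalities and poles, lying at or beyond a neighbour, equalities, so the
    quotient keeps the inequality; a single zero on the vertex pays for kap = q. *)
Lemma star_rn lP lQ rP rQ s (kap : R) : s != 0 ->
  {in rQ, forall b, (q%:R * absv s <= absv b) \/ exists c, absv (b - scal c * s) <= absv s / q%:R} ->
  kap = 1 \/ (kap = q%:R /\ exists2 a, a \in rP & Gs 0 s a) ->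
  kap * rn lP lQ rP rQ 0 s ^+ q.+1 <=
  rn lP lQ rP rQ 0 (th * s) * \prod_(c : F) rn lP lQ rP rQ (scal c * s) (s / th).
Proof.
move=> s0 HQ Hk; have as0 : 0 < absv s by rewrite absv_gt0.
have gQ : gn rQ 0 (absv s) ^+ q.+1 = gn rQ 0 (absv (th * s)) *
    \prod_(c : F) gn rQ (scal c * s) (absv (s / th)).
  rewrite /gn exchange_big /= -big_split -prodrXl big_seq [RHS]big_seq.
  by apply: eq_bigr => b bQ; have [_ [+ _]] := star_factor b s0; apply; apply: HQ.
have gP0 r : gn r 0 (absv s) ^+ q.+1 <= gn r 0 (absv (th * s)) *
    \prod_(c : F) gn r (scal c * s) (absv (s / th)).
  rewrite /gn exchange_big /= -big_split -prodrXl.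
  apply: ler_prod => a _; have [-> _] := star_factor a s0.
  by rewrite exprn_ge0 // le_max absv_ge0.
have gP : kap * gn rP 0 (absv s) ^+ q.+1 <= gn rP 0 (absv (th * s)) *
    \prod_(c : F) gn rP (scal c * s) (absv (s / th)).
  case: Hk => [->|[-> [a aP Ga]]]; first by rewrite mul1r.
  have pe (c0 : C) rho : gn rP c0 rho = Num.max rho (absv (a - c0)) * gn (rem a rP) c0 rho.
    by rewrite /gn (perm_big _ (perm_to_rem aP)) big_cons.
  rewrite !pe (eq_bigr _ (fun c _ => pe _ _)) big_split /= exprMn mulrA [leRHS]mulrACA.
  apply: ler_pM; rewrite ?exprn_ge0 ?gn_ge0 //.
    by rewrite mulr_ge0 ?ler0n // exprn_ge0 // le_max absv_ge0.
  by have [_ [_]] := star_factor a s0; apply.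
rewrite /rn; set L := absv lP / absv lQ.
have L0 : 0 <= L by rewrite divr_ge0 ?absv_ge0.
rewrite big_split /= prodr_const big_split /= prodfV.
set X := \prod_(c : F) gn rP _ _ in gP *; set Y := \prod_(c : F) gn rQ _ _ in gQ *.
have -> : L * (gn rP 0 (absv (th * s)) / gn rQ 0 (absv (th * s))) * (L ^+ #|F| * (X / Y)) =
  L ^+ q.+1 * (gn rP 0 (absv (th * s)) * X / (gn rQ 0 (absv (th * s)) * Y)).
  by rewrite exprS invfM; ring.
rewrite -gQ exprMn mulrCA ler_wpM2l ?exprn_ge0 // expr_div_n mulrA.
by rewrite ler_wpM2r // invr_ge0 exprn_ge0 // gn_ge0.
Qed.

End GaussNorms.

(** Removes the error of rational approximation from the star inequality. The cases x = 0 and y = 0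
    are separate because the maximum is then the error itself. *)
Lemma max_limit (R : realFieldType) (K x y D : R) n : 0 <= x -> 0 <= y -> 0 < D -> (0 < n)%N ->
  (forall e, 0 < e < D -> K <= Num.max x e * Num.max y e ^+ n) -> K <= x * y ^+ n.
Proof.
move=> x0 y0 D0 n0 H.
have small (A : R) : 0 <= A -> (forall e, 0 < e < D -> e <= 1 -> K <= A * e) -> K <= 0.
  move=> A0 HA; apply/ler_addgt0Pr => d d0; rewrite add0r.
  pose e := Num.min (D / 2) (Num.min 1 (d / (A + 1))).
  have A1 : 0 < A + 1 by lra.
  have e0 : 0 < e by rewrite !lt_min ltr01 !divr_gt0.
  have eD : e < D by rewrite gt_min; apply/orP; left; lra.
  have e1 : e <= 1 by rewrite !ge_min lexx orbT.
  apply: le_trans (HA e _ e1) _; first by rewrite e0.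
  have ed : e <= d / (A + 1) by rewrite !ge_min lexx !orbT.
  apply: le_trans (_ : (A + 1) * e <= _); first by rewrite ler_pM2r //; lra.
  by rewrite mulrC -ler_pdivlMr.
have [x00|xn] := eqVneq x 0.
  rewrite x00 mul0r; apply: (small (Num.max y 1 ^+ n)) => [|e eD e1].
    by rewrite exprn_ge0 // le_max y0.
  case/andP: (eD) => e0 _; have := H e eD; rewrite ?x00 ?y00 [Num.max 0 e](max_idPr (ltW e0)).
  move=> le; apply: le_trans le _; rewrite mulrC.
  have my : Num.max y e <= Num.max y 1 by rewrite ge_max !le_max lexx e1 orbT.
  by rewrite ler_pM2r // lerXn2r ?nnegrE // le_max y0.
have [y00|yn] := eqVneq y 0.
  rewrite y00 expr0n eqn0Ngt n0 mulr0; apply: (small (Num.max x 1)) => [|e eD e1].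
    by rewrite le_max x0.
  case/andP: (eD) => e0 _; have := H e eD; rewrite ?x00 ?y00 [Num.max 0 e](max_idPr (ltW e0)).
  have mx : Num.max x e <= Num.max x 1 by rewrite ge_max !le_max lexx e1 orbT.
  move=> le; apply: le_trans le _; apply: ler_pM => //; rewrite ?exprn_ge0 ?(ltW e0) //.
    by rewrite le_max x0.
  by case: n n0 {H} => // n _; rewrite exprS ger_pMr ?exprn_ile1 ?e1 ?(ltW e0).
have xp : 0 < x by rewrite lt_def xn.
have yp : 0 < y by rewrite lt_def yn.
pose e := Num.min (D / 2) (Num.min x y).
have eD : 0 < e < D by rewrite !lt_min xp yp divr_gt0 //= gt_min; apply/orP; left; lra.
have := H e eD; rewrite !(max_idPl _) // !ge_min lexx ?orbT //.
Qed.

(** * Sup norms of analytic functions at the vertices *)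

Section SupNorms.
Variables (F : finFieldType) (R : realType) (C : valuedField F R).
Local Notation q := #|F|.
Local Notation th := (theta C).
Local Notation scal := (@vf_scal F R C).
Local Notation evA := (@evA F R C).
Local Notation Omega := (Omega C).
Implicit Types (x y k s : C) (z w : Omega) (f g : Omega -> C) (P Q : {poly C}).
Hypothesis Cclosed : GRing.closed_field_axiom C.

Lemma Gs_point (c0 : C) s : Kc s -> s != 0 -> Kc c0 -> exists z, Gs c0 s (sval z).
Proof.
move=> Ks s0 K0; have [x [Gx _]] := generic_Gs Cclosed [::] c0 s0.
by exists (mkO (Gs_notKinf Ks s0 K0 Gx)).
Qed.

Definition Mset f (c0 s : C) : set R := [set absv (f z) | z in [set z | Gs c0 s (sval z)]].
Definition Msup f (c0 s : C) : R := sup (Mset f c0 s).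

Lemma Msup_has_sup f (c0 s : C) : holomorphic f -> Kc s -> s != 0 -> Kc c0 -> has_sup (Mset f c0 s).
Proof.
move=> hf Ks s0 K0; split; first by have [z Gz] := Gs_point Ks s0 K0; exists (absv (f z)), z.
have [N HN] := Gs_affinoid Ks s0 K0; have [B HB] := hol_bounded Cclosed N hf.
by exists B => _ [z /= /HN/HB ? <-].
Qed.

Lemma Msup_ge f (c0 s : C) z : holomorphic f -> Kc s -> s != 0 -> Kc c0 -> Gs c0 s (sval z) ->
  absv (f z) <= Msup f c0 s.
Proof.
by move=> hf Ks s0 K0 Gz; apply: sup_upper_bound; [apply: Msup_has_sup|exists z].
Qed.

Lemma Msup_le f (c0 s : C) B : Kc s -> s != 0 -> Kc c0 ->
  (forall z, Gs c0 s (sval z) -> absv (f z) <= B) -> Msup f c0 s <= B.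
Proof.
move=> Ks s0 K0 H; apply: ge_sup; first by have [z Gz] := Gs_point Ks s0 K0; exists (absv (f z)), z.
by move=> _ [z /= /H ? <-].
Qed.

Lemma Msup_ge0 f (c0 s : C) : holomorphic f -> Kc s -> s != 0 -> Kc c0 -> 0 <= Msup f c0 s.
Proof.
move=> hf Ks s0 K0; have [z Gz] := Gs_point Ks s0 K0.
exact: le_trans (absv_ge0 _) (Msup_ge hf Ks s0 K0 Gz).
Qed.

Lemma Msup_map f (c0 s c1 s1 : C) : holomorphic f -> Kc s -> s != 0 -> Kc c0 -> Kc s1 -> s1 != 0 -> Kc c1 ->
  (forall z, Gs c0 s (sval z) -> exists2 w, Gs c1 s1 (sval w) & absv (f w) = absv (f z)) ->
  Msup f c0 s <= Msup f c1 s1.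
Proof.
move=> hf Ks s0 K0 Ks1 s10 K1 H; apply: Msup_le => // z /H[w Gw <-].
exact: Msup_ge.
Qed.

Lemma rat_rfun P Q : P != 0 -> Q != 0 -> exists rP rQ : seq C,
  [/\ forall x, P.[x] / Q.[x] = rfun (lead_coef P) (lead_coef Q) rP rQ x,
      forall a, (a \in rP) = root P a & forall b, (b \in rQ) = root Q b].
Proof.
move=> P0 Q0; have [rP EP] := closed_factor Cclosed P0; have [rQ EQ] := closed_factor Cclosed Q0.
have He (r : seq C) x : (\prod_(a <- r) ('X - a%:P)).[x] = \prod_(a <- r) (x - a).
  by rewrite horner_prod; apply: eq_bigr => a _; rewrite hornerXsubC.
have Hr (T : {poly C}) (r : seq C) : T != 0 -> T = lead_coef T *: \prod_(a <- r) ('X - a%:P) ->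
    forall a, (a \in r) = root T a.
  by move=> T0 ET a; rewrite ET rootZ ?lead_coef_eq0 // root_prod_XsubC.
exists rP, rQ; split; [move=> x|exact: Hr|exact: Hr].
have -> : P.[x] = lead_coef P * \prod_(a <- rP) (x - a) by rewrite {1}EP hornerZ He.
have -> : Q.[x] = lead_coef Q * \prod_(a <- rQ) (x - a) by rewrite {1}EQ hornerZ He.
by rewrite /rfun invfM mulrACA.
Qed.

(** Transfers [star_rn] from a rational function within [eps] of [f] on an affinoid containing the
    whole star. At the centre eps < [Msup f 0 s] makes the error invisible; at the neighbours it
    survives as a maximum with [eps]. *)
Lemma star_sup f s (kap eps : R) : holomorphic f -> Kc s -> s != 0 ->
  0 < eps < Msup f 0 s ->
  kap = 1 \/ (kap = q%:R /\ exists2 z : Omega, Gs 0 s (sval z) & f z = 0) ->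
  kap * Msup f 0 s ^+ q.+1 <= Num.max (Msup f 0 (th * s)) eps *
    \prod_(c : F) Num.max (Msup f (scal c * s) (s / th)) eps.
Proof.
move=> hf Ks s0 /andP[e0 eM] Hk.
have as0 : 0 < absv s by rewrite absv_gt0.
have Kts : Kc (th * s) by apply: KcM => //; apply: Kc_th.
have ts0 : th * s != 0 by rewrite mulf_neq0 ?th_neq0.
have Kst : Kc (s / th) by apply: KcM => //; apply: Kc_thV.
have st0 : s / th != 0 by rewrite mulf_neq0 ?invr_eq0 ?th_neq0.
have Kcs (c : F) : Kc (scal c * s) by apply: KcM => //; apply: Kc_scal.
have K0 : Kc (0 : C) := Kc0.
have [N0 HN0] := Gs_affinoid Ks s0 K0.
have [N1 HN1] := Gs_affinoid Kts ts0 K0.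
have /boolp.choice[N2 HN2] : forall c : F, exists N, forall z, Gs (scal c * s) (s / th) (sval z) -> affinoid N z.
  by move=> c; apply: Gs_affinoid.
have sq0 : 0 < absv s / q%:R by rewrite divr_gt0 ?qR_gt0.
have [N3 HN3] := @ex_affinoid F R C (q%:R * absv s) _ sq0.
pose N := (N0 + N1 + \max_(c : F) N2 c + N3)%N.
have {}HN0 z : Gs 0 s (sval z) -> affinoid N z by move=> /HN0; apply: affinoid_le; rewrite /N; lia.
have {}HN1 z : Gs 0 (th * s) (sval z) -> affinoid N z by move=> /HN1; apply: affinoid_le; rewrite /N; lia.
have {}HN2 c z : Gs (scal c * s) (s / th) (sval z) -> affinoid N z.
  move=> /HN2; apply: affinoid_le; move: (@leq_bigmax F N2 c); rewrite /N.
  by move: (\max_(c : F) N2 c)%N => m; lia.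
have {}HN3 z : absv (sval z) <= q%:R * absv s ->
    (forall k, Kc k -> absv s / q%:R <= absv (sval z - k)) -> affinoid N z.
  by move=> h1 h2; apply: affinoid_le (HN3 z h1 h2); rewrite /N leq_addl.
have exPQ : exists (P Q : {poly C}), (forall z, affinoid N z ->
    Q.[sval z] != 0 /\ absv (f z - P.[sval z] / Q.[sval z]) < eps) /\
    (kap = 1 \/ (kap = q%:R /\ exists2 z : Omega, Gs 0 s (sval z) & P.[sval z] = 0)).
  have [P [Q H]] := hf N _ e0.
  case: Hk => [->|[-> [z0 Gz0 fz0]]]; first by exists P, Q; split=> //; left.
  have [Qz0 Rz0] := H z0 (HN0 _ Gz0).
  (* Subtracting the value at [z0], which is smaller than [eps], makes the approximation vanish
     exactly where [f] does. *)
  exists (P - (P.[sval z0] / Q.[sval z0]) *: Q), Q; split=> [z zN|]; last first.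
    by right; split=> //; exists z0; rewrite // !hornerE divfK // subrr.
  have [Qz Rz] := H z zN; split=> //; rewrite !hornerE mulrBl mulfK // opprB addrCA addrC.
  by apply: absvD_lt => //; rewrite fz0 sub0r absvN in Rz0.
case: exPQ => P [Q [HPQ Hz]].
have P0 : P != 0.
  apply/eqP => P0; move: eM; rewrite ltNge => /negP; apply; apply: Msup_le => // z Gz.
  by have [_] := HPQ z (HN0 _ Gz); rewrite P0 horner0 mul0r subr0 => /ltW.
have Q0 : Q != 0.
  have [z /HN0/HPQ[+ _]] := Gs_point Ks s0 K0; apply: contra_neq => ->.
  by rewrite horner0.
have [rP [rQ [ER HrP HrQ]]] := rat_rfun P0 Q0.
have nQ b : b \in rQ -> forall z, affinoid N z -> sval z <> b.
  by rewrite HrQ => /rootP Qb z /HPQ[+ _] zb; rewrite zb Qb eqxx.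
have nG (c0 s1 : C) : Kc s1 -> s1 != 0 -> Kc c0 -> (forall z, Gs c0 s1 (sval z) -> affinoid N z) ->
    {in rQ, forall b, ~ Gs c0 s1 b}.
  move=> Ks1 s10 Kc0 HN b bQ Gb.
  by apply: (nQ b bQ (mkO (Gs_notKinf Ks1 s10 Kc0 Gb))) => //; apply: HN.
pose rn' := rn (lead_coef P) (lead_coef Q) rP rQ.
have up (c0 s1 : C) : Kc s1 -> s1 != 0 -> Kc c0 -> (forall z, Gs c0 s1 (sval z) -> affinoid N z) ->
    rn' c0 s1 <= Num.max (Msup f c0 s1) eps.
  move=> Ks1 s10 Kc0 HN.
  have [x [Gx Ex]] := rfun_attained Cclosed (lead_coef P) (lead_coef Q) rP rQ Ks1 s10 Kc0.
  pose z := mkO (Gs_notKinf Ks1 s10 Kc0 Gx).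
  rewrite /rn' -Ex -ER -(subrK (f z) (P.[x] / Q.[x])); apply: absvD_le; rewrite le_max.
    by apply/orP; right; rewrite absv_distC; have [_ lt] := HPQ z (HN z Gx); apply: ltW.
  by rewrite Msup_ge.
have low : Msup f 0 s <= rn' 0 s.
  have : Msup f 0 s <= Num.max (rn' 0 s) eps.
    apply: Msup_le => // z Gz; have [_ lt] := HPQ z (HN0 z Gz).
    rewrite -(subrK (P.[sval z] / Q.[sval z]) (f z)); apply: absvD_le; rewrite le_max.
      by apply/orP; right; apply: ltW.
    by rewrite ER rfun_le //; apply: nG.
  by rewrite le_max leNgt => /orP[|] //; rewrite leNgt eM.
(* A pole in the open star would be at distance at least |s| / q from K_infty, hence in the
   affinoid, where the denominator has no zero. *)
have HQ : {in rQ, forall b, (q%:R * absv s <= absv b) \/ exists c, absv (b - scal c * s) <= absv s / q%:R}.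
  move=> b bQ; apply: contrapT => /not_orP[/negP + nex]; rewrite -ltNge => lt.
  have far c : absv s / q%:R < absv (b - scal c * s).
    by rewrite ltNge; apply/negP => le; apply: nex; exists c.
  have dist k : Kc k -> absv s / q%:R <= absv (b - k).
    move=> Kk; have [ks|sk] := lerP (absv k) (absv s).
      have [c Hc] := Kc_digit Ks s0 Kk ks.
      have -> : b - k = (b - scal c * s) - (k - scal c * s) by ring.
      by rewrite absvB_eql ?(le_lt_trans Hc) // ltW.
    have := Kc_jump Ks s0 Kk sk => qk; rewrite absvB_eqr ?(lt_le_trans lt) //.
    by rewrite (le_trans _ (ltW sk)) // ler_pdivrMr ?qR_gt0 // ler_peMr ?(ltW as0) // ltW ?qR_gt1.
  have nb : ~ Kinf b by move=> /KinfP/dist; rewrite subrr absv0 leNgt sq0.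
  apply: (nQ b bQ (mkO nb)) => //; apply: HN3 => [|k /dist//]; exact: ltW.
have Hk' : kap = 1 \/ (kap = q%:R /\ exists2 a, a \in rP & Gs 0 s a).
  case: Hz => [|[-> [z Gz /rootP Pz]]]; [by left|right; split=> //].
  by exists (sval z); rewrite ?HrP.
have kap0 : 0 <= kap by case: Hk => [->|[->]].
apply: (le_trans (_ : _ <= kap * rn' 0 s ^+ q.+1)).
  by rewrite ler_wpM2l // lerXn2r ?nnegrE ?(le_trans (ltW e0) (ltW eM)) // (le_trans _ low) // (le_trans (ltW e0) (ltW eM)).
have rn0 (c0 s1 : C) : 0 <= rn' c0 s1.
  by rewrite /rn' /rn mulr_ge0 // divr_ge0 ?absv_ge0 ?gn_ge0.
apply: (le_trans (star_rn _ _ s0 HQ Hk')).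
apply: ler_pM; [exact: rn0|by apply: prodr_ge0 => c _; apply: rn0|exact: up|].
by apply: ler_prod => c _; rewrite rn0 up // => z; apply: HN2.
Qed.

(** The norm [rn] at centre 0 as a function of a real radius, which need not be the absolute value
    of an element of K_infty. *)
Definition rn0 (lP lQ : C) (rP rQ : seq C) (rho : R) : R :=
  absv lP / absv lQ * (gn rP 0 rho / gn rQ 0 rho).

(* Between two vertices the norm of a rational function without poles in the
   annulus is log-convex, hence bounded by its values at the two ends. *)
Lemma edge_rn (lP lQ : C) (rP rQ : seq C) (rho sig tau : R) : 0 < sig -> sig < rho -> rho < tau ->
  {in rQ, forall b, absv b <= sig \/ tau <= absv b} ->
  rn0 lP lQ rP rQ rho <= Num.max (rn0 lP lQ rP rQ sig) (rn0 lP lQ rP rQ tau).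
Proof.
move=> s0 sr rt HQ; set N := rn0 _ _ _ _; have r0 := lt_trans s0 sr; have t0 := lt_trans r0 rt.
pose cnt r := count (fun a : C => absv a < rho) r.
have upP r (x : R) : 0 < x -> (rho <= x) || (x <= rho) -> (x / rho) ^+ cnt r * gn r 0 rho <= gn r 0 x.
  move=> x0 _; rewrite /gn; elim: r => [|a r IHr]; first by rewrite !big_nil mulr1.
  rewrite !big_cons /= subr0.
  have g0 : 0 <= (x / rho) ^+ cnt r * \prod_(j <- r) Num.max rho (absv (j - 0)).
    by rewrite mulr_ge0 ?gn_ge0 // exprn_ge0 // divr_ge0 ?ltW.
  case: ltP => ar /=.
    rewrite add1n exprS.
    rewrite (_ : \prod_(j <- r) _ = gn r 0 rho) // in IHr g0 *.
    rewrite -/(cnt r).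
    have -> : x / rho * (x / rho) ^+ cnt r * (rho * gn r 0 rho) = x * ((x / rho) ^+ cnt r * gn r 0 rho).
      by field; rewrite gt_eqF.
    by apply: ler_pM => //; rewrite ?(ltW x0) // le_max lexx.
  rewrite add0n mulrCA; apply: ler_pM => //; first exact: absv_ge0.
  by rewrite le_max lexx orbT.
have eqQ r (x : R) : 0 < x -> {in r, forall b, (absv b < rho /\ absv b <= x) \/ (rho <= absv b /\ x <= absv b)} ->
    (x / rho) ^+ cnt r * gn r 0 rho = gn r 0 x.
  move=> x0; rewrite /gn; elim: r => [|a r IHr] H; first by rewrite !big_nil mulr1.
  rewrite !big_cons /= subr0 -IHr; last by move=> b br; apply: H; rewrite inE br orbT.
  case: (H a (mem_head _ _)) => -[h1 h2].
    by rewrite h1 add1n exprS (max_idPl (ltW h1)) (max_idPl h2); field; rewrite gt_eqF.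
  by rewrite ltNge h1 add0n (max_idPr h1) (max_idPr h2) mulrCA.
have key (x : R) : 0 < x -> {in rQ, forall b, (absv b < rho /\ absv b <= x) \/ (rho <= absv b /\ x <= absv b)} ->
    1 <= (x / rho) ^+ cnt rP / (x / rho) ^+ cnt rQ -> N rho <= N x.
  move=> x0 H ge1; rewrite /N /rn0 -(eqQ rQ x x0 H).
  rewrite ler_wpM2l ?divr_ge0 ?absv_ge0 //.
  have gP := gn_ge0 rP 0 rho; have gQ := gn_gt0 rQ 0 r0.
  have xr : 0 < x / rho by rewrite divr_gt0.
  apply: (le_trans (_ : _ <= ((x / rho) ^+ cnt rP / (x / rho) ^+ cnt rQ) * (gn rP 0 rho / gn rQ 0 rho))).
    by rewrite ler_peMl // divr_ge0 // ltW.
  rewrite mulrACA -invfM ler_wpM2r ?upP ?le_total //.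
  by rewrite invr_ge0 mulr_ge0 ?exprn_ge0 // ltW.
rewrite le_max; have [le|lt] := leqP (cnt rQ) (cnt rP).
  apply/orP; right; apply: key => // [b /HQ[bs|tb]|].
  - by left; rewrite (le_lt_trans bs) // (le_trans bs) // ltW // (lt_trans sr).
  - by right; rewrite tb (le_trans _ tb) // ltW.
  have ge1 : 1 <= tau / rho by rewrite ler_pdivlMr // mul1r ltW.
  by rewrite -(subnK le) exprD mulfK ?expf_neq0 ?exprn_ege1 // gt_eqF // divr_gt0.
apply/orP; left; apply: key => // [b /HQ[bs|tb]|].
- by left; rewrite (le_lt_trans bs).
- by right; rewrite (le_trans (ltW rt)) // (le_trans _ tb) // ltW // (lt_trans sr).
have le1 : sig / rho <= 1 by rewrite ler_pdivrMr // mul1r ltW.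
have srp : 0 < sig / rho by rewrite divr_gt0.
rewrite ler_pdivlMr ?exprn_gt0 // mul1r -(subnK (ltnW lt)) exprD ger_pMl ?exprn_gt0 //.
by rewrite exprn_ile1 // ltW.
Qed.

End SupNorms.

Lemma seq_argmin (R : realDomainType) (T : eqType) (r : seq T) (f : T -> R) : r != [::] ->
  exists2 x, x \in r & {in r, forall y, f x <= f y}.
Proof.
elim: r => // a [|b r] IHr _.
  by exists a; rewrite ?mem_head // => y; rewrite inE => /eqP->.
have [x xr Hx] := IHr isT; have [le|lt] := lerP (f a) (f x).
  exists a; rewrite ?mem_head // => y; rewrite in_cons => /predU1P[->//|/Hx].
  exact: le_trans.
exists x; first by rewrite in_cons xr orbT.
move=> y; rewrite in_cons => /predU1P[->|/Hx//].
exact: ltW.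
Qed.

(** * Reduction to a fundamental domain *)

Section Reduction.
Variables (F : finFieldType) (R : realType) (C : valuedField F R).
Local Notation q := #|F|.
Local Notation th := (theta C).
Local Notation scal := (@vf_scal F R C).
Local Notation evA := (@evA F R C).
Local Notation Omega := (Omega C).
Implicit Types (x y k s : C) (z w : Omega) (a b c d e : {poly F}).

Definition mx22 a b c d : 'M[{poly F}]_2 :=
  \matrix_(i, j) (if i == 0 then if j == 0 then a else b else if j == 0 then c else d).

Lemma mx22_unit a b c d : a * d - b * c \is a GRing.unit -> mx22 a b c d \in unitmx.
Proof. by move=> u; rewrite unitmxE det_mx22 !mxE. Qed.

Lemma moebius_mx22 a b c d z w : moebius_rel (mx22 a b c d) z w <->
  sval w = (evA a * sval z + evA b) / (evA c * sval z + evA d).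
Proof. by rewrite /moebius_rel /autJ !mxE. Qed.

(** The lower row (c, d) minimizes |c z + d|, hence is coprime, and a Bezout relation completes it
    to determinant one; a translation then brings w as close to 0 as A allows. The upper row
    competes with (c, d), which gives |w| >= 1. *)
Lemma reduction z : exists gam w, [/\ gam \in unitmx, moebius_rel gam z w,
  forall k, Kc k -> absv (sval w) <= absv (sval w - k) & 1 <= absv (sval w)].
Proof.
have [n zn] := affinoid_ex z.
pose lam (p : {poly F} * {poly F}) := absv (evA p.1 * sval z + evA p.2).
pose S := [seq p <- [seq (c, d) | c <- polys F (n + n).+1, d <- polys F (n + n).+1] | p != (0, 0)].
have S01 : (0, 1) \in S.
  rewrite mem_filter xpair_eqE oner_eq0 andbF /=; apply/allpairsP; exists (0, 1).
  split=> //; [have := mem_polys (n + n).+1 (0 : {poly F})|have := mem_polys (n + n).+1 (1 : {poly F})].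
    rewrite size_poly0 => H; exact: H.
  rewrite size_poly1 => H; exact: H.
have [[c d] /= cdS min0] : exists2 p, p \in S & {in S, forall p', lam p <= lam p'}.
  by apply: seq_argmin; case: S S01.
have cmin c' d' : (c', d') != (0, 0) -> lam (c, d) <= lam (c', d').
  move=> n0; have [le|lt] := lerP 1 (lam (c', d')).
    by apply: le_trans le; rewrite (le_trans (min0 _ S01)) // /lam /= rmorph0 mul0r add0r rmorph1 absv1.
  apply: min0; rewrite mem_filter n0 /=; apply/allpairsP; exists (c', d').
  have := @lattice_small F R C n 0 z d' c' zn; rewrite expr0 addrC => /(_ lt)[s1 s2].
  split=> //; [have := mem_polys (n + n).+1 c'|have := mem_polys (n + n).+1 d'].
    have -> : (size c' <= (n + n).+1)%N by lia.
    by move=> H; exact: H.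
  have -> : (size d' <= (n + n).+1)%N by lia.
  by move=> H; exact: H.
have cd0 : (c, d) != (0, 0) by move: cdS; rewrite mem_filter => /andP[].
have J0 : 0 < lam (c, d).
  rewrite absv_gt0 addrC lattice_eq0 andbC /=.
  by move: cd0; rewrite xpair_eqE.
have cop : coprimep c d.
  rewrite /coprimep; apply/negPn/negP => g1.
  have [c' cE] := dvdpP _ _ (dvdp_gcdl c d); have [d' dE] := dvdpP _ _ (dvdp_gcdr c d).
  set g := gcdp c d in g1 cE dE *.
  have g0 : g != 0 by rewrite gcdp_eq0; move: cd0; rewrite xpair_eqE.
  have n0 : (c', d') != (0, 0).
    by apply: contra cd0 => /eqP[c0 d0]; rewrite cE dE c0 d0 !mul0r.
  have := cmin _ _ n0; rewrite leNgt => /negP; apply.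
  have -> : lam (c, d) = lam (c', d') * absv (evA g).
    by rewrite /lam /= {1}cE {1}dE !rmorphM -absvM; congr absv; ring.
  rewrite ltr_pMr; last first.
    rewrite absv_gt0 addrC lattice_eq0 andbC.
    by move: n0; rewrite xpair_eqE.
  rewrite absv_evA // exprn_egt1 ?qR_gt1 //.
  have : (0 < size g)%N by rewrite size_poly_gt0.
  by move: g1; case: (size g) => [|[]].
have [[u v] /= uv] := Bezout_eq1_coprimepP _ _ cop.
have u0 : mx22 v (- u) c d \in unitmx.
  by apply: mx22_unit; rewrite mulNr opprK addrC uv unitr1.
have [w0 /moebius_mx22 w0E] := moebius_ex z u0.
have [M HM] := ex_expq F (absv (sval w0)).
(* Polynomials of degree above M exceed [w0] in absolute value, so the minimum over this finite box
   is a minimum over A. *)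
have [e eM emin0] : exists2 e, e \in polys F M.+1 & {in polys F M.+1, forall a, absv (sval w0 - evA e) <= absv (sval w0 - evA a)}.
  apply: seq_argmin; have H := mem_polys M.+1 (0 : {poly F}).
  by apply/eqP => E; move: H; rewrite E size_poly0.
have emin a : absv (sval w0 - evA e) <= absv (sval w0 - evA a).
  have [le|lt] := leqP (size a) M.+1; first by apply: emin0; rewrite mem_polys.
  apply: (@le_trans _ _ (absv (sval w0))).
    by have := emin0 0; rewrite mem_polys size_poly0 rmorph0 subr0; apply.
  have := @absv_evA_ge F R C a M.+1 lt; rewrite exprS => le.
  have lt' : absv (sval w0) < absv (evA a).
    apply: le_lt_trans HM _; apply: lt_le_trans le.
    by rewrite ltr_pMl ?absv_th_neq0 // qR_gt1.
  by rewrite absvB_eqr ?ltW.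
have u1 : mx22 (v - e * c) (- u - e * d) c d \in unitmx.
  by apply: mx22_unit; rewrite (_ : _ - _ = 1) ?unitr1 // -uv; ring.
have [w wr] := moebius_ex z u1; move: (wr) => /moebius_mx22 wE.
exists (mx22 (v - e * c) (- u - e * d) c d), w.
have J0' : evA c * sval z + evA d != 0 by rewrite -absv_gt0.
have ww : sval w = sval w0 - evA e.
  by rewrite wE w0E !rmorphB !rmorphM rmorphN; field.
have w1 : 1 <= absv (sval w).
  have n0 : (v - e * c, - u - e * d) != (0, 0).
    apply/negP => /eqP[E1 E2].
    have : (v - e * c) * d - (- u - e * d) * c = 1 by rewrite -uv; ring.
    by rewrite E1 E2 !mul0r subrr => /esym/eqP; rewrite oner_eq0.
  have := cmin _ _ n0; rewrite /lam /= => le.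
  by rewrite wE absvM absvV ler_pdivlMr ?mul1r.
split=> // k Kk; have [a ka] := Kc_round Kk.
have wa : absv (sval w) <= absv (sval w - evA a).
  by rewrite ww -addrA -opprD -rmorphD; apply: emin.
have -> : sval w - k = (sval w - evA a) - (k - evA a) by ring.
by rewrite absvB_eql // (lt_le_trans ka) // (le_trans w1).
Qed.

End Reduction.

(** * A Liouville theorem on the quotient half-line *)

Section Liouville.
Variables (F : finFieldType) (R : realType) (C : valuedField F R).
Local Notation q := #|F|.
Local Notation th := (theta C).
Local Notation scal := (@vf_scal F R C).
Local Notation evA := (@evA F R C).
Local Notation Omega := (Omega C).
Hypothesis Cclosed : GRing.closed_field_axiom C.
Implicit Types (x y k s : C) (z w : Omega) (f : Omega -> C).

Definition absGinv f := forall gam z w, gam \in unitmx -> moebius_rel gam z w ->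
  absv (f w) = absv (f z).

Lemma absGinv_trans f z w (a : {poly F}) : absGinv f -> sval w = sval z + evA a ->
  absv (f w) = absv (f z).
Proof.
move=> fG wz; apply: (fG (mx22 1 a 0 1)).
  by apply: mx22_unit; rewrite mulr1 mulr0 subr0 unitr1.
by apply/moebius_mx22; rewrite !rmorph1 rmorph0 mul0r add0r divr1 mul1r.
Qed.

Lemma absGinv_inv f z : absGinv f -> absv (f (Oinv z)) = absv (f z).
Proof.
move=> fG; apply: (fG (mx22 0 1 1 0)).
  by apply: mx22_unit; rewrite mulr0 mulr1 sub0r unitrN1.
by apply/moebius_mx22; rewrite !rmorph1 !rmorph0 mul0r add0r !mul1r addr0.
Qed.

Lemma notKinf_trans z (a : {poly F}) : ~ Kinf (sval z + evA a).
Proof.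
move=> /KinfP K; apply: (@notKc _ _ _ z).
by rewrite -[sval z](addrK (evA a)); apply: KcB => //; apply: Kc_evA.
Qed.

Lemma KcthX n : Kc (th ^+ n). Proof. exact/KcX/Kc_th. Qed.

Definition mG f n := Msup f 0 (th ^+ n).
(** All q + 1 neighbours of the origin of the half-line are equivalent to vertex 1, and q neighbours
    of a vertex n > 0 are equivalent to vertex n - 1. *)
Definition mGpred f n := if n is n'.+1 then mG f n' else mG f 1.

Lemma mG_ge0 f n : holomorphic f -> 0 <= mG f n.
Proof. by move=> hf; apply: (Msup_ge0 Cclosed) => //; rewrite ?thX_neq0 //; [apply: KcthX|apply: Kc0]. Qed.

Lemma mGpred_ge0 f n : holomorphic f -> 0 <= mGpred f n.
Proof. by case: n => [|n] hf; apply: mG_ge0. Qed.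

(** A translation by a multiple of theta^n moves the neighbour to the centre 0; for n = 0 its radius
    1 / q is turned into q by the inversion z -> 1 / z. *)
Lemma Msup_neighbour f n (c : F) : holomorphic f -> absGinv f ->
  Msup f (scal c * th ^+ n) (th ^+ n / th) <= mGpred f n.
Proof.
move=> hf fG.
have K1 : Kc (th ^+ n / th) by apply: KcM (KcthX _) Kc_thV.
have n1 : th ^+ n / th != 0 by rewrite mulf_neq0 ?invr_eq0 ?thX_neq0 ?th_neq0.
have K2 : Kc (scal c * th ^+ n) by apply: KcM (KcthX _); apply: Kc_scal.
have tr z : let w := mkO (@notKinf_trans z (- (c *: 'X^n))) in
    sval w = sval z - scal c * th ^+ n /\ absv (f w) = absv (f z).
  have E : evA (c *: 'X^n) = scal c * th ^+ n.
    by rewrite -mul_polyC rmorphM rmorphXn /= evAC evAX.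
  by split; [rewrite /= rmorphN /= E|apply: (absGinv_trans fG (a := - (c *: 'X^n)))].
case: n K1 n1 K2 tr => [|n] K1 n1 K2 tr /=.
  apply: (Msup_map Cclosed) => //; try exact: Kc0; try exact: (KcthX 1); try exact: (thX_neq0 C 1).
  move=> z Gz; have [] := tr z; set w := mkO _ => wz fw; exists (Oinv w); last by rewrite absGinv_inv.
  move: Gz; rewrite expr0 mulr1 mul1r => Gz d /=; rewrite subr0.
  have w0 := sval_neq0 w.
  have aw : absv (sval w) = q%:R^-1.
    by rewrite wz expr0 mulr1 (Gs0 Gz) absvV absv_th.
  have [->|d0] := eqVneq d 0; first by rewrite rmorph0 mul0r subr0 absvV aw invrK absv_th.
  have sd0 : scal d != 0 by rewrite fmorph_eq0.
  have -> : (sval w)^-1 - scal d * th = - (scal d * th / sval w) * (sval w - scal d^-1 / th).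
    by rewrite fmorphV; field; rewrite w0 sd0 th_neq0.
  rewrite !absvM absvN !absvM absvV absv_scal d0 mul1r aw invrK.
  have -> : sval w - scal d^-1 / th = sval z - scal c - scal d^-1 / th by rewrite wz expr0 mulr1.
  by rewrite (Gz d^-1) absvV absv_th mulfK // gt_eqF ?qR_gt0.
have En : th ^+ n.+1 / th = th ^+ n by rewrite exprSr mulfK ?th_neq0.
rewrite En in K1 n1 *.
apply: (Msup_map Cclosed) => //; try exact: Kc0; try exact: KcthX; try exact: thX_neq0.
move=> z Gz; have [] := tr z; set w := mkO _ => wz fw; exists w => //.
by move=> d; rewrite subr0 wz.
Qed.

Lemma mG_star f n (kap : R) : holomorphic f -> absGinv f -> 0 < mG f n ->
  kap = 1 \/ (kap = q%:R /\ exists2 z : Omega, Gs 0 (th ^+ n) (sval z) & f z = 0) ->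
  kap * mG f n ^+ q.+1 <= mG f n.+1 * mGpred f n ^+ q.
Proof.
move=> hf fG m0 Hk; apply: (max_limit _ _ m0 (q_gt0 F)); rewrite ?mG_ge0 ?mGpred_ge0 // => e em.
apply: (le_trans (star_sup Cclosed hf (KcthX n) (thX_neq0 _ _) em Hk)).
rewrite -exprS ler_wpM2l //; first by rewrite le_max mG_ge0.
rewrite -[X in _ <= X]prodr_const.
apply: ler_prod => c _; rewrite le_max; case/andP: em => /ltW-> _; rewrite orbT /=.
by rewrite ge_max !le_max lexx orbT andbT Msup_neighbour.
Qed.

Lemma mG_rec f n : holomorphic f -> absGinv f -> mG f n ^+ q.+1 <= mG f n.+1 * mGpred f n ^+ q.
Proof.
move=> hf fG; have := mG_ge0 n hf; rewrite le_eqVlt => /predU1P[<-|m0].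
  by rewrite expr0n /= mulr_ge0 ?exprn_ge0 ?mG_ge0 ?mGpred_ge0.
by rewrite -[X in X <= _]mul1r mG_star //; left.
Qed.

(** In m_n^(q+1) <= m_(n+1) m_(n-1)^q the inductive bound m_(n-1) <= m_n cancels q powers; at the
    origin the recursion is already m_0^(q+1) <= m_1^(q+1). *)
Lemma mG_mono f n : holomorphic f -> absGinv f -> mG f n <= mG f n.+1.
Proof.
move=> hf fG; elim: n => [|n IHn]; have := mG_rec _ hf fG.
  move=> /(_ 0%N); rewrite /= -exprS => le; rewrite leNgt; apply/negP => lt; move: le.
  by rewrite leNgt ltrXn2r ?nnegrE ?mG_ge0.
move=> /(_ n.+1) /= le; have := mG_ge0 n.+1 hf; rewrite le_eqVlt => /predU1P[<-|m0].
  exact: mG_ge0.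
rewrite -(ler_pM2r (exprn_gt0 q m0)) -exprS (le_trans le) // ler_wpM2l ?mG_ge0 //.
by rewrite lerXn2r ?nnegrE ?mG_ge0.
Qed.

Lemma mG_zero f : holomorphic f -> absGinv f -> mG f 0 = 0 -> forall n, mG f n = 0.
Proof.
move=> hf fG m0; suff H : forall n, mG f n = 0 /\ mG f n.+1 = 0 by move=> n; case: (H n).
have step n : mG f n = 0 -> mG f n.+1 = 0.
  move=> mn; have := mG_rec n.+1 hf fG; rewrite /= mn expr0n eqn0Ngt q_gt0 mulr0.
  have := mG_ge0 n.+1 hf; rewrite le_eqVlt => /predU1P[<-//|m1].
  by rewrite leNgt exprn_gt0.
by elim=> [|n [_ IHn]]; split=> //; apply: step.
Qed.

(** A reduced point lies on a vertex of the half-line or in an annulus q^n < |w| < q^(n+1). In the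
    annulus an approximating rational function has no poles, so [edge_rn] bounds it by its norms at
    the two ends, where [f] vanishes. *)
Lemma mG_zero_edge f : holomorphic f -> absGinv f -> (forall n, mG f n = 0) -> forall z, f z = 0.
Proof.
move=> hf fG m0 z.
have G0 n w : Gs 0 (th ^+ n) (sval w) -> f w = 0.
  move=> Gw; apply/eqP; rewrite -absv_eq0 eq_le absv_ge0 andbT -(m0 n).
  by apply: (Msup_ge Cclosed) => //; rewrite ?thX_neq0 //; [apply: KcthX|apply: Kc0].
have [gam [w [ug gzw wk w1]]] := reduction z.
apply/eqP; rewrite -absv_eq0 -(fG gam z w ug gzw) absv_eq0; apply/eqP.
have ex : exists n, absv (sval w) < q%:R ^+ n.+1.
  have [N HN] := ex_expq F (absv (sval w)); exists N.
  by rewrite (le_lt_trans HN) // exprS ltr_pMl ?absv_th_neq0 // qR_gt1.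
have [n nlt nmin] : exists2 n, absv (sval w) < q%:R ^+ n.+1 & q%:R ^+ n <= absv (sval w).
  exists (ex_minn ex); first by case: ex_minnP.
  case: ex_minnP => -[|n] _ Hmin; first by rewrite expr0.
  by rewrite leNgt; apply/negP => /Hmin; rewrite ltnn.
move: nmin; rewrite le_eqVlt => /predU1P[En|nlt'].
  apply: (G0 n) => c; rewrite subr0 absvX absv_th En.
  apply/eqP; rewrite eq_le wk ?andbT; last by apply: KcM (KcthX n); apply: Kc_scal.
  apply: absvB_le => //; rewrite absvM absvX absv_th -En -[leRHS]mul1r ler_wpM2r ?absv_ge0 //.
  exact: absv_scal_le1.
have Kt := @KcthX n; have Kt1 := @KcthX n.+1; have K0 : Kc (0 : C) := Kc0.
have t0 := thX_neq0 C n; have t1 := thX_neq0 C n.+1.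
have [N0 HN0] := Gs_affinoid Kt t0 K0; have [N1 HN1] := Gs_affinoid Kt1 t1 K0.
have [N2 HN2] := @ex_affinoid F R C (q%:R ^+ n.+1) 1 ltr01.
pose N := (N0 + N1 + N2)%N.
apply: absv_small => eps e0; have e20 : 0 < eps / 2 by lra.
have [P [Q H]] := hf N _ e20.
have wN : affinoid N w.
  apply: (@affinoid_le _ _ _ N2); first by rewrite /N leq_addl.
  by apply: HN2 => [|k Kk]; [apply: ltW|rewrite (le_trans w1) // wk].
have [Qw Rw] := H w wN.
have Rsmall : absv (P.[sval w] / Q.[sval w]) <= eps / 2.
  have [P0|P0] := eqVneq P 0; first by rewrite P0 horner0 mul0r absv0 ltW.
  have Q0 : Q != 0 by apply: contra_neq Qw => ->; rewrite horner0.
  have [rP [rQ [ER _ HrQ]]] := rat_rfun Cclosed P0 Q0.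
  have nQ b : b \in rQ -> forall z, affinoid N z -> sval z <> b.
    by rewrite HrQ => /rootP Qb z' /H[+ _] zb; rewrite zb Qb eqxx.
  have vert m : Kc (th ^+ m) -> (forall z, Gs 0 (th ^+ m) (sval z) -> affinoid N z) ->
      rn0 (lead_coef P) (lead_coef Q) rP rQ (q%:R ^+ m) <= eps / 2.
    move=> Km HmN; have tm := thX_neq0 C m.
    have [x [Gx Ex]] := rfun_attained Cclosed (lead_coef P) (lead_coef Q) rP rQ Km tm K0.
    pose z' := mkO (Gs_notKinf Km tm K0 Gx).
    have -> : rn0 (lead_coef P) (lead_coef Q) rP rQ (q%:R ^+ m) =
        rn (lead_coef P) (lead_coef Q) rP rQ 0 (th ^+ m) by rewrite /rn absvX absv_th.
    rewrite -Ex -ER; have [_] := H z' (HmN z' Gx).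
    by rewrite (G0 m z' Gx) sub0r absvN => /ltW.
  have sep : {in rQ, forall b, absv b <= q%:R ^+ n \/ q%:R ^+ n.+1 <= absv b}.
    move=> b bQ; apply: contrapT => /not_orP[/negP + /negP]; rewrite -!ltNge => b1 b2.
    have far k : Kc k -> 1 <= absv (b - k).
      move=> Kk; have bk : absv b <= absv (b - k).
        have [le|lt] := lerP (absv k) (absv (th ^+ n)).
          by rewrite absvB_eql // (le_lt_trans le) // absvX absv_th.
        have := Kc_jump Kt t0 Kk lt; rewrite absvX absv_th -exprS => le.
        by rewrite absvB_eqr ?(lt_le_trans b2) // ltW // (lt_le_trans b2).
      rewrite (le_trans _ bk) // (le_trans _ (ltW b1)) // exprn_ege1 // ltW ?qR_gt1 //.
    have nb : ~ Kinf b by move=> /KinfP/far; rewrite subrr absv0 ler10.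
    apply: (nQ b bQ (mkO nb)) => //; apply: (@affinoid_le _ _ _ N2); first by rewrite /N leq_addl.
    by apply: HN2 => //; apply: ltW.
  apply: (le_trans (_ : _ <= rn0 (lead_coef P) (lead_coef Q) rP rQ (absv (sval w)))).
    rewrite ER /rfun /rn0 !absvM !absvV !absv_prod.
    have -> : \prod_(b <- rQ) absv (sval w - b) = gn rQ 0 (absv (sval w)).
      rewrite /gn big_seq [RHS]big_seq; apply: eq_bigr => b /sep[le|ge]; rewrite subr0.
        by rewrite absvB_eql ?(le_lt_trans le) // (max_idPl _) // (le_trans le) // ltW.
      by rewrite absvB_eqr ?(lt_le_trans nlt) // (max_idPr _) // (le_trans _ ge) // ltW.
    apply: ler_wpM2l; first by rewrite divr_ge0 ?absv_ge0.
    apply: ler_wpM2r; first by rewrite invr_ge0 gn_ge0.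
    apply: ler_prod => a _; rewrite absv_ge0 subr0 /=.
    by rewrite -[absv a]absvN absv_ultra.
  have s0 : 0 < q%:R ^+ n :> R by apply: absv_th_neq0.
  apply: (le_trans (edge_rn _ _ _ s0 nlt' nlt sep)).
  rewrite ge_max !vert // => z'.
    by move=> /HN1; apply: affinoid_le; rewrite /N addnAC leq_addl.
  by move=> /HN0; apply: affinoid_le; rewrite /N -addnA leq_addr.
rewrite -(subrK (P.[sval w] / Q.[sval w]) (f w)); apply: absvD_lt.
  by apply: lt_trans Rw _; lra.
by apply: le_lt_trans Rsmall _; lra.
Qed.

(** Norms that are nondecreasing along the half-line and tend to zero at the cusp vanish. Requiring
    invariance of |f| only leaves room for powers of the determinant. *)
Theorem liouville_zero f : holomorphic f -> absGinv f ->
  (forall eps : R, 0 < eps -> exists n0, forall n z, (n0 <= n)%N ->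
     Gs 0 (th ^+ n) (sval z) -> absv (f z) <= eps) ->
  forall z, f z = 0.
Proof.
move=> hf fG f0; apply: mG_zero_edge => // n.
apply/eqP; rewrite eq_le mG_ge0 // andbT; apply/ler_addgt0Pr => eps e0; rewrite add0r.
have [n0 Hn0] := f0 _ e0.
have mono (k : nat) : mG f n <= mG f (n + k)%N.
  elim: k => [|k IHk]; first by rewrite addn0.
  by rewrite addnS (le_trans IHk) // mG_mono.
apply: le_trans (mono n0) _; apply: (Msup_le Cclosed); rewrite ?thX_neq0 //; [exact: KcthX|exact: Kc0|].
by move=> z; apply: Hn0; rewrite leq_addl.
Qed.

(** Subtracting the value at a point of vertex 0 creates a zero there; the star inequality gains a
    factor q and yields m_1 = rho m_0 with rho > 1 unless m_0 = 0. The recursion propagates this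
    ratio, and geometric growth contradicts boundedness near the cusp. *)
Theorem liouville_const f : holomorphic f ->
  (forall gam z w, gam \in unitmx -> moebius_rel gam z w -> f w = f z) ->
  (exists (B : R) n0, forall n z, (n0 <= n)%N -> Gs 0 (th ^+ n) (sval z) -> absv (f z) <= B) ->
  exists x, forall z, f z = x.
Proof.
move=> hf fG [B0 [n0 HB]].
have [z0 Gz0] := Gs_point Cclosed (KcthX 0) (thX_neq0 C 0) (Kc0 : Kc (0 : C)).
exists (f z0) => z; apply/eqP; rewrite -subr_eq0; apply/eqP.
pose f1 w := f w - f z0.
have hf1 : holomorphic f1 by apply: holB => //; apply: hol_const.
have fG1 : absGinv f1 by move=> gam w w' ug wr; rewrite /f1 (fG gam w w').
suff m0 : mG f1 0 = 0 by apply: (@mG_zero_edge f1 hf1 fG1) => //; apply: mG_zero.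
have := mG_ge0 0 hf1; rewrite le_eqVlt => /predU1P[//|m0].
have kap : (q%:R : R) = 1 \/ (q%:R = q%:R :> R /\ exists2 w : Omega, Gs 0 (th ^+ 0) (sval w) & f1 w = 0).
  by right; split=> //; exists z0 => //; rewrite /f1 subrr.
have := mG_star hf1 fG1 m0 kap; rewrite /= -exprS => le.
pose rho := mG f1 1 / mG f1 0.
have m01 : mG f1 0 < mG f1 1.
  rewrite ltNge; apply/negP => le'; move: le; rewrite leNgt => /negP; apply.
  apply: le_lt_trans (_ : _ <= mG f1 0 ^+ q.+1) _; first by rewrite lerXn2r ?nnegrE ?mG_ge0.
  by rewrite ltr_pMl ?exprn_gt0 // qR_gt1.
have rho1 : 1 < rho by rewrite ltr_pdivlMr // mul1r.
have rho0 : 0 < rho := lt_trans ltr01 rho1.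
have grow n : 0 < mG f1 n /\ rho * mG f1 n <= mG f1 n.+1.
  elim: n => [|n [mn IHn]]; first by rewrite /rho divfK ?gt_eqF.
  have mn1 : 0 < mG f1 n.+1 by apply: lt_le_trans IHn; rewrite mulr_gt0.
  split=> //; have := mG_rec n.+1 hf1 fG1; rewrite /= => lerec.
  have lea : mG f1 n <= mG f1 n.+1 / rho by rewrite ler_pdivlMr // mulrC.
  have le2 : mG f1 n ^+ q <= (mG f1 n.+1 / rho) ^+ q.
    by rewrite lerXn2r // nnegrE ?(ltW mn) // (le_trans (ltW mn) lea).
  have : mG f1 n.+1 ^+ q.+1 <= mG f1 n.+2 * (mG f1 n.+1 / rho) ^+ q.
    by apply: le_trans lerec _; rewrite ler_wpM2l ?mG_ge0.
  rewrite expr_div_n exprS mulrCA [mG f1 n.+1 * _]mulrC ler_pM2l ?exprn_gt0 //.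
  rewrite ler_pdivlMr ?exprn_gt0 // mulrC; apply: le_trans.
  by rewrite ler_wpM2r ?(ltW mn1) // -[leLHS]expr1 ler_weXn2l ?(ltW rho1) ?q_gt0.
have pw n : rho ^+ n * mG f1 0 <= mG f1 n.
  elim: n => [|n IHn]; first by rewrite expr0 mul1r.
  by rewrite exprS -mulrA; apply: le_trans (grow n).2; rewrite ler_wpM2l // ltW.
pose B := Num.max B0 (absv (f z0)) + 1.
have mB n : (n0 <= n)%N -> mG f1 n < B.
  move=> nn; apply: le_lt_trans (_ : _ <= Num.max B0 (absv (f z0))) _; last by rewrite ltrDl.
  apply: (Msup_le Cclosed); rewrite ?thX_neq0 //; [exact: KcthX|exact: Kc0|].
  by move=> w /(HB n w nn) fw; apply: absvB_le; rewrite le_max ?fw ?lexx ?orbT.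
have Bp : 0 < B by apply: le_lt_trans (mG_ge0 n0 hf1) (mB _ (leqnn _)).
have ri : 0 <= rho^-1 < 1 by rewrite invr_ge0 ltW //= invf_lt1.
have [N HN] := geom_small ri (ltW Bp) m0.
have := HN (N + n0)%N (leq_addr _ _); rewrite exprVn ltr_pdivrMr ?exprn_gt0 // mulrC => lt.
have := lt_trans (le_lt_trans (pw _) (mB _ (leq_addl N n0))) lt.
by rewrite ltxx.
Qed.

End Liouville.

(** * The exponential of A and its functional equation *)

Section CarlitzExponential.
Variables (F : finFieldType) (R : realType) (C : valuedField F R).
Local Notation q := #|F|.
Local Notation th := (theta C).
Local Notation scal := (@vf_scal F R C).
Local Notation evA := (@evA F R C).
Implicit Types (x y l : C) (a b : {poly F}).

(** Each application of [Phi] costs at most a factor q while D n is of order q^(-2n), so |D 0| <=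
    q^N |D N| = O(q^-N). With D n a difference evaluated at x / theta^n, it shows that an error
    compatible with a Drinfeld module and quadratic at 0 vanishes. *)
Lemma contraction_zero (D : nat -> C) (Phi : C -> C) (K eta : R) :
  (forall n, D n = Phi (D n.+1)) ->
  0 < eta -> (forall y, absv y <= eta -> absv (Phi y) <= q%:R * absv y) ->
  (exists n0, forall n, (n0 <= n)%N -> absv (D n) <= K * (q%:R ^- n * q%:R ^- n)) -> D 0%N = 0.
Proof.
move=> DPhi eta0 HPhi [n0 Hn0].
have K0 : 0 <= K.
  have := le_trans (absv_ge0 _) (Hn0 n0 (leqnn _)).
  by rewrite pmulr_lge0 // mulr_gt0 ?invr_gt0 ?absv_th_neq0.
have qi : 0 <= (q%:R : R)^-1 < 1.
  by rewrite invr_ge0 ltW ?qR_gt0 //= invf_lt1 ?qR_gt0 // qR_gt1.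
apply: absv_small => eps eps0.
have e0 : 0 < Num.min eta eps by rewrite lt_min eta0.
have [N1 HN1] := geom_small qi K0 e0.
pose N := (n0 + N1)%N.
have lt : K * q%:R ^- N < Num.min eta eps by rewrite -exprVn HN1 // leq_addl.
have X0 : 0 <= K * (q%:R ^- N * q%:R ^- N).
  have qn : 0 <= q%:R ^- N :> R by rewrite invr_ge0 ltW // absv_th_neq0.
  by rewrite !mulr_ge0.
have XE : q%:R ^+ N * (K * (q%:R ^- N * q%:R ^- N)) = K * q%:R ^- N.
  by field; rewrite gt_eqF ?absv_th_neq0.
have H j : (j <= N)%N -> absv (D (N - j)%N) <= q%:R ^+ j * (K * (q%:R ^- N * q%:R ^- N)).
  elim: j => [|j IHj] jN; first by rewrite subn0 expr0 mul1r Hn0 // leq_addr.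
  have le := IHj (ltnW jN).
  rewrite DPhi -subSn // subSS.
  apply: (le_trans (HPhi _ _)).
    apply: (le_trans le); rewrite (le_trans (_ : _ <= q%:R ^+ N * (K * (q%:R ^- N * q%:R ^- N)))) //.
      by rewrite ler_wpM2r // ler_weXn2l ?(ltW (qR_gt1 F R)) // ltnW.
    by rewrite XE; apply: ltW; move: lt; rewrite lt_min => /andP[].
  by rewrite exprS -mulrA ler_pM2l ?qR_gt0.
have := H N (leqnn _); rewrite subnn => /le_lt_trans; apply.
by rewrite XE; move: lt; rewrite lt_min => /andP[].
Qed.

Definition yA x a : C := x / evA a.
Definition eA x : C := x * xget 0 [set l | limto summability.totally (tprod (yA x)) l].
Definition EA n x : C := x * tprod (yA x) (fpolys F n).

Lemma yA_small x n a : a \notin fpolys F n -> absv (yA x a) <= absv x / q%:R ^+ n.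
Proof.
rewrite in_fpolys -ltnNge => lt; rewrite absvM absvV ler_wpM2l ?absv_ge0 //.
have := @absv_evA_ge _ R C _ _ lt; have qn := absv_th_neq0 F R n => le.
by rewrite lef_pV2 ?posrE // (lt_le_trans qn).
Qed.

Lemma yA_null x : cofinite_null (yA x).
Proof.
move=> eps e0; have [n Hn] := ex_expq F ((absv x + 1) / eps).
exists (fpolys F n) => a an; apply: le_lt_trans (yA_small x an) _.
rewrite ltr_pdivrMr ?absv_th_neq0 // mulrC -ltr_pdivrMr // (lt_le_trans _ Hn) //.
by rewrite ltr_pM2r ?invr_gt0 // ltrDl.
Qed.

Lemma yA0 x : yA x 0 = 0. Proof. by rewrite /yA rmorph0 invr0 mulr0. Qed.

Lemma psub_EA n : exists2 D : C, D != 0 & forall x, psub n x = D * EA n x.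
Proof.
exists (\prod_(a <- polys F n | a != 0) evA a).
  by rewrite prodf_seq_neq0; apply/allP => a _; rewrite evA_eq0; apply/implyP.
move=> x; rewrite /EA /tprod big_fpolys /psub.
have p0 : 0 \in polys F n by rewrite mem_polys size_poly0.
rewrite (bigD1_seq 0) ?polys_uniq //= rmorph0 addr0 mulrCA; congr (_ * _).
rewrite [X in _ = _ * X](bigD1_seq 0) ?polys_uniq //= yA0 addr0 mul1r -big_split /=.
apply: eq_bigr => a a0; rewrite /yA mulrDr mulr1 mulrCA divff ?evA_eq0 // mulr1.
exact: addrC.
Qed.

Lemma EA_lin n : (forall x y, EA n (x + y) = EA n x + EA n y) *
  (forall (c : F) x, EA n (scal c * x) = scal c * EA n x).
Proof.
have [D D0 HD] := psub_EA n; split=> *; apply: (mulfI D0).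
  by rewrite mulrDr -!HD psubD.
by rewrite [RHS]mulrCA -!HD (psub_lin C n).
Qed.

Lemma EA_ratio n x y : psub n x / psub n y = EA n x / EA n y.
Proof.
by have [D D0 HD] := psub_EA n; rewrite !HD invfM mulrACA divff // mul1r.
Qed.

Hypothesis Ccomp : Ccomplete C.

Lemma eAP x : exists l, limto summability.totally (tprod (yA x)) l /\ eA x = x * l.
Proof.
have ex := tprod_ex Ccomp (@yA_null x); have H := xgetPex 0 ex.
by exists (xget 0 [set l | limto summability.totally (tprod (yA x)) l]).
Qed.

Lemma EA_lim x : limto \oo (fun n => EA n x) (eA x).
Proof.
have [l [Hl ->]] := eAP x.
have /limto_seqP H := limto_tot_seq Hl (@fpolys_exhaust F).
have [->|x0] := eqVneq x 0.
  by apply/limto_seqP => eps e0; exists 0%N => n _; rewrite /EA !mul0r subrr absv0.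
apply/limto_seqP => eps e0; have ax : 0 < absv x by rewrite absv_gt0.
have [N HN] := H _ (divr_gt0 e0 ax); exists N => n /HN.
by rewrite ltr_pdivlMr // /EA -mulrBr absvM mulrC.
Qed.

Lemma limto_seqD (u v : nat -> C) l m : limto \oo u l -> limto \oo v m ->
  limto \oo (fun n => u n + v n) (l + m).
Proof.
move=> /limto_seqP ul /limto_seqP vm; apply/limto_seqP => eps e0.
have [N HN] := ul _ e0; have [M HM] := vm _ e0; exists (maxn N M) => n.
rewrite geq_max => /andP[Nn Mn]; rewrite opprD addrACA.
by apply: absvD_lt; [apply: HN|apply: HM].
Qed.

Lemma limto_seqM (u v : nat -> C) l m : limto \oo u l -> limto \oo v m ->
  limto \oo (fun n => u n * v n) (l * m).
Proof.
move=> /limto_seqP ul /limto_seqP vm; apply/limto_seqP => eps e0.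
pose A := Num.max 1 (Num.max (absv l) (absv m)) + 1.
have A0 : 0 < A by rewrite ltr_wpDl // le_max ler01.
have e1 : 0 < Num.min 1 (eps / A) by rewrite lt_min ltr01 divr_gt0.
have [N HN] := ul _ e1.
have [M HM] := vm _ (divr_gt0 e0 A0); exists (maxn N M) => n.
rewrite geq_max => /andP[/HN + /HM]; rewrite lt_min => /andP[u1 ue] ve.
have -> : u n * v n - l * m = u n * (v n - m) + m * (u n - l) by ring.
have lem (s t : C) : absv s < A -> absv t < eps / A -> absv (s * t) < eps.
  move=> sA; rewrite ltr_pdivlMr // absvM; apply: le_lt_trans.
  by rewrite mulrC ler_wpM2l ?absv_ge0 // ltW.
have mA : absv m < A by rewrite ltr_pwDr // !le_max lexx !orbT.
apply: absvD_lt; apply: lem => //.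
rewrite -(subrK l (u n)); apply: le_lt_trans (_ : Num.max 1 (Num.max (absv l) (absv m)) < _).
  by apply: absvD_le; rewrite !le_max ?(ltW u1) ?lexx ?orbT.
by rewrite ltrDl.
Qed.

Lemma limto_seqC l : limto \oo (fun=> l : C) l.
Proof. by apply/limto_seqP => eps e0; exists 0%N => n _; rewrite subrr absv0. Qed.

Lemma limto_seqX (u : nat -> C) l k : limto \oo u l -> limto \oo (fun n => u n ^+ k) (l ^+ k).
Proof.
move=> ul; elim: k => [|k IHk]; first exact: limto_seqC.
have -> : (fun n => u n ^+ k.+1) = (fun n => u n * u n ^+ k) by apply/funext => n; rewrite exprS.
by rewrite exprS; apply: limto_seqM.
Qed.

Lemma limto_seqV (u : nat -> C) l : l != 0 -> limto \oo u l -> limto \oo (fun n => (u n)^-1) l^-1.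
Proof.
move=> l0 /limto_seqP ul; apply/limto_seqP => eps e0.
have al : 0 < absv l by rewrite absv_gt0.
have e1 : 0 < Num.min (absv l) (eps * absv l ^+ 2) by rewrite lt_min al mulr_gt0 // exprn_gt0.
have [N HN] := ul _ e1.
exists N => n /HN; rewrite lt_min => /andP[lt1 lt2].
have un : absv (u n) = absv l by rewrite -(subrK l (u n)) absvD_eqr.
have un0 : u n != 0 by rewrite -absv_gt0 un.
have -> : (u n)^-1 - l^-1 = - (u n - l) / (u n * l) by field; rewrite un0 l0.
by rewrite absvM absvV absvM absvN un -expr2 ltr_pdivrMr ?exprn_gt0.
Qed.

Lemma limto_seq_prod (I : Type) (r : seq I) (u : I -> nat -> C) (l : I -> C) :
  (forall i, limto \oo (u i) (l i)) ->
  limto \oo (fun n => \prod_(i <- r) u i n) (\prod_(i <- r) l i).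
Proof.
move=> H; elim: r => [|i r IHr].
  have -> : (fun n => \prod_(i <- [::]) u i n) = (fun=> 1) by apply/funext => n; rewrite big_nil.
  by rewrite big_nil; apply: limto_seqC.
have -> : (fun n => \prod_(j <- i :: r) u j n) = (fun n => u i n * \prod_(j <- r) u j n).
  by apply/funext => n; rewrite big_cons.
by rewrite big_cons; apply: limto_seqM.
Qed.

Lemma limto_seqS (u : nat -> C) l : limto \oo u l -> limto \oo (fun n => u n.+1) l.
Proof.
by move=> /limto_seqP ul; apply/limto_seqP => eps /ul[N HN]; exists N => n Nn; apply: HN; apply: leqW.
Qed.

Lemma eAD x y : eA (x + y) = eA x + eA y.
Proof.
apply: limto_seq_unique (EA_lim _) _.
have -> : (fun n => EA n (x + y)) = (fun n => EA n x + EA n y).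
  by apply/funext => n; rewrite (EA_lin n).
by apply: limto_seqD; apply: EA_lim.
Qed.

Lemma eAZ (c : F) x : eA (scal c * x) = scal c * eA x.
Proof.
apply: limto_seq_unique (EA_lim _) _.
have -> : (fun n => EA n (scal c * x)) = (fun n => scal c * EA n x).
  by apply/funext => n; rewrite (EA_lin n).
exact: limto_seqM (limto_seqC _) (EA_lim _).
Qed.

Lemma eA_0 : eA 0 = 0. Proof. by rewrite /eA mul0r. Qed.

Lemma eAN x : eA (- x) = - eA x.
Proof. by apply/eqP; rewrite -subr_eq0 opprK -eAD addNr eA_0. Qed.

Lemma eAB x y : eA (x - y) = eA x - eA y.
Proof. by rewrite eAD eAN. Qed.

Lemma eA_absv x n : absv x < q%:R ^+ n -> absv (eA x) = absv x * absv (tprod (yA x) (fpolys F n)).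
Proof.
move=> lt; have [l [Hl ->]] := eAP x; rewrite absvM; congr (_ * _).
apply: tprod_absv Hl _ => [|a an]; first exact: yA_null.
by apply: le_lt_trans (yA_small x an) _; rewrite ltr_pdivrMr ?absv_th_neq0 // mul1r.
Qed.

Lemma eA_small x : absv x < 1 -> absv (eA x) = absv x.
Proof.
move=> lt; rewrite (@eA_absv x 0) ?expr0 // /tprod big_fpolys big_seq1 yA0 addr0 absv1.
by rewrite mulr1.
Qed.

Lemma eA_eq0 x : eA x = 0 <-> exists a, x = evA a.
Proof.
split=> [E|[a ->]].
  have [n Hn] := ex_expq F (absv x + 1).
  have lt : absv x < q%:R ^+ n by rewrite (lt_le_trans _ Hn) // ltrDl.
  have := eA_absv lt; rewrite E absv0 => /esym/eqP; rewrite mulf_eq0 !absv_eq0.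
  case/orP => [/eqP->|]; first by exists 0; rewrite rmorph0.
  rewrite /tprod prodf_seq_eq0 => /hasP[a _ /=].
  have [->|a0] := eqVneq a 0; first by rewrite yA0 addr0 oner_eq0.
  move=> /eqP E'; exists (- a); apply: (mulIf (_ : (evA a)^-1 != 0)); rewrite ?invr_eq0 ?evA_eq0 //.
  rewrite rmorphN mulNr divff ?evA_eq0 //; apply/eqP; rewrite -addr_eq0 addrC.
  by apply/eqP.
have [->|a0] := eqVneq a 0; first by rewrite rmorph0 eA_0.
apply/eqP; rewrite -absv_eq0; have [n Hn] := ex_expq F (absv (evA a) + 1).
have lt : absv (evA a) < q%:R ^+ n by rewrite (lt_le_trans _ Hn) // ltrDl.
rewrite (eA_absv lt) mulf_eq0; apply/orP; right.
have an : - a \in polys F n by rewrite mem_polys size_polyN (@size_absv_lt _ R C).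
rewrite /tprod big_fpolys (bigD1_seq _ an (polys_uniq F n)) /= /yA rmorphN invrN mulrN.
by rewrite divff ?evA_eq0 // subrr mul0r absv0.
Qed.

Lemma eA_quad x : absv x < 1 -> absv (eA x - x) <= absv x * absv x.
Proof.
move=> lt; have [l [Hl ->]] := eAP x.
rewrite -{2}[x]mulr1 -mulrBr absvM ler_wpM2l ?absv_ge0 //.
have x01 : 0 <= absv x <= 1 by rewrite absv_ge0 ltW.
have := tprod_tail (S := fpolys F 0) x01 Hl; rewrite /tprod big_fpolys big_seq1 yA0 addr0 absv1 mul1r.
by apply=> a an; have := yA_small x an; rewrite expr0 divr1.
Qed.

Lemma perm_polysS n : perm_eq (polys F n.+1) [seq (c%:P + a * 'X)%R | c <- enum F, a <- polys F n].
Proof.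
have szX (a : {poly F}) (c : F) m : (size (c%:P + a * 'X)%R <= m.+1)%N = (size a <= m)%N.
  rewrite addrC -cons_poly_def size_cons_poly; case: nilP => [->|_] //=.
  by case: eqP.
apply: uniq_perm; first exact: polys_uniq.
  apply: allpairs_uniq; [exact: enum_uniq|exact: polys_uniq|].
  move=> [c a] [d b] /= _ _ E.
  have := congr1 (fun p : {poly F} => p`_0) E; rewrite /= !coefD !coefC !coefMX !eqxx !addr0 => cd.
  by move: E; rewrite cd => /addrI/(mulIf (negbT (polyX_eq0 F)))->.
move=> a; rewrite mem_polys; apply/idP/allpairsP => [sa|[[c b] [_ + ->]]]; last first.
  by rewrite /= mem_polys szX.
exists (a`_0, drop_poly 1 a); split; rewrite ?mem_enum //=.
  by rewrite mem_polys size_drop_poly; lia.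
rewrite -{1}(poly_take_drop 1 a) expr1; congr (_ + _).
by apply/polyP => i; rewrite coef_take_poly coefC; case: i.
Qed.

(** Polynomials of degree at most n are sorted by their constant term c. The class c = 0 gives the
    partial product at x, and every other class is a quotient of values of [psub], so that the
    product over c becomes one over F_q. *)
Lemma EA_th n x : EA n.+1 (th * x) = th * EA n x * (1 - (EA n x / EA n th^-1) ^+ (q - 1)).
Proof.
have t0 := th_neq0 C; set Z := 1 - _.
rewrite /EA /tprod big_fpolys (perm_big _ (perm_polysS n)) /= big_allpairs_dep big_enum /=.
rewrite (bigD1 (0 : F)) //= -!mulrA; congr (_ * (_ * _)).
have -> : \prod_(a <- polys F n) (1 + yA (th * x) (0%:P + a * 'X)) = \prod_(a <- fpolys F n) (1 + yA x a).
  rewrite big_fpolys; apply: eq_bigr => a _; rewrite /yA polyC0 add0r rmorphM /= evAX.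
  by rewrite invfM [th * x]mulrC mulrACA divff // mulr1.
congr (_ * _).
have Ec (c : F) : c != 0 -> \prod_(a <- polys F n) (1 + yA (th * x) (c%:P + a * 'X)) =
    1 - scal (- c^-1) * (EA n x / EA n th^-1).
  move=> c0; have sc0 : scal c != 0 by rewrite fmorph_eq0.
  have nz a : scal c / th + evA a != 0.
    apply/eqP => E; have : evA (c%:P + a * 'X) == 0.
      rewrite rmorphD rmorphM /= evAC evAX; have -> : scal c + evA a * th = (scal c / th + evA a) * th.
        by rewrite mulrDl divfK.
      by rewrite E mul0r.
    rewrite evA_eq0 => /eqP/(congr1 (fun p : {poly F} => p`_0)) /=.
    by rewrite coefD coefC coefMX eqxx addr0 coef0 => /eqP; rewrite (negPf c0).
  have -> : \prod_(a <- polys F n) (1 + yA (th * x) (c%:P + a * 'X)) =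
      psub n (x + scal c / th) / psub n (scal c / th).
    rewrite /psub -prodf_div; apply: eq_bigr => a _; rewrite /yA rmorphD rmorphM /= evAC evAX.
    have -> : scal c + evA a * th = (scal c / th + evA a) * th by rewrite mulrDl divfK.
    have nz' : scal c + evA a * th != 0.
      have -> : scal c + evA a * th = (scal c / th + evA a) * th by rewrite mulrDl divfK.
      by rewrite mulf_neq0.
    have := nz a; move: (scal c) (evA a) nz' => u v nz' nz1.
    by field; rewrite nz' t0.
  have p0 : psub n (scal c / th) != 0.
    by rewrite /psub prodf_seq_neq0; apply/allP => a _; apply: nz.
  rewrite psubD mulrDl divff // EA_ratio rmorphN fmorphV mulNr opprK addrC; congr (_ + _).
  by rewrite (EA_lin n) invfM mulrCA.
rewrite (eq_bigr (fun c => 1 - scal (- c^-1) * (EA n x / EA n th^-1))) => [|c c0]; last exact: Ec.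
transitivity (\prod_(c : F) (1 - scal c * (EA n x / EA n th^-1))); last first.
  by rewrite prod_scal expr1n mulr1 /Z.
rewrite [RHS](bigD1 (0 : F)) //= rmorph0 mul0r subr0 mul1r.
(* With 0^-1 = 0, the map c -> - c^-1 permutes F_q and fixes 0. *)
have injh : injective (fun c : F => - c^-1) by move=> c d /oppr_inj/invr_inj.
rewrite [RHS](reindex_inj injh) /=.
by apply: eq_bigl => c; rewrite oppr_eq0 invr_eq0.
Qed.

Lemma eA_thV_neq0 : eA th^-1 != 0.
Proof.
rewrite -absv_eq0 eA_small absvV absv_th ?invr_eq0 ?gt_eqF ?qR_gt0 //.
by rewrite invf_lt1 ?qR_gt0 ?qR_gt1.
Qed.

Lemma eA_th x : eA (th * x) = th * eA x - th * eA th^-1 ^- (q - 1) * eA x ^+ q.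
Proof.
have -> : th * eA x - th * eA th^-1 ^- (q - 1) * eA x ^+ q =
   th * eA x * (1 + -1 * (eA x * (eA th^-1)^-1) ^+ (q - 1)).
  move: (eA x) (eA th^-1) => X Y; rewrite exprMn exprVn.
  have -> : X ^+ q = X * X ^+ (q - 1) by rewrite -exprS subn1 prednK ?q_gt0.
  by move: (X ^+ _) (Y ^- _) => u v; ring.
apply: limto_seq_unique (limto_seqS (EA_lim (th * x))) _.
have -> : (fun n => EA n.+1 (th * x)) =
    (fun n => th * EA n x * (1 + -1 * (EA n x * (EA n th^-1)^-1) ^+ (q - 1))).
  by apply/funext => n; rewrite EA_th mulN1r.
apply: limto_seqM; first exact: limto_seqM (limto_seqC _) (EA_lim _).
apply: limto_seqD; first exact: limto_seqC.
apply: limto_seqM; first exact: limto_seqC.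
apply: limto_seqX; apply: limto_seqM; first exact: EA_lim.
by apply: limto_seqV; [exact: eA_thV_neq0|exact: EA_lim].
Qed.

End CarlitzExponential.

(** * The Carlitz exponential and its period *)

Section Period.
Variables (F : finFieldType) (R : realType) (C : valuedField F R).
Local Notation q := #|F|.
Local Notation th := (theta C).
Local Notation scal := (@vf_scal F R C).
Local Notation evA := (@evA F R C).
Local Notation bracket := (@bracket F R C).
Local Notation dcar := (@dcar F R C).
Implicit Types (x y l : C) (a b : {poly F}).

Lemma absv_bracket i : (0 < i)%N -> absv (bracket i) = q%:R ^+ (q ^ i).
Proof.
move=> i0; rewrite /Defs.bracket absvB_eql absvX absv_th //.
by rewrite -[X in X < _]expr1 ltr_eXn2l ?qR_gt1 // -(exp1n i) ltn_exp2r ?q_gt1.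
Qed.

Lemma dcarS i : dcar i.+1 = bracket i.+1 * dcar i ^+ q.
Proof.
rewrite /Defs.dcar big_ord_recl /= subn0 expr1 -prodrXl; congr (_ * _).
by apply: eq_bigr => j _; rewrite -exprM -expnSr /bump /= add1n subSS.
Qed.

Lemma absv_dcar i : absv (dcar i) = q%:R ^+ (i * q ^ i).
Proof.
elim: i => [|i IHi]; first by rewrite /Defs.dcar big_ord0 absv1.
rewrite dcarS absvM absvX absv_bracket // IHi -exprM -exprD; congr (_ ^+ _).
by rewrite expnSr -mulnA mulSn.
Qed.

Lemma dcar_neq0 i : dcar i != 0.
Proof. by rewrite -absv_eq0 absv_dcar gt_eqF ?absv_th_neq0. Qed.

Lemma eCar_term x i : x ^+ (q ^ i) / dcar i = x ^+ (q ^ i) * (dcar i)^-1. Proof. by []. Qed.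

Lemma leq_qexp i : (i <= q ^ i)%N.
Proof. by apply/ltnW/ltn_expl/q_gt1. Qed.

Lemma eCar_null x : nullseq (fun i => x ^+ (q ^ i) / dcar i).
Proof.
move=> eps e0; have h01 : 0 <= (2^-1 : R) < 1 by lra.
have [N0 HN0] := geom_small h01 ler01 e0.
have [N1 HN1] := ex_expq F (absv x * 2).
exists (N0 + N1)%N => n Nn; have Hn := HN0 n ltac:(lia).
rewrite absvM absvV absvX absv_dcar exprM -expr_div_n.
apply: le_lt_trans Hn; rewrite mul1r.
have le : absv x / q%:R ^+ n <= 2^-1.
  rewrite ler_pdivrMr ?absv_th_neq0 // mulrC ler_pdivlMr // (le_trans HN1) //.
  by rewrite ler_weXn2l ?(ltW (qR_gt1 F R)) //; lia.
apply: (le_trans (_ : _ <= 2^-1 ^+ (q ^ n))).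
  by rewrite lerXn2r ?nnegrE ?divr_ge0 ?absv_ge0 ?exprn_ge0 ?ler0n //; lra.
by rewrite ler_wiXn2l ?leq_qexp //; lra.
Qed.

Hypothesis Ccomp : Ccomplete C.

Lemma eCar_sum x : has_sum (fun i => x ^+ (q ^ i) / dcar i) (eCar x).
Proof.
by have [l Hl] := has_sum_ex Ccomp (@eCar_null x); rewrite /eCar (has_sum_Csum Hl).
Qed.

Lemma eCarD x y : eCar (x + y) = eCar x + eCar y.
Proof.
apply: has_sum_unique (eCar_sum _) _; apply: has_sum_ext (has_sumD (eCar_sum x) (eCar_sum y)).
by move=> i; rewrite FrobD mulrDl.
Qed.

Lemma eCar_th x : eCar (th * x) = th * eCar x + eCar x ^+ q.
Proof.
apply: has_sum_unique (eCar_sum _) _.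
apply: (@has_sum_ext _ _ _ (fun i => th * (x ^+ (q ^ i) / dcar i) +
   (if i is j.+1 then (x ^+ (q ^ j) / dcar j) ^+ q else 0))).
  case=> [|i]; first by rewrite !expr1 /Defs.dcar big_ord0 !divr1 addr0.
  rewrite expr_div_n -exprM -expnSr exprMn.
  have -> : th ^+ (q ^ i.+1) = th + bracket i.+1 by rewrite /Defs.bracket addrC subrK.
  have d1 : bracket i.+1 != 0 by rewrite -absv_eq0 absv_bracket // gt_eqF ?absv_th_neq0.
  have d2 := dcar_neq0 i.
  by rewrite dcarS; field; rewrite d1 expf_neq0.
apply: has_sumD; first exact/has_sumZ/eCar_sum.
rewrite -[_ ^+ _]add0r; apply: (@has_sumS _ _ _ (fun i => if i is j.+1 then (x ^+ (q ^ j) / dcar j) ^+ q else 0)).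
by have := has_sum_Frob 1 (eCar_sum x); rewrite expn1.
Qed.

Lemma eCar_quad x : absv x <= 1 -> absv (eCar x - x) <= absv x * absv x.
Proof.
move=> x1; have x0 := absv_ge0 x.
have := @has_sum_tail _ _ _ _ _ 1 (absv x * absv x) (eCar_sum x) (mulr_ge0 x0 x0).
rewrite big_ord_recl big_ord0 addr0 /= expr1 /Defs.dcar big_ord0 divr1; apply=> -[//|n] _.
rewrite absvM absvV absvX absv_dcar -expr2 ler_pdivrMr ?absv_th_neq0 //.
apply: (le_trans (_ : _ <= absv x ^+ 2)).
  rewrite ler_wiXn2l // (leq_trans (q_gt1 F)) // -[X in (X <= _)%N]expn1.
  by rewrite leq_pexp2l ?q_gt0.
by rewrite ler_peMr ?exprn_ge0 // exprn_ege1 // ltW ?qR_gt1.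
Qed.

Hypothesis Cclosed : GRing.closed_field_axiom C.

(** The scale [rho] is chosen so that rho e_A(x / rho) satisfies the functional equation of the
    Carlitz exponential. The difference satisfies the same additive equation and is quadratic at 0,
    so [contraction_zero] applies. *)
Lemma eCar_eA : exists2 rho : C, rho != 0 & forall x, eCar x = rho * eA (x / rho).
Proof.
have q1 : (0 < q - 1)%N by rewrite subn_gt0 q_gt1.
have [rho rhoE] := @Cclosed _ (fun i => if i == 0%N then - th * eA th^-1 ^- (q - 1) else 0) q1.
have {}rhoE : rho ^+ (q - 1) = - th * eA th^-1 ^- (q - 1).
  rewrite rhoE; case: (q - 1)%N q1 => // n _.
  by rewrite big_ord_recl /= expr0 mulr1 big1 ?addr0 // => i _; rewrite mul0r.
have r0 : rho != 0.
  apply/eqP => r0; move/esym/eqP: rhoE; rewrite r0 expr0n eqn0Ngt q1 /=.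
  by rewrite mulf_eq0 oppr_eq0 (negPf (th_neq0 C)) invr_eq0 expf_eq0 (negPf (eA_thV_neq0 Ccomp)) andbF.
exists rho => // x; apply/eqP; rewrite -subr_eq0; apply/eqP.
pose f y := eCar y - rho * eA (y / rho).
have fth y : f (th * y) = th * f y + f y ^+ q.
  rewrite /f eCar_th -mulrA (eA_th Ccomp).
  have := @FrobB F R C 1; rewrite expn1 => ->; rewrite [(rho * _) ^+ q]exprMn.
  have -> : rho ^+ q = rho * rho ^+ (q - 1) by rewrite -exprS subn1 prednK ?q_gt0.
  by rewrite rhoE; move: (eA _ ^- _) (eA (y / rho)) => u v; ring.
pose D n := f (x / th ^+ n).
have := @contraction_zero F R C D (fun y => th * y + y ^+ q) (absv x * absv x * (1 + (absv rho)^-1)) 1.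
rewrite /D /f expr0 divr1; apply.
- move=> n; rewrite -fth exprS; congr (f _).
  by rewrite invfM mulrCA [th * _]mulrA divff ?th_neq0 // mul1r.
- exact: ltr01.
- move=> y y1; apply: absvD_le; first by rewrite absvM absv_th.
  rewrite absvX (le_trans (_ : _ <= absv y)) //.
    by rewrite -[leRHS]expr1 ler_wiXn2l ?absv_ge0 ?q_gt0.
  by rewrite ler_peMl ?absv_ge0 // ltW ?qR_gt1.
have ar : 0 < absv rho by rewrite absv_gt0.
have [N1 HN1] := ex_expq F (absv x); have [N2 HN2] := ex_expq F (absv x / absv rho + 1).
exists (N1 + N2)%N => n Nn.
have leq (i : nat) : (i <= n)%N -> q%:R ^+ i <= q%:R ^+ n :> R by move=> ni; rewrite ler_weXn2l ?(ltW (qR_gt1 F R)).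
have y1 : absv (x / th ^+ n) <= 1.
  rewrite absvM absvV absvX absv_th ler_pdivrMr ?absv_th_neq0 // mul1r (le_trans HN1) // leq //; lia.
have y2 : absv (x / th ^+ n / rho) < 1.
  rewrite !absvM !absvV absvX absv_th mulrAC ltr_pdivrMr ?absv_th_neq0 // mul1r.
  apply: lt_le_trans (_ : q%:R ^+ N2 <= _); last by rewrite leq //; lia.
  by apply: lt_le_trans HN2; rewrite ltrDl.
set y := x / th ^+ n in y1 y2 *.
have yE : absv x * absv x * (q%:R ^- n * q%:R ^- n) = absv y * absv y.
  by rewrite /y absvM absvV absvX absv_th mulrACA.
have -> : eCar y - rho * eA (y / rho) = (eCar y - y) - rho * (eA (y / rho) - y / rho).
  by rewrite mulrBr [rho * (y / rho)]mulrC divfK //; ring.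
rewrite [leRHS]mulrAC yE; clearbody y.
apply: absvB_le.
  by rewrite (le_trans (eCar_quad y1)) // ler_peMr ?mulr_ge0 ?absv_ge0 // lerDl invr_ge0 ltW.
rewrite absvM (le_trans (ler_wpM2l (ltW ar) (eA_quad Ccomp y2))) // !absvM absvV.
rewrite (_ : absv rho * _ = absv y * absv y * (absv rho)^-1); last by field; rewrite gt_eqF.
by rewrite ler_wpM2l ?mulr_ge0 ?absv_ge0 // lerDr.
Qed.

Variable pi : C.
Hypothesis hpi : is_period pi.

(** [pi] and [rho] generate the same lattice, so they differ by a unit of A, that is, a constant of
    F_q, with which e_A commutes. *)
Lemma period_eA : pi != 0 /\ forall x, eCar (pi * x) = pi * eA x.
Proof.
have [rho r0 E] := eCar_eA.
have ker x : eCar x = 0 <-> exists a, x = rho * evA a.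
  rewrite E; split=> [/eqP|[a ->]].
    rewrite mulf_eq0 (negPf r0) /= => /eqP/(eA_eq0 Ccomp)[a xa].
    by exists a; rewrite -xa mulrC divfK.
  rewrite [rho * evA a]mulrC mulfK //.
  by rewrite (_ : eA (evA a) = 0) ?mulr0 //; apply/(eA_eq0 Ccomp); exists a.
have [a aE] : exists a, rho = pi * evA a.
  by apply/hpi/ker; exists 1; rewrite rmorph1 mulr1.
have [b bE] : exists b, pi = rho * evA b.
  by apply/ker/hpi; exists 1; rewrite rmorph1 mulr1.
have p0 : pi != 0 by apply: contra_neq r0 => p0; rewrite aE p0 mul0r.
split=> // x.
have ab : a * b = 1.
  apply: (@evA_inj F R C); rewrite rmorphM rmorph1; apply: (mulfI p0).
  by rewrite mulrA -aE mulr1 -bE.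
have sa : size a == 1%N.
  have := congr1 (fun p : {poly F} => size p) ab; rewrite size_poly1.
  have a0 : a != 0 by apply: contra_eq_neq ab => ->; rewrite mul0r eq_sym oner_neq0.
  have b0 : b != 0 by apply: contra_eq_neq ab => ->; rewrite mulr0 eq_sym oner_neq0.
  rewrite size_mul //; have : (0 < size a)%N by rewrite size_poly_gt0.
  have : (0 < size b)%N by rewrite size_poly_gt0.
  by move: (size a) (size b) => m n; lia.
have /size_poly1P[c c0 ac] := sa.
have sc0 : scal c != 0 by rewrite fmorph_eq0.
rewrite E aE ac evAC.
have -> : pi * x / (pi * scal c) = scal c^-1 * x by rewrite fmorphV; field; rewrite sc0 p0.
by rewrite (eAZ Ccomp) fmorphV; field.
Qed.

End Period.

(** * The lattice exponential e_z *)

Section LatticeExponential.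
Variables (F : finFieldType) (R : realType) (C : valuedField F R).
Local Notation q := #|F|.
Local Notation th := (theta C).
Local Notation scal := (@vf_scal F R C).
Local Notation evA := (@evA F R C).
Local Notation Omega := (Omega C).
Implicit Types (x y l k : C) (a b c d : {poly F}) (z w : Omega).

(** At the zero lattice element the convention 0^-1 = 0 makes the factor 1 + [ylat] equal to one, so
    the product runs over all indices. *)
Definition ylat z x (ab : {poly F} * {poly F}) : C := - (x / lattice_elt (sval z) ab).

Definition boxseq i j : seq ({poly F} * {poly F}) := [seq (a, b) | a <- polys F i, b <- polys F j].
Definition fbox i j : {fset {poly F} * {poly F}} := [fset p in boxseq i j]%fset.

Lemma boxseq_uniq i j : uniq (boxseq i j).
Proof. by apply: allpairs_uniq; rewrite ?polys_uniq // => -[? ?] [? ?]. Qed.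

Lemma in_fbox i j (p : {poly F} * {poly F}) : (p \in fbox i j) = (size p.1 <= i)%N && (size p.2 <= j)%N.
Proof.
rewrite inE; apply/allpairsP/andP => [[[a b] /= [+ + ->]]|[pI pJ]].
  by rewrite !mem_polys.
by exists p; split; rewrite ?mem_polys //; case: p {pI pJ}.
Qed.

Lemma big_fbox (V : Type) (idx : V) (op : Monoid.com_law idx) i j (f : {poly F} * {poly F} -> V) :
  \big[op/idx]_(p <- fbox i j) f p = \big[op/idx]_(p <- boxseq i j) f p.
Proof.
apply: perm_big; apply: uniq_perm; rewrite ?fset_uniq ?boxseq_uniq //.
by move=> p; rewrite inE.
Qed.

Lemma fbox_exhaust (S : {fset {poly F} * {poly F}}) :
  exists N, forall i j, (N <= i)%N -> (N <= j)%N -> (S `<=` fbox i j)%fset.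
Proof.
exists (\max_(p <- S) maxn (size p.1) (size p.2)) => i j Ni Nj; apply/fsubsetP => p pS.
have le : (maxn (size p.1) (size p.2) <= \max_(p <- S) maxn (size p.1) (size p.2))%N.
  by rewrite [X in (_ <= X)%N](big_rem p) //= leq_maxl.
by rewrite in_fbox (leq_trans (leq_maxl _ _) (leq_trans le Ni)) (leq_trans (leq_maxr _ _) (leq_trans le Nj)).
Qed.

Lemma lattice_box n N z p : affinoid n z -> p \notin fbox (N + n + n) (N + n) ->
  q%:R ^+ N <= absv (lattice_elt (sval z) p).
Proof.
move=> zn; rewrite in_fbox => np; rewrite leNgt; apply/negP => lt.
have [s1 s2] := lattice_small zn lt; by rewrite s1 s2 in np.
Qed.

Lemma lattice_elt_ge n z p : affinoid n z -> p != (0, 0) -> q%:R ^- n <= absv (lattice_elt (sval z) p).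
Proof.
case: p => a b zn n0; rewrite /lattice_elt /=.
have qn := absv_th_neq0 F R n.
have [b0|b0] := eqVneq b 0.
  rewrite b0 rmorph0 mul0r addr0 (@le_trans _ _ 1) ?(@absv_evA_ge1 F R C) //.
    by rewrite invf_le1 // exprn_ege1 // ltW ?qR_gt1.
  by apply: contra_neq n0 => ->; rewrite b0.
apply: le_trans (lattice_ge a b zn).
by rewrite ler_peMl ?invr_ge0 ?(ltW qn) //; apply: (@absv_evA_ge1 F R C).
Qed.

Lemma ylat_small n N z x p : affinoid n z -> p \notin fbox (N + n + n) (N + n) ->
  absv (ylat z x p) <= absv x / q%:R ^+ N.
Proof.
move=> zn np; have le := lattice_box zn np; rewrite absvN absvM absvV ler_wpM2l ?absv_ge0 //.
have qN := absv_th_neq0 F R N.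
by rewrite lef_pV2 ?posrE // (lt_le_trans qN).
Qed.

Lemma ylat_null z x : cofinite_null (ylat z x).
Proof.
have [n zn] := affinoid_ex z.
move=> eps e0; have [N HN] := ex_expq F ((absv x + 1) / eps).
exists (fbox (N + n + n) (N + n)) => p np; apply: le_lt_trans (ylat_small x zn np) _.
rewrite ltr_pdivrMr ?absv_th_neq0 // mulrC -ltr_pdivrMr // (lt_le_trans _ HN) //.
by rewrite ltr_pM2r ?invr_gt0 // ltrDl.
Qed.

Hypothesis Ccomp : Ccomplete C.

Lemma eLatP z x : exists l, limto summability.totally (tprod (ylat z x)) l /\ eLat z x = x * l.
Proof.
have ex := tprod_ex Ccomp (@ylat_null z x).
rewrite /eLat.
have -> : (fun S : {fset {poly F} * {poly F}} =>
       \prod_(ab <- S | lattice_elt (sval z) ab != 0) (1 - x / lattice_elt (sval z) ab)) = tprod (ylat z x).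
  apply/funext => S; rewrite /tprod big_mkcond /=; apply: eq_bigr => p _; rewrite /ylat.
  by case: eqP => //= ->; rewrite invr0 mulr0 subr0.
have H := xgetPex 0 ex.
by exists (xget 0 [set l | limto summability.totally (tprod (ylat z x)) l]).
Qed.

Lemma eLat0 z : eLat z 0 = 0. Proof. by rewrite /eLat mul0r. Qed.

Lemma eLat_quad n z x : affinoid n z -> absv x * q%:R ^+ n <= 1 ->
  absv (eLat z x - x) <= absv x * absv x * q%:R ^+ n.
Proof.
move=> zn x1; have [l [Hl ->]] := eLatP z x.
have qn := absv_th_neq0 F R n.
rewrite -{2}[x]mulr1 -mulrBr absvM -mulrA ler_wpM2l ?absv_ge0 //.
have e01 : 0 <= absv x * q%:R ^+ n <= 1 by rewrite x1 mulr_ge0 ?absv_ge0 ?ltW.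
have := @tprod_tail _ _ _ _ _ fset0 _ _ e01 Hl.
rewrite /tprod big_seq_fset0 absv1 mul1r; apply=> p _.
rewrite absvN absvM absvV ler_wpM2l ?absv_ge0 //.
have [->|p0] := eqVneq p (0, 0).
  by rewrite /lattice_elt rmorph0 mul0r addr0 absv0 invr0 ltW.
have le := lattice_elt_ge zn p0.
have qi : 0 < q%:R ^- n :> R by rewrite invr_gt0.
by rewrite -[leRHS]invrK lef_pV2 ?posrE // (lt_le_trans qi).
Qed.

Lemma eLat_absv n N z x : affinoid n z -> absv x < q%:R ^+ N ->
  absv (eLat z x) = absv x * absv (tprod (ylat z x) (fbox (N + n + n) (N + n))).
Proof.
move=> zn lt; have [l [Hl ->]] := eLatP z x; rewrite absvM; congr (_ * _).
apply: tprod_absv Hl _ => [|p np]; first exact: ylat_null.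
by apply: le_lt_trans (ylat_small x zn np) _; rewrite ltr_pdivrMr ?absv_th_neq0 // mul1r.
Qed.

Lemma lattice_elt0 z p : (lattice_elt (sval z) p == 0) = (p == (0, 0)).
Proof. by case: p => a b; rewrite /lattice_elt lattice_eq0 xpair_eqE. Qed.

Lemma eLat_eq0 z x : eLat z x = 0 <-> exists a b, x = evA a + evA b * sval z.
Proof.
have [n zn] := affinoid_ex z; split=> [E|[a [b xE]]].
  have [N HN] := ex_expq F (absv x + 1).
  have lt : absv x < q%:R ^+ N by rewrite (lt_le_trans _ HN) // ltrDl.
  have := eLat_absv zn lt; rewrite E absv0 => /esym/eqP; rewrite mulf_eq0 !absv_eq0.
  case/orP => [/eqP->|]; first by exists 0, 0; rewrite !rmorph0 mul0r addr0.
  rewrite /tprod prodf_seq_eq0 => /hasP[p _ /=].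
  have [->|p0] := eqVneq p (0, 0).
    by rewrite /ylat /lattice_elt rmorph0 mul0r addr0 invr0 mulr0 subr0 oner_eq0.
  have l0 : lattice_elt (sval z) p != 0 by rewrite lattice_elt0.
  rewrite subr_eq0 eq_sym -(inj_eq (mulIf l0)) divfK // mul1r => /eqP->.
  by exists p.1, p.2.
have [->|x0] := eqVneq x 0; first exact: eLat0.
have p0 : (a, b) != (0, 0).
  by apply: contra_neq x0 => -[a0 b0]; rewrite xE a0 b0 !rmorph0 mul0r addr0.
have [l [Hl ->]] := eLatP z x.
have [N HN] := fbox_exhaust [fset (a, b)]%fset.
suff -> : l = 0 by rewrite mulr0.
apply: limto_tot_unique Hl _; apply/limto_totP => eps e0; exists [fset (a, b)]%fset => S /fsubsetP sub.
rewrite subr0 /tprod (big_rem (a, b)) /=; last by apply: sub; rewrite inE.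
have -> : ylat z x (a, b) = -1.
  by rewrite /ylat /lattice_elt /= -xE divff.
by rewrite subrr mul0r absv0.
Qed.

Lemma tprod_bij (T : choiceType) (y : T -> C) (h : T -> T) l : bijective h ->
  limto summability.totally (tprod y) l -> limto summability.totally (tprod (y \o h)) l.
Proof.
move=> [h' hK h'K] /limto_totP yl; apply/limto_totP => eps /yl[S0 HS0].
exists [fset h' i | i in S0]%fset => S sub.
have -> : tprod (y \o h) S = tprod y [fset h i | i in S]%fset.
  by rewrite /tprod big_imfset //= => i j _ _; apply: can_inj hK i j.
apply: HS0; apply/fsubsetP => i iS; apply/imfsetP; exists (h' i); rewrite ?h'K //=.
by move/fsubsetP: sub; apply; apply/imfsetP; exists i.
Qed.

(** The lattice of w is that of z divided by J. The change of basis permutes the index set A x A,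
    and an unordered product is insensitive to permutations. *)
Lemma eLat_moebius (gam : 'M[{poly F}]_2) z w x : gam \in unitmx -> moebius_rel gam z w ->
  eLat w x = (autJ gam z)^-1 * eLat z (autJ gam z * x).
Proof.
move=> ug gzw; set J := autJ gam z.
have detE := det_mx22 gam.
have ud : \det gam \is a GRing.unit by rewrite -unitmxE.
have J0 : J != 0.
  rewrite /J /autJ addrC lattice_eq0; apply: contraL ud => /andP[/eqP E1 /eqP E2].
  by rewrite detE E1 E2 !mulr0 subrr unitr0.
have [l [Hl ->]] := eLatP z (J * x); have [m [Hm ->]] := eLatP w x.
rewrite !mulrA mulVf // mul1r; congr (_ * _).
pose h (p : {poly F} * {poly F}) := (p.1 * gam 1 1 + p.2 * gam 0 1, p.1 * gam 1 0 + p.2 * gam 0 0).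
pose D := (\det gam)^-1.
pose h' (p : {poly F} * {poly F}) :=
  (D * (p.1 * gam 0 0 - p.2 * gam 0 1), D * (p.2 * gam 1 1 - p.1 * gam 1 0)).
have DE : D * (gam 0 0 * gam 1 1 - gam 0 1 * gam 1 0) = 1 by rewrite -detE mulVr.
have bh : bijective h.
  exists h' => -[a b]; rewrite /h /h' /=; congr (_, _).
  - by transitivity (D * (gam 0 0 * gam 1 1 - gam 0 1 * gam 1 0) * a); [ring|rewrite DE mul1r].
  - by transitivity (D * (gam 0 0 * gam 1 1 - gam 0 1 * gam 1 0) * b); [ring|rewrite DE mul1r].
  - by transitivity (D * (gam 0 0 * gam 1 1 - gam 0 1 * gam 1 0) * a); [ring|rewrite DE mul1r].
  - by transitivity (D * (gam 0 0 * gam 1 1 - gam 0 1 * gam 1 0) * b); [ring|rewrite DE mul1r].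
have := tprod_bij bh Hl; have -> : ylat z (J * x) \o h = ylat w x.
  apply/funext => -[a b]; rewrite /= /ylat /lattice_elt /= gzw; congr (- _).
  rewrite -/J !rmorphD !rmorphM /=.
  have -> : evA a * evA (gam 1 1) + evA b * evA (gam 0 1) +
    (evA a * evA (gam 1 0) + evA b * evA (gam 0 0)) * sval z =
    J * (evA a + evA b * ((evA (gam 0 0) * sval z + evA (gam 0 1)) / J)).
    have -> : J * (evA a + evA b * ((evA (gam 0 0) * sval z + evA (gam 0 1)) / J)) =
      evA a * J + evA b * (evA (gam 0 0) * sval z + evA (gam 0 1)) by field.
    by rewrite /J /autJ; ring.
  by rewrite invfM mulrACA divff // mul1r.
by move=> H; apply: limto_tot_unique Hm H.
Qed.

Lemma eLat_bound n N z x : affinoid n z -> absv x < q%:R ^+ N ->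
  absv (eLat z x) <= absv x * (q%:R ^+ (N + n)) ^+ size (boxseq (N + n + n) (N + n)).
Proof.
move=> zn lt; rewrite (eLat_absv zn lt) ler_wpM2l ?absv_ge0 // /tprod big_fbox absv_prod.
have q1 : 1 <= q%:R ^+ (N + n) :> R by rewrite exprn_ege1 // ltW ?qR_gt1.
elim: (boxseq _ _) => [|p r IHr]; first by rewrite big_nil.
rewrite big_cons exprS ler_pM ?absv_ge0 ?prodr_ge0 // => [i _|]; first exact: absv_ge0.
apply: absvD_le; rewrite ?absv1 // absvN absvM absvV exprD.
have [->|p0] := eqVneq p (0, 0).
  by rewrite /lattice_elt rmorph0 mul0r addr0 absv0 invr0 mulr0 -exprD (le_trans ler01).
have le := lattice_elt_ge zn p0.
have qn : 0 < q%:R ^- n :> R by rewrite invr_gt0 absv_th_neq0.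
have lp : 0 < absv (lattice_elt (sval z) p) by apply: lt_le_trans le.
apply: ler_pM; rewrite ?absv_ge0 ?invr_ge0 ?absv_ge0 ?(ltW lt) //.
by rewrite -[leRHS]invrK lef_pV2 ?posrE ?invr_gt0 ?absv_th_neq0.
Qed.

(** The finite box that determines |e_z(x)| depends only on n and N, and each of its factors is at
    least min(1, d / q^K). *)
Lemma eLat_lower n N (d : R) : 0 < d -> exists2 e : R, 0 < e & forall z x, affinoid n z ->
  absv x < q%:R ^+ N -> (forall a b, d <= absv (x - (evA a + evA b * sval z))) ->
  absv x * e <= absv (eLat z x).
Proof.
move=> d0; set K := (N + n + n + n)%N.
have qK := absv_th_neq0 F R K.
pose e := Num.min 1 (d / q%:R ^+ K).
have e0 : 0 < e by rewrite lt_min ltr01 divr_gt0.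
exists (e ^+ size (boxseq (N + n + n) (N + n))); first by rewrite exprn_gt0.
move=> z x zn lt far; rewrite (eLat_absv zn lt) ler_wpM2l ?absv_ge0 // /tprod big_fbox absv_prod.
apply: prod_ge_exp => [|[a b] abb]; first exact: ltW.
have [->|p0] := eqVneq (a, b) (0, 0).
  by rewrite /ylat /lattice_elt rmorph0 mul0r addr0 invr0 mulr0 subr0 absv1 ge_min lexx.
have l0 : lattice_elt (sval z) (a, b) != 0 by rewrite lattice_elt0.
rewrite /ylat.
have -> : 1 - x / lattice_elt (sval z) (a, b) = - (x - lattice_elt (sval z) (a, b)) / lattice_elt (sval z) (a, b).
  by field.
rewrite absvM absvN absvV ge_min; apply/orP; right.
apply: ler_pM; rewrite ?invr_ge0 ?(ltW d0) ?(ltW qK) // ?far //.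
have al : 0 < absv (lattice_elt (sval z) (a, b)) by rewrite absv_gt0.
rewrite lef_pV2 ?posrE //.
move: abb; rewrite -[_ \in _]/((a, b) \in boxseq _ _).
have -> : ((a, b) \in boxseq (N + n + n) (N + n)) = ((a, b) \in fbox (N + n + n) (N + n)) by rewrite inE.
rewrite in_fbox /= => /andP[sa sb].
have qle (i : nat) : (i <= K)%N -> q%:R ^+ i <= q%:R ^+ K :> R.
  by move=> iK; rewrite ler_weXn2l ?(ltW (qR_gt1 F R)).
apply: absvD_le.
  by rewrite (le_trans (ltW (absv_evA_lt C sa))) // qle // /K; lia.
rewrite absvM (le_trans (ler_pM (absv_ge0 _) (absv_ge0 _) (ltW (absv_evA_lt C sb)) zn.1)) //.
by rewrite -exprD qle // /K; lia.
Qed.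

(** The product is grouped into columns of fixed b. A column of finite height N is a quotient of
    values of [psub], and N -> infinity at fixed m turns it into 1 - e_A(x) / e_A(b z). This is the
    source of all u-expansions. *)
Lemma eLat_column z x : limto \oo (fun m => eA x *
  \prod_(b <- polys F m | b != 0) (1 - eA x / eA (evA b * sval z))) (eLat z x).
Proof.
have [l [Hl lE]] := eLatP z x.
have nz b : b != 0 -> eA (evA b * sval z) != 0.
  move=> b0; apply/eqP => /(eA_eq0 Ccomp)[a aE].
  have := lattice_eq0 z (- a) b; rewrite rmorphN aE addNr eqxx (negPf b0) andbF; discriminate.
have fin N m : (0 < m)%N -> x * tprod (ylat z x) (fbox N m) =
    EA N x * \prod_(b <- polys F m | b != 0) (1 - EA N x / EA N (evA b * sval z)).
  move=> m0; rewrite /tprod big_fbox big_allpairs_dep exchange_big /=.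
  have p0 : 0 \in polys F m by rewrite mem_polys size_poly0.
  rewrite (bigD1_seq 0) ?polys_uniq //= mulrA; congr (_ * _).
    have -> : \prod_(a <- polys F N) (1 + ylat z x (a, 0)) = tprod (yA (- x)) (fpolys F N).
      rewrite /tprod big_fpolys; apply: eq_bigr => a _; rewrite /ylat /yA /lattice_elt /=.
      by rewrite rmorph0 mul0r addr0 mulNr.
    have := (EA_lin C N).2 (-1) x; rewrite rmorphN1 !mulN1r => E.
    by apply: oppr_inj; rewrite -E /EA mulNr.
  rewrite big_seq_cond [RHS]big_seq_cond; apply: eq_bigr => b /andP[_ b0].
  have nzb a : evA b * sval z + evA a != 0 by rewrite addrC lattice_eq0 (negPf b0) andbF.
  transitivity (psub N (evA b * sval z - x) / psub N (evA b * sval z)).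
    rewrite /psub -prodf_div; apply: eq_bigr => a _; rewrite /ylat /lattice_elt /=.
    have nz2 := nzb a; have := nz2; rewrite addrC; move: nz2; move: (evA b * sval z) (evA a) => u v n1 n2.
    by field; rewrite ?n1 ?n2.
  have p1 : psub N (evA b * sval z) != 0.
    by rewrite /psub prodf_seq_neq0; apply/allP => a _; apply: nzb.
  by rewrite psubB mulrBl divff // EA_ratio.
apply/limto_seqP => eps e0.
have [x0|x0] := eqVneq x 0.
  exists 0%N => m _; rewrite x0 eA_0 mul0r eLat0 subrr absv0 //.
have ax : 0 < absv x by rewrite absv_gt0.
have e20 : 0 < eps / 2 / absv x by rewrite !divr_gt0.
have [S0 HS0] := (limto_totP _ _).1 Hl _ e20; have [N0 HN0] := fbox_exhaust S0.
exists N0.+1 => m N0m.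
have : limto \oo (fun N => x * tprod (ylat z x) (fbox N m))
    (eA x * \prod_(b <- polys F m | b != 0) (1 - eA x / eA (evA b * sval z))).
  have -> : (fun N => x * tprod (ylat z x) (fbox N m)) = (fun N => EA N x *
     \prod_(b <- [seq b <- polys F m | b != 0]) (1 - EA N x / EA N (evA b * sval z))).
    by apply/funext => N; rewrite fin ?big_filter //; lia.
  rewrite -big_filter; apply: limto_seqM; first exact: EA_lim.
  have -> : \prod_(b <- [seq b <- polys F m | b != 0]) (1 - eA x / eA (evA b * sval z)) =
     \prod_(b <- [seq b <- polys F m | b != 0]) (if b != 0 then 1 + -1 * (eA x * (eA (evA b * sval z))^-1) else 0).
    by rewrite !big_filter; apply: eq_bigr => b b0; rewrite b0 mulN1r.
  have -> : (fun N => \prod_(b <- [seq b <- polys F m | b != 0]) (1 - EA N x / EA N (evA b * sval z))) =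
     (fun N => \prod_(b <- [seq b <- polys F m | b != 0]) (if b != 0 then 1 + -1 * (EA N x * (EA N (evA b * sval z))^-1) else 0)).
    by apply/funext => N; rewrite !big_filter; apply: eq_bigr => b b0; rewrite b0 mulN1r.
  apply: (@limto_seq_prod _ _ _ _ _ (fun b N => if b != 0 then 1 + -1 * (EA N x * (EA N (evA b * sval z))^-1) else 0)
    (fun b => if b != 0 then 1 + -1 * (eA x * (eA (evA b * sval z))^-1) else 0)) => b.
  case: eqP => [_|/eqP b0] /=; first exact: limto_seqC.
  apply: limto_seqD (limto_seqC _) (limto_seqM (limto_seqC _) (limto_seqM (EA_lim Ccomp _) _)).
  by apply: limto_seqV (nz b b0) (EA_lim Ccomp _).
move=> /limto_seqP/(_ _ (divr_gt0 e0 (ltr0n _ 2)))[N1 HN1].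
have H1 := HN1 (N0 + N1)%N (leq_addl _ _).
set u := eA x * _ in H1 *; set v := x * tprod _ _ in H1.
have -> : u - eLat z x = (v - eLat z x) - (v - u) by ring.
apply: absvB_lt; last by apply: lt_trans H1 _; lra.
rewrite lE /v -mulrBr absvM mulrC -ltr_pdivlMr //.
have := HS0 _ (HN0 (N0 + N1)%N m (leq_addr _ _) (ltnW N0m)); move/lt_trans; apply.
by rewrite ltr_pM2r ?invr_gt0 //; lra.
Qed.

End LatticeExponential.

(** * Analytic dependence of e_z on z *)

Section LatticeHolomorphy.
Variables (F : finFieldType) (R : realType) (C : valuedField F R).
Local Notation q := #|F|.
Local Notation th := (theta C).
Local Notation scal := (@vf_scal F R C).
Local Notation evA := (@evA F R C).
Local Notation Omega := (Omega C).
Implicit Types (x y l k : C) (a b c d : {poly F}) (z w : Omega).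
Hypothesis Ccomp : Ccomplete C.
Hypothesis Cclosed : GRing.closed_field_axiom C.

Lemma hol_ylat al be p : holomorphic (fun z => 1 + ylat z (al + be * sval z) p).
Proof.
apply: holD; first exact: hol_const.
have [->|p0] := eqVneq p (0, 0).
  apply: hol_ext (hol_const 0) => z.
  by rewrite /ylat /lattice_elt rmorph0 mul0r addr0 invr0 mulr0 oppr0.
apply: holN => //; apply: holM => //.
  by apply: holD; [exact: hol_const|apply: holZ => //; apply: hol_id].
apply: holV => [|n].
  by apply: holD; [exact: hol_const|apply: holZ => //; apply: hol_id].
exists (q%:R ^- n); first by rewrite invr_gt0 absv_th_neq0.
by move=> z zn; apply: lattice_elt_ge.
Qed.

(** An argument affine in z covers both e_z(1 / theta^i) and e_z(z / theta^i). Over an affinoid the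
    tails of the product are uniformly small, so finite products approximate. *)
Lemma hol_eLat al be : holomorphic (fun z => eLat z (al + be * sval z)).
Proof.
apply: hol_lim => n eps e0.
have [N HN] : exists N, forall z, affinoid n z -> absv (al + be * sval z) < q%:R ^+ N.
  have [N HN] := ex_expq F (Num.max (absv al) (absv be * q%:R ^+ n) + 1).
  exists N => z [zn _]; apply: lt_le_trans HN.
  apply: le_lt_trans (_ : _ <= Num.max (absv al) (absv be * q%:R ^+ n)) _; last by rewrite ltrDl.
  apply: absvD_le; rewrite le_max ?lexx // absvM; apply/orP; right.
  by rewrite ler_wpM2l ?absv_ge0.
pose B : R := q%:R ^+ N * (q%:R ^+ (N + n)) ^+ size (boxseq F (N + n + n) (N + n)).
have B0 : 0 <= B by rewrite mulr_ge0 ?exprn_ge0 ?ler0n.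
have [N1 HN1] := ex_expq F ((B * q%:R ^+ N + 1) / eps).
pose N' := (N + N1)%N.
exists (fun z => (al + be * sval z) * tprod (ylat z (al + be * sval z)) (fbox F (N' + n + n) (N' + n))).
  apply: holM => //; first by apply: holD; [exact: hol_const|apply: holZ => //; apply: hol_id].
  by apply: hol_prod => // p _; apply: hol_ylat.
move=> z zn; have xN := HN z zn; set x := al + be * sval z in xN *.
have xN' : absv x < q%:R ^+ N'.
  by rewrite (lt_le_trans xN) // ler_weXn2l ?(ltW (qR_gt1 F R)) // leq_addr.
have [l [Hl lE]] := eLatP Ccomp z x.
have e01 : 0 <= absv x / q%:R ^+ N' <= 1.
  by rewrite divr_ge0 ?absv_ge0 ?exprn_ge0 ?ler0n //= ler_pdivrMr ?absv_th_neq0 // mul1r ltW.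
have := tprod_tail e01 Hl (fun p => @ylat_small F R C n N' z x p zn).
rewrite lE -mulrBr absvM => le.
apply: le_lt_trans (ler_wpM2l (absv_ge0 x) le) _.
rewrite (mulrA (absv x)) -(eLat_absv Ccomp zn xN') mulrA ltr_pdivrMr ?absv_th_neq0 //.
apply: le_lt_trans (_ : _ <= B * q%:R ^+ N) _.
  apply: ler_pM; rewrite ?absv_ge0 ?(ltW xN) //.
  apply: le_trans (eLat_bound Ccomp zn xN) _.
  by rewrite ler_wpM2r ?exprn_ge0 ?ler0n // ltW.
rewrite [ltRHS]mulrC -ltr_pdivrMr //.
apply: (@lt_le_trans _ _ ((B * q%:R ^+ N + 1) / eps)).
  by rewrite ltr_pM2r ?invr_gt0 // ltrDl.
by rewrite (le_trans HN1) // ler_weXn2l ?(ltW (qR_gt1 F R)) // leq_addl.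
Qed.

(** A nonzero theta-torsion point keeps away from the lattice: theta times the difference is a
    lattice element with coefficients congruent to d and c modulo theta, hence nonzero. *)
Lemma eLat_torsion_lower n (c d : F) : (c, d) != (0, 0) -> exists2 e : R, 0 < e &
  forall z, affinoid n z -> e <= absv (eLat z ((scal c * sval z + scal d) / th)).
Proof.
move=> cd0; have qn := absv_th_neq0 F R n.
have dpos : 0 < q%:R ^- n / q%:R :> R by rewrite divr_gt0 ?invr_gt0 ?qR_gt0.
have [e e0 He] := @eLat_lower F R C Ccomp n n.+1 _ dpos.
exists (q%:R ^- n / q%:R * e); first by rewrite mulr_gt0.
move=> z zn; set x := _ / th.
have far a b : q%:R ^- n / q%:R <= absv (x - (evA a + evA b * sval z)).
  have -> : x - (evA a + evA b * sval z) =
     lattice_elt (sval z) (d%:P - 'X * a, c%:P - 'X * b) / th.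
    rewrite /lattice_elt /= !rmorphB !rmorphM /= !evAC evAX /x.
    by field; rewrite th_neq0.
  rewrite absvM absvV absv_th ler_wpM2r ?invr_ge0 ?ler0n //.
  apply: lattice_elt_ge => //; apply: contra_neq cd0 => -[E1 E2].
  have := congr1 (fun p : {poly F} => p`_0) E1; have := congr1 (fun p : {poly F} => p`_0) E2.
  by rewrite /= !coefB !coefC !coefXM eqxx !subr0 ?coef0 => -> ->.
have qx : q%:R ^- n / q%:R <= absv x by have := far 0 0; rewrite !rmorph0 mul0r addr0 subr0.
have xn : absv x < q%:R ^+ n.+1.
  rewrite /x absvM absvV absv_th ltr_pdivrMr ?qR_gt0 // -exprSr.
  have q1 : 1 <= q%:R ^+ n :> R by rewrite exprn_ege1 // ltW ?qR_gt1.
  apply: le_lt_trans (_ : q%:R ^+ n < _); last by rewrite ltr_eXn2l ?qR_gt1.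
  apply: absvD_le; last by rewrite (le_trans (absv_scal_le1 _ _)).
  rewrite absvM -[leRHS]mul1r ler_pM ?absv_ge0 ?absv_scal_le1 //; by case: zn.
apply: le_trans (He z x zn xn far).
by rewrite ler_pM2r.
Qed.

End LatticeHolomorphy.

(** * The Drinfeld module, the series s_1, s_2 and their Moore determinants *)

Section DrinfeldModule.
Variables (F : finFieldType) (R : realType) (C : valuedField F R).
Local Notation q := #|F|.
Local Notation th := (theta C).
Local Notation scal := (@vf_scal F R C).
Local Notation evA := (@evA F R C).
Local Notation Omega := (Omega C).
Local Notation bar := (@bar F R C).
Local Notation s1 := (@s1 F R C).
Local Notation s2 := (@s2 F R C).
Implicit Types (x y l k : C) (a b c d : {poly F}) (z w : Omega).
Hypothesis Ccomp : Ccomplete C.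
Hypothesis Cclosed : GRing.closed_field_axiom C.
Variables (pi : C) (g Delta : Omega -> C).
Hypothesis hg : is_g_Delta pi g Delta.

Definition gG z := pi ^+ (q - 1) * g z.
Definition gD z := pi ^+ (q ^ 2 - 1) * Delta z.
Definition Phi z y := th * y + gG z * y ^+ q + gD z * y ^+ (q ^ 2).

Lemma eLat_th z x : eLat z (th * x) = Phi z (eLat z x).
Proof. exact: hg. Qed.

Lemma PhiD z x y : Phi z (x + y) = Phi z x + Phi z y.
Proof. by rewrite /Phi FrobqD FrobD; ring. Qed.

Lemma PhiZ z (c : F) x : Phi z (scal c * x) = scal c * Phi z x.
Proof. by rewrite /Phi !exprMn scal_Frob scal_Frobq; ring. Qed.

Lemma Phi_sum z (r : seq (F * C)) (f : F * C -> C) :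
  Phi z (\sum_(p <- r) scal p.1 * f p) = \sum_(p <- r) scal p.1 * Phi z (f p).
Proof.
elim: r => [|p r IHr]; last by rewrite !big_cons PhiD PhiZ IHr.
by rewrite !big_nil /Phi !expr0n eqn0Ngt q_gt0 eqn0Ngt expn_gt0 q_gt0 !mulr0 !addr0.
Qed.

Lemma Phi_small z : exists2 eta : R, 0 < eta & forall y, absv y <= eta -> absv (Phi z y) <= q%:R * absv y.
Proof.
set A := absv (gG z) + absv (gD z) + 1.
have A0 : 0 < A by rewrite ltr_wpDl // addr_ge0 ?absv_ge0.
exists (Num.min 1 (q%:R / A)); first by rewrite lt_min ltr01 divr_gt0 ?qR_gt0.
move=> y; rewrite le_min => /andP[y1 yA].
have key (u : C) (k : nat) : absv u <= A -> (1 < k)%N -> absv (u * y ^+ k) <= q%:R * absv y.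
  move=> uA k1; rewrite absvM absvX -(subnK k1) addn2 !exprS mulrCA [q%:R * _]mulrC.
  rewrite ler_wpM2l ?absv_ge0 // (le_trans (_ : _ <= A * absv y)) //; last first.
    by rewrite mulrC -ler_pdivlMr.
  apply: ler_pM; rewrite ?absv_ge0 ?mulr_ge0 ?exprn_ge0 ?absv_ge0 //.
  by rewrite ler_piMr ?absv_ge0 // exprn_ile1 ?absv_ge0.
have q2 : (1 < q ^ 2)%N by rewrite -(expn0 q) ltn_exp2l ?q_gt1.
apply: absvD_le; first apply: absvD_le.
- by rewrite absvM absv_th.
- by apply: key (q_gt1 F); rewrite /A -addrA lerDl addr_ge0 ?absv_ge0.
- by apply: key q2; rewrite /A addrAC lerDr addr_ge0 ?absv_ge0.
Qed.

(* Both sides are compatible with Phi, so a relation sum c_i x_i = 0 can be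
   tested after division by a large power of th, where e_z is nearly the identity. *)
Lemma eLat_rel z (r : seq (F * C)) : \sum_(p <- r) scal p.1 * p.2 = 0 ->
  \sum_(p <- r) scal p.1 * eLat z p.2 = 0.
Proof.
move=> r0; have [eta eta0 He] := Phi_small z.
have [n0 zn0] := affinoid_ex z.
pose X : R := \sum_(p <- r) absv p.2.
have X0 : 0 <= X by apply: sumr_ge0 => p _; apply: absv_ge0.
have rX p : p \in r -> absv p.2 <= X.
  by move=> pr; rewrite /X (big_rem p) //= lerDl sumr_ge0 // => i _; apply: absv_ge0.
pose D n := \sum_(p <- r) scal p.1 * eLat z (p.2 / th ^+ n).
have := @contraction_zero F R C D (Phi z) (X * X * q%:R ^+ n0) eta _ eta0 He.
rewrite /D => H; rewrite -[RHS]H.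
- by apply: eq_bigr => p _; rewrite expr0 divr1.
- move=> n; rewrite Phi_sum; apply: eq_bigr => p _; rewrite -eLat_th exprS; congr (_ * eLat z _).
  by rewrite invfM mulrCA [th * _]mulrA divff ?th_neq0 // mul1r.
have [N HN] := ex_expq F (X * q%:R ^+ n0); exists N => n Nn.
have -> : \sum_(p <- r) scal p.1 * eLat z (p.2 / th ^+ n) =
   \sum_(p <- r) scal p.1 * (eLat z (p.2 / th ^+ n) - p.2 / th ^+ n).
  rewrite [RHS](eq_bigr (fun p => scal p.1 * eLat z (p.2 / th ^+ n) - scal p.1 * p.2 / th ^+ n)).
    by rewrite sumrB -mulr_suml r0 mul0r subr0.
  by move=> p _; rewrite mulrBr [scal p.1 * (p.2 * _)]mulrA.
have qn := absv_th_neq0 F R n; have qn0 := absv_th_neq0 F R n0.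
rewrite big_seq; apply: absv_sum_le => [|p pr].
  by rewrite !mulr_ge0 ?invr_ge0 ?exprn_ge0 ?ler0n.
rewrite absvM -[leRHS]mul1r ler_pM ?absv_ge0 ?absv_scal_le1 //.
have px : absv (p.2 / th ^+ n) <= X / q%:R ^+ n.
  by rewrite absvM absvV absvX absv_th ler_wpM2r ?invr_ge0 ?(ltW qn) // rX.
apply: le_trans (eLat_quad Ccomp zn0 _) _.
  apply: le_trans (_ : X / q%:R ^+ n * q%:R ^+ n0 <= _); first by rewrite ler_wpM2r // ltW.
  rewrite mulrAC ler_pdivrMr // mul1r (le_trans HN) // ler_weXn2l ?(ltW (qR_gt1 F R)) //.
apply: le_trans (_ : X / q%:R ^+ n * (X / q%:R ^+ n) * q%:R ^+ n0 <= _).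
  by rewrite ler_wpM2r ?(ltW qn0) // ler_pM ?absv_ge0.
by rewrite le_eqVlt; apply/orP; left; apply/eqP; field; rewrite gt_eqF.
Qed.

Lemma eLatD z x y : eLat z (x + y) = eLat z x + eLat z y.
Proof.
have := @eLat_rel z [:: (1, x + y); (-1, x); (-1, y)].
rewrite !big_cons !big_nil /= rmorphN1 rmorph1 !mul1r !mulN1r !addr0 => H.
apply/eqP; rewrite -subr_eq0 opprD H //; ring.
Qed.

Lemma eLatZ z (c : F) x : eLat z (scal c * x) = scal c * eLat z x.
Proof.
have := @eLat_rel z [:: (1, scal c * x); (- c, x)].
rewrite !big_cons !big_nil /= rmorphN rmorph1 !mul1r !mulNr !addr0 => H.
by apply/eqP; rewrite -subr_eq0 H // subrr.
Qed.

Lemma eLat_sum z (I : Type) (r : seq I) (P : pred I) (f : I -> C) :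
  eLat z (\sum_(i <- r | P i) f i) = \sum_(i <- r | P i) eLat z (f i).
Proof. exact: (big_morph (eLat z) (eLatD z) (eLat0 z)). Qed.

Lemma eLat_lattice z a b : eLat z (evA a + evA b * sval z) = 0.
Proof. by apply/(eLat_eq0 Ccomp); exists a, b. Qed.

(** For a lattice point x this is its Anderson generating function; x = z and x = 1 give s_1 and
    s_2. *)
Definition sgen z x : fps C := Fps (fun i => eLat z (x / th ^+ i.+1)).

Lemma bar_coef a i : fcoef (bar a) i = scal a`_i. Proof. by []. Qed.

Lemma bar_is_zmod_morphism : zmod_morphism bar.
Proof. by move=> a b; apply: fpsP => i; rewrite fcoefB !bar_coef coefB rmorphB. Qed.
Lemma bar_is_monoid_morphism : monoid_morphism bar.
Proof.
split=> [|a b]; apply: fpsP => i; rewrite ?fcoefM bar_coef.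
  by rewrite coef1 fcoef1 rmorph_nat.
by rewrite coefM rmorph_sum; apply: eq_bigr => j _; rewrite rmorphM.
Qed.
HB.instance Definition _ := GRing.isZmodMorphism.Build {poly F} (fps C) bar bar_is_zmod_morphism.
HB.instance Definition _ := GRing.isMonoidMorphism.Build {poly F} (fps C) bar bar_is_monoid_morphism.

Lemma twist_bar (k : nat) a : twist k (bar a) = bar a.
Proof. by apply: fpsP => i /=; rewrite scal_Frob. Qed.

Lemma barC (c : F) : bar c%:P = fpsC (scal c).
Proof. by apply: fpsP => i; rewrite bar_coef coefC fcoefC; case: eqP; rewrite ?rmorph0. Qed.

Lemma evA_sum a : evA a = \sum_(j < size a) scal a`_j * th ^+ j.
Proof.
rewrite /Defs.evA horner_coef size_map_poly; apply: eq_bigr => j _.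
by rewrite coef_map.
Qed.

(** Multiplication by t replaces x / theta^(i+1) by x / theta^i; the terms that would need
    nonnegative powers of theta are the values assumed to vanish. *)
Lemma bar_sgen z x a : (forall b, eLat z (x * evA b) = 0) -> bar a * sgen z x = sgen z (evA a * x).
Proof.
move=> x0; apply: fpsP => i; rewrite fcoefM /=.
have widen n (f : nat -> C) : (size a <= n)%N -> \sum_(j < size a) scal a`_j * f j =
    \sum_(j < n) scal a`_j * f j.
  move=> an; rewrite (big_ord_widen n (fun j => scal a`_j * f j)) // [RHS](bigID (fun j : 'I_n => (j < size a)%N)) /=.
  rewrite [X in _ = _ + X]big1 ?addr0 // => j; rewrite -leqNgt => ja.
  by rewrite nth_default // rmorph0 mul0r.
pose n := (size a + i.+1)%N.
rewrite evA_sum (widen n (fun j => th ^+ j)) ?leq_addr // 2!mulr_suml eLat_sum.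
rewrite (big_ord_widen n (fun j => scal a`_j * eLat z (x / th ^+ (i - j).+1))) ?leq_addl //.
rewrite [RHS](bigID (fun j : 'I_n => (j < i.+1)%N)) /= [X in _ = _ + X]big1 ?addr0.
  apply: eq_bigr => j ji; rewrite -!mulrA eLatZ; congr (_ * eLat z _).
  rewrite mulrCA; congr (_ * _).
  have -> : i.+1 = ((i - j).+1 + j)%N by rewrite addSn subnK.
  by rewrite exprD invfM mulrCA divff ?mulr1 ?thX_neq0.
move=> j; rewrite -leqNgt => ij; rewrite -!mulrA eLatZ [th ^+ j * _]mulrCA.
have -> : th ^+ j / th ^+ i.+1 = evA ('X^(j - i.+1)).
  by rewrite rmorphXn /= evAX -{1}(subnK ij) exprD mulfK ?thX_neq0.
by rewrite x0 mulr0.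
Qed.

Lemma s1E z : s1 z = sgen z (sval z). Proof. by []. Qed.
Lemma s2E z : s2 z = sgen z 1. Proof. by []. Qed.

Lemma eLat_1 z b : eLat z (1 * evA b) = 0.
Proof. by have := eLat_lattice z b 0; rewrite rmorph0 mul0r addr0 mul1r. Qed.
Lemma eLat_z z b : eLat z (sval z * evA b) = 0.
Proof. by have := eLat_lattice z 0 b; rewrite rmorph0 add0r mulrC. Qed.

Lemma sgenD z x y : sgen z (x + y) = sgen z x + sgen z y.
Proof. by apply: fpsP => i; rewrite fcoefD /= mulrDl eLatD. Qed.

Lemma sgen_lattice z a b : sgen z (evA a * sval z + evA b) = bar a * s1 z + bar b * s2 z.
Proof. by rewrite sgenD -{1}[evA b]mulr1 s1E s2E !bar_sgen //; [exact: eLat_1|exact: eLat_z]. Qed.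

(** The functional equation of e_z read coefficientwise. The shift by t loses the term e_z(x), which
    is zero. *)
Lemma sgen_th z x : (forall b, eLat z (x * evA b) = 0) ->
  (@fpsX C - fpsC th) * sgen z x = fpsC (gG z) * twist 1 (sgen z x) + fpsC (gD z) * twist 2 (sgen z x).
Proof.
move=> x0; apply: fpsP => i; rewrite mulrBl fcoefB fcoefD !fcoefCM fcoefXM /=.
have -> : (if i is j.+1 then eLat z (x / th ^+ j.+1) else 0) = eLat z (th * (x / th ^+ i.+1)).
  have -> : th * (x / th ^+ i.+1) = x / th ^+ i.
    by rewrite exprS invfM mulrCA [th * _]mulrA divff ?th_neq0 // mul1r.
  by case: i => [|i] //; have := x0 1; rewrite rmorph1 mulr1 expr0 divr1.
by rewrite eLat_th /Phi expn1; ring.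
Qed.

Lemma autJ_neq0 (gam : 'M[{poly F}]_2) z : gam \in unitmx -> autJ gam z != 0.
Proof.
rewrite unitmxE => ud; rewrite /autJ addrC lattice_eq0; apply: contraL ud => /andP[/eqP E1 /eqP E2].
by rewrite det_mx22 E1 E2 !mulr0 subrr unitr0.
Qed.

Lemma sgen_moebius (gam : 'M[{poly F}]_2) z w x : gam \in unitmx -> moebius_rel gam z w ->
  sgen w x = fpsC (autJ gam z)^-1 * sgen z (autJ gam z * x).
Proof.
move=> ug gzw; apply: fpsP => i; rewrite fcoefCM /= (eLat_moebius Ccomp _ ug gzw).
by rewrite mulrA.
Qed.

Lemma s1_moebius (gam : 'M[{poly F}]_2) z w : gam \in unitmx -> moebius_rel gam z w ->
  s1 w = fpsC (autJ gam z)^-1 * (bar (gam 0 0) * s1 z + bar (gam 0 1) * s2 z).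
Proof.
move=> ug gzw; rewrite s1E (sgen_moebius _ ug gzw) gzw [autJ gam z * _]mulrC divfK ?autJ_neq0 //.
by rewrite sgen_lattice.
Qed.

Lemma s2_moebius (gam : 'M[{poly F}]_2) z w : gam \in unitmx -> moebius_rel gam z w ->
  s2 w = fpsC (autJ gam z)^-1 * (bar (gam 1 0) * s1 z + bar (gam 1 1) * s2 z).
Proof. by move=> ug gzw; rewrite s2E (sgen_moebius _ ug gzw) mulr1 sgen_lattice. Qed.

Definition e1 z := eLat z th^-1.
Definition f1 z := eLat z (sval z / th).

Lemma s1_0 z : fcoef (s1 z) 0 = f1 z. Proof. by []. Qed.
Lemma s2_0 z : fcoef (s2 z) 0 = e1 z. Proof. by rewrite /= expr1 div1r. Qed.

Definition psi z := s1 z * twist 1 (s2 z) - twist 1 (s1 z) * s2 z.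
Definition M z := f1 z * e1 z ^+ q - f1 z ^+ q * e1 z.

Lemma psi0 z : fcoef (psi z) 0 = M z.
Proof. by rewrite /psi fcoefB !fcoefM0 /= expn1 expr1 div1r. Qed.

Lemma torsion_ef z (c d : F) : eLat z ((scal c * sval z + scal d) / th) = scal c * f1 z + scal d * e1 z.
Proof. by rewrite mulrDl eLatD -!mulrA !eLatZ. Qed.

(** A Moore determinant of a basis of the theta-torsion is, up to sign, the product of one point in
    each F_q-line. None of these points is zero, which is how [M] is bounded below. *)
Lemma MprodE z : M z = - (e1 z * \prod_(c : F) eLat z ((scal 1 * sval z + scal (- c)) / th)).
Proof.
rewrite (eq_bigr (fun c : F => f1 z - scal c * e1 z)); last first.
  by move=> c _; rewrite torsion_ef rmorph1 mul1r rmorphN mulNr.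
rewrite prod_scal /M.
have -> : e1 z ^+ q = e1 z * e1 z ^+ (q - 1) by rewrite -exprS subn1 prednK ?q_gt0.
by move: (e1 z) (f1 z) => x y; ring.
Qed.

Lemma e1E z : e1 z = eLat z ((scal 0 * sval z + scal 1) / th).
Proof. by rewrite rmorph0 mul0r add0r rmorph1 div1r. Qed.

Lemma e1_lower n : exists2 e : R, 0 < e & forall z, affinoid n z -> e <= absv (e1 z).
Proof.
have [|e e0 He] := @eLat_torsion_lower F R C Ccomp n 0 1; first by rewrite xpair_eqE oner_eq0 andbF.
by exists e => // z zn; rewrite e1E He.
Qed.

Lemma M_lower n : exists2 e : R, 0 < e & forall z, affinoid n z -> e <= absv (M z).
Proof.
have [e e0 He] := e1_lower n.
have /boolp.choice[e' He'] : forall c : F, exists e' : R, 0 < e' /\ forall z, affinoid n z ->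
    e' <= absv (eLat z ((scal 1 * sval z + scal (- c)) / th)).
  move=> c; have [|e' e'0 H] := @eLat_torsion_lower F R C Ccomp n 1 (- c); last by exists e'.
  by rewrite xpair_eqE oner_eq0.
exists (e * \prod_(c : F) e' c).
  by rewrite mulr_gt0 // prodr_gt0 // => c _; case: (He' c).
move=> z zn; rewrite MprodE absvN absvM absv_prod ler_pM ?He ?(ltW e0) //.
  by apply: prodr_ge0 => c _; apply: ltW; case: (He' c).
by apply: ler_prod => c _; case: (He' c) => /ltW-> H; rewrite H.
Qed.

Lemma e1_neq0 z : e1 z != 0.
Proof.
have [n zn] := affinoid_ex z; have [e e0 He] := e1_lower n.
by rewrite -absv_gt0 (lt_le_trans e0) ?He.
Qed.

Lemma M_neq0 z : M z != 0.
Proof.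
have [n zn] := affinoid_ex z; have [e e0 He] := M_lower n.
by rewrite -absv_gt0 (lt_le_trans e0) ?He.
Qed.

Lemma hol_e1 : holomorphic e1.
Proof. by apply: hol_ext (hol_eLat Ccomp Cclosed th^-1 0) => z; rewrite mul0r addr0. Qed.

Lemma hol_f1 : holomorphic f1.
Proof. by apply: hol_ext (hol_eLat Ccomp Cclosed 0 th^-1) => z; rewrite add0r mulrC. Qed.

Lemma hol_M : holomorphic M.
Proof.
have h1 := hol_e1; have h2 := hol_f1.
by apply: holB => //; apply: holM => //; apply: holX.
Qed.

Lemma hol_MV : holomorphic (fun z => (M z)^-1).
Proof. by apply: holV => //; [exact: hol_M|exact: M_lower]. Qed.

Lemma hol_e1V : holomorphic (fun z => (e1 z)^-1).
Proof. by apply: holV => //; [exact: hol_e1|exact: e1_lower]. Qed.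

Lemma Phi_e1 z : Phi z (e1 z) = 0.
Proof. by rewrite -eLat_th divff ?th_neq0 //; have := eLat_1 z 1; rewrite rmorph1 mulr1. Qed.

Lemma Phi_f1 z : Phi z (f1 z) = 0.
Proof.
rewrite -eLat_th mulrC divfK ?th_neq0 //.
by have := eLat_z z 1; rewrite rmorph1 mulr1.
Qed.

(** Eliminates g between the torsion equations of [e1] and [f1]. *)
Lemma gD_M z : gD z * M z ^+ q = th * M z.
Proof.
have Mq : M z ^+ q = f1 z ^+ q * e1 z ^+ (q ^ 2) - f1 z ^+ (q ^ 2) * e1 z ^+ q.
  have := @FrobB F R C 1; rewrite expn1 => FB.
  by rewrite /M FB !exprMn -!exprM mulnn.
have := Phi_e1 z; have := Phi_f1 z; rewrite Mq /M /Phi.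
move: (e1 z) (f1 z) (gD z) (gG z) => e f D G.
move: (e ^+ q) (f ^+ q) (e ^+ (q ^ 2)) (f ^+ (q ^ 2)) => eq fq eqq fqq E1 E2.
apply/eqP; rewrite -subr_eq0.
have -> : D * (fq * eqq - fqq * eq) - th * (f * eq - fq * e) =
  fq * (th * e + G * eq + D * eqq) - eq * (th * f + G * fq + D * fqq) by ring.
by rewrite E1 E2 !mulr0 subrr.
Qed.

Lemma gD_neq0 z : gD z != 0.
Proof.
apply/eqP => D0; have := gD_M z; rewrite D0 mul0r => /esym/eqP.
by rewrite mulf_eq0 (negPf (th_neq0 C)) (negPf (M_neq0 z)).
Qed.

Lemma gDE z : gD z = th * (M z)^-1 ^+ (q - 1).
Proof.
have M0 := M_neq0 z; apply: (mulIf (expf_neq0 q M0)); rewrite gD_M -mulrA; congr (_ * _).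
have -> : M z ^+ q = M z ^+ (q - 1) * M z by rewrite -exprSr subn1 prednK ?q_gt0.
by rewrite mulrA -exprMn mulVf // expr1n mul1r.
Qed.

Lemma gGE z : gG z = - (th + gD z * e1 z ^+ (q ^ 2 - 1)) / e1 z ^+ (q - 1).
Proof.
have e0 := e1_neq0 z; have := Phi_e1 z; rewrite /Phi.
have E1 : e1 z ^+ q = e1 z ^+ (q - 1) * e1 z by rewrite -exprSr subn1 prednK ?q_gt0.
have E2 : e1 z ^+ (q ^ 2) = e1 z ^+ (q ^ 2 - 1) * e1 z.
  by rewrite -exprSr subn1 prednK ?expn_gt0 ?q_gt0.
rewrite E1 E2; have := expf_neq0 (q - 1) e0.
move: (e1 z ^+ (q ^ 2 - 1)) (e1 z ^+ (q - 1)) e0 => u v e0 v0 H.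
apply: (mulIf v0); rewrite divfK //; apply: (mulIf e0).
by apply/eqP; rewrite -subr_eq0 -[X in _ == X]H; apply/eqP; ring.
Qed.

Lemma hol_gD : holomorphic gD.
Proof.
apply: hol_ext (holZ Cclosed th (holX Cclosed (q - 1) hol_MV)) => z.
by rewrite gDE.
Qed.

Lemma hol_gG : holomorphic gG.
Proof.
have h1 := hol_e1; have h2 := hol_gD; have h3 := hol_e1V.
apply: hol_ext (_ : holomorphic (fun z => - (th + gD z * e1 z ^+ (q ^ 2 - 1)) * (e1 z)^-1 ^+ (q - 1))).
  by move=> z; rewrite gGE exprVn.
apply: holM => //; last exact: holX.
apply: holN => //; apply: holD; first exact: hol_const.
by apply: holM => //; apply: holX.
Qed.

Lemma psi_moebius (gam : 'M[{poly F}]_2) z w : gam \in unitmx -> moebius_rel gam z w ->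
  psi w = fpsC ((autJ gam z)^-1 ^+ q.+1) * bar (\det gam) * psi z.
Proof.
move=> ug gzw; rewrite /psi (s1_moebius ug gzw) (s2_moebius ug gzw).
rewrite !rmorphM !rmorphD !rmorphM /= !twist_bar !twistC expn1 det_mx22 rmorphB !rmorphM /=.
rewrite exprS rmorphM /=.
move: (fpsC _) (fpsC _) (s1 z) (s2 z) (twist 1 (s1 z)) (twist 1 (s2 z)) => u v x y x' y'.
by move: (bar (gam 0 0)) (bar (gam 0 1)) (bar (gam 1 0)) (bar (gam 1 1)) => a b c d; ring.
Qed.

Lemma bar_det (gam : 'M[{poly F}]_2) : gam \in unitmx ->
  bar (\det gam) = fpsC (evA (\det gam)).
Proof.
by rewrite unitmxE poly_unitE => /andP[/eqP/eqP/size_poly1P[c _ ->] _]; rewrite barC evAC.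
Qed.

Lemma M_moebius (gam : 'M[{poly F}]_2) z w : gam \in unitmx -> moebius_rel gam z w ->
  M w = (autJ gam z)^-1 ^+ q.+1 * evA (\det gam) * M z.
Proof.
move=> ug gzw; rewrite -psi0 (psi_moebius ug gzw) bar_det // -mulrA !fcoefCM psi0.
by rewrite mulrA.
Qed.

(** The elimination of [gD_M] carried out on the difference equations of s_1 and s_2, with theta
    replaced by theta - t. *)
Lemma psi_twist z : twist 1 (psi z) * fpsC (gD z) = (fpsC th - @fpsX C) * psi z.
Proof.
have H1 := @sgen_th z 1 (eLat_1 z); have H2 := @sgen_th z (sval z) (eLat_z z).
rewrite -s1E -s2E in H1 H2.
have -> : twist 1 (psi z) = twist 1 (s1 z) * twist 2 (s2 z) - twist 2 (s1 z) * twist 1 (s2 z).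
  by rewrite /psi rmorphB !rmorphM /= !twist_twist.
rewrite /psi; move: H1 H2.
move: (fpsC (gG z)) (fpsC (gD z)) (s1 z) (s2 z) => G D x y.
move: (twist 1 x) (twist 1 y) (twist 2 x) (twist 2 y) (fpsC th) (@fpsX C) => x1 y1 x2 y2 t X H1 H2.
apply/eqP; rewrite -subr_eq0.
have -> : (x1 * y2 - x2 * y1) * D - (t - X) * (x * y1 - x1 * y) =
  y1 * ((X - t) * x - (G * x1 + D * x2)) - x1 * ((X - t) * y - (G * y1 + D * y2)) by ring.
by rewrite H1 H2 !subrr !mulr0 subrr.
Qed.

End DrinfeldModule.

(** * Expansions in u at the cusp *)

Section UExpansion.
Variables (F : finFieldType) (R : realType) (C : valuedField F R).
Local Notation q := #|F|.
Local Notation th := (theta C).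
Local Notation scal := (@vf_scal F R C).
Local Notation evA := (@evA F R C).
Local Notation Omega := (Omega C).
Local Notation X := (@fpsX C).
Implicit Types (x y l k : C) (a b c d : {poly F}) (z w : Omega).
Hypothesis Ccomp : Ccomplete C.
Hypothesis Cclosed : GRing.closed_field_axiom C.
Variable pi : C.
Hypothesis hpi : is_period pi.
Local Notation u := (upar pi).

Lemma pi_neq0 : pi != 0. Proof. by case: (period_eA Ccomp Cclosed hpi). Qed.

Lemma eCar_pi x : eCar (pi * x) = pi * eA x.
Proof. by case: (period_eA Ccomp Cclosed hpi). Qed.

Lemma eA_bz_neq0 z b : b != 0 -> eA (evA b * sval z) != 0.
Proof.
move=> b0; apply/eqP => /(eA_eq0 Ccomp)[a aE].
have := lattice_eq0 z (- a) b; rewrite rmorphN aE addNr eqxx (negPf b0) andbF; discriminate.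
Qed.

Lemma eA_z_neq0 z : eA (sval z) != 0.
Proof. by have := eA_bz_neq0 z (oner_neq0 {poly F}); rewrite rmorph1 mul1r. Qed.

Lemma uE z : u z = (pi * eA (sval z))^-1.
Proof. by rewrite /upar eCar_pi. Qed.

Lemma u_neq0 z : u z != 0.
Proof. by rewrite uE invr_eq0 mulf_neq0 ?pi_neq0 ?eA_z_neq0. Qed.

(** The polynomial in u equal to pi e_A(theta^j z) u^(q^j); the recursion is the Carlitz functional
    equation, starting from pi e_A(z) = 1 / u. *)
Fixpoint vser j : fps C :=
  if j is i.+1 then fpsC th * X ^+ (q ^ i.+1 - q ^ i) * vser i + vser i ^+ q else 1.

Lemma fcoefMXn (f : fps C) n i : fcoef (X ^+ n * f) i = if (i < n)%N then 0 else fcoef f (i - n)%N.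
Proof.
elim: n i => [|n IHn] i; first by rewrite expr0 mul1r subn0.
by rewrite exprS -mulrA fcoefXM; case: i => [|i] //; rewrite IHn.
Qed.

Lemma pbound_Xn (r B : R) n (f : fps C) : 0 <= r -> pbound r B f -> pbound r (r ^+ n * B) (X ^+ n * f).
Proof.
move=> r0 fB i; rewrite fcoefMXn; case: ltnP => [_|ni].
  by rewrite absv0 mul0r mulr_ge0 ?exprn_ge0 ?(pbound_ge0 fB).
rewrite -{2}(subnK ni) exprD mulrA mulrC ler_wpM2l ?exprn_ge0 //; exact: fB.
Qed.

Lemma pbound1 (r : R) : pbound r 1 (1 : fps C).
Proof. by have := pboundC r (1 : C); rewrite absv1. Qed.

Lemma pbound1X (r : R) n (f : fps C) : 0 < r -> pbound r 1 f -> pbound r 1 (f ^+ n).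
Proof.
move=> r0 f1; elim: n => [|n IHn].
  by rewrite expr0; apply: pbound1.
by rewrite exprS -[1]mul1r; apply: pboundM.
Qed.

Lemma pbound_sum (r B : R) (I : Type) (s : seq I) (P : pred I) (f : I -> fps C) : 0 < r -> 0 <= B ->
  (forall i, P i -> pbound r B (f i)) -> pbound r B (\sum_(i <- s | P i) f i).
Proof.
move=> r0 B0 H; apply: (big_ind (pbound r B)) => // [i|f1 f2]; last by apply: pboundD; rewrite ltW.
by rewrite fcoef0 absv0 mul0r.
Qed.

(** A radius on which the polynomials and factors below have Gauss norm at most one: r q <= 1
    controls the coefficient theta, and r |pi| <= 1 the factor pi in [user]. *)
Variable r : R.
Hypotheses (r0 : 0 < r) (rq : r * q%:R <= 1) (rpi : r * absv pi <= 1).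

Lemma r_lt1 : r < 1.
Proof. by apply: lt_le_trans rq; rewrite ltr_pMr // qR_gt1. Qed.

Lemma vser_bound j : pbound r 1 (vser j).
Proof.
elim: j => [|j IHj] /=; first exact: pbound1.
apply: pboundD; [exact: ltW|rewrite -mulrA|exact: pbound1X].
apply: (@pbound_le _ _ _ r r (absv th * (r ^+ (q ^ j.+1 - q ^ j) * 1))).
- exact: ltW.
- exact: lexx.
- rewrite absv_th mulr1 mulrC; apply: le_trans rq; rewrite ler_wpM2r ?ler0n //.
  rewrite -[leRHS]expr1 ler_wiXn2l ?(ltW r0) ?(ltW r_lt1) //.
  by rewrite subn_gt0 ltn_exp2l ?q_gt1.
by apply: pboundM => //; [apply: pboundC|apply: pbound_Xn => //; exact: ltW].
Qed.

Lemma vser0 j : fcoef (vser j) 0 = 1.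
Proof.
elim: j => [|j IHj] //; rewrite [vser j.+1]/= fcoefD -mulrA fcoefCM fcoefMXn subn_gt0 ltn_exp2l ?q_gt1 // ltnSn.
have -> n : fcoef (vser j ^+ n) 0 = fcoef (vser j) 0 ^+ n.
  by elim: n => [|n IHn] //; rewrite !exprS fcoefM0 IHn.
by rewrite mulr0 add0r IHj expr1n.
Qed.

Lemma vser_eval z j : absv (u z) < r ->
  has_eval (vser j) (u z) (pi * eA (th ^+ j * sval z) * u z ^+ (q ^ j)).
Proof.
move=> ur; elim: j => [|j IHj] /=.
  rewrite !expr1 expr0 mul1r uE divff; first exact: has_eval1.
  by rewrite mulf_neq0 ?pi_neq0 ?eA_z_neq0.
have le : (q ^ j <= q ^ j.+1)%N by rewrite leq_exp2l ?q_gt1.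
set e := pi * eA (th ^+ j * sval z) in IHj *.
have -> : pi * eA (th ^+ j.+1 * sval z) * u z ^+ (q ^ j.+1) =
   th * u z ^+ (q ^ j.+1 - q ^ j) * (e * u z ^+ (q ^ j)) + (e * u z ^+ (q ^ j)) ^+ q.
  rewrite [th ^+ j.+1]exprS -[th * th ^+ j * _]mulrA -eCar_pi [pi * (th * _)]mulrCA (eCar_th Ccomp) eCar_pi -/e mulrDl; clearbody e.
  congr (_ + _); last by rewrite [RHS]exprMn -[in RHS]exprM -expnSr.
  rewrite -!mulrA; congr (_ * _); rewrite [RHS]mulrCA; congr (_ * _).
  by rewrite -exprD subnK.
apply: has_evalD; last exact: has_evalXn.
apply: has_evalM => //; apply: has_evalM; first exact: has_evalC.
exact/has_evalXn/has_evalX.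
Qed.

(** The series pi e_A(b z) freed of its pole of order q^(deg b) in u. Its constant term is the
    leading coefficient of b, so it is a unit. *)
Definition wser b : fps C :=
  \sum_(j < size b) fpsC (scal b`_j) * (X ^+ (q ^ (size b).-1 - q ^ j) * vser j).

Lemma wser_bound b : pbound r 1 (wser b).
Proof.
apply: pbound_sum => // j _; apply: (@pbound_le _ _ _ r r (absv (scal b`_j) * (r ^+ (q ^ (size b).-1 - q ^ j) * 1))).
- exact: ltW.
- exact: lexx.
- rewrite mulr1 mulr_ile1 ?absv_ge0 ?exprn_ge0 ?absv_scal_le1 ?(ltW r0) //.
  by rewrite exprn_ile1 // ltW // r_lt1.
apply: pboundM => //; first exact: pboundC.
by apply: pbound_Xn; [exact: ltW|exact: vser_bound].
Qed.

Lemma wser0 b : b != 0 -> fcoef (wser b) 0 = scal (lead_coef b).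
Proof.
move=> b0; have sb : (0 < size b)%N by rewrite size_poly_gt0.
rewrite /wser lead_coefE; case: (size b) sb => // n _.
rewrite fcoef_sum big_ord_recr big1 ?add0r.
  by rewrite fcoefCM fcoefMXn [nat_of_ord _]/= [_.-1]/= subnn vser0 mulr1 /= add0r.
move=> j _; rewrite fcoefCM fcoefMXn ifT ?mulr0 //.
by rewrite subn_gt0 ltn_exp2l ?q_gt1 //=.
Qed.

Lemma wser_eval z b : absv (u z) < r ->
  has_eval (wser b) (u z) (pi * eA (evA b * sval z) * u z ^+ (q ^ (size b).-1)).
Proof.
move=> ur; have -> : pi * eA (evA b * sval z) * u z ^+ (q ^ (size b).-1) =
  \sum_(j < size b) scal b`_j * (u z ^+ (q ^ (size b).-1 - q ^ j) * (pi * eA (th ^+ j * sval z) * u z ^+ (q ^ j))).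
  rewrite evA_sum mulr_suml (big_morph (@eA F R C) (eAD Ccomp) (eA_0 C)) mulr_sumr mulr_suml.
  apply: eq_bigr => j _; rewrite -(mulrA (scal b`_j) _ (sval z)) (eAZ Ccomp).
  have le : (q ^ j <= q ^ (size b).-1)%N.
    by rewrite leq_exp2l ?q_gt1 // -ltnS prednK ?(leq_ltn_trans (leq0n j)).
  have -> : u z ^+ (q ^ (size b).-1) = u z ^+ (q ^ (size b).-1 - q ^ j) * u z ^+ (q ^ j).
    by rewrite -exprD subnK.
  by move: (eA _) (u z ^+ _) (u z ^+ _) => e v w; ring.
rewrite /wser; elim: (index_enum _) => [|j s IHs]; first by rewrite !big_nil; exact: has_evalC.
rewrite !big_cons; apply: has_evalD => //.
apply: has_evalM; first exact: has_evalC.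
apply: has_evalM; last exact: vser_eval.
exact/has_evalXn/has_evalX.
Qed.

Lemma absv_scal1 (x : F) : x != 0 -> absv (scal x) = 1.
Proof. by rewrite absv_scal => ->. Qed.

Lemma wserV_bound b : b != 0 -> pbound r 1 (wser b)^-1.
Proof.
move=> b0; have l0 : lead_coef b != 0 by rewrite lead_coef_eq0.
have := @pbound_inv F R C r (wser b) r0; rewrite wser0 // fmorph_eq0 l0 absv_scal1 // invr1.
by apply=> //; apply: wser_bound.
Qed.

(* The series of pi / e_Car(pi b z) in u *)
Definition user b : fps C := fpsC pi * (X ^+ (q ^ (size b).-1) * (wser b)^-1).

Lemma user_eval z b : b != 0 -> absv (u z) < r -> has_eval (user b) (u z) (eA (evA b * sval z))^-1.
Proof.
move=> b0 ur.
have W := wser_eval b ur; set V := _ * _ in W.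
have V0 : V != 0 by apply: mulf_neq0; [apply: mulf_neq0; [exact: pi_neq0|exact: eA_bz_neq0]|rewrite expf_neq0 ?u_neq0].
have [W' HW'] := pbound_eval Ccomp ur (wserV_bound b0).
have uw : wser b \is a GRing.unit by rewrite fps_unitE wser0 // fmorph_eq0 lead_coef_eq0.
have E := has_evalM HW' W; rewrite mulVr // in E.
have WE : W' = V^-1.
  by apply: (mulIf V0); rewrite mulVf // (has_eval_unique E (has_eval1 _)).
have -> : (eA (evA b * sval z))^-1 = pi * (u z ^+ (q ^ (size b).-1) * V^-1).
  rewrite /V; have := eA_bz_neq0 z b0; have := pi_neq0; have := expf_neq0 (q ^ (size b).-1) (u_neq0 z).
  by move: (eA _) (u z ^+ _) => e v n1 n2 n3; field; rewrite n1 n2 n3.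
apply: has_evalM; first exact: has_evalC.
by apply: has_evalM; [exact/has_evalXn/has_evalX|rewrite -WE].
Qed.

Section Factor.
Variable x : C.
Hypothesis x1 : absv x < 1.
Let xi := eA x.

Let axi : absv xi <= 1. Proof. by rewrite /xi (eA_small Ccomp) // ltW. Qed.

Definition facser b : fps C := 1 - fpsC xi * user b.

Lemma facser_eval z b : b != 0 -> absv (u z) < r ->
  has_eval (facser b) (u z) (1 - xi / eA (evA b * sval z)).
Proof.
move=> b0 ur; apply: has_evalB; first exact: has_eval1.
by apply: has_evalM; [exact: has_evalC|exact: user_eval].
Qed.

Lemma facserE b : facser b = 1 - X ^+ (q ^ (size b).-1) * (fpsC (xi * pi) * (wser b)^-1).
Proof. by rewrite /facser /user [fpsC (xi * pi)]rmorphM /=; congr (_ - _); ring. Qed.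

Lemma facser_bound b : b != 0 -> pbound r 1 (facser b).
Proof.
move=> b0; rewrite facserE; apply: pboundD; first exact: ltW.
  exact: pbound1.
apply: pboundN; apply: (@pbound_le _ _ _ r r (r ^+ (q ^ (size b).-1) * (absv (xi * pi) * 1))).
- exact: ltW.
- exact: lexx.
- rewrite mulr1 (le_trans _ rpi) // absvM.
  apply: ler_pM; rewrite ?exprn_ge0 ?(ltW r0) ?mulr_ge0 ?absv_ge0 //.
    by rewrite -[leRHS]expr1 ler_wiXn2l ?(ltW r0) ?(ltW r_lt1) ?expn_gt0 ?q_gt0.
  by rewrite ler_piMl ?absv_ge0.
apply: pbound_Xn; first exact: ltW.
by apply: pboundM => //; [exact: pboundC|exact: wserV_bound].
Qed.

Definition prodser m : fps C := \prod_(b <- polys F m | b != 0) facser b.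

Lemma prodser_bound m : pbound r 1 (prodser m).
Proof.
apply: (big_ind (pbound r 1)) => [|f1 f2 H1 H2|b b0]; last exact: facser_bound.
  exact: pbound1.
by rewrite -[1]mul1r; apply: pboundM.
Qed.

Lemma prodser_eval z m : absv (u z) < r ->
  has_eval (prodser m) (u z) (\prod_(b <- polys F m | b != 0) (1 - xi / eA (evA b * sval z))).
Proof.
move=> ur; rewrite /prodser; elim: (polys F m) => [|b s IHs].
  by rewrite !big_nil; apply: has_eval1.
rewrite !big_cons; case: ifP => // b0; apply: has_evalM => //; exact: facser_eval.
Qed.

(** The new factors have deg b = m and are congruent to 1 modulo u^(q^m). *)
Lemma prodser_stable m i : (i < q ^ m)%N -> fcoef (prodser m.+1) i = fcoef (prodser m) i.
Proof.
move=> im; apply/eqP; rewrite -subr_eq0 -fcoefB; apply/eqP.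
suff [f ->] : exists f, prodser m.+1 - prodser m = X ^+ (q ^ m) * f by rewrite fcoefMXn im.
pose S := [seq b : {poly F} <- polys F m.+1 | (b != 0) && (m < size b)%N].
have ex : exists f, \prod_(b <- S) facser b = 1 + X ^+ (q ^ m) * f.
  have : all (fun b : {poly F} => size b == m.+1) S.
    apply/allP => b; rewrite mem_filter mem_polys => /andP[/andP[_ h1] h2].
    by rewrite eqn_leq h2 h1.
  elim: S => [_|b S' IHS]; first by exists 0; rewrite big_nil mulr0 addr0.
  move=> /= /andP[/eqP sb /IHS[f Hf]]; rewrite big_cons Hf facserE sb /=.
  by eexists; rewrite mulrDl mul1r mulNr -mulrA -addrA -mulrBr; reflexivity.
have -> : prodser m.+1 = prodser m * \prod_(b <- S) facser b.
  rewrite /prodser big_filter [LHS](bigID (fun b : {poly F} => (size b <= m)%N)); congr (_ * _).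
    rewrite -big_filter -[RHS]big_filter; apply: perm_big; apply: uniq_perm; rewrite ?filter_uniq ?polys_uniq //.
    by move=> b; rewrite !mem_filter !mem_polys; case: (b != 0) => //=; apply/andP/idP => [[]//|h]; rewrite h leqW.
  by apply: eq_bigl => b; rewrite -ltnNge.
have [f ->] := ex; exists (prodser m * f).
by rewrite mulrDr mulr1 addrAC subrr add0r mulrCA.
Qed.

(** Diagonal coefficients suffice because [prodser m] is stable in degrees below q^m and i < q^i. *)
Definition limser : fps C := Fps (fun i => fcoef (prodser i) i).

Lemma limser_coef m i : (i <= m)%N -> fcoef limser i = fcoef (prodser m) i.
Proof.
move=> /subnKC<-; elim: (m - i)%N => [|n IHn]; first by rewrite addn0.
rewrite addnS IHn prodser_stable //.
by rewrite (leq_ltn_trans (leq_addr n i)) // ltn_expl ?q_gt1.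
Qed.

Lemma limser_bound : pbound r 1 limser.
Proof. by move=> i; rewrite (limser_coef (leqnn i)); apply: prodser_bound. Qed.

Lemma limser0 : fcoef limser 0 = 1.
Proof. by rewrite /= /prodser big_cons eqxx big_nil. Qed.

Lemma limser_eval z : absv (u z) < r -> has_eval (fpsC xi * limser) (u z) (eLat z x).
Proof.
move=> ur; apply: (@eq_rect _ _ (fun l => has_eval (fpsC xi * limser) (u z) l) _ _ _).
  by apply: has_evalM; [exact: has_evalC|exact: pbound_has_eval ur limser_bound].
apply: limto_seq_unique (eLat_column Ccomp z x).
apply: limto_seqM; first exact: limto_seqC.
apply/limto_seqP => eps e0.
have ur1 : 0 <= absv (u z) / r < 1 by rewrite divr_ge0 ?absv_ge0 ?(ltW r0) //= ltr_pdivrMr // mul1r.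
have [N HN] := geom_small ur1 ler01 e0; exists N => m Nm.
have H := has_evalB (prodser_eval m ur) (pbound_has_eval Ccomp ur limser_bound).
have D1 : pbound r 1 (prodser m - limser).
  by apply: pboundD; [exact: ltW|exact: prodser_bound|apply: pboundN; exact: limser_bound].
apply: le_lt_trans (HN m Nm); rewrite mul1r.
apply: (has_sum_le H) => [|i]; first by rewrite exprn_ge0 // divr_ge0 ?absv_ge0 // ltW.
rewrite absvM absvX.
have [im|mi] := ltnP i m.
  by rewrite fcoefB (limser_coef (ltnW im)) subrr absv0 mul0r exprn_ge0 // divr_ge0 ?absv_ge0 // ltW.
apply: le_trans (_ : (absv (u z) / r) ^+ i <= _); last first.
  by case/andP: ur1 => h1 h2; rewrite ler_wiXn2l // ltW.
rewrite expr_div_n ler_pdivlMr ?exprn_gt0 // mulrAC -[leRHS]mul1r.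
by rewrite ler_wpM2r ?exprn_ge0 ?absv_ge0.
Qed.

End Factor.

Lemma eLat_uexp x : absv x < 1 -> exists a : fps C,
  [/\ pbound r 1 a, fcoef a 0 = eA x & forall z, absv (u z) < r -> has_eval a (u z) (eLat z x)].
Proof.
move=> x1; exists (fpsC (eA x) * limser x); split.
- have := pboundM r0 (pboundC r (eA x)) (limser_bound x1); rewrite mulr1.
  by apply: pbound_le; rewrite ?(ltW r0) // (eA_small Ccomp) // ltW.
- by rewrite fcoefCM limser0 mulr1.
- by move=> z; apply: limser_eval.
Qed.

End UExpansion.

(** * Approach to the cusp along the vertices *)

Section Cusp.
Variables (F : finFieldType) (R : realType) (C : valuedField F R).
Local Notation q := #|F|.
Local Notation th := (theta C).
Local Notation scal := (@vf_scal F R C).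
Local Notation evA := (@evA F R C).
Local Notation Omega := (Omega C).
Implicit Types (x y l k : C) (a b c d : {poly F}) (z w : Omega).
Hypothesis Ccomp : Ccomplete C.
Hypothesis Cclosed : GRing.closed_field_axiom C.
Variable pi : C.
Hypothesis hpi : is_period pi.
Local Notation u := (upar pi).
Let pi0 := pi_neq0 Ccomp Cclosed hpi.

Lemma ex_expq_lt (B : R) : exists N, B < q%:R ^+ N.
Proof.
by have [N HN] := ex_expq F (B + 1); exists N; apply: lt_le_trans HN; rewrite ltrDl.
Qed.

Lemma tprod_absv_prod x n : absv (tprod (yA x) (fpolys F n)) =
  \prod_(a <- polys F n) absv (1 + x / evA a).
Proof. by rewrite /tprod big_fpolys absv_prod. Qed.

Lemma absv_1div y a : a != 0 -> Num.max (absv y) (absv (evA a)) <= absv (y + evA a) ->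
  Num.max 1 (absv y / absv (evA a)) <= absv (1 + y / evA a).
Proof.
move=> a0 dom; have aa : 0 < absv (evA a) by rewrite absv_gt0 evA_eq0.
have -> : 1 + y / evA a = (y + evA a) / evA a by field; rewrite evA_eq0.
rewrite absvM absvV ge_max ler_pdivlMr // mul1r.
move: dom; rewrite ge_max => /andP[h1 ->] /=.
by rewrite ler_pM2r ?invr_gt0.
Qed.

(** The products are compared factor by factor: the hypothesis on [y] makes |1 + y / a| at least the
    maximum of 1 and |y / a|, which the ultrametric inequality grants as an upper bound for [x]. *)
Lemma eA_le x y : absv x <= absv y -> (forall a, Num.max (absv y) (absv (evA a)) <= absv (y + evA a)) ->
  absv (eA x) <= absv (eA y).
Proof.
move=> xy dom; have [N yN] := ex_expq_lt (absv y).
rewrite (eA_absv Ccomp (le_lt_trans xy yN)) (eA_absv Ccomp yN) !tprod_absv_prod.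
apply: ler_pM; rewrite ?absv_ge0 //; first by apply: prodr_ge0 => a _; apply: absv_ge0.
apply: ler_prod => a _; rewrite absv_ge0 /=.
have [->|a0] := eqVneq a 0; first by rewrite rmorph0 invr0 !mulr0 addr0.
apply: le_trans (absv_1div a0 (dom a)).
apply: (le_trans (absv_ultra _ _)); rewrite absv1 ge_max !le_max lexx /=.
apply/orP; right; rewrite absvM absvV ler_wpM2r ?invr_ge0 ?absv_ge0 //.
Qed.

Lemma eA_ge y : (forall a, Num.max (absv y) (absv (evA a)) <= absv (y + evA a)) ->
  absv y <= absv (eA y).
Proof.
move=> dom; have [N yN] := ex_expq_lt (absv y).
rewrite (eA_absv Ccomp yN) tprod_absv_prod ler_peMr ?absv_ge0 //.
rewrite -[X in X <= _](expr1n R (size (polys F N))).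
apply: prod_ge_exp; first exact: ler01.
move=> a _; have [->|a0] := eqVneq a 0; first by rewrite rmorph0 invr0 !mulr0 addr0 absv1.
by apply: le_trans (absv_1div a0 (dom a)); rewrite le_max lexx.
Qed.

(** On a vertex of the half-line |z| is the least possible distance to K_infty, so no cancellation
    occurs between b z and a. *)
Lemma G_dom n z : Gs 0 (th ^+ n) (sval z) -> forall b a, b != 0 ->
  Num.max (absv (evA b * sval z)) (absv (evA a)) <= absv (evA b * sval z + evA a).
Proof.
move=> Gz b a b0.
have az : absv (sval z) = absv (th ^+ n) by rewrite -(Gs0 Gz) subr0.
have le : absv (evA b * sval z) <= absv (evA b * sval z + evA a).
  have -> : evA b * sval z + evA a = evA b * (sval z - (- evA a / evA b)).
    by field; rewrite evA_eq0.
  rewrite !absvM ler_wpM2l ?absv_ge0 // az.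
  apply: (Gs_dist (KcthX C n) (thX_neq0 _ _) Kc0 Gz).
  by rewrite mulNr; apply/KcN/KcM; [exact: Kc_evA|exact: Kc_evAV].
rewrite ge_max le /=; have [lt|le'] := ltrP (absv (evA b * sval z)) (absv (evA a)).
  by rewrite absvD_eqr.
exact: le_trans le.
Qed.

Lemma G_absv n z : Gs 0 (th ^+ n) (sval z) -> absv (sval z) = q%:R ^+ n.
Proof. by move=> Gz; rewrite -[sval z]subr0 (Gs0 Gz) absvX absv_th. Qed.

Lemma G_dom1 n z : Gs 0 (th ^+ n) (sval z) -> forall a,
  Num.max (absv (sval z)) (absv (evA a)) <= absv (sval z + evA a).
Proof. by move=> Gz a; have := G_dom Gz a (oner_neq0 {poly F}); rewrite rmorph1 mul1r. Qed.

Lemma u_G n z : Gs 0 (th ^+ n) (sval z) -> absv (u z) <= (absv pi)^-1 * q%:R ^- n.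
Proof.
move=> Gz; rewrite (uE Ccomp Cclosed hpi) absvV absvM invfM.
rewrite ler_wpM2l ?invr_ge0 ?absv_ge0 //.
have le := eA_ge (G_dom1 Gz); rewrite (G_absv Gz) in le.
have qn := absv_th_neq0 F R n.
by rewrite lef_pV2 ?posrE // (lt_le_trans qn).
Qed.

Lemma u_G_small (eps : R) : 0 < eps -> exists n0, forall n z, (n0 <= n)%N ->
  Gs 0 (th ^+ n) (sval z) -> absv (u z) < eps.
Proof.
move=> e0; have pp : 0 <= (absv pi)^-1 by rewrite invr_ge0 absv_ge0.
have qi : 0 <= (q%:R : R)^-1 < 1.
  by rewrite invr_ge0 ltW ?qR_gt0 //= invf_lt1 ?qR_gt0 // qR_gt1.
have [N HN] := geom_small qi pp e0; exists N => n z Nn Gz.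
by apply: le_lt_trans (u_G Gz) _; rewrite -exprVn; apply: HN.
Qed.

Lemma u_pt (eps : R) : 0 < eps -> exists z, absv (u z) < eps.
Proof.
move=> /u_G_small[n Hn].
have [z Gz] := Gs_point Cclosed (KcthX C n) (thX_neq0 C n) (Kc0 : Kc (0 : C)).
by exists z; apply: (Hn n).
Qed.

Lemma limto_seq_le (v : nat -> C) l (B : R) : limto \oo v l -> (forall n, absv (v n) <= B) -> absv l <= B.
Proof.
move=> /limto_seqP vl vB; apply/ler_addgt0Pr => e e0; have [N HN] := vl _ e0.
have -> : l = v N - (v N - l) by ring.
apply: absvB_le; first by rewrite (le_trans (vB N)) // lerDl ltW.
rewrite (le_trans (ltW (HN N (leqnn N)))) // lerDr; exact: le_trans (absv_ge0 _) (vB 0%N).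
Qed.

(** In the column product every factor has absolute value at most one, since e_A(x) is dominated by
    each e_A(b z). *)
Lemma eLat_le_eA n z x : Gs 0 (th ^+ n) (sval z) -> absv x <= absv (sval z) ->
  absv (eLat z x) <= absv (eA x).
Proof.
move=> Gz xz; apply: limto_seq_le (eLat_column Ccomp z x) _ => m.
rewrite absvM ler_piMr ?absv_ge0 // absv_prod; apply: prodr_ile1 => b b0.
rewrite absv_ge0 /=; apply: absvB_le; rewrite ?absv1 // absvM absvV.
have e0 : 0 < absv (eA (evA b * sval z)) by rewrite absv_gt0 (eA_bz_neq0 Ccomp).
rewrite ler_pdivrMr // mul1r; apply: eA_le; last by move=> a; apply: G_dom.
by rewrite (le_trans xz) // absvM ler_peMl ?absv_ge0 // absv_evA_ge1.
Qed.

End Cusp.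

(** * Constancy of h M and of h psi *)

Section Discriminant.
Variables (F : finFieldType) (R : realType) (C : valuedField F R).
Local Notation q := #|F|.
Local Notation th := (theta C).
Local Notation scal := (@vf_scal F R C).
Local Notation evA := (@evA F R C).
Local Notation Omega := (Omega C).
Local Notation X := (@fpsX C).
Implicit Types (x y l k : C) (a b c d : {poly F}) (z w : Omega).
Hypothesis Ccomp : Ccomplete C.
Hypothesis Cclosed : GRing.closed_field_axiom C.
Variable pi : C.
Hypothesis hpi : is_period pi.
Variables g Delta h : Omega -> C.
Hypothesis hg : is_g_Delta pi g Delta.
Hypothesis hh : is_h pi h.
Local Notation u := (upar pi).

(** At the torsion points e_z is dominated by e_A, and the product over c of e_A(z / theta) - c
    e_A(1 / theta) collapses by the functional equation to a constant times e_A(z), where pi e_A(z)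
    = 1 / u. *)
Lemma M_bound : exists2 K : R, 0 < K & forall n z, Gs 0 (th ^+ n) (sval z) -> absv (M z) * absv (u z) <= K.
Proof.
have pi0 := pi_neq0 Ccomp Cclosed hpi.
pose e := eA (th^-1 : C).
have e0 : e != 0 := eA_thV_neq0 Ccomp.
exists (absv (e * (th^-1 * e ^+ (q - 1) / pi))).
  rewrite absv_gt0; apply: mulf_neq0 => //; apply: mulf_neq0; last by rewrite invr_eq0.
  by apply: mulf_neq0; [rewrite invr_eq0 th_neq0|exact: expf_neq0].
move=> n z Gz; have ez0 := eA_z_neq0 Ccomp z.
rewrite (uE Ccomp Cclosed hpi) (MprodE Ccomp hg) absvN absvV (absvM (e1 z)) absv_prod.
have q1 : 1 <= q%:R ^+ n :> R by rewrite exprn_ege1 // ltW ?qR_gt1.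
have az := G_absv Gz.
have le1 : absv (e1 z) <= absv e.
  apply: eLat_le_eA Gz _ => //; rewrite absvV absv_th az (le_trans _ q1) // invf_le1 ?qR_gt0 //.
  by rewrite ltW ?qR_gt1.
have le2 : \prod_(c : F) absv (eLat z ((scal 1 * sval z + scal (- c)) / th)) <=
    absv (th^-1 * e ^+ (q - 1) * eA (sval z)).
  have -> : th^-1 * e ^+ (q - 1) * eA (sval z) = - \prod_(c : F) (eA (sval z / th) - scal c * e).
    rewrite prod_scal; have := eA_th Ccomp (sval z / th).
    have -> : th * (sval z / th) = sval z by rewrite mulrCA divff ?mulr1 ?th_neq0.
    move=> ->; rewrite -/e; have := expf_neq0 (q - 1) e0; have := th_neq0 C.
    by move: (eA _) (e ^+ _) => X1 Y1 t0 Y0; field; rewrite t0 Y0.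
  rewrite absvN absv_prod; apply: ler_prod => c _; rewrite absv_ge0 /=.
  have -> : eA (sval z / th) - scal c * e = eA ((scal 1 * sval z + scal (- c)) / th).
    by rewrite mulrDl -mulrA (eAD Ccomp) !(eAZ Ccomp) rmorph1 mul1r rmorphN mulNr.
  apply: eLat_le_eA Gz _ => //.
  rewrite absvM absvV absv_th ler_pdivrMr ?qR_gt0 //.
  apply: (le_trans (_ : _ <= absv (sval z))); last by rewrite ler_peMr ?absv_ge0 // ltW ?qR_gt1.
  rewrite rmorph1 mul1r; apply: absvD_le => //; rewrite az (le_trans (absv_scal_le1 _ _)) //.
apply: (le_trans (_ : _ <= absv e * absv (th^-1 * e ^+ (q - 1) * eA (sval z)) / absv (pi * eA (sval z)))).
  apply: ler_wpM2r; first by rewrite invr_ge0 absv_ge0.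
  apply: ler_pM; rewrite ?absv_ge0 //.
  by apply: prodr_ge0 => c _; apply: absv_ge0.
rewrite -absvV -!absvM le_eqVlt; apply/orP; left; apply/eqP; congr absv.
by move: (e ^+ _) => Y; field; rewrite ez0 pi0 th_neq0.
Qed.

Lemma hol_h : holomorphic h. Proof. by case: hh => -[]. Qed.

Lemma h_moebius (gam : 'M[{poly F}]_2) z w : gam \in unitmx -> moebius_rel gam z w ->
  h w = autJ gam z ^+ q.+1 * (evA (\det gam))^-1 * h z.
Proof. by case: hh => -[_ H _ _] _ ug /(H _ _ _ ug); rewrite -exprnN expr1. Qed.

Lemma h_uexp : exists (r B : R) (a : fps C), [/\ 0 < r, pbound r B a,
  forall z, absv (u z) < r -> has_eval a (u z) (h z), fcoef a 0 = 0 & fcoef a 1 = -1].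
Proof.
case: hh => _ [a [[c c0 Ha] a0 a1]].
have [z0 uz0] := u_pt Ccomp Cclosed hpi c0.
have az0 : has_eval (Fps a) (u z0) (h z0) by apply: Ha.
have [B HB] := has_eval_pbound az0.
exists (absv (u z0)), B, (Fps a); split=> //.
  by rewrite absv_gt0 (u_neq0 Ccomp Cclosed hpi).
by move=> z zu; apply: Ha; apply: lt_trans uz0.
Qed.

Lemma det_neq0 (gam : 'M[{poly F}]_2) : gam \in unitmx -> evA (\det gam) != 0.
Proof. by rewrite unitmxE evA_eq0; apply: contraTneq => ->; rewrite unitr0. Qed.

(** Near the cusp h is O(u) and [M] is O(1 / u), which is the boundedness needed by
    [liouville_const]. The constant is nonzero because [M] has no zero and h has leading coefficient
    -1. *)
Lemma hM_const : exists2 k, k != 0 & forall z, h z * M z = k.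
Proof.
have hM : holomorphic (fun z => h z * M z).
  by apply: holM => //; [exact: hol_h|exact: hol_M].
have [r [B [a [r0 aB Ha a0 a1]]]] := h_uexp.
have [K K0 HK] := M_bound.
have inv (gam : 'M[{poly F}]_2) z w : gam \in unitmx -> moebius_rel gam z w -> h w * M w = h z * M z.
  move=> ug gzw; rewrite (h_moebius ug gzw) (M_moebius Ccomp hg ug gzw).
  have J0 := autJ_neq0 z ug; have d0 := det_neq0 ug.
  by rewrite exprVn; have := expf_neq0 q.+1 J0; move: (_ ^+ _) => J J1; field; rewrite J1 d0.
have bd : exists (B : R) n0, forall n z, (n0 <= n)%N -> Gs 0 (th ^+ n) (sval z) -> absv (h z * M z) <= B.
  have [n0 Hn0] := u_G_small Ccomp Cclosed hpi r0.
  exists (B / r * K), n0 => n z nn Gz; have uz := Hn0 n z nn Gz.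
  have := has_eval_le_t (Ha z uz) (ltW uz) r0 aB a0 => le.
  have Br : 0 <= B / r by rewrite divr_ge0 ?(pbound_ge0 aB) // ltW.
  rewrite absvM; apply: (le_trans (ler_wpM2r (absv_ge0 (M z)) le)).
  rewrite -(mulrA (B / r)); apply: ler_wpM2l => //.
  by rewrite mulrC; apply: HK Gz.
have [k Hk] := liouville_const Cclosed hM inv bd.
exists k => //; apply/eqP => k0.
have h0 z : h z = 0.
  have /eqP := Hk z; rewrite k0 mulf_eq0 (negPf (M_neq0 Ccomp hg z)) orbF => /eqP//.
suff a00 : a = 0 by move: a1; rewrite a00 fcoef0 => /eqP; rewrite eq_sym oppr_eq0 oner_eq0.
apply: (fps_identity r0 aB) => eps e0.
have e1 : 0 < Num.min eps r by rewrite lt_min e0.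
have [z] := u_pt Ccomp Cclosed hpi e1; rewrite lt_min => /andP[ue ur].
by exists (u z); split=> //; [exact: u_neq0|rewrite -(h0 z); apply: Ha].
Qed.

Lemma h_neq0 z : h z != 0.
Proof.
have [k k0 Hk] := hM_const; apply: contra_neq k0 => h0.
by rewrite -(Hk z) h0 mul0r.
Qed.

Lemma hol_hV : holomorphic (fun z => (h z)^-1).
Proof.
have [k k0 Hk] := hM_const.
apply: hol_ext (holZ Cclosed k^-1 (hol_M Ccomp Cclosed)) => z.
by rewrite -(Hk z); have := h_neq0 z; have := M_neq0 Ccomp hg z => n1 n2; field; rewrite n1 n2.
Qed.

(** Dividing [psi] by its constant term removes both the weight and the determinant, so every
    coefficient is an invariant function. *)
Definition chi z : fps C := fpsC (M z)^-1 * psi z.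

Lemma chi_twist z : fpsC th * twist 1 (chi z) = (fpsC th - X) * chi z.
Proof.
have M0 := M_neq0 Ccomp hg z; have uM : fpsC (M z) \is a GRing.unit by rewrite fps_unitE.
have E := psi_twist Ccomp hg z.
have Epsi : psi z = fpsC (M z) * chi z.
  by rewrite /chi mulrA -rmorphM divff // rmorph1 mul1r.
have Etw : twist 1 (psi z) = fpsC (M z ^+ q) * twist 1 (chi z).
  by rewrite Epsi rmorphM /= twistC expn1.
have ED := gD_M Ccomp hg z.
have n0 : fpsC (M z) != 0 by apply/eqP => E0; move: uM; rewrite E0 unitr0.
apply: (mulfI n0).
transitivity (fpsC (gD pi Delta z * M z ^+ q) * twist 1 (chi z)).
  by rewrite ED [fpsC (th * M z)]rmorphM /= mulrA [fpsC th * _]mulrC.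
rewrite [fpsC (gD _ _ _ * _)]rmorphM /= -mulrA -Etw mulrC E Epsi.
by rewrite mulrCA.
Qed.

Lemma chi_coef0 z : fcoef (chi z) 0 = 1.
Proof. by rewrite fcoefCM psi0 mulVf // (M_neq0 Ccomp hg). Qed.

(** Consecutive coefficients satisfy y = theta (x - x^q). If |x| > 1 the right side has absolute
    value q |x|^q > 1, against the inductive bound on y. This bounds the coefficients on all of
    Omega without any estimate at the cusp. *)
Lemma chi_coef_le z i : absv (fcoef (chi z) i) <= 1.
Proof.
elim: i => [|i IHi]; first by rewrite chi_coef0 absv1.
have tw : fcoef (twist 1 (chi z)) i.+1 = fcoef (chi z) i.+1 ^+ q by rewrite -[in RHS](expn1 q).
have : fcoef (fpsC th * twist 1 (chi z)) i.+1 = fcoef ((fpsC th - X) * chi z) i.+1.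
  by rewrite chi_twist.
rewrite mulrBl fcoefB (fcoefCM th (twist 1 (chi z))) (fcoefCM th (chi z)) fcoefXM tw.
move: (fcoef (chi z) i.+1) (fcoef (chi z) i) IHi => x y y1 E.
rewrite leNgt; apply/negP => x1.
have x0 := absv_ge0 x.
have Ey : y = th * (x - x ^+ q) by rewrite mulrBr E; ring.
have xq : absv x < absv (x ^+ q).
  by rewrite absvX -[ltLHS]expr1 ltr_eXn2l // q_gt1.
move: y1; rewrite Ey absvM absv_th absvB_eqr // leNgt => /negP; apply.
rewrite -[X in X < _]mulr1 ltr_pM ?ler01 ?qR_gt1 //; exact: lt_trans xq.
Qed.

Lemma chi_hol i : holomorphic (fun z => fcoef (chi z) i).
Proof.
have hs1 j : holomorphic (fun z => fcoef (s1 z) j).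
  apply: hol_ext (hol_eLat Ccomp Cclosed 0 (th ^+ j.+1)^-1) => z.
  by rewrite add0r mulrC.
have hs2 j : holomorphic (fun z => fcoef (s2 z) j).
  apply: hol_ext (hol_eLat Ccomp Cclosed (1 / th ^+ j.+1) 0) => z.
  by rewrite mul0r addr0.
apply: hol_ext (_ : holomorphic (fun z => (M z)^-1 * (
   \sum_(j < i.+1) fcoef (s1 z) j * fcoef (s2 z) (i - j)%N ^+ (q ^ 1) -
   \sum_(j < i.+1) fcoef (s1 z) j ^+ (q ^ 1) * fcoef (s2 z) (i - j)%N))).
  by move=> z; rewrite fcoefCM.
apply: holM => //; first exact: (hol_MV Ccomp Cclosed hg).
apply: holB => //; apply: hol_sum => j _; apply: holM => //; exact: holX.
Qed.

Lemma chi_const : exists2 f : fps C, pbound 1 1 f & forall z, chi z = f.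
Proof.
have inv (gam : 'M[{poly F}]_2) z w : gam \in unitmx -> moebius_rel gam z w -> chi w = chi z.
  move=> ug gzw; rewrite /chi (psi_moebius Ccomp hg ug gzw) (M_moebius Ccomp hg ug gzw) (bar_det _ ug).
  have M0 := M_neq0 Ccomp hg z; have J0 := autJ_neq0 z ug; have d0 := det_neq0 ug.
  rewrite !mulrA -!rmorphM; congr (fpsC _ * _).
  by have := expf_neq0 q.+1 (invr_neq0 J0); move: (_ ^+ _) => J J1; field; rewrite J1 d0 M0.
have /boolp.choice[f Hf] : forall i, exists x, forall z, fcoef (chi z) i = x.
  move=> i; apply: (liouville_const Cclosed (chi_hol i)).
    by move=> gam z w ug gzw; rewrite (inv gam z w).
  by exists 1, 0%N => n z _ _; apply: chi_coef_le.
have [z0 _] := u_pt Ccomp Cclosed hpi ltr01.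
exists (Fps f) => [i|z]; last by apply: fpsP => i; apply: Hf.
by rewrite /= -(Hf i z0) expr1n mulr1 chi_coef_le.
Qed.

Lemma hpsi_const : exists f : fps C, [/\ Tpos f, f \is a GRing.unit & forall z, fpsC (h z) * psi z = f].
Proof.
have [k k0 Hk] := hM_const; have [f f1 Hf] := chi_const.
have fE z : fpsC (h z) * psi z = fpsC k * f.
  rewrite -(Hf z) -(Hk z) rmorphM /= -mulrA /chi [fpsC (M z) * _]mulrA -rmorphM.
  by rewrite divff ?rmorph1 ?mul1r // (M_neq0 Ccomp hg).
have [z0 _] := u_pt Ccomp Cclosed hpi ltr01.
exists (fpsC k * f); split=> //.
  apply: TposM; first exact: TposC.
  by apply/(TposP Ccomp); exists 1, 1.
by rewrite fps_unitE -(Hf z0) fcoefCM chi_coef0 mulr1.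
Qed.

End Discriminant.

(** * Unordered double series *)

Section DoubleSums.
Variables (F : finFieldType) (R : realType) (C : valuedField F R).
Implicit Types (T : nat -> nat -> C) (b : nat -> C) (l : C) (B x : R).

Definition nbox N : {fset nat * nat} :=
  [fset p in [seq (i, j) | i <- index_iota 0 N, j <- index_iota 0 N]]%fset.

Lemma in_nbox N (p : nat * nat) : (p \in nbox N) = (p.1 < N)%N && (p.2 < N)%N.
Proof.
rewrite inE; apply/allpairsP/andP => [[[a b] /= [+ + ->]]|[pI pJ]]; first by rewrite !mem_index_iota.
by exists p; split; rewrite ?mem_index_iota //; case: p {pI pJ}.
Qed.

Lemma big_nbox N (f : nat * nat -> C) :
  \sum_(p <- nbox N) f p = \sum_(i < N) \sum_(j < N) f (i : nat, j : nat).
Proof.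
rewrite (perm_big [seq (i, j) | i <- index_iota 0 N, j <- index_iota 0 N]) /=.
  by rewrite big_allpairs /= big_mkord; apply: eq_bigr => i _; rewrite big_mkord.
apply: uniq_perm; rewrite ?fset_uniq //; last by move=> p; rewrite inE.
by apply: allpairs_uniq; rewrite ?iota_uniq // => -[? ?] [? ?].
Qed.

Lemma dsum_tail T B x N (S : {fset nat * nat}) : 0 <= x <= 1 -> 0 <= B ->
  (forall n m, absv (T n m) <= B * x ^+ (n + m)) -> (nbox N `<=` S)%fset ->
  absv (\sum_(p <- S) T p.1 p.2 - \sum_(i < N) \sum_(j < N) T i j) <= B * x ^+ N.
Proof.
move=> /andP[x0 x1] B0 HT sub.
have -> : \sum_(p <- S) T p.1 p.2 = \sum_(p <- nbox N) T p.1 p.2 + \sum_(p <- (S `\` nbox N)%fset) T p.1 p.2.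
  rewrite -big_cat /=; apply: perm_big; apply: uniq_perm; first exact: fset_uniq.
    rewrite cat_uniq !fset_uniq andbT /=; apply/hasPn => p.
    by rewrite in_fsetD => /andP[].
  move=> p; rewrite mem_cat in_fsetD; case: (boolP (p \in nbox N)) => //= pN.
  exact: (fsubsetP sub _ pN).
rewrite big_nbox addrAC subrr add0r big_seq; apply: absv_sum_le => [|p].
  by rewrite mulr_ge0 ?exprn_ge0.
rewrite in_fsetD in_nbox => /andP[np _]; apply: (le_trans (HT _ _)); rewrite ler_wpM2l //.
apply: ler_wiXn2l => //; move: np; rewrite negb_and -!leqNgt.
by case/orP => le; apply: (leq_trans le); rewrite ?leq_addr ?leq_addl.
Qed.

Lemma dsum_conv T b l B x : 0 <= x < 1 ->
  (forall n m, absv (T n m) <= B * x ^+ (n + m)) ->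
  (forall n, has_sum (T n) (b n)) -> has_sum b l ->
  limto summability.totally (fun S : {fset nat * nat} => \sum_(p <- S) T p.1 p.2) l.
Proof.
move=> x01 HT Hb Hl; case/andP: (x01) => x0 x1.
have B0 : 0 <= B by have := HT 0%N 0%N; rewrite mulr1; apply: le_trans; apply: absv_ge0.
have bB n : absv (b n) <= B * x ^+ n.
  apply: (has_sum_le (Hb n)) => [|m]; first by rewrite mulr_ge0 ?exprn_ge0.
  by apply: (le_trans (HT n m)); rewrite ler_wpM2l // ler_wiXn2l ?(ltW x1) ?leq_addr.
apply/limto_totP => eps e0; have [N HN] := geom_small x01 B0 e0.
have xN : 0 <= B * x ^+ N by rewrite mulr_ge0 ?exprn_ge0.
exists (nbox N) => S sub; apply: le_lt_trans (HN _ (leqnn N)).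
have -> : \sum_(p <- S) T p.1 p.2 - l =
  (\sum_(p <- S) T p.1 p.2 - \sum_(i < N) \sum_(j < N) T i j) -
  (\sum_(i < N) (b i - \sum_(j < N) T i j)) - (l - \sum_(i < N) b i).
  by rewrite sumrB; move: (\sum_(p <- S) _) (\sum_(i < N) \sum_(j < N) _) (\sum_(i < N) b i) => ? ? ?; ring.
apply: absvB_le; first apply: absvB_le.
- by apply: (dsum_tail _ B0 HT sub); rewrite x0 ltW.
- apply: absv_sum_le => // i _; apply: (has_sum_tail (Hb i)) => // m Nm.
  apply: (le_trans (HT i m)); rewrite ler_wpM2l // ler_wiXn2l ?(ltW x1) //.
  by rewrite (leq_trans Nm) ?leq_addl.
- apply: (has_sum_tail Hl) => // m Nm; apply: (le_trans (bB m)).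
  by rewrite ler_wpM2l // ler_wiXn2l ?(ltW x1).
Qed.

Hypothesis Ccomp : Ccomplete C.

(** The geometric majorant provides an iterated sum, which [dsum_conv] and uniqueness of unordered
    limits identify with [l]. *)
Lemma dsum_inv T b l B x : 0 <= x < 1 ->
  (forall n m, absv (T n m) <= B * x ^+ (n + m)) -> (forall n, has_sum (T n) (b n)) ->
  limto summability.totally (fun S : {fset nat * nat} => \sum_(p <- S) T p.1 p.2) l ->
  has_sum b l.
Proof.
move=> x01 HT Hb Hl; case/andP: (x01) => x0 x1.
have B0 : 0 <= B by have := HT 0%N 0%N; rewrite mulr1; apply: le_trans; apply: absv_ge0.
have bB n : absv (b n) <= B * x ^+ n.
  apply: (has_sum_le (Hb n)) => [|m]; first by rewrite mulr_ge0 ?exprn_ge0.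
  by apply: (le_trans (HT n m)); rewrite ler_wpM2l // ler_wiXn2l ?(ltW x1) ?leq_addr.
have [|l' Hl'] := has_sum_ex Ccomp (a := b).
  move=> eps e0; have [N HN] := geom_small x01 B0 e0.
  by exists N => n Nn; apply: le_lt_trans (HN n Nn).
by rewrite (limto_tot_unique Hl (dsum_conv x01 HT Hb Hl')).
Qed.

(** A term outside the finite set [S0] is the difference of two partial sums within 1 of the limit;
    the remaining terms are finitely many. *)
Lemma dsum_bounded (v : nat * nat -> C) l :
  limto summability.totally (fun S : {fset nat * nat} => \sum_(p <- S) v p) l ->
  exists B : R, forall p, absv (v p) <= B.
Proof.
move=> /limto_totP/(_ 1 ltr01)[S0 HS].
exists (\sum_(p <- S0) absv (v p) + 1) => p.
have [pS|pS] := boolP (p \in S0).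
  rewrite (big_rem p) //= -addrA lerDl addr_ge0 ?ler01 //.
  by apply: sumr_ge0 => i _; apply: absv_ge0.
have h1 := HS S0 (fsubset_refl _); have h2 := HS (p |` S0)%fset (fsubsetUr _ _).
have s0 : 0 <= \sum_(p <- S0) absv (v p) by apply: sumr_ge0 => i _; apply: absv_ge0.
apply: (@le_trans _ _ 1); last by rewrite lerDr.
have -> : v p = (\sum_(i <- (p |` S0)%fset) v i - l) - (\sum_(i <- S0) v i - l).
  by rewrite big_fsetU1 //=; move: (\sum_(i <- _) _) => ?; ring.
by apply/ltW/absvB_lt.
Qed.

End DoubleSums.

(** * Regular functions *)

Section Regular.
Variables (F : finFieldType) (R : realType) (C : valuedField F R).
Local Notation q := #|F|.
Local Notation th := (theta C).
Local Notation Omega := (Omega C).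
Local Notation eval := Defs.eval.
Implicit Types (x y l t : C) (z w : Omega) (phi chi : Omega -> C) (f : Omega -> fps C) (c B : R).
Hypothesis Ccomp : Ccomplete C.
Hypothesis Cclosed : GRing.closed_field_axiom C.
Variable pi : C.
Hypothesis hpi : is_period pi.
Local Notation u := (upar pi).

(** A u-expansion of Gauss norm at most [B] on the disc of radius [c]. Recording the bound allows
    uniform statements about the family of t-coefficients. *)
Definition ub c B phi := exists2 a : fps C, pbound c B a &
  forall z, absv (u z) < c -> has_eval a (u z) (phi z).

Lemma ub_ext c B phi chi : phi =1 chi -> ub c B phi -> ub c B chi.
Proof. by move=> E [a aB Ha]; exists a => // z /Ha; rewrite E. Qed.

Lemma ub_ge0 c B phi : ub c B phi -> 0 <= B.
Proof. by case=> a /pbound_ge0. Qed.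

Lemma ub_le c c' B B' phi : 0 <= c' -> c' <= c -> B <= B' -> ub c B phi -> ub c' B' phi.
Proof.
move=> c0 cc BB [a aB Ha]; exists a; first exact: pbound_le aB.
by move=> z uz; apply: Ha; apply: lt_le_trans cc.
Qed.

Lemma ubD c B phi chi : 0 <= c -> ub c B phi -> ub c B chi -> ub c B (fun z => phi z + chi z).
Proof.
move=> c0 [a aB Ha] [b bB Hb]; exists (a + b); first exact: pboundD.
by move=> z uz; apply: has_evalD; [apply: Ha|apply: Hb].
Qed.

Lemma ubN c B phi : ub c B phi -> ub c B (fun z => - phi z).
Proof.
move=> [a aB Ha]; exists (- a); first exact: pboundN.
by move=> z uz; apply: has_evalN; apply: Ha.
Qed.

Lemma ubM c A B phi chi : 0 < c -> ub c A phi -> ub c B chi -> ub c (A * B) (fun z => phi z * chi z).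
Proof.
move=> c0 [a aB Ha] [b bB Hb]; exists (a * b); first exact: pboundM.
by move=> z uz; apply: has_evalM; [apply: Ha|apply: Hb].
Qed.

Lemma ubC c x : ub c (absv x) (fun=> x).
Proof. by exists (fpsC x); [exact: pboundC|move=> z _; apply: has_evalC]. Qed.

Lemma ubX c B phi n : 0 < c -> ub c B phi -> ub c (B ^+ n) (fun z => phi z ^+ n).
Proof.
move=> c0 bp; elim: n => [|n IHn].
  by have := ubC c 1; rewrite absv1; apply: ub_ext.
by rewrite exprS; apply: ub_ext (ubM c0 bp IHn) => z; rewrite exprS.
Qed.

Lemma ub_sum c B (I : Type) (s : seq I) (P : pred I) (phi : I -> Omega -> C) : 0 < c -> 0 <= B ->
  (forall i, P i -> ub c B (phi i)) -> ub c B (fun z => \sum_(i <- s | P i) phi i z).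
Proof.
move=> c0 B0 H; elim: s => [|i s IHs].
  apply: (@ub_ext _ _ (fun=> 0)) => [z|]; first by rewrite big_nil.
  by apply: (ub_le _ _ _ (ubC c 0)); rewrite ?absv0 ?(ltW c0).
case Pi : (P i); last by apply: ub_ext IHs => z; rewrite big_cons Pi.
by apply: ub_ext (ubD (ltW c0) (H i Pi) IHs) => z; rewrite big_cons Pi.
Qed.

Lemma ub_near c B phi : 0 < c -> ub c B phi -> forall z, absv (u z) < c -> absv (phi z) <= B.
Proof. by move=> c0 [a aB Ha] z uz; apply: has_eval_le (Ha z uz) (ltW uz) aB. Qed.

(** The double expansion in t and u, kept one t-coefficient at a time so that products and inverses
    reduce to convolutions of single series. *)
Definition uan_with c B f := forall n, ub c (B / c ^+ n) (fun z => fcoef (f z) n).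
Definition uan f := exists c B, 0 < c /\ uan_with c B f.

Lemma uan_with_le c c' B B' f : 0 < c' -> c' <= c -> B <= B' -> uan_with c B f -> uan_with c' B' f.
Proof.
move=> c0 cc BB H n; have c1 := lt_le_trans c0 cc; apply: ub_le (H n) => //; first exact: ltW.
have Bc0 := ub_ge0 (H n).
have B0 : 0 <= B by rewrite -(@pmulr_lge0 _ (c ^+ n)^-1) ?invr_gt0 ?exprn_gt0.
apply: ler_pM; rewrite ?invr_ge0 ?exprn_ge0 ?(ltW c1) // lef_pV2 ?posrE ?exprn_gt0 //.
by rewrite lerXn2r // nnegrE ltW.
Qed.

Lemma uan_with_ge0 c B f : uan_with c B f -> 0 <= B.
Proof. by move=> /(_ 0%N)/ub_ge0; rewrite expr0 divr1. Qed.

Lemma uan2 f f' : uan f -> uan f' -> exists c B, [/\ 0 < c, uan_with c B f & uan_with c B f'].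
Proof.
move=> [c [B [c0 H]]] [c' [B' [c0' H']]]; exists (Num.min c c'), (Num.max B B').
have m0 : 0 < Num.min c c' by rewrite lt_min c0.
split=> //; [apply: uan_with_le H|apply: uan_with_le H'] => //;
 by rewrite ?ge_min ?le_max lexx ?orbT.
Qed.

Lemma uanD f f' : uan f -> uan f' -> uan (f + f').
Proof.
move=> hf hf'; have [c [B [c0 H H']]] := uan2 hf hf'.
exists c, B; split=> // n; apply: ub_ext (ubD (ltW c0) (H n) (H' n)) => z.
by rewrite -fcoefD.
Qed.

Lemma uanN f : uan f -> uan (- f).
Proof. by move=> [c [B [c0 H]]]; exists c, B; split=> // n; apply: ub_ext (ubN (H n)). Qed.

Lemma uan_conv c A B f (phi : nat -> Omega -> C) n : 0 < c ->
  (forall i, (i <= n)%N -> ub c (A / c ^+ i) (phi i)) -> uan_with c B f ->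
  ub c (A * B / c ^+ n) (fun z => \sum_(i < n.+1) phi i z * fcoef (f z) (n - i)%N).
Proof.
move=> c0 H H'; have cn := exprn_gt0 n c0.
have A0 : 0 <= A by have := ub_ge0 (H 0%N isT); rewrite expr0 divr1.
have B0 := uan_with_ge0 H'.
apply: ub_sum => // [|i _]; first by rewrite divr_ge0 ?mulr_ge0 // ltW.
apply: ub_le (ubM c0 (H i _) (H' (n - i)%N)) => //; rewrite ?(ltW c0) ?leq_ord //.
have -> : c ^+ n = c ^+ i * c ^+ (n - i) by rewrite -exprD subnKC ?leq_ord.
have := gt_eqF (exprn_gt0 i c0); have := gt_eqF (exprn_gt0 (n - i) c0).
move: (c ^+ i) (c ^+ (n - i)) => x1 x2 e1 e2.
by rewrite invfM mulrACA.
Qed.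

Lemma uanM f f' : uan f -> uan f' -> uan (f * f').
Proof.
move=> hf hf'; have [c [B [c0 H H']]] := uan2 hf hf'.
exists c, (B * B); split=> // n; exact: (uan_conv (phi := fun i z => fcoef (f z) i) c0 (fun i _ => H i) H').
Qed.

Lemma uanC (a : fps C) : Tpos a -> uan (cst a).
Proof.
move=> /(TposP Ccomp)[c [B [c0 aB]]]; exists c, B; split=> // n.
apply: ub_le (ubC c (fcoef a n)); rewrite ?(ltW c0) // ler_pdivlMr ?exprn_gt0 //; exact: aB.
Qed.

Lemma uan_scalar c B phi : 0 < c -> ub c B phi -> uan (fun z => fpsC (phi z)).
Proof.
move=> c0 H; exists c, B; split=> // -[|n].
  by rewrite expr0 divr1; apply: ub_ext H => z; rewrite fcoefC.
apply: (@ub_ext _ _ (fun=> 0)) => [z|]; first by rewrite fcoefC mulr0n.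
apply: ub_le (ubC c 0); rewrite ?(ltW c0) // absv0 divr_ge0 ?(ub_ge0 H) // exprn_ge0 //; exact: ltW.
Qed.

Lemma uan_twist k f : uan f -> uan (fun z => twist k (f z)).
Proof.
move=> [c [B [c0 H]]]; set Q := (q ^ k)%N.
have cQ : 0 < c ^+ Q by rewrite exprn_gt0.
have m0 : 0 < Num.min c (c ^+ Q) by rewrite lt_min c0.
exists (Num.min c (c ^+ Q)), (B ^+ Q); split=> // n.
apply: ub_le (ubX Q c0 (H n)); rewrite ?ge_min ?lexx ?(ltW m0) //.
rewrite expr_div_n ler_wpM2l ?exprn_ge0 ?(uan_with_ge0 H) //.
rewrite lef_pV2 ?posrE ?exprn_gt0 // -exprM mulnC exprM.
by rewrite lerXn2r ?nnegrE ?(ltW m0) ?(ltW cQ) // ge_min lexx orbT.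
Qed.

Lemma uanX f n : uan f -> uan (fun z => f z ^+ n).
Proof.
move=> hf; elim: n => [|n IHn].
  have := uanC (Tpos1 C); suff -> : (fun z => f z ^+ 0) = cst 1 by [].
  by apply/funext => z; rewrite expr0.
have := uanM hf IHn; suff -> : f * (fun z => f z ^+ n) = (fun z => f z ^+ n.+1) by [].
by apply/funext => z; rewrite exprS.
Qed.

(* [g] is bounded by [D K^n / c^n] coefficientwise where [K] dominates [D B]. *)
Lemma uanV f c D : 0 < c -> ub c D (fun z => (fcoef (f z) 0)^-1) -> (forall z, fcoef (f z) 0 != 0) ->
  uan f -> uan (fun z => (f z)^-1).
Proof.
move=> c1 H1 f0 [c2 [B [c2p H2]]].
pose c' := Num.min c c2; have c0 : 0 < c' by rewrite lt_min c1.
have {}H1 : ub c' D (fun z => (fcoef (f z) 0)^-1).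
  by apply: ub_le H1; rewrite ?ge_min ?lexx ?(ltW c0).
have {}H2 : uan_with c' B f by apply: uan_with_le H2; rewrite ?ge_min ?lexx ?orbT.
move: {c c1 c2 c2p} c' c0 H1 H2 => c c0 H1 H2.
have D0 := ub_ge0 H1; have B0 := uan_with_ge0 H2.
pose K := Num.max 1 (D * B); have K1 : 1 <= K by rewrite le_max lexx.
have K0 : 0 < K by apply: lt_le_trans K1.
have rec z n : fcoef (f z)^-1 n.+1 =
    - ((fcoef (f z) 0)^-1 * \sum_(i < n.+1) fcoef (f z)^-1 i * fcoef (f z) (n.+1 - i)%N).
  have : f z * (f z)^-1 = 1 by rewrite mulrV // fps_unitE.
  move=> /(congr1 (fun a => fcoef a n.+1)); rewrite mulrC fcoefM fcoef1 big_ord_recr /= subnn.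
  move: (fcoef _ n.+1) (\sum_(i < n.+1) _) => y S /eqP; rewrite addrC addr_eq0 => /eqP E.
  by rewrite -mulrN -E [y * _]mulrC mulKf.
exists (c / K), D; split; first by rewrite divr_gt0.
have key n : forall i, (i <= n)%N -> ub c (D * K ^+ i / c ^+ i) (fun z => fcoef (f z)^-1 i).
  elim: n => [|n IHn] i.
    rewrite leqn0 => /eqP->; rewrite expr0 expr0 mulr1 divr1.
    by apply: ub_ext H1 => z; rewrite fcoefV0.
  rewrite leq_eqVlt => /orP[/eqP->|]; last by rewrite ltnS; apply: IHn.
  have cn := exprn_gt0 n.+1 c0.
  have KK j : 0 <= K ^+ j by rewrite exprn_ge0 // ltW.
  apply: (@ub_ext _ _ (fun z => - ((fcoef (f z) 0)^-1 * \sum_(i < n.+1) fcoef (f z)^-1 i * fcoef (f z) (n.+1 - i)%N))) => [z|].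
    by rewrite rec.
  apply: ubN.
  have -> : D * K ^+ n.+1 / c ^+ n.+1 = D * (K ^+ n.+1 / c ^+ n.+1) by rewrite mulrA.
  apply: ubM => //; apply: ub_sum => // [|j _]; first by rewrite divr_ge0 // ltW.
  apply: ub_le (ubM c0 (IHn j _) (H2 (n.+1 - j)%N)); rewrite ?(ltW c0) ?leq_ord //.
  have jn : (j <= n.+1)%N by rewrite ltnW.
  have -> : c ^+ n.+1 = c ^+ j * c ^+ (n.+1 - j) by rewrite -exprD subnKC.
  rewrite mulrACA invfM ler_wpM2r ?divr_ge0 ?mulr_ge0 ?invr_ge0 ?exprn_ge0 ?(ltW c0) //.
  apply: (@le_trans _ _ (K ^+ j * K)).
    by rewrite mulrAC mulrC ler_wpM2l // le_max lexx orbT.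
  by rewrite -exprSr ler_weXn2l.
move=> n; apply: ub_le (key n n (leqnn n)).
- by rewrite divr_ge0 // ltW.
- by rewrite ler_pdivrMr // ler_peMr // ltW.
- by rewrite expr_div_n invf_div mulrA.
Qed.

End Regular.

Section RegularRing.
Variables (F : finFieldType) (R : realType) (C : valuedField F R).
Local Notation q := #|F|.
Local Notation th := (theta C).
Local Notation Omega := (Omega C).
Local Notation eval := Defs.eval.
Implicit Types (x y l t : C) (z w : Omega) (phi chi : Omega -> C) (f : Omega -> fps C) (c B : R).
Hypothesis Ccomp : Ccomplete C.
Hypothesis Cclosed : GRing.closed_field_axiom C.
Variable pi : C.
Hypothesis hpi : is_period pi.
Local Notation u := (upar pi).
Local Notation regular := (@regular F R C pi).
Local Notation uan := (uan pi).
Local Notation uan_with := (uan_with pi).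
Local Notation ub := (ub pi).

(** Conditions (1) and (2) of regularity with a common radius. The values are carried by a function
    [ev], so that operations need no computation with [eval]. *)
Definition hol12 f := exists2 r : R, 0 < r & exists ev : C -> Omega -> C,
  forall t, absv t < r -> holomorphic (ev t) /\ forall z, has_eval (f z) t (ev t z).

Lemma hol12_ext f f' : f =1 f' -> hol12 f -> hol12 f'.
Proof. by move=> /funext ->. Qed.

Lemma hol12_2 f f' : hol12 f -> hol12 f' -> exists2 r : R, 0 < r & exists ev ev' : C -> Omega -> C,
  forall t, absv t < r -> [/\ holomorphic (ev t), holomorphic (ev' t),
    forall z, has_eval (f z) t (ev t z) & forall z, has_eval (f' z) t (ev' t z)].
Proof.
move=> [r r0 [ev H]] [r' r0' [ev' H']]; exists (Num.min r r'); first by rewrite lt_min r0.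
exists ev, ev' => t; rewrite lt_min => /andP[/H[h1 h2] /H'[h3 h4]]; by split.
Qed.

Lemma hol12D f f' : hol12 f -> hol12 f' -> hol12 (fun z => f z + f' z).
Proof.
move=> hf hf'; have [r r0 [ev [ev' H]]] := hol12_2 hf hf'; exists r => //.
exists (fun t z => ev t z + ev' t z) => t /H[h1 h2 h3 h4]; split; first exact: holD.
by move=> z; apply: has_evalD.
Qed.

Lemma hol12M f f' : hol12 f -> hol12 f' -> hol12 (fun z => f z * f' z).
Proof.
move=> hf hf'; have [r r0 [ev [ev' H]]] := hol12_2 hf hf'; exists r => //.
exists (fun t z => ev t z * ev' t z) => t /H[h1 h2 h3 h4]; split; first exact: holM.
by move=> z; apply: has_evalM.
Qed.

Lemma hol12N f : hol12 f -> hol12 (fun z => - f z).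
Proof.
move=> [r r0 [ev H]]; exists r => //.
exists (fun t z => - ev t z) => t /H[h1 h2]; split; first exact: holN.
by move=> z; apply: has_evalN.
Qed.

Lemma hol12C (a : fps C) : Tpos a -> hol12 (cst a).
Proof.
move=> [r r0 H]; exists r => //; exists (fun t _ => eval a t) => t /H[l Hl].
by split; [exact: hol_const|move=> z; rewrite (has_eval_eval Hl)].
Qed.

Lemma hol12X f n : hol12 f -> hol12 (fun z => f z ^+ n).
Proof.
move=> hf; elim: n => [|n IHn].
  by apply: hol12_ext (hol12C (Tpos1 C)) => z; rewrite expr0.
by apply: hol12_ext (hol12M hf IHn) => z; rewrite exprS.
Qed.

Lemma hol12_scalar phi : holomorphic phi -> hol12 (fun z => fpsC (phi z)).
Proof.
move=> hp; exists 1; first exact: ltr01.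
exists (fun _ z => phi z) => t _; split; first exact: hp.
by move=> z; apply: has_evalC.
Qed.

Lemma hol12_twist k f : hol12 f -> hol12 (fun z => twist k (f z)).
Proof.
move=> [r r0 [ev H]]; exists (r ^+ (q ^ k)); first by rewrite exprn_gt0.
have /boolp.choice[rt Hrt] := Froot Cclosed k.
exists (fun t z => ev (rt t) z ^+ (q ^ k)) => t tr.
have /H[h1 h2] : absv (rt t) < r.
  have qk : (0 < q ^ k)%N by rewrite expn_gt0 q_gt0.
  rewrite -(ltr_pXn2r qk) ?nnegrE ?absv_ge0 ?(ltW r0) //.
  by rewrite -absvX Hrt.
by split; [exact: holX|move=> z; rewrite -{1}(Hrt t); apply: has_eval_twist].
Qed.

Lemma hol12_Oinv f : hol12 f -> hol12 (fun z => f (Oinv z)).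
Proof.
move=> [r r0 [ev H]]; exists r => //; exists (fun t z => ev t (Oinv z)) => t /H[h1 h2].
by split=> //; exact: hol_Oinv.
Qed.

(** The bound on an affinoid makes the series converge uniformly there, so partial sums approximate.
    The radius [r] is common to all affinoids while [B] may grow with them. *)
Lemma hol12_coef r f : 0 < r -> (forall i, holomorphic (fun z => fcoef (f z) i)) ->
  (forall n, exists B, forall z, affinoid n z -> pbound r B (f z)) -> hol12 f.
Proof.
move=> r0 hol bd; exists r => //; exists (fun t z => eval (f z) t) => t tr.
have Hev z : has_eval (f z) t (eval (f z) t).
  have [n zn] := affinoid_ex z; have [B HB] := bd n.
  exact: (pbound_has_eval Ccomp tr (HB z zn)).
split=> //; apply: hol_lim => n eps e0; have [B0 HB0] := bd n.
have [B HB BB] : exists2 B, forall z, affinoid n z -> pbound r B (f z) & 0 <= B.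
  by exists (Num.max B0 0) => [z /HB0 fz i|]; rewrite ?le_max ?fz ?lexx ?orbT.
have tr1 : 0 <= absv t / r < 1 by rewrite divr_ge0 ?absv_ge0 ?(ltW r0) // ltr_pdivrMr // mul1r.
have [N HN] := geom_small tr1 BB e0.
exists (fun z => \sum_(i < N) fcoef (f z) i * t ^+ i) => [|z zn].
  by apply: hol_sum => i _; apply: holM => //; apply: hol_const.
apply: le_lt_trans (HN _ (leqnn N)).
have xN : 0 <= B * (absv t / r) ^+ N by rewrite mulr_ge0 ?exprn_ge0 //; case/andP: tr1.
apply: (has_sum_tail (Hev z) xN) => m Nm; rewrite absvM absvX.
apply: (@le_trans _ _ (B * (absv t / r) ^+ m)).
  rewrite expr_div_n mulrA mulrAC ler_wpM2r ?exprn_ge0 ?absv_ge0 //.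
  by rewrite ler_pdivlMr ?exprn_gt0 //; apply: HB.
by rewrite ler_wpM2l // ler_wiXn2l //; case/andP: tr1 => // _ /ltW.
Qed.

Lemma dterm_le (a t v : C) (rho B x : R) n m : 0 < rho -> absv a * rho ^+ m <= B / rho ^+ n ->
  absv t <= x * rho -> absv v <= x * rho -> absv (a * t ^+ n * v ^+ m) <= B * x ^+ (n + m).
Proof.
move=> r0 aB tx vx; rewrite !absvM !absvX.
have x0 : 0 <= x by rewrite -(pmulr_lge0 _ r0) (le_trans _ tx) ?absv_ge0.
have xr : 0 <= x * rho by rewrite mulr_ge0 // ltW.
apply: (@le_trans _ _ (absv a * (x * rho) ^+ n * (x * rho) ^+ m)).
  apply: ler_pM; rewrite ?mulr_ge0 ?exprn_ge0 ?absv_ge0 //; last first.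
    by rewrite lerXn2r // nnegrE ?absv_ge0.
  by rewrite ler_wpM2l ?absv_ge0 // lerXn2r // nnegrE ?absv_ge0.
have -> : absv a * (x * rho) ^+ n * (x * rho) ^+ m = (absv a * rho ^+ m * rho ^+ n) * x ^+ (n + m).
  by rewrite !exprMn exprD; move: (x ^+ n) (x ^+ m) (rho ^+ n) (rho ^+ m) => ? ? ? ?; ring.
by rewrite ler_wpM2r ?exprn_ge0 // -ler_pdivlMr ?exprn_gt0.
Qed.

Lemma ratio_max (t v : C) (c : R) : absv t < c -> absv v < c -> exists2 x : R, 0 <= x < 1 &
  absv t <= x * c /\ absv v <= x * c.
Proof.
move=> tc vc; have c0 : 0 < c := le_lt_trans (absv_ge0 t) tc.
exists (Num.max (absv t) (absv v) / c).
  rewrite divr_ge0 ?(ltW c0) ?le_max ?absv_ge0 //= ltr_pdivrMr // mul1r.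
  by rewrite gt_max tc.
by rewrite divfK ?gt_eqF // !le_max !lexx orbT.
Qed.

(** The delicate direction recovers coefficientwise u-expansions from one unordered double series:
    convergence at a single point bounds all its coefficients, and the series in t built from them
    agrees with [f z] at all small t, hence equals it by [fps_identity]. *)
Lemma regularE f : regular f <-> [/\ hol12 f, A_periodic f & uan f].
Proof.
split.
  case=> [[r r0 Hr] [eps e0 Heps] per [c [a [c0 H]]]]; split=> //.
    exists (Num.min r eps); first by rewrite lt_min r0.
    exists (fun t z => eval (f z) t) => t; rewrite lt_min => /andP[tr te].
    by split; [exact: Heps|move=> z; have [l Hl] := Hr z t tr; rewrite (has_eval_eval Hl)].
  have [t0 nt0 t0c] := ex_small C c0.
  have [z0 z0c] := u_pt Ccomp Cclosed hpi c0.
  have [B HB] := dsum_bounded (H z0 t0 z0c t0c).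
  (* Below both |t0| and |u(z0)|, so that boundedness of the terms at this one point becomes a Gauss
     norm in both variables. *)
  pose rho := Num.min (absv t0) (absv (u z0)).
  have rho0 : 0 < rho by rewrite lt_min !absv_gt0 nt0 (u_neq0 Ccomp Cclosed hpi).
  have rhoc : rho <= c by apply: le_trans (ltW t0c); rewrite ge_min lexx.
  have aB n m : absv (a n m) * rho ^+ m <= B / rho ^+ n.
    rewrite ler_pdivlMr ?exprn_gt0 //; apply: le_trans (HB (n, m)).
    rewrite !absvM !absvX /= -mulrA -mulrA ler_wpM2l ?absv_ge0 // mulrC.
    by apply: ler_pM; rewrite ?exprn_ge0 ?(ltW rho0) // lerXn2r ?nnegrE ?absv_ge0 ?(ltW rho0) // ge_min lexx ?orbT.
  clearbody rho.
  pose A n : fps C := Fps (a n).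
  exists rho, B; split=> // n; exists (A n) => [m|z uz]; first exact: aB.
  have Hb k : has_eval (A k) (u z) (eval (A k) (u z)).
    by apply: (pbound_has_eval Ccomp uz (B := B / rho ^+ k)) => m; apply: aB.
  suff -> : f z = Fps (fun k => eval (A k) (u z)) by apply: Hb.
  have [t1 nt1 t1r] := ex_small C r0.
  have [l1 /has_eval_pbound[B1 HB1]] := Hr z t1 t1r.
  have B0 : 0 <= B by apply: le_trans (HB (0, 0)%N); apply: absv_ge0.
  have pb : pbound rho B (Fps (fun k => eval (A k) (u z))).
    move=> k; rewrite /= -ler_pdivlMr ?exprn_gt0 //; apply: (has_eval_le (Hb k) (ltW uz)) => m.
    exact: aB.
  pose c' := Num.min rho (absv t1).
  have c'0 : 0 < c' by rewrite lt_min rho0 absv_gt0.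
  have c'r : c' <= rho by rewrite ge_min lexx.
  have c't : c' <= absv t1 by rewrite ge_min lexx orbT.
  clearbody c'.
  apply/eqP; rewrite -subr_eq0; apply/eqP.
  have pbB : pbound c' (Num.max B B1) (f z - Fps (fun k => eval (A k) (u z))).
    apply: pboundD; rewrite ?(ltW c'0) //; last apply: pboundN.
      by apply: pbound_le HB1; [exact: ltW|exact: c't|rewrite le_max lexx orbT].
    by apply: pbound_le pb; [exact: ltW|exact: c'r|rewrite le_max lexx].
  apply: (fps_identity c'0 pbB) => ee ee0.
  have m0 : 0 < Num.min ee (Num.min rho r) by rewrite !lt_min ee0 rho0.
  have [t nt] := ex_small C m0; rewrite !lt_min => /and3P[tee trho tr].
  exists t; split=> //; have [l Hl] := Hr z t tr.
  have [x x01 [tx ux]] := ratio_max trho uz.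
  rewrite -(subrr l); apply: has_evalB => //.
  have HT i j : absv (a i j * t ^+ i * u z ^+ j) <= B * x ^+ (i + j) by apply: dterm_le tx ux.
  apply: (dsum_inv Ccomp x01 HT) => [k|]; last first.
    rewrite -(has_eval_eval Hl); apply: H; first exact: lt_le_trans rhoc.
    exact: lt_le_trans rhoc.
  have := has_sumZ (t ^+ k) (Hb k); rewrite mulrC; apply: has_sum_ext => m /=.
  by rewrite mulrA [t ^+ k * _]mulrC.
case=> [[r r0 [ev H]] per [c [B [c0 Hc]]]]; split=> //.
- by exists r => // z t /H[_ h2]; exists (ev t z).
- exists r => // t /H[h1 h2]; apply: hol_ext h1 => z.
  by rewrite (has_eval_eval (h2 z)).
have /boolp.choice[A HA] : forall n, exists a : fps C, pbound c (B / c ^+ n) a /\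
    forall z, absv (u z) < c -> has_eval a (u z) (fcoef (f z) n).
  by move=> n; have [a h1 h2] := Hc n; exists a.
exists (Num.min c r), (fun n m => fcoef (A n) m); split; first by rewrite lt_min c0.
move=> z t; rewrite !lt_min => /andP[uc _] /andP[tc tr].
have [x x01 [tx ux]] := ratio_max tc uc.
have Hl := (H t tr).2 z; rewrite (has_eval_eval Hl).
have HT n m : absv (fcoef (A n) m * t ^+ n * u z ^+ m) <= B * x ^+ (n + m).
  by apply: dterm_le tx ux => //; apply: (HA n).1.
apply: (dsum_conv x01 HT _ Hl) => n.
have := has_sumZ (t ^+ n) ((HA n).2 z uc); rewrite mulrC; apply: has_sum_ext => m /=.
by rewrite mulrA [t ^+ n * _]mulrC.
Qed.

Lemma perM (T : pzRingType) (f1 f2 : Omega -> T) : A_periodic f1 -> A_periodic f2 ->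
  A_periodic (fun z => f1 z * f2 z).
Proof. by move=> h1 h2 a z w e; rewrite (h1 a z w e) (h2 a z w e). Qed.

Lemma regD f f' : regular f -> regular f' -> regular (fun z => f z + f' z).
Proof.
move=> /regularE[h1 h2 h3] /regularE[g1 g2 g3]; apply/regularE; split.
- exact: hol12D.
- by move=> a z w e; rewrite (h2 a z w e) (g2 a z w e).
- exact: uanD.
Qed.

Lemma regM f f' : regular f -> regular f' -> regular (fun z => f z * f' z).
Proof.
move=> /regularE[h1 h2 h3] /regularE[g1 g2 g3]; apply/regularE; split.
- exact: hol12M.
- exact: perM.
- exact: uanM.
Qed.

Lemma regN f : regular f -> regular (fun z => - f z).
Proof.
move=> /regularE[h1 h2 h3]; apply/regularE; split.
- exact: hol12N.
- by move=> a z w e; rewrite (h2 a z w e).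
- exact: uanN.
Qed.

Lemma regC (a : fps C) : Tpos a -> regular (cst a).
Proof. by move=> ha; apply/regularE; split; [exact: hol12C|move=> ? ?|exact: uanC]. Qed.

Lemma reg_ext f f' : f =1 f' -> regular f -> regular f'.
Proof. by move=> /funext ->. Qed.

Lemma regX f n : regular f -> regular (fun z => f z ^+ n).
Proof.
move=> /regularE[h1 h2 h3]; apply/regularE; split; first exact: hol12X.
- by move=> a z w e; rewrite (h2 a z w e).
- exact: uanX.
Qed.

Lemma reg_twist k f : regular f -> regular (fun z => twist k (f z)).
Proof.
move=> /regularE[h1 h2 h3]; apply/regularE; split; first exact: hol12_twist.
- by move=> a z w e; rewrite (h2 a z w e).
- exact: uan_twist.
Qed.

Lemma reg_sum (I : Type) (s : seq I) (P : pred I) (f : I -> Omega -> fps C) :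
  (forall i, P i -> regular (f i)) -> regular (fun z => \sum_(i <- s | P i) f i z).
Proof.
move=> H; elim: s => [|i s IHs].
  by apply: reg_ext (regC (Tpos0 C)) => z; rewrite big_nil.
case Pi : (P i); last by apply: reg_ext IHs => z; rewrite big_cons Pi.
by apply: reg_ext (regD (H i Pi) IHs) => z; rewrite big_cons Pi.
Qed.

Lemma reg_scalar c B phi : holomorphic phi -> A_periodic phi -> 0 < c -> ub c B phi ->
  regular (fun z => fpsC (phi z)).
Proof.
move=> h1 h2 c0 h3; apply/regularE; split; first exact: hol12_scalar.
- by move=> a z w e; rewrite (h2 a z w e).
- exact: uan_scalar h3.
Qed.

End RegularRing.

(** * Values at the cusp and division by h *)

Section CuspValues.
Variables (F : finFieldType) (R : realType) (C : valuedField F R).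
Local Notation q := #|F|.
Local Notation th := (theta C).
Local Notation evA := (@evA F R C).
Local Notation Omega := (Omega C).
Local Notation s1 := (@s1 F R C).
Local Notation s2 := (@s2 F R C).
Local Notation X := (@fpsX C).
Implicit Types (x y l t : C) (z w : Omega) (phi chi : Omega -> C) (f : Omega -> fps C) (c B : R) (a : {poly F}).
Hypothesis Ccomp : Ccomplete C.
Hypothesis Cclosed : GRing.closed_field_axiom C.
Variable pi : C.
Hypothesis hpi : is_period pi.
Local Notation u := (upar pi).
Local Notation uan := (uan pi).
Local Notation uan_with := (uan_with pi).
Local Notation ub := (ub pi).

(** For a function with a u-expansion this is the constant term ([ub_coef0]); as a limit it is
    compatible with operations without any expansion being tracked. *)
Definition cuspval phi x := forall eps : R, 0 < eps -> exists2 d : R, 0 < d &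
  forall z, absv (u z) < d -> absv (phi z - x) < eps.

Lemma cuspval_unique phi x y : cuspval phi x -> cuspval phi y -> x = y.
Proof.
move=> hx hy; apply/eqP; rewrite -subr_eq0; apply/eqP; apply: absv_small => eps e0.
have [d d0 Hd] := hx _ e0; have [d' d0' Hd'] := hy _ e0.
have m0 : 0 < Num.min d d' by rewrite lt_min d0.
have [z] := u_pt Ccomp Cclosed hpi m0; rewrite lt_min => /andP[/Hd h1 /Hd' h2].
have -> : x - y = (phi z - y) - (phi z - x) by ring.
exact: absvB_lt.
Qed.

Lemma cuspval_ext phi chi x : phi =1 chi -> cuspval phi x -> cuspval chi x.
Proof. by move=> /funext ->. Qed.

Lemma cuspvalC x : cuspval (fun=> x) x.
Proof. by move=> eps e0; exists 1 => // z _; rewrite subrr absv0. Qed.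

Lemma ub_coef0 c B (b : fps C) phi : 0 < c -> pbound c B b ->
  (forall z, absv (u z) < c -> has_eval b (u z) (phi z)) -> cuspval phi (fcoef b 0).
Proof.
move=> c0 bB Hb eps e0; set x := fcoef b 0.
have xB : absv x <= B by have := bB 0%N; rewrite expr0 mulr1.
have bB' : pbound c B (b - fpsC x).
  by apply: pboundD; rewrite ?(ltW c0) //; apply/pboundN/(pbound_le _ _ xB (pboundC c x)); rewrite ?(ltW c0).
have B1 : 0 < B / c + 1 by rewrite ltr_wpDl // divr_ge0 ?(ltW c0) // (pbound_ge0 bB).
exists (Num.min c (eps / (B / c + 1))); first by rewrite lt_min c0 divr_gt0.
move=> z; rewrite lt_min => /andP[uc ue].
have Hz : has_eval (b - fpsC x) (u z) (phi z - x) by apply: has_evalB; [apply: Hb|apply: has_evalC].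
apply: le_lt_trans (has_eval_le_t Hz (ltW uc) c0 bB' _) _.
  by rewrite fcoefB fcoefC mulr1n subrr.
rewrite ltr_pdivlMr // in ue.
apply: le_lt_trans ue; rewrite mulrC ler_wpM2l ?absv_ge0 // lerDl; exact: ler01.
Qed.

Lemma ub_cusp c B phi : 0 < c -> ub c B phi -> exists2 x, cuspval phi x & absv x <= B.
Proof.
move=> c0 [b bB Hb]; exists (fcoef b 0); first exact: (ub_coef0 c0 bB Hb).
by have := bB 0%N; rewrite expr0 mulr1.
Qed.

Lemma cuspvalD phi chi x y : cuspval phi x -> cuspval chi y -> cuspval (fun z => phi z + chi z) (x + y).
Proof.
move=> hx hy eps e0; have [d d0 Hd] := hx _ e0; have [d' d0' Hd'] := hy _ e0.
exists (Num.min d d') => [|z]; first by rewrite lt_min d0.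
rewrite lt_min => /andP[/Hd h1 /Hd' h2].
have -> : phi z + chi z - (x + y) = (phi z - x) + (chi z - y) by ring.
exact: absvD_lt.
Qed.

Lemma cuspvalN phi x : cuspval phi x -> cuspval (fun z => - phi z) (- x).
Proof.
move=> hx eps e0; have [d d0 Hd] := hx _ e0; exists d => // z /Hd.
by rewrite -opprD absvN.
Qed.

Lemma cuspvalM phi chi x y : cuspval phi x -> cuspval chi y -> cuspval (fun z => phi z * chi z) (x * y).
Proof.
move=> hx hy eps e0.
pose K := Num.max 1 (Num.max (absv x) (absv y)).
have K1 : 1 <= K by rewrite le_max lexx.
have xK : absv x <= K by rewrite !le_max lexx orbT.
have yK : absv y <= K by rewrite !le_max lexx !orbT.
clearbody K; have K0 : 0 < K := lt_le_trans ltr01 K1.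
have m0 : 0 < Num.min 1 (eps / K) by rewrite lt_min ltr01 divr_gt0.
have [d d0 Hd] := hx _ m0; have [d' d0' Hd'] := hy _ m0.
exists (Num.min d d') => [|z]; first by rewrite lt_min d0.
rewrite lt_min => /andP[/Hd + /Hd']; rewrite !lt_min => /andP[x1 xe] /andP[y1 ye].
have -> : phi z * chi z - x * y = (phi z - x) * (chi z - y) + x * (chi z - y) + (phi z - x) * y by ring.
have eK : eps / K * K = eps by rewrite divfK // gt_eqF.
move: (phi z - x) (chi z - y) x1 xe y1 ye => a1 a2 x1 xe y1 ye.
apply: absvD_lt; first apply: absvD_lt.
- rewrite absvM; apply: (@le_lt_trans _ _ (absv a1 * 1)); first by rewrite ler_wpM2l ?absv_ge0 ?ltW.
  rewrite mulr1; apply: lt_le_trans xe _; rewrite ler_pdivrMr // ler_peMr // ltW //.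
- rewrite absvM mulrC; apply: (@le_lt_trans _ _ (absv a2 * K)); first by rewrite ler_wpM2l ?absv_ge0.
  by rewrite -eK ltr_pM2r.
- rewrite absvM; apply: (@le_lt_trans _ _ (absv a1 * K)); first by rewrite ler_wpM2l ?absv_ge0.
  by rewrite -eK ltr_pM2r.
Qed.

Lemma cuspvalX phi x n : cuspval phi x -> cuspval (fun z => phi z ^+ n) (x ^+ n).
Proof.
move=> hx; elim: n => [|n IHn]; first by apply: cuspval_ext (cuspvalC 1).
by rewrite exprS; apply: cuspval_ext (cuspvalM hx IHn) => z; rewrite exprS.
Qed.

Lemma uan_cusp f : uan f -> exists2 x : fps C, Tpos x & forall n, cuspval (fun z => fcoef (f z) n) (fcoef x n).
Proof.
move=> [c [B [c0 H]]].
have /boolp.choice[x Hx] : forall n, exists x, cuspval (fun z => fcoef (f z) n) x /\ absv x <= B / c ^+ n.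
  by move=> n; have [x h1 h2] := ub_cusp c0 (H n); exists x.
exists (Fps x) => [|n]; last by case: (Hx n).
by apply/(TposP Ccomp); exists c, B; split=> // n; rewrite -ler_pdivlMr ?exprn_gt0 //; case: (Hx n).
Qed.

Lemma ub_inv c B phi x : 0 < c -> ub c B phi -> cuspval phi x -> x != 0 ->
  exists c' D, [/\ 0 < c', ub c' D (fun z => (phi z)^-1) & cuspval (fun z => (phi z)^-1) x^-1].
Proof.
move=> c0 [b bB Hb] hx x0.
have b0 : fcoef b 0 = x := cuspval_unique (ub_coef0 c0 bB Hb) hx.
rewrite -b0 in x0; have [c' /andP[c'0 cc] b'] := pbound_shrink c0 x0 bB.
have bi := pbound_inv c'0 x0 b'.
have Hi z : absv (u z) < c' -> has_eval b^-1 (u z) (phi z)^-1.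
  move=> uc; have [l Hl] := pbound_eval Ccomp uc bi.
  have := has_evalM Hl (Hb z (lt_le_trans uc cc)).
  rewrite mulVr ?fps_unitE // => H1.
  have E : l * phi z = 1 := has_eval_unique H1 (has_eval1 _).
  have p0 : phi z != 0 by apply/eqP => e; move/eqP: E; rewrite e mulr0 eq_sym oner_eq0.
  by rewrite -[(phi z)^-1]mul1r -E mulfK.
exists c', (absv (fcoef b 0))^-1; split=> //; first by exists b^-1.
by rewrite -b0 -fcoefV0 //; exact: (ub_coef0 c'0 bi Hi).
Qed.

Lemma ub_divu c B phi : 0 < c -> ub c B phi -> cuspval phi 0 -> ub c (B / c) (fun z => phi z / u z).
Proof.
move=> c0 [b bB Hb] h0.
have b0 : fcoef b 0 = 0 := cuspval_unique (ub_coef0 c0 bB Hb) h0.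
pose b' : fps C := Fps (fun i => fcoef b i.+1).
have bE : b = X * b' by apply: fpsP => -[|i]; rewrite fcoefXM.
have b'B : pbound c (B / c) b' by move=> i; rewrite ler_pdivlMr // -mulrA -exprSr; exact: bB.
exists b' => // z uz; have [l Hl] := pbound_eval Ccomp uz b'B.
have := Hb z uz; rewrite bE => H1.
rewrite (has_eval_unique H1 (has_evalM (has_evalX _) Hl)) mulrC mulKf //.
exact: (u_neq0 Ccomp Cclosed hpi).
Qed.

Lemma rad_ex : exists r : R, [/\ 0 < r, r * q%:R <= 1, r * absv pi <= 1 & r < 1].
Proof.
have p0 : 0 < absv pi by rewrite absv_gt0 (pi_neq0 Ccomp Cclosed hpi).
have m0 : 0 < Num.min q%:R^-1 (absv pi)^-1 by rewrite lt_min !invr_gt0 qR_gt0.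
exists (Num.min q%:R^-1 (absv pi)^-1).
have h1 : Num.min q%:R^-1 (absv pi)^-1 * q%:R <= 1 by rewrite -ler_pdivlMr ?qR_gt0 // div1r ge_min lexx.
split=> //; first by rewrite -ler_pdivlMr // div1r ge_min lexx orbT.
by apply: lt_le_trans h1; rewrite ltr_pMr // qR_gt1.
Qed.

Lemma ub_eLat : exists2 r : R, 0 < r < 1 & forall x, absv x < 1 -> ub r 1 (fun z => eLat z x) /\
  cuspval (fun z => eLat z x) (eA x).
Proof.
have [r [r0 rq rp r1]] := rad_ex; exists r; first by rewrite r0.
move=> x x1; have [b [bB b0 Hb]] := eLat_uexp Ccomp Cclosed hpi r0 rq rp x1.
split; first by exists b.
by rewrite -b0; exact: (ub_coef0 r0 bB Hb).
Qed.

Lemma absv_thV_lt1 i : absv (1 / th ^+ i.+1) < 1.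
Proof.
rewrite div1r absvV absvX absv_th invf_lt1 ?exprn_gt0 ?qR_gt0 //.
by rewrite exprn_egt1 // qR_gt1.
Qed.

Lemma uan_s2 : uan s2.
Proof.
have [r /andP[r0 r1] H] := ub_eLat; exists r, 1; split=> // n.
apply: ub_le (H _ (absv_thV_lt1 n)).1; rewrite ?(ltW r0) //.
by rewrite ler_pdivlMr ?exprn_gt0 // mul1r exprn_ile1 // ltW.
Qed.

Lemma trans_rel a z w : sval w = sval z + evA a ->
  [/\ mx22 1 a 0 1 \in unitmx, moebius_rel (mx22 1 a 0 1) z w & autJ (mx22 1 a 0 1) z = 1].
Proof.
move=> e; split; first by apply: mx22_unit; rewrite mulr1 mulr0 subr0 unitr1.
  by apply/moebius_mx22; rewrite rmorph1 rmorph0 mul1r mul0r add0r divr1.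
by rewrite /autJ !mxE /= rmorph1 rmorph0 mul0r add0r.
Qed.

Lemma hol12_s1 : hol12 s1.
Proof.
apply: (@hol12_coef _ _ _ Ccomp Cclosed 1) => // [i|n].
  apply: hol_ext (hol_eLat Ccomp Cclosed 0 (th ^+ i.+1)^-1) => z.
  by rewrite add0r mulrC.
eexists => z zn i; rewrite expr1n mulr1.
have zq : absv (sval z / th ^+ i.+1) < q%:R ^+ n.
  case: zn => zn _; rewrite absvM; apply: le_lt_trans (ler_wpM2r (absv_ge0 _) zn) _.
  by rewrite gtr_pMr ?absv_th_neq0 // -[_^-1]div1r absv_thV_lt1.
apply: (le_trans (eLat_bound Ccomp zn zq)).
by apply: ler_wpM2r (ltW zq); rewrite exprn_ge0 // exprn_ge0 // ltW ?qR_gt0.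
Qed.

Lemma hol12_s2 : hol12 s2.
Proof.
apply: (@hol12_coef _ _ _ Ccomp Cclosed 1) => // [i|n].
  apply: hol_ext (hol_eLat Ccomp Cclosed (1 / th ^+ i.+1) 0) => z.
  by rewrite mul0r addr0.
eexists => z zn i; rewrite expr1n mulr1.
have zq : absv (1 / th ^+ i.+1) < q%:R ^+ 0 by exact: absv_thV_lt1.
apply: (le_trans (eLat_bound Ccomp zn zq)).
by apply: ler_wpM2r (ltW zq); rewrite exprn_ge0 // exprn_ge0 // ltW ?qR_gt0.
Qed.

Variables g Delta h : Omega -> C.
Hypothesis hg : is_g_Delta pi g Delta.
Hypothesis hh : is_h pi h.
Local Notation gG := (gG pi g).
Local Notation gD := (gD pi Delta).
Local Notation regular := (@regular F R C pi).

Lemma per_s2 : A_periodic s2.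
Proof.
move=> a z w e; have [h1 h2 h3] := trans_rel e.
rewrite (s2_moebius Ccomp hg h1 h2) h3 invr1 rmorph1 mul1r !mxE /=.
by rewrite rmorph0 mul0r add0r rmorph1 mul1r.
Qed.

Lemma reg_s2 : regular s2.
Proof. by apply/regularE => //; split; [exact: hol12_s2|exact: per_s2|exact: uan_s2]. Qed.

Lemma per_h : A_periodic h. Proof. by case: hh => -[]. Qed.

Lemma ub_h : exists2 c : R, 0 < c & exists B, [/\ ub c B h, cuspval h 0 & cuspval (fun z => h z / u z) (-1)].
Proof.
have [r [B [b [r0 bB Hb b0 b1]]]] := h_uexp Ccomp Cclosed hpi hh.
exists r => //; exists B.
have ch0 : cuspval h 0 by rewrite -b0; exact: (ub_coef0 r0 bB Hb).
split=> //; first by exists b.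
pose b' : fps C := Fps (fun i => fcoef b i.+1).
have bE : b = X * b' by apply: fpsP => -[|i]; rewrite fcoefXM.
have b'B : pbound r (B / r) b' by move=> i; rewrite ler_pdivlMr // -mulrA -exprSr; exact: bB.
rewrite -b1 -[fcoef b 1]/(fcoef b' 0); apply: (ub_coef0 r0 b'B) => z uz.
have [l Hl] := pbound_eval Ccomp uz b'B; have := Hb z uz; rewrite bE => H1.
rewrite (has_eval_unique H1 (has_evalM (has_evalX _) Hl)) mulrC mulKf //.
exact: (u_neq0 Ccomp Cclosed hpi).
Qed.

Lemma reg_h : regular (fun z => fpsC (h z)).
Proof.
have [c c0 [B [H _ _]]] := ub_h; apply: (reg_scalar Ccomp Cclosed hpi (hol_h hh) per_h c0 H).
Qed.

(** h / u takes the value -1 at the cusp, so its inverse is bounded there and dividing by h costs no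
    more than dividing by u. The factor [K] does not depend on [phi], as is needed to divide all
    t-coefficients at once. *)
Lemma ub_divh : exists2 ch : R, 0 < ch & exists K : R, forall c B phi, 0 < c -> c <= ch -> ub c B phi ->
  cuspval phi 0 -> ub c (B / c * K) (fun z => phi z / h z).
Proof.
have [c c0 [B [H h0 h1]]] := ub_h.
have m1 : (-1 : C) != 0 by rewrite oppr_eq0 oner_eq0.
have [c' [K [c'0 HK _]]] := ub_inv c0 (ub_divu c0 H h0) h1 m1.
exists c' => //; exists K => d D phi d0 dc hp p0.
apply: ub_ext (ubM d0 (ub_divu d0 hp p0) (ub_le (ltW d0) dc (lexx _) HK)) => z.
by rewrite invf_div mulrA divfK // (u_neq0 Ccomp Cclosed hpi).
Qed.

Lemma reg_divh f : regular f -> (forall n, cuspval (fun z => fcoef (f z) n) 0) ->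
  regular (fun z => fpsC (h z)^-1 * f z).
Proof.
move=> /(regularE Ccomp Cclosed hpi)[h1 h2 [c [B [c0 Hc]]]] f0; apply/(regularE Ccomp Cclosed hpi); split.
- apply: hol12M => //; apply: hol12_scalar.
  exact: (hol_hV Ccomp Cclosed hpi hg hh).
- by move=> a z w e; rewrite (h2 a z w e) (per_h e).
have [ch ch0 [K HK]] := ub_divh; have m0 : 0 < Num.min c ch by rewrite lt_min c0.
have mc : Num.min c ch <= c by rewrite ge_min lexx.
have mh : Num.min c ch <= ch by rewrite ge_min lexx orbT.
move: (Num.min c ch) m0 mc mh => d d0 dc dh.
exists d, (B / d * K); split=> // n.
have := HK _ _ _ d0 dh (uan_with_le d0 dc (lexx _) Hc n) (f0 n).
have -> : B / d ^+ n / d * K = B / d * K / d ^+ n by rewrite [B / d ^+ n / d]mulrAC [LHS]mulrAC.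
by apply: ub_ext => z; rewrite fcoefCM mulrC.
Qed.

Lemma e1_cusp : exists c B, [/\ 0 < c, ub c B (@e1 F R C) & cuspval (@e1 F R C) (eA th^-1)].
Proof.
have [r /andP[r0 _] H] := ub_eLat; exists r, 1; have [] := H th^-1; last by split.
by have := absv_thV_lt1 0; rewrite expr1 div1r.
Qed.

Lemma uan_s2V : uan (fun z => (s2 z)^-1).
Proof.
have [c [B [c0 H1 H2]]] := e1_cusp.
have [c' [D [c'0 H' _]]] := ub_inv c0 H1 H2 (eA_thV_neq0 Ccomp).
apply: (uanV c'0 _ _ uan_s2) => [|z].
  by apply: ub_ext H' => z; rewrite -s2_0.
by rewrite s2_0 (e1_neq0 Ccomp).
Qed.

Lemma s2_unit z : s2 z \is a GRing.unit.
Proof. by rewrite fps_unitE s2_0 (e1_neq0 Ccomp). Qed.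

(** [gD] is a multiple of h^(q-1) and vanishes at the cusp, so the torsion equation of [e1] leaves
    the nonzero value - theta / e_A(1 / theta)^(q-1). *)
Lemma gG_cusp : exists c B x, [/\ 0 < c, ub c B gG, cuspval gG x & x != 0].
Proof.
have [c1 [B1 [c10 H1 H1']]] := e1_cusp.
have [c2 [D [c20 H2 H2']]] := ub_inv c10 H1 H1' (eA_thV_neq0 Ccomp).
have [c3 c30 [B3 [H3 H3' _]]] := ub_h.
have [k k0 Hk] := hM_const Ccomp Cclosed hpi hg hh.
pose c := Num.min c1 (Num.min c2 c3).
have c0 : 0 < c by rewrite !lt_min c10 c20.
have {}H1 : ub c B1 (@e1 F R C) by apply: ub_le H1; rewrite ?(ltW c0) // ge_min lexx.
have {}H2 : ub c D (fun z => (e1 z)^-1) by apply: ub_le H2; rewrite ?(ltW c0) // !ge_min lexx orbT.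
have {}H3 : ub c B3 h by apply: ub_le H3; rewrite ?(ltW c0) // !ge_min lexx !orbT.
have gE z : gG z = - (th + th * (k^-1 * h z) ^+ (q - 1) * e1 z ^+ (q ^ 2 - 1)) * (e1 z)^-1 ^+ (q - 1).
  have -> : k^-1 * h z = (M z)^-1 by rewrite -(Hk z) invfM mulrAC mulVf ?mul1r // (h_neq0 Ccomp Cclosed hpi hg hh).
  by rewrite (gGE Ccomp hg) (gDE Ccomp hg) !exprVn.
clearbody c.
have q1 : (0 < q - 1)%N by rewrite subn_gt0 q_gt1.
exists c; eexists; exists (- (th + th * (k^-1 * 0) ^+ (q - 1) * eA th^-1 ^+ (q ^ 2 - 1)) * (eA th^-1)^-1 ^+ (q - 1)).
split=> //.
- apply: (ub_ext (fsym gE)); apply: ubM => //; last exact: (ubX _ c0 H2).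
  apply: ubN; apply: (@ubD _ _ _ _ _ (Num.max (absv th) (absv th * (absv k^-1 * B3) ^+ (q - 1) * B1 ^+ (q ^ 2 - 1)))); first exact: ltW.
    by apply: ub_le (ubC _ c th); rewrite ?(ltW c0) // le_max lexx.
  apply: (@ub_le _ _ _ _ c _ (absv th * (absv k^-1 * B3) ^+ (q - 1) * B1 ^+ (q ^ 2 - 1))); rewrite ?(ltW c0) ?le_max ?lexx ?orbT //.
  apply: ubM => //; last exact: (ubX _ c0 H1).
  apply: ubM => //; first exact: ubC.
  by apply: ubX => //; apply: ubM => //; exact: ubC.
- apply: (cuspval_ext (fsym gE)); apply: cuspvalM; last exact: cuspvalX.
  apply: cuspvalN; apply: cuspvalD; first exact: cuspvalC.
  apply: cuspvalM; last exact: cuspvalX.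
  apply: cuspvalM; first exact: cuspvalC.
  by apply: cuspvalX; apply: cuspvalM => //; exact: cuspvalC.
- rewrite mulr0 expr0n -[(q - 1)%N == 0%N]negbK -lt0n q1 /= mulr0 mul0r addr0.
  by rewrite mulf_neq0 ?oppr_eq0 ?th_neq0 // expf_neq0 // invr_neq0 // eA_thV_neq0.
Qed.

Lemma det_Frob (gam : 'M[{poly F}]_2) : gam \in unitmx -> evA (\det gam) ^+ (q - 1) = 1.
Proof.
move=> ug; move: (ug); rewrite unitmxE poly_unitE; case/andP => /size_poly1P[d d0 ->] _.
rewrite evAC; have s0 : vf_scal C d != 0 by rewrite fmorph_eq0.
by apply: (mulfI s0); rewrite mulr1 -exprS subn1 prednK ?q_gt0 // scal_Frobq.
Qed.

(** Evaluates e_w at theta times 1 / theta in two ways, through w and through z. The weight of Delta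
    is known from [gDE]; cancelling the linear and the q^2 terms leaves that of g. *)
Lemma gG_moebius (gam : 'M[{poly F}]_2) z w : gam \in unitmx -> moebius_rel gam z w ->
  gG w = autJ gam z ^+ (q - 1) * gG z.
Proof.
move=> ug gzw; have J0 := autJ_neq0 z ug; set J := autJ gam z in J0 *.
have E x : eLat w x = J^-1 * eLat z (J * x) by apply: (eLat_moebius Ccomp x ug gzw).
have DE : gD w = J ^+ (q ^ 2 - 1) * gD z.
  rewrite !(gDE Ccomp hg) (M_moebius Ccomp hg ug gzw); have dF := det_Frob ug.
  move: (evA (\det gam)) (M z) dF => d m dF.
  have -> : (J^-1 ^+ q.+1 * d * m)^-1 = J ^+ q.+1 * d^-1 * m^-1 by rewrite !invfM exprVn invrK.
  rewrite !exprMn [d^-1 ^+ _]exprVn dF invr1 mulr1 -exprM mulrCA; congr (_ ^+ _ * _).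
  by rewrite -[in RHS](exp1n 2) subn_sqr mulnC addn1.
have y0 := e1_neq0 Ccomp w.
have H1 := eLat_th hg w th^-1.
have H2 : eLat w (th * th^-1) = J^-1 * Phi pi g Delta z (J * e1 w).
  by rewrite E [J * (th * _)]mulrCA (eLat_th hg) [e1 w]E mulVKf.
rewrite H1 /Phi -[eLat w _]/(e1 w) in H2; move: (e1 w) y0 H2 => y y0.
rewrite DE !mulrDr => H2.
have Jq n : (0 < n)%N -> J^-1 * (J * y) ^+ n = J ^+ (n - 1) * y ^+ n.
  by case: n => // n _; rewrite exprMn exprS subn1 /= mulrA mulKf.
move: H2; rewrite (mulrCA J^-1 th) (mulrCA J^-1 (gG z)) (mulrCA J^-1 (gD z)) mulKf // !Jq ?q_gt0 ?expn_gt0 ?q_gt0 // => H2.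
apply: (mulIf (expf_neq0 q y0)).
move: H2; rewrite [gD z * _]mulrA [gD z * _]mulrC => /addIr/addrI ->.
by rewrite mulrCA mulrA.
Qed.

End CuspValues.

Lemma inf_roots_eq0 (D : idomainType) (p : {poly D}) (v : nat -> D) :
  injective v -> (forall n, root p (v n)) -> p = 0.
Proof.
move=> vi rp; apply/eqP/negPn/negP => p0.
have ar : all (root p) [seq v i | i <- iota 0 (size p)] by apply/allP => _ /mapP[i _ ->].
have := max_poly_roots p0 ar; rewrite size_map size_iota ltnn map_inj_uniq // iota_uniq.
by move=> /(_ isT).
Qed.

Lemma horner_add (A : comNzRingType) (p : {poly A}) a b : exists s, p.[a + b] = p.[a] + b * s.
Proof.
elim/poly_ind: p => [|p c [s IHp]]; first by exists 0; rewrite !horner0 mulr0 addr0.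
exists (p.[a] + s * (a + b)); rewrite !hornerMXaddC IHp; ring.
Qed.

(** * Polynomials in three variables and independence of the automorphy factors *)

Section TriplePoly.
Variable K : idomainType.
Local Notation p3 := {poly {poly {poly K}}}.
Implicit Types (P Q : p3) (a x y w : K).

(* The outer variable is evaluated at [w], the middle one at [y], the inner one at [x]. *)
Definition ev3 x y w P : K := P.[w%:P%:P].[y%:P].[x].
Definition c3 P i j k : K := P`_i`_j`_k.
Definition mono3 a i j k : p3 := ((a%:P * 'X^k)%:P * 'X^j)%:P * 'X^i.

Lemma ev3D x y w P Q : ev3 x y w (P + Q) = ev3 x y w P + ev3 x y w Q.
Proof. by rewrite /ev3 !hornerD. Qed.

Lemma ev3N x y w P : ev3 x y w (- P) = - ev3 x y w P.
Proof. by rewrite /ev3 !hornerN. Qed.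

Lemma ev3M x y w P Q : ev3 x y w (P * Q) = ev3 x y w P * ev3 x y w Q.
Proof. by rewrite /ev3 !hornerM. Qed.

Lemma ev3X x y w P n : ev3 x y w (P ^+ n) = ev3 x y w P ^+ n.
Proof. by rewrite /ev3 !horner_exp. Qed.

Lemma ev3_0 x y w : ev3 x y w 0 = 0.
Proof. by rewrite /ev3 !horner0. Qed.

Lemma ev3_sum x y w (I : Type) (r : seq I) (p : pred I) (f : I -> p3) :
  ev3 x y w (\sum_(i <- r | p i) f i) = \sum_(i <- r | p i) ev3 x y w (f i).
Proof. by rewrite /ev3 !horner_sum. Qed.

Lemma ev3_mono x y w a i j k : ev3 x y w (mono3 a i j k) = a * x ^+ k * y ^+ j * w ^+ i.
Proof. by rewrite /ev3 /mono3 !(hornerM, hornerXn, hornerC, horner_exp). Qed.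

Lemma c3D P Q i j k : c3 (P + Q) i j k = c3 P i j k + c3 Q i j k.
Proof. by rewrite /c3 !coefD. Qed.

Lemma c3M P Q i j k : c3 (P * Q) i j k = \sum_(i1 < i.+1) \sum_(j1 < j.+1) \sum_(k1 < k.+1)
  c3 P i1 j1 k1 * c3 Q (i - i1) (j - j1) (k - k1).
Proof.
rewrite /c3 coefM !coef_sum; apply: eq_bigr => i1 _.
rewrite coefM coef_sum; apply: eq_bigr => j1 _.
by rewrite coefM.
Qed.

Lemma c3_sum (I : Type) (r : seq I) (p : pred I) (f : I -> p3) i j k :
  c3 (\sum_(l <- r | p l) f l) i j k = \sum_(l <- r | p l) c3 (f l) i j k.
Proof. by rewrite /c3 !coef_sum. Qed.

Lemma c3_mono a i j k i' j' k' : c3 (mono3 a i j k) i' j' k' =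
  a *+ [&& i' == i, j' == j & k' == k].
Proof.
rewrite /c3 /mono3 coefCM coefXn; case: eqP => _; last by rewrite mulr0 !coef0.
rewrite mulr1 coefCM coefXn; case: eqP => _; last by rewrite mulr0 coef0.
by rewrite mulr1 coefCM coefXn mulr_natr.
Qed.

Lemma c3P P Q : (forall i j k, c3 P i j k = c3 Q i j k) -> P = Q.
Proof. by move=> H; apply/polyP => i; apply/polyP => j; apply/polyP => k; apply: H. Qed.

Lemma ev3_wide E x y w P : (forall i j k, c3 P i j k != 0 -> [&& i < E, j < E & k < E]%N) ->
  ev3 x y w P = \sum_(i < E) \sum_(j < E) \sum_(k < E) c3 P i j k * x ^+ k * y ^+ j * w ^+ i.
Proof.
move=> H.
have s1 i j : (size (P`_i`_j)%R <= E)%N.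
  apply/leq_sizeP => k Ek; apply/eqP/negPn/negP => /H/and3P[_ _].
  by rewrite ltnNge Ek.
have s2 i : (size (P`_i)%R <= E)%N.
  apply/leq_sizeP => j Ej; apply/polyP => k; rewrite coef0; apply/eqP/negPn/negP => /H/and3P[_].
  by rewrite ltnNge Ej.
have s3 : (size P <= E)%N.
  apply/leq_sizeP => i Ei; apply/polyP => j; apply/polyP => k; rewrite !coef0.
  by apply/eqP/negPn/negP => /H/and3P[]; rewrite ltnNge Ei.
rewrite /ev3 (horner_coef_wide _ s3) !horner_sum; apply: eq_bigr => i _.
rewrite -!polyC_exp !hornerM !hornerC (horner_coef_wide _ (s2 i)) horner_sum mulr_suml; apply: eq_bigr => j _.
rewrite -!polyC_exp hornerM hornerC (horner_coef_wide _ (s1 i j)) !mulr_suml; apply: eq_bigr => k _.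
by [].
Qed.

End TriplePoly.

Section Independence.
Variables (F : finFieldType) (R : realType) (C : valuedField F R).
Local Notation evA := (@evA F R C).
Local Notation bar := (@bar F R C).
Local Notation K := (fps C).
Local Notation X := (@fpsX C).
Implicit Types (c d k : {poly F}) (x : C).

Lemma bar_inj : injective bar.
Proof.
move=> a b /(congr1 (@fcoef C)) E; apply/polyP => i.
by have := congr1 (fun v => v i) E => /fmorph_inj.
Qed.

Lemma bar_Xn n : bar 'X^n = X ^+ n.
Proof.
rewrite rmorphXn /=; congr (_ ^+ _); apply: fpsP => i.
by rewrite bar_coef coefX fcoefX rmorph_nat.
Qed.

Lemma polyFX_inj : injective (fun n => 'X^n : {poly F}).
Proof. by move=> m n /(congr1 (fun p : {poly F} => size p)); rewrite !size_polyXn => -[]. Qed.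

(* Taking [k] divisible by a high power of the variable moves [J] through infinitely many
   values while fixing the middle argument modulo any given power of [t]. *)
Lemma indep_J (Q : {poly {poly K}}) c (y : K) x : c != 0 ->
  (forall k, Q.[(y + bar (c * k))%:P].[fpsC (x + evA (c * k))] = 0) -> Q.[y%:P] = 0.
Proof.
move=> c0 H; set p := Q.[y%:P].
apply/polyP => j; rewrite coef0; apply: fpsP => i; rewrite fcoef0.
pose r : {poly C} := \poly_(j < size p) fcoef p`_j i.
suff r0 : r = 0.
  have := congr1 (fun v : {poly C} => v`_j) r0; rewrite coef_poly coef0; case: ltnP => // sj _.
  by rewrite [p`_j]nth_default // fcoef0.
apply: (@inf_roots_eq0 _ _ (fun n => x + evA (c * ('X^(i.+1) * 'X^n)))).
  by move=> m n /addrI/evA_inj/(mulfI c0)/(mulfI _)/polyFX_inj -> //; rewrite monic_neq0 ?monicXn.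
move=> n; set k := c * _; have := H ('X^(i.+1) * 'X^n); rewrite -/k.
rewrite polyCD; have [s ->] := horner_add Q y%:P (bar k)%:P; rewrite -/p.
have kE : bar k = X ^+ i.+1 * bar (c * 'X^n) by rewrite /k mulrCA [LHS]rmorphM /= bar_Xn.
rewrite hornerD hornerM hornerC kE -[X ^+ _ * _ * _]mulrA; set x' := x + _.
move: (bar (c * _) * s.[_]) => b /eqP; rewrite addr_eq0 => /eqP E.
have : fcoef p.[fpsC x'] i = 0 by rewrite E fcoefN fcoefMXn ltnSn oppr0.
rewrite horner_coef fcoef_sum /root horner_poly => e; apply/eqP; rewrite -[RHS]e.
apply: eq_bigr => l _; have -> : fpsC x' ^+ l = fpsC (x' ^+ l) by rewrite rmorphXn.
by rewrite [p`_l * _]mulrC fcoefCM mulrC.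
Qed.

(** The variables are treated from the outside in: c runs through the powers of the indeterminate;
    for fixed c the parameter [k] is a power plus a correction, the power moving the middle argument
    through infinitely many values and the correction serving [indep_J] for the inner one. *)
Lemma indep3 (P : {poly {poly {poly K}}}) (z sg : K) (z0 : C) :
  (forall c k, ev3 (fpsC (evA c * z0 + evA (1 + c * k))) (bar c * sg + bar (1 + c * k)) (bar c) P = 0) ->
  P = 0.
Proof.
move=> H; apply: (@inf_roots_eq0 _ _ (fun n => (bar 'X^n)%:P%:P)).
  by move=> m n /polyC_inj/polyC_inj/bar_inj/polyFX_inj.
move=> n; set c := 'X^n; have c0 : c != 0 by rewrite monic_neq0 ?monicXn.
apply/eqP; apply: (@inf_roots_eq0 _ _ (fun m => (bar c * sg + bar (1 + c * 'X^m))%:P)).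
  by move=> m m' /polyC_inj/addrI/bar_inj/addrI/(mulfI c0)/polyFX_inj.
move=> m; apply/eqP.
apply: (@indep_J _ c _ (evA c * z0 + evA (1 + c * 'X^m)) c0) => k.
have := H c ('X^m + k); rewrite /ev3 [c * (_ + k)]mulrDr addrA ![_ (1 + _ + c * k)]rmorphD /=.
by rewrite !addrA.
Qed.

End Independence.

(** * Generated subalgebras *)

Section TalgTheory.
Variables (F : finFieldType) (R : realType) (C : valuedField F R).
Local Notation Omega := (Omega C).
Implicit Types (S B : set (Omega -> fps C)) (f : Omega -> fps C).

Lemma Talg_ind S B : Tsubalgebra B -> S `<=` B -> Talg S `<=` B.
Proof. by move=> hB SB f; apply; split. Qed.

Lemma Talg_sub S : S `<=` Talg S.
Proof. by move=> f Sf B [_]; apply. Qed.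

Lemma Talg_alg S : Tsubalgebra (Talg S).
Proof.
split=> [c hc|f f' hf hf'|f f' hf hf'] B [hB SB]; have [h1 h2 h3] := hB; first exact: h1.
  by apply: h2; [apply: hf|apply: hf'].
by apply: h3; [apply: hf|apply: hf'].
Qed.

Lemma Talg_ext S f f' : f =1 f' -> Talg S f -> Talg S f'.
Proof. by move=> /funext ->. Qed.

Lemma TalgC S (a : fps C) : Tpos a -> Talg S (cst a).
Proof. by case: (Talg_alg S) => h _ _ /h. Qed.

Lemma TalgD S f f' : Talg S f -> Talg S f' -> Talg S (fun z => f z + f' z).
Proof. by case: (Talg_alg S) => _ h _; apply: h. Qed.

Lemma TalgM S f f' : Talg S f -> Talg S f' -> Talg S (fun z => f z * f' z).
Proof. by case: (Talg_alg S) => _ _ h; apply: h. Qed.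

Lemma TalgX S f n : Talg S f -> Talg S (fun z => f z ^+ n).
Proof.
move=> hf; elim: n => [|n IHn]; last first.
  by apply: Talg_ext (TalgM hf IHn) => z; rewrite exprS.
have -> : (fun z => f z ^+ 0) = cst 1 by apply/funext => z; rewrite expr0.
exact: TalgC (Tpos1 C).
Qed.

Lemma TalgZ S (a : fps C) f : Tpos a -> Talg S f -> Talg S (fun z => a * f z).
Proof. by move=> ha hf; apply: TalgM hf; exact: (TalgC ha). Qed.

Lemma TalgB S f f' : Talg S f -> Talg S f' -> Talg S (fun z => f z - f' z).
Proof.
move=> hf hf'; apply: Talg_ext (TalgD hf (TalgZ (TposN (Tpos1 C)) hf')) => z.
by rewrite mulN1r.
Qed.

Lemma Talg_mono S S' : S `<=` Talg S' -> Talg S `<=` Talg S'.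
Proof. by move=> h; apply: Talg_ind => //; exact: Talg_alg. Qed.

End TalgTheory.

(** * Transformation of s_2, g and h, and first members of Mhat *)

Section ModularForms.
Variables (F : finFieldType) (R : realType) (C : valuedField F R).
Local Notation q := #|F|.
Local Notation th := (theta C).
Local Notation evA := (@evA F R C).
Local Notation bar := (@bar F R C).
Local Notation Omega := (Omega C).
Local Notation s1 := (@s1 F R C).
Local Notation s2 := (@s2 F R C).
Local Notation psi := (@psi F R C).
Local Notation X := (@fpsX C).
Implicit Types (x y : C) (z w : Omega) (f : Omega -> fps C) (a : {poly F}) (gam : 'M[{poly F}]_2).
Hypothesis Ccomp : Ccomplete C.
Hypothesis Cclosed : GRing.closed_field_axiom C.
Variable pi : C.
Hypothesis hpi : is_period pi.
Variables g Delta h : Omega -> C.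
Hypothesis hg : is_g_Delta pi g Delta.
Hypothesis hh : is_h pi h.
Local Notation gG := (gG pi g).
Local Notation gD := (gD pi Delta).
Local Notation regular := (@regular F R C pi).
Local Notation Mhat := (@Mhat F R C pi).

Lemma thX_unit : (fpsC th - X : fps C) \is a GRing.unit.
Proof. by rewrite fps_unitE fcoefB fcoefC fcoefX mulr1n subr0 th_neq0. Qed.

Lemma Tpos_thX : Tpos (fpsC th - X : fps C).
Proof. by apply: TposD; [exact: TposC|apply/TposN/TposX]. Qed.

Lemma s2_bJ gam z w : gam \in unitmx -> moebius_rel gam z w ->
  s2 w = fpsC (autJ gam z)^-1 * bJ gam z * s2 z.
Proof.
move=> ug gzw; rewrite (s2_moebius Ccomp hg ug gzw) -mulrA; congr (_ * _).
by rewrite /bJ mulrDl -[bar (gam 1 0) * _ * _]mulrA divrK // (s2_unit Ccomp).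
Qed.

Lemma bJ_unit gam z : gam \in unitmx -> bJ gam z \is a GRing.unit.
Proof.
move=> ug; have [w gzw] := moebius_ex z ug; have := s2_unit Ccomp w.
by rewrite (s2_bJ ug gzw) !unitrM => /andP[/andP[]].
Qed.

(** Read backwards, the definition of bold L expresses c(t) as (theta - t) s_2 times bold J bold L,
    which converts polynomials in bold L into polynomials in c(t). *)
Lemma bar_bL gam z : gam \in unitmx ->
  bar (gam 1 0) = (fpsC th - X) * (s2 z * (bJ gam z * bL gam z)).
Proof.
move=> ug; have E : bar (gam 1 0) * s1 z + bar (gam 1 1) * s2 z = bJ gam z * s2 z.
  by rewrite /bJ mulrDl -[bar (gam 1 0) * _ * _]mulrA divrK // (s2_unit Ccomp).
rewrite /bL E; have u1 := thX_unit; have u2 := bJ_unit z ug; have u3 := s2_unit Ccomp z.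
move: (fpsC th - X) (bJ gam z) (s2 z) u1 u2 u3 => T J s u1 u2 u3.
rewrite mulrA [T * s * _]mulrA [T * s * J]mulrAC mulrC -[T * J * s]mulrA.
by rewrite divrK // !unitrM u1 u2 u3.
Qed.

(** The twist fixes c(t) and d(t), so c(t) s_1^(1) + d(t) s_2^(1) differs from bold J s_2^(1) by a
    multiple of the determinant [psi]; this is the first-order term in bold L. *)
Lemma twist1_s2 gam z w : gam \in unitmx -> moebius_rel gam z w ->
  twist 1 (s2 w) = fpsC ((autJ gam z)^-1 ^+ q) * (bJ gam z * (twist 1 (s2 z) - (fpsC th - X) * (psi z * bL gam z))).
Proof.
move=> ug gzw; rewrite (s2_moebius Ccomp hg ug gzw) rmorphM /= twistC expn1 rmorphD !rmorphM /= !twist_bar.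
congr (_ * _); have u3 := s2_unit Ccomp z; apply: (mulIr u3).
have E : bar (gam 1 0) * s1 z + bar (gam 1 1) * s2 z = bJ gam z * s2 z.
  by rewrite /bJ mulrDl -[bar (gam 1 0) * _ * _]mulrA divrK.
have -> : bJ gam z * (twist 1 (s2 z) - (fpsC th - X) * (psi z * bL gam z)) * s2 z =
  (bJ gam z * s2 z) * twist 1 (s2 z) - bar (gam 1 0) * psi z.
  rewrite (bar_bL z ug); move: (bJ gam z) (s2 z) (twist 1 (s2 z)) (fpsC th - X) (psi z) (bL gam z) => *; ring.
rewrite -E /psi; ring.
Qed.

Lemma Mhat_le0 mu nu m f : regular f -> (forall gam z w, gam \in unitmx -> moebius_rel gam z w ->
  f w = fpsC (evA (\det gam)) ^ (- m) * fpsC (autJ gam z) ^ mu * bJ gam z ^ nu * f z) ->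
  Mhat_le pi 0 mu nu m f.
Proof.
move=> rf H; split=> //; exists (fun _ => f); split=> // gam z w ug gzw.
by rewrite big_ord1 expr0 mulr1; apply: H.
Qed.

Lemma Mhat_weight (l : nat) mu nu m f : Mhat_le pi l mu nu m f -> Mhat f.
Proof. by move=> H; apply: Talg_sub; exists l, mu, nu, m. Qed.

Lemma gGg z : g z = (pi ^+ (q - 1))^-1 * gG z.
Proof. by rewrite /gG mulKf // expf_neq0 // (pi_neq0 Ccomp Cclosed hpi). Qed.

Lemma g_moebius gam z w : gam \in unitmx -> moebius_rel gam z w -> g w = autJ gam z ^+ (q - 1) * g z.
Proof. by move=> ug gzw; rewrite !gGg (gG_moebius Ccomp hg ug gzw) mulrCA. Qed.

Lemma reg_gG : regular (fun z => fpsC (gG z)).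
Proof.
have [c [B [x [c0 H _ _]]]] := gG_cusp Ccomp Cclosed hpi hg hh.
apply: (reg_scalar Ccomp Cclosed hpi _ _ c0 H); first exact: (hol_gG Ccomp Cclosed hg).
move=> a z w e; have [h1 h2 h3] := trans_rel e.
by rewrite (gG_moebius Ccomp hg h1 h2) h3 expr1n mul1r.
Qed.

Lemma reg_g : regular (fun z => fpsC (g z)).
Proof.
have := regM Ccomp Cclosed hpi (regC Ccomp Cclosed hpi (TposC (pi ^+ (q - 1))^-1)) reg_gG.
by apply: reg_ext => z; rewrite gGg [in RHS]rmorphM.
Qed.

Lemma Mhat_le_g : Mhat_le pi 0 (q - 1)%N 0 0 (fun z => fpsC (g z)).
Proof.
apply: Mhat_le0 => [|gam z w ug gzw]; first exact: reg_g.
by rewrite (g_moebius ug gzw) rmorphM rmorphXn oppr0 !expr0z mul1r mulr1.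
Qed.

Lemma g_Amod : A_modular_form pi (q - 1)%N 0 0 (fun z => fpsC (g z)).
Proof.
split=> [|k]; first exact: Mhat_le_g.
apply: Talg_ext (TalgX (q ^ k) (Mhat_weight Mhat_le_g)) => z.
by rewrite twistC rmorphXn.
Qed.

Lemma reg_hs2 i : regular (fun z => fpsC (h z) * s2 z ^+ i).
Proof.
apply: (regM Ccomp Cclosed hpi); first exact: (reg_h Ccomp Cclosed hpi hh).
by apply: (regX Ccomp Cclosed hpi); exact: (reg_s2 Ccomp Cclosed hpi hg).
Qed.

Lemma hs2_moebius i gam z w : (i <= q.+1)%N -> gam \in unitmx -> moebius_rel gam z w ->
  fpsC (h w) * s2 w ^+ i = fpsC (evA (\det gam))^-1 * fpsC (autJ gam z) ^+ (q.+1 - i) * bJ gam z ^+ i *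
    (fpsC (h z) * s2 z ^+ i).
Proof.
move=> iq ug gzw; rewrite (h_moebius hh ug gzw) (s2_bJ ug gzw) !exprMn.
have -> : autJ gam z ^+ q.+1 = autJ gam z ^+ (q.+1 - i) * autJ gam z ^+ i by rewrite -exprD subnK.
have J0 := autJ_neq0 z ug; have := expf_neq0 i J0.
rewrite -[fpsC _ ^+ (q.+1 - i)]rmorphXn -[fpsC _ ^+ i]rmorphXn /= exprVn.
move: (_ ^+ i) (_ ^+ (q.+1 - i)) (evA _) (bJ gam z ^+ i) (s2 z ^+ i) (h z) => Ji Jq d b s hz Ji0.
rewrite !rmorphM /=; have E : fpsC Ji * fpsC Ji^-1 = 1 by rewrite -rmorphM divff // rmorph1.
transitivity (fpsC Ji * fpsC Ji^-1 * (fpsC d^-1 * fpsC Jq * b * (fpsC hz * s))); first by ring.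
by rewrite E mul1r.
Qed.

Lemma fpsCVz (x : C) : fpsC x ^ (-1) = fpsC x^-1.
Proof.
rewrite -invr_expz expr1z; have [->|x0] := eqVneq x 0; first by rewrite !invr0.
have ux : fpsC x \is a GRing.unit by rewrite fps_unitE fcoefC mulr1n.
by apply: (mulrI ux); rewrite divrr // -rmorphM divff // rmorph1.
Qed.

Lemma Mhat_le_hs2 i : (i <= q.+1)%N -> Mhat_le pi 0 (q.+1 - i)%N i 1 (fun z => fpsC (h z) * s2 z ^+ i).
Proof.
move=> iq; apply: Mhat_le0 => [|gam z w ug gzw]; first exact: reg_hs2.
by rewrite (hs2_moebius iq ug gzw) fpsCVz.
Qed.

Lemma Mhat_h : Mhat (fun z => fpsC (h z)).
Proof. by have := Mhat_weight (Mhat_le_hs2 (leq0n q.+1)); apply: Talg_ext => z; rewrite expr0 mulr1. Qed.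

(** Multiplication by h makes the coefficient of bold L a constant, since h psi does not depend on
    z. *)
Lemma Mhat_E0 : Mhat (fun z => fpsC (h z) * twist 1 (s2 z)).
Proof.
have [f0 [Tf0 uf0 Hf0]] := hpsi_const Ccomp Cclosed hpi hg hh.
have r1 : regular (fun z => fpsC (h z) * twist 1 (s2 z)).
  apply: (regM Ccomp Cclosed hpi); first exact: (reg_h Ccomp Cclosed hpi hh).
  by apply: (reg_twist Ccomp Cclosed hpi); exact: (reg_s2 Ccomp Cclosed hpi hg).
apply: (@Mhat_weight 1 1 1 1); split=> //.
pose c0 := - ((fpsC th - X) * f0) : fps C.
exists (fun i : 'I_2 => if i == 0 then fun z => fpsC (h z) * twist 1 (s2 z) else cst c0); split.
  move=> i; case: eqP => // _; apply: (regC Ccomp Cclosed hpi).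
  by apply/TposN/TposM => //; exact: Tpos_thX.
move=> gam z w ug gzw; rewrite big_ord_recl big_ord1 /= expr0 expr1 mulr1 fpsCVz !expr1z.
rewrite (h_moebius hh ug gzw) (twist1_s2 ug gzw) /c0 -(Hf0 z).
have J0 := autJ_neq0 z ug; have := expf_neq0 q J0.
rewrite [autJ gam z ^+ q.+1]exprS [_^-1 ^+ q]exprVn.
move: (autJ gam z) (evA _) (h z) (bJ gam z) (twist 1 (s2 z)) (psi z) (bL gam z) => J d hz b s p L.
set Jq := J ^+ q; clearbody Jq => Jq0.
rewrite !rmorphM /=; have E : fpsC Jq * fpsC Jq^-1 = 1 by rewrite -rmorphM divff // rmorph1.
rewrite -[LHS]mul1r -[RHS]mul1r -{2}E; ring: E.
Qed.

End ModularForms.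

(** * The generators are A-modular *)

Section Generators.
Variables (F : finFieldType) (R : realType) (C : valuedField F R).
Local Notation q := #|F|.
Local Notation th := (theta C).
Local Notation Omega := (Omega C).
Local Notation s2 := (@s2 F R C).
Local Notation X := (@fpsX C).
Implicit Types (x y : C) (z w : Omega) (f : Omega -> fps C).
Hypothesis Ccomp : Ccomplete C.
Hypothesis Cclosed : GRing.closed_field_axiom C.
Variable pi : C.
Hypothesis hpi : is_period pi.
Variables g Delta h : Omega -> C.
Hypothesis hg : is_g_Delta pi g Delta.
Hypothesis hh : is_h pi h.
Local Notation gG := (gG pi g).
Local Notation gD := (gD pi Delta).
Local Notation regular := (@regular F R C pi).
Local Notation Mhat := (@Mhat F R C pi).

Lemma twist_fpsX (k : nat) : twist k X = X.
Proof.
apply: fpsP => i; rewrite /= ; case: (i == 1%N); rewrite ?expr1n //.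
by rewrite expr0n gtn_eqF // expn_gt0 q_gt0.
Qed.

Lemma s2_rec (k : nat) z : (X - fpsC (th ^+ (q ^ k))) * twist k (s2 z) =
  fpsC (gG z ^+ (q ^ k)) * twist k.+1 (s2 z) + fpsC (gD z ^+ (q ^ k)) * twist k.+2 (s2 z).
Proof.
have := sgen_th hg (eLat_1 Ccomp z); rewrite -s2E ; move: (gG z) (gD z) => G D /(congr1 (@twist F R C k)).
by rewrite !(rmorphM, rmorphB, rmorphD) /= !twist_twist !twistC twist_fpsX add1n add2n.
Qed.

Lemma gD_h : exists2 x, x != 0 & forall z, gD z = x * h z ^+ (q - 1).
Proof.
have [k k0 Hk] := hM_const Ccomp Cclosed hpi hg hh.
exists (th * k^-1 ^+ (q - 1)) => [|z]; first by rewrite mulf_neq0 ?th_neq0 // expf_neq0 // invr_neq0.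
rewrite (gDE Ccomp hg) -mulrA -exprMn; congr (_ * _ ^+ _).
by rewrite -(Hk z) invfM mulrAC mulVf ?mul1r // (h_neq0 Ccomp Cclosed hpi hg hh).
Qed.

Lemma Mhat_hs2 : Mhat (fun z => fpsC (h z) * s2 z).
Proof. by have := Mhat_weight (Mhat_le_hs2 Ccomp Cclosed hpi hg hh (isT : (1 <= q.+1)%N)). Qed.

(** The twisted recursion expresses gD^(q^k) s_2^(k+2) through s_2^(k) and s_2^(k+1). As [gD] is a
    multiple of h^(q-1), multiplying by h^(q^k) produces h to the power q^k + (q-1) q^k = q^(k+1).
    Two consecutive twists are carried through the induction. *)
Lemma Mhat_E (k : nat) : Mhat (fun z => fpsC (h z) ^+ (q ^ k) * twist k.+1 (s2 z)).
Proof.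
have [x x0 Hx] := gD_h; have hM := Mhat_h Ccomp Cclosed hpi hg hh.
have gM : Mhat (fun z => fpsC (gG z)).
  have := TalgZ (TposC (pi ^+ (q - 1))) (Mhat_weight (Mhat_le_g Ccomp Cclosed hpi hg hh)).
  by apply: Talg_ext => z; rewrite -[in LHS]rmorphM.
suff : Mhat (fun z => fpsC (h z) ^+ (q ^ k) * twist k (s2 z)) /\
       Mhat (fun z => fpsC (h z) ^+ (q ^ k) * twist k.+1 (s2 z)) by case.
elim: k => [|k [IH1 IH2]].
  split; first by apply: Talg_ext Mhat_hs2 => z; rewrite expn0 expr1 twist0.
  by apply: Talg_ext (Mhat_E0 Ccomp Cclosed hpi hg hh) => z; rewrite expn0 expr1.
have qk : (q ^ k.+1 = q ^ k + (q - 1) * q ^ k)%N by rewrite mulnBl mul1n addnC subnK // ?leq_pmull ?q_gt0 // expnS.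
have qE : (q ^ k.+1 = q ^ k + (q - 1) * q ^ k)%N := qk.
split.
  apply: Talg_ext (TalgM (TalgX ((q - 1) * q ^ k) hM) IH2) => z.
  by rewrite qE exprD mulrA [fpsC (h z) ^+ _ * _ in RHS]mulrC.
have Tx : Tpos (fpsC (x ^+ (q ^ k))^-1 : fps C) := TposC _.
have TX : Tpos (X - fpsC (th ^+ (q ^ k)) : fps C) by apply: TposD; [exact: TposX|exact/TposN/TposC].
have := TalgZ Tx (TalgB (TalgZ TX IH1) (TalgM (TalgX (q ^ k) gM) IH2)).
apply: Talg_ext => z.
have -> : fpsC (h z) ^+ (q ^ k.+1) * twist k.+2 (s2 z) =
    fpsC (x ^+ (q ^ k))^-1 * (fpsC (h z) ^+ (q ^ k) * (fpsC (gD z ^+ (q ^ k)) * twist k.+2 (s2 z))).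
  rewrite Hx exprMn -exprM [fpsC (_ * _)]rmorphM /= qE exprD [fpsC (h z ^+ _)]rmorphXn /=.
  have xx : fpsC (x ^+ (q ^ k))^-1 * fpsC (x ^+ (q ^ k)) = 1.
    by rewrite -rmorphM mulVf ?rmorph1 // expf_neq0.
  move: (fpsC (x ^+ _)^-1) (fpsC (x ^+ _)) (fpsC (h z) ^+ _) (fpsC (h z) ^+ _) (twist _ _) xx => a b c d e ab.
  by transitivity (a * b * (d * c * e)); [rewrite ab mul1r|ring].
congr (_ * _); have := s2_rec k z; rewrite [fpsC (gG z ^+ _)]rmorphXn /=.
move: (fpsC (gG z)) (fpsC (gD z ^+ _)) (twist k _) (twist k.+1 _) (twist k.+2 _) (X - _) => a b c d e T E.
have -> : b * e = T * c - a ^+ (q ^ k) * d by rewrite E addrC addKr.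
ring.
Qed.

Definition kap : fps C := fpsC pi * (sCar pi)^-1.

Lemma Tpos_sCar : Tpos (sCar pi).
Proof.
apply/(TposP Ccomp); exists 1, (absv pi); split=> // i; rewrite expr1n mulr1 /=.
rewrite (eCar_pi Ccomp Cclosed hpi) absvM ger_pMr ?absv_gt0 ?(pi_neq0 Ccomp Cclosed hpi) //.
have := absv_thV_lt1 C i; rewrite div1r => h1; rewrite (eA_small Ccomp) //; exact: ltW.
Qed.

Lemma sCar_unit : sCar pi \is a GRing.unit.
Proof.
rewrite fps_unitE /= (eCar_pi Ccomp Cclosed hpi) expr1.
by rewrite mulf_neq0 ?(pi_neq0 Ccomp Cclosed hpi) // (eA_thV_neq0 Ccomp).
Qed.

Lemma kap_unit : kap \is a GRing.unit.
Proof.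
rewrite /kap unitrM unitrV sCar_unit andbT fps_unitE fcoefC mulr1n.
exact: (pi_neq0 Ccomp Cclosed hpi).
Qed.

Lemma Tpos_kap : Tpos kap.
Proof. by apply: TposM; [exact: TposC|apply: TposV Tpos_sCar]. Qed.

Lemma hvecE i z : hvec pi h i z = kap ^+ i * (fpsC (h z) * s2 z ^+ i).
Proof. by rewrite /hvec /kap exprMn exprVn !mulrA. Qed.

(** After k + 1 twists h becomes h^(q^(k+1)), and each of the i factors s_2^(k+1) has to absorb one
    h^(q^k); there are q of these, so i <= q suffices. *)
Lemma hvec_Amod i : (i <= q)%N -> A_modular_form pi (q.+1 - i)%N i 1 (hvec pi h i).
Proof.
move=> iq; have iq1 : (i <= q.+1)%N := leqW iq.
have [r0 [fs [rfs Hfs]]] := Mhat_le_hs2 Ccomp Cclosed hpi hg hh iq1.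
have Mi : Mhat_le pi 0 (q.+1 - i)%N i 1 (hvec pi h i).
  apply: Mhat_le0 => [|gam z w ug gzw].
    have := regM Ccomp Cclosed hpi (regC Ccomp Cclosed hpi (TposXn i Tpos_kap)) r0.
    by apply: reg_ext => z; rewrite hvecE.
  rewrite !hvecE (hs2_moebius Ccomp hg hh iq1 ug gzw) fpsCVz.
  by rewrite mulrCA.
split=> // -[|k].
  by apply: Talg_ext (Mhat_weight Mi) => z; rewrite twist0.
have TK : Tpos (twist k.+1 kap ^+ i) by apply/TposXn/Tpos_twist/Tpos_kap.
have := TalgZ TK (TalgM (TalgX i (Mhat_E k)) (TalgX (q ^ k * (q - i)) (Mhat_h Ccomp Cclosed hpi hg hh))).
apply: Talg_ext => z; rewrite hvecE; move: kap => K.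
rewrite !rmorphM !rmorphXn /=; congr (_ * _).
have -> : twist k.+1 (fpsC (h z)) = fpsC (h z) ^+ (q ^ k * i) * fpsC (h z) ^+ (q ^ k * (q - i)).
  by rewrite twistC rmorphXn -exprD -mulnDr subnKC // expnSr.
by rewrite exprMn -exprM mulrAC.
Qed.

End Generators.

(** * Constraints imposed by the twisted form *)

Section LinearPower.
Variable A : idomainType.
Implicit Types (a b : A).

Lemma coef_linear_expn a b n :
  (((a%:P + b%:P * 'X) ^+ n)`_n = b ^+ n) /\ forall i, (n < i)%N -> ((a%:P + b%:P * 'X) ^+ n)`_i = 0.
Proof.
have st (p : {poly A}) i : ((a%:P + b%:P * 'X) * p)`_i.+1 = a * p`_i.+1 + b * p`_i.
  by rewrite mulrDl coefD coefCM -mulrA coefCM coefXM.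
elim: n => [|n [IH1 IH2]]; first by split=> [|[|i]] //; rewrite expr0 coef1.
split; first by rewrite !exprS st IH1 IH2 // mulr0 add0r.
by case=> // i; rewrite ltnS exprS st => ni; rewrite !IH2 ?mulr0 ?addr0 // ltnW.
Qed.

End LinearPower.

Section ModularTwist.
Variables (F : finFieldType) (R : realType) (C : valuedField F R).
Local Notation q := #|F|.
Local Notation th := (theta C).
Local Notation evA := (@evA F R C).
Local Notation bar := (@bar F R C).
Local Notation Omega := (Omega C).
Local Notation s1 := (@s1 F R C).
Local Notation s2 := (@s2 F R C).
Local Notation psi := (@psi F R C).
Local Notation X := (@fpsX C).
Local Notation K := (fps C).
Local Notation p3 := {poly {poly {poly K}}}.
Implicit Types (x y : C) (z w : Omega) (f : Omega -> fps C) (c e : {poly F}) (P Q : Omega -> p3).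
Hypothesis Ccomp : Ccomplete C.
Hypothesis Cclosed : GRing.closed_field_axiom C.
Variable pi : C.
Hypothesis hpi : is_period pi.
Variables g Delta h : Omega -> C.
Hypothesis hg : is_g_Delta pi g Delta.
Hypothesis hh : is_h pi h.
Local Notation regular := (@regular F R C pi).
Local Notation Mhat := (@Mhat F R C pi).
Local Notation T := (fpsC th - X : fps C).

(** Determinant one for arbitrary c and e: a two-parameter family with enough lower rows (c, 1 + c
    e) for [indep3]. *)
Definition gck c e : 'M[{poly F}]_2 := mx22 1 e c (1 + c * e).
Let J c e z : K := fpsC (evA c * sval z + evA (1 + c * e)).
Let Y c e z : K := bar c * (s1 z / s2 z) + bar (1 + c * e).

Lemma gck_det c e : \det (gck c e) = 1.
Proof. rewrite det_mx22 !mxE /=; ring. Qed.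

Lemma gck_unit c e : gck c e \in unitmx.
Proof. by rewrite unitmxE gck_det unitr1. Qed.

Lemma gck_J c e z : fpsC (autJ (gck c e) z) = J c e z.
Proof. by rewrite /autJ !mxE. Qed.

Lemma gck_Y c e z : bJ (gck c e) z = Y c e z.
Proof. by rewrite /bJ !mxE. Qed.

Lemma gck10 c e : gck c e 1 0 = c. Proof. by rewrite mxE. Qed.

Lemma J_unit c e z : J c e z \is a GRing.unit.
Proof. by rewrite -gck_J fps_unitE fcoefC mulr1n (autJ_neq0 z (gck_unit c e)). Qed.

Lemma Y_unit c e z : Y c e z \is a GRing.unit.
Proof. by rewrite -gck_Y (bJ_unit Ccomp hg z (gck_unit c e)). Qed.

Lemma J_Y_eq0 z (P : p3) : (forall c e, ev3 (J c e z) (Y c e z) (bar c) P = 0) -> P = 0.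
Proof. by apply: indep3; exact: 0. Qed.

(** In bold L = c(t) / ((theta - t) s_2 bold J) each c(t) brings one denominator (theta - t) s_2, so
    that the coefficient of c(t)^i may carry its i-th power. *)
Definition RC P := forall i j k, regular (fun z => (T * s2 z) ^+ i * c3 (P z) i j k).

Lemma RC_D P Q : RC P -> RC Q -> RC (fun z => P z + Q z).
Proof.
move=> hP hQ i j k; apply: reg_ext (regD Ccomp Cclosed hpi (hP i j k) (hQ i j k)) => z.
by rewrite c3D mulrDr.
Qed.

Lemma RC_M P Q : RC P -> RC Q -> RC (fun z => P z * Q z).
Proof.
move=> hP hQ i j k.
have H : regular (fun z => \sum_(i1 < i.+1) \sum_(j1 < j.+1) \sum_(k1 < k.+1)
    ((T * s2 z) ^+ i1 * c3 (P z) i1 j1 k1) *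
    ((T * s2 z) ^+ (i - i1) * c3 (Q z) (i - i1) (j - j1) (k - k1))).
  by do 3!(apply: (reg_sum Ccomp Cclosed hpi) => ? _); apply: (regM Ccomp Cclosed hpi).
apply: reg_ext H => z; rewrite c3M mulr_sumr; apply: eq_bigr => i1 _.
rewrite mulr_sumr; apply: eq_bigr => j1 _; rewrite mulr_sumr; apply: eq_bigr => k1 _.
by rewrite mulrACA -exprD subnKC // leq_ord.
Qed.

Lemma reg_Ts2 i : regular (fun z => (T * s2 z) ^+ i).
Proof.
apply: (regX Ccomp Cclosed hpi); apply: (regM Ccomp Cclosed hpi); last exact: (reg_s2 Ccomp Cclosed hpi hg).
exact: (regC Ccomp Cclosed hpi (Tpos_thX C)).
Qed.

Lemma reg0 : regular (fun=> 0). Proof. exact: (regC Ccomp Cclosed hpi (Tpos0 C)). Qed.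

Lemma RC_mono (b : Omega -> K) i j k : regular (fun z => (T * s2 z) ^+ i * b z) ->
  RC (fun z => mono3 (b z) i j k).
Proof.
move=> hb i' j' k'; case E : [&& i' == i, j' == j & k' == k]; last first.
  by apply: reg_ext reg0 => z; rewrite c3_mono E mulr0n mulr0.
by case/and3P: (E) => /eqP-> _ _; apply: reg_ext hb => z; rewrite c3_mono eqxx; case/and3P: E => _ -> ->.
Qed.

Lemma RC_mono1 j k : RC (fun z => mono3 1 0 j k).
Proof.
apply: RC_mono; apply: reg_ext (regC Ccomp Cclosed hpi (Tpos1 C)) => z.
by rewrite expr0 mulr1.
Qed.

(** Along the family [gck] an element of Mhat becomes a polynomial in J, bold J and c(t) once a
    power of J bold J is cleared; by [J_Y_eq0] this polynomial is determined by f, z and the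
    exponent. *)
Definition Rep f := exists N P, RC P /\ forall c e z w, moebius_rel (gck c e) z w ->
  (J c e z * Y c e z) ^+ N * f w = ev3 (J c e z) (Y c e z) (bar c) (P z).

Lemma Rep_alg : Tsubalgebra Rep.
Proof.
split.
- move=> a ha; exists 0%N, (fun=> mono3 a 0 0 0); split=> [|c e z w _].
    apply: RC_mono; apply: reg_ext (regC Ccomp Cclosed hpi ha) => z.
    by rewrite expr0 mul1r.
  by rewrite ev3_mono !expr0 mul1r !mulr1.
- move=> f f' [N [P [hP HP]]] [N' [P' [hP' HP']]].
  exists (N + N')%N, (fun z => P z * mono3 1 0 N' N' + P' z * mono3 1 0 N N); split=> [|c e z w gzw].
    by apply: RC_D; apply: RC_M => //; exact: RC_mono1.
  rewrite ev3D ev3M [ev3 _ _ _ (P' z * _)]ev3M !ev3_mono !expr0 !mulr1 !mul1r -(HP _ _ _ _ gzw) -(HP' _ _ _ _ gzw) !exprMn !exprD.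
  rewrite -[(f + f') w]/(f w + f' w).
  move: (_ ^+ N) (_ ^+ N') (_ ^+ N) (_ ^+ N') => a b a' b'; ring.
- move=> f f' [N [P [hP HP]]] [N' [P' [hP' HP']]].
  exists (N + N')%N, (fun z => P z * P' z); split=> [|c e z w gzw]; first exact: RC_M.
  rewrite ev3M -(HP _ _ _ _ gzw) -(HP' _ _ _ _ gzw) exprD mulrACA; congr (_ * _).
Qed.

Lemma Rep_weight (l : nat) mu nu m f : Mhat_le pi l mu nu m f -> Rep f.
Proof.
(* Large enough for N + mu and N + nu - i to be nonnegative for all i <= l. *)
move=> [rf [fs [rfs H]]]; pose N := (`|mu| + `|nu| + l)%N.
have TsU z : T * s2 z \is a GRing.unit by rewrite unitrM thX_unit (s2_unit Ccomp z).
pose P z : p3 := \sum_(i < l.+1) mono3 (fs i z * (T * s2 z) ^- i) i (absz (N%:Z + nu - i%:Z)%R) (absz (N%:Z + mu)%R).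
exists N, P; split.
  move=> i j k.
  have Hs : regular (fun z => \sum_(i0 < l.+1) (T * s2 z) ^+ i *
      c3 (mono3 (fs i0 z * (T * s2 z) ^- i0) i0 (absz (N%:Z + nu - i0%:Z)%R) (absz (N%:Z + mu)%R)) i j k).
    apply: (reg_sum Ccomp Cclosed hpi) => i0 _; apply: RC_mono.
    apply: reg_ext (rfs i0) => z; rewrite mulrCA divrr ?mulr1 //; exact: unitrX.
  by apply: reg_ext Hs => z; rewrite /P c3_sum mulr_sumr.
move=> c e z w gzw; have := H _ _ _ (gck_unit c e) gzw.
have bc := bar_bL Ccomp hg z (gck_unit c e); rewrite gck10 gck_Y in bc.
rewrite gck_det rmorph1 rmorph1 exp1rz mul1r gck_J gck_Y => ->.
have uJ := J_unit c e z; have uY := Y_unit c e z; have uT := TsU z.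
rewrite ev3_sum !mulr_sumr; apply: eq_bigr => i _; rewrite ev3_mono bc.
move: (J c e z) (Y c e z) (bL _ z) uJ uY => j y L uj uy.
have il : (i <= l)%N := leq_ord i.
have pE (v : K) (r : int) : v \is a GRing.unit -> (`|r| <= N)%N -> v ^+ absz (N%:Z + r)%R = v ^+ N * v ^ r.
  move=> uv rN; rewrite exprnP gez0_abs ?exprzDr //.
  by rewrite -lerBlDr sub0r; apply: le_trans (_ : `|r|%N%:Z <= N%:Z) => //; rewrite abszE -normrN ler_norm.
have munu : (`|mu| <= N)%N by rewrite /N -addnA leq_addr.
have nuN : (`|nu| <= N)%N by apply: (leq_trans (leq_addl _ _) (leq_addr _ _)).
have N0nu : 0 <= N%:Z + nu.
  by rewrite -lerBlDr sub0r; apply: le_trans (_ : `|nu|%N%:Z <= N%:Z) => //; rewrite abszE -normrN ler_norm.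
have inn : (i <= absz (N%:Z + nu)%R)%N.
  rewrite -lez_nat gez0_abs // -lerBlDr; apply: (@le_trans _ _ (l%:Z + `|nu|%N%:Z)).
    by rewrite lerD ?lez_nat // abszE -normrN ler_norm.
  by rewrite /N -PoszD lez_nat addnC leq_add2r leq_addl.
have yE : y ^+ absz (N%:Z + nu - i%:Z)%R * y ^+ i = y ^+ N * y ^ nu.
  rewrite -(pE _ _ uy nuN) -exprD; congr (_ ^+ _); apply/eqP; rewrite -eqz_nat PoszD.
  move: inn; rewrite -lez_nat gez0_abs => [inn|]; last exact: N0nu.
  by rewrite gez0_abs ?subr_ge0 // subrK ?gez0_abs ?N0nu.
rewrite (pE _ _ uj munu).
have -> : (T * (s2 z * (y * L))) ^+ i = (T * s2 z) ^+ i * (y ^+ i * L ^+ i) by rewrite -!exprMn mulrA.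
have tE : (T * s2 z) ^+ i * (T * s2 z) ^- i = 1 by rewrite divrr // unitrX.
move: (T * s2 z) tE => ts; rewrite exprMn.
move: (ts ^+ i) (ts ^- i) (y ^+ i) (y ^+ absz _) (y ^+ N) (y ^ nu) yE (j ^+ N) (j ^ mu) (L ^+ i) (fs i z).
move=> t1 t2 y1 y2 y3 y4 yE j1 j2 L1 f1 tE.
transitivity (t1 * t2 * (y2 * y1) * (j1 * j2 * f1 * L1)); last by ring.
by rewrite tE yE; ring.
Qed.

Lemma Mhat_Rep f : Mhat f -> Rep f.
Proof. by apply: Talg_ind f; [exact: Rep_alg|move=> f [l [mu [nu [m]]]]; apply: Rep_weight]. Qed.

(** The difference between s_1 / s_2 and its twist, hence the coefficient by which the twist of bold
    J differs from bold J. *)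
Definition kappa z : K := psi z / (s2 z * twist 1 (s2 z)).

Lemma tw_s2_unit k z : twist k (s2 z) \is a GRing.unit.
Proof. by rewrite twist_unit (s2_unit Ccomp). Qed.

Lemma twist_Y c e z : twist 1 (Y c e z) = Y c e z - kappa z * bar c.
Proof.
rewrite /Y /kappa /psi rmorphD !rmorphM /= !twist_bar rmorphV ?(s2_unit Ccomp) //=.
have u1 := s2_unit Ccomp z; have u2 := tw_s2_unit 1 z.
rewrite invrM //; have := divrr u1; have := divrr u2.
move: (s1 z) (s2 z) (twist 1 (s1 z)) (twist 1 (s2 z)) ((s2 z)^-1) ((twist 1 (s2 z))^-1) => a b a' b' v v' e' e1.
transitivity (bar c * (a * v * (1 - b' * v') + a' * v' * (b * v)) + bar (1 + c * e)); last by ring.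
by rewrite e' e1 subrr mulr0 add0r mulr1.
Qed.

Lemma weight_gck mu nu m f c e z w : Mhat_le pi 0 mu nu m f -> moebius_rel (gck c e) z w ->
  f w = J c e z ^ mu * Y c e z ^ nu * f z.
Proof.
move=> [_ [fs [_ H]]] gzw.
have E c' e' z' w' : moebius_rel (gck c' e') z' w' ->
    f w' = J c' e' z' ^ mu * Y c' e' z' ^ nu * fs ord0 z'.
  move=> r; rewrite (H _ _ _ (gck_unit c' e') r) gck_det !rmorph1 exp1rz mul1r gck_J gck_Y.
  by rewrite big_ord1 expr0 mulr1.
rewrite (E _ _ _ _ gzw); congr (_ * _).
have r0 : moebius_rel (gck 0 0) z z.
  by apply/moebius_mx22; rewrite mulr0 addr0 rmorph0 !rmorph1 mul0r addr0 add0r mul1r divr1.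
rewrite (E _ _ _ _ r0) /J /Y mulr0 addr0 !rmorph0 !mul0r !add0r !rmorph1.
by rewrite ?rmorph1 !exp1rz !mul1r.
Qed.

(** The exponents serve every unit at once, so that the resulting identities are polynomial in J. *)
Lemma clear_exponent (mu : int) : exists M k : nat, forall v : K, v \is a GRing.unit ->
  v ^+ M * (v ^+ q) ^ mu = v ^+ k.
Proof.
case: mu => a; first by exists 0%N, (q * a)%N => v _; rewrite expr0 mul1r -exprnP -exprM.
by exists (q * a.+1)%N, 0%N => v uv; rewrite NegzE -invr_expz -exprnP -exprM divrr ?expr0 ?unitrX.
Qed.

Lemma twist_weight mu nu m f c e z w : Mhat_le pi 0 mu nu m f -> moebius_rel (gck c e) z w ->
  twist 1 (f w) = (J c e z ^+ q) ^ mu * (Y c e z - kappa z * bar c) ^ nu * twist 1 (f z).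
Proof.
move=> Hf gzw; rewrite (weight_gck Hf gzw) !rmorphM /= !rmorphXz ?J_unit ?Y_unit //= twist_Y.
by rewrite twistC expn1 [fpsC (_ ^+ q)]rmorphXn.
Qed.

Let Apol z : p3 := ('X : {poly {poly K}})%:P + (- (kappa z)%:P%:P : {poly {poly K}})%:P * 'X.

Lemma ev3_Apol (x y w : K) z : ev3 x y w (Apol z) = y - kappa z * w.
Proof. by rewrite /ev3 !(hornerD, hornerM, hornerC, hornerX, hornerN) mulNr. Qed.

Lemma kappa_neq0 z : kappa z != 0.
Proof.
have [f0 [_ uf0 Hf0]] := hpsi_const Ccomp Cclosed hpi hg hh.
rewrite mulf_neq0 ?invr_neq0 //; last first.
  by rewrite mulf_neq0 //; apply/eqP => E; [have := s2_unit Ccomp z|have := tw_s2_unit 1 z]; rewrite E unitr0.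
by apply/eqP => E; have := uf0; rewrite -(Hf0 z) E mulr0 unitr0.
Qed.

(** With nu = - (n + 1) the twisted transformation has (bold J - kappa c(t))^(n+1) as denominator.
    Clearing it equates a nonzero polynomial free of c(t) with a multiple of that power, which has
    positive degree in c(t) because kappa is nonzero. *)
Lemma Amod_neg mu nu m f : Mhat_le pi 0 mu nu m f -> Mhat (fun z => twist 1 (f z)) -> nu < 0 ->
  forall z, f z = 0.
Proof.
move=> Hf /Mhat_Rep[N [P [_ HP]]] nu0 z; case: nu nu0 Hf => // n _ Hf.
have [M [k Hk]] := clear_exponent mu.
apply: (@twist_inj _ _ _ 1); rewrite rmorph0; apply/eqP/negPn/negP => f0.
have E : mono3 (twist 1 (f z)) 0 N (N + k) = mono3 1 0 0 M * P z * Apol z ^+ n.+1.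
  apply/eqP; rewrite -subr_eq0; apply/eqP; apply: (@J_Y_eq0 z) => c e.
  have [w gzw] := moebius_ex z (gck_unit c e).
  rewrite ev3D ev3N [ev3 _ _ _ (_ * Apol z ^+ _)]ev3M [ev3 _ _ _ (mono3 _ _ _ _ * _)]ev3M ev3X ev3_Apol !ev3_mono -(HP _ _ _ _ gzw).
  rewrite (twist_weight Hf gzw) NegzE -twist_Y; apply/eqP; rewrite subr_eq0; apply/eqP.
  have uy : twist 1 (Y c e z) \is a GRing.unit by rewrite twist_unit Y_unit.
  rewrite -[_ ^ (- _)]invr_expz -exprnP !expr0 !mulr1 !mul1r exprD -(Hk _ (J_unit c e z)) exprMn.
  have := divrr (unitrX n.+1 uy).
  move: (_ ^+ n.+1) (_ ^- n.+1) => a b ab.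
  move: (J c e z ^+ M) (J c e z ^+ N) (_ ^ mu) (Y c e z ^+ N) (twist 1 (f z)) => j1 j2 j3 y1 f1.
  transitivity (a * b * (f1 * (j2 * (j1 * j3)) * y1)); first by rewrite ab mul1r.
  by ring.
have L0 : mono3 (twist 1 (f z)) 0 N (N + k) != 0.
  apply: contraNneq f0 => /(congr1 (fun p => c3 p 0 N (N + k))); rewrite c3_mono !eqxx mulr1n => ->.
  by rewrite /c3 !coef0.
have sL : (size (mono3 (twist 1 (f z)) 0 N (N + k)) <= 1)%N by rewrite /mono3 expr0 mulr1 size_polyC_leq1.
move: L0 sL; rewrite E mulf_eq0 negb_or => /andP[p0 a0]; rewrite size_mul // leqNgt => /negP; apply.
have sA : (n.+1 < size (Apol z ^+ n.+1))%N.
  rewrite ltnNge; apply/negP => /(fun h => nth_default 0 h); rewrite (coef_linear_expn _ _ _).1 => /eqP.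
  by rewrite expf_eq0 oppr_eq0 !polyC_eq0 (negPf (kappa_neq0 z)).
move: p0; set Q := mono3 1 0 0 M * P z; rewrite -size_poly_gt0; case: (size Q) => // s' _; rewrite addSn /=.
by apply: leq_trans (leq_addl _ _); apply: leq_trans sA.
Qed.

(** The coefficient of c(t)^n in f^(1) (bold J - kappa c(t))^n is (- kappa)^n f^(1), so [RC] makes
    ((theta - t) s_2 kappa)^n f^(1) regular. Now kappa s_2 = psi / s_2^(1), and h psi is a constant
    unit. *)
Lemma Amod_reg mu (n : nat) m f : Mhat_le pi 0 mu n m f -> Mhat (fun z => twist 1 (f z)) ->
  regular (fun z => fpsC (h z)^-1 ^+ n * ((twist 1 (s2 z))^-1 ^+ n * twist 1 (f z))).
Proof.
move=> Hf /Mhat_Rep[N [P [RP HP]]].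
have [M [k Hk]] := clear_exponent mu.
have E z : mono3 (twist 1 (f z)) 0 N (N + k) * Apol z ^+ n = mono3 1 0 0 M * P z.
  apply/eqP; rewrite -subr_eq0; apply/eqP; apply: (@J_Y_eq0 z) => c e.
  have [w gzw] := moebius_ex z (gck_unit c e).
  rewrite ev3D ev3N ev3M [ev3 _ _ _ (_ * P z)]ev3M ev3X ev3_Apol !ev3_mono -(HP _ _ _ _ gzw).
  rewrite (twist_weight Hf gzw) -exprnP; apply/eqP; rewrite subr_eq0; apply/eqP.
  rewrite !expr0 !mulr1 !mul1r exprD -(Hk _ (J_unit c e z)) exprMn; ring.
have C3 z : c3 (mono3 1 0 0 M * P z) n N (N + k) = twist 1 (f z) * (- kappa z) ^+ n.
  rewrite -E /c3 /mono3 expr0 mulr1 coefCM (coef_linear_expn _ _ n).1.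
  by rewrite -!polyCN -!polyC_exp coefMC coefCM coefXn eqxx mulr1 coefMC coefCM coefXn eqxx mulr1.
have [f0 [Tf0 uf0 Hf0]] := hpsi_const Ccomp Cclosed hpi hg hh.
have r1 := RC_M (RC_mono1 0 M) RP n N (N + k)%N.
have uT : T * f0 \is a GRing.unit by rewrite unitrM thX_unit.
have Tc : Tpos ((- (T * f0))^-1 ^+ n) by apply/TposXn/TposV/TposN/TposM => //; exact: Tpos_thX.
have := regM Ccomp Cclosed hpi (regC Ccomp Cclosed hpi Tc) r1.
apply: reg_ext => z; rewrite C3 /=.
have h0 := h_neq0 Ccomp Cclosed hpi hg hh z.
have hpsi : psi z = fpsC (h z)^-1 * f0.
  by rewrite -(Hf0 z) mulrA -rmorphM mulVf // rmorph1 mul1r.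
rewrite /kappa hpsi invrM ?(s2_unit Ccomp) ?tw_s2_unit //.
rewrite !mulrA -!exprMn mulrAC -!exprMn; congr (_ ^+ _ * _).
rewrite invrN; have := divrr (s2_unit Ccomp z).
move: (s2 z)^-1 (twist 1 (s2 z))^-1 (fpsC _^-1) (T) uT => b d p t uT e1; have := divrr uT.
set a := (t * f0)^-1; clearbody a => e2.
transitivity ((s2 z * b) * (t * f0 * a) * (p * d)); first by ring.
by rewrite e1 e2 !mul1r.
Qed.

End ModularTwist.

(** * Division by a power of s_2 *)

Section Structure.
Variables (F : finFieldType) (R : realType) (C : valuedField F R).
Local Notation q := #|F|.
Local Notation th := (theta C).
Local Notation scal := (@vf_scal F R C).
Local Notation evA := (@evA F R C).
Local Notation bar := (@bar F R C).
Local Notation Omega := (Omega C).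
Local Notation s1 := (@s1 F R C).
Local Notation s2 := (@s2 F R C).
Local Notation psi := (@psi F R C).
Implicit Types (x y : C) (z w : Omega) (f : Omega -> fps C) (gam : 'M[{poly F}]_2).
Hypothesis Ccomp : Ccomplete C.
Hypothesis Cclosed : GRing.closed_field_axiom C.
Variable pi : C.
Hypothesis hpi : is_period pi.
Variables g Delta h : Omega -> C.
Hypothesis hg : is_g_Delta pi g Delta.
Hypothesis hh : is_h pi h.
Local Notation u := (upar pi).
Local Notation regular := (@regular F R C pi).
Local Notation Mhat := (@Mhat F R C pi).
Local Notation cuspval := (cuspval pi).

Definition gens : set (Omega -> fps C) := [set (fun z => fpsC (g z))] `|`
  [set hvec pi h i | i in [set i : nat | (i <= #|F|)%N]].

Lemma fpsC_Xz x (r : int) : x != 0 -> fpsC x ^ r = fpsC (x ^ r).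
Proof. by move=> x0; rewrite rmorphXz // unitfE. Qed.

(** Forms for the scalar factor J alone; division by s_2^nu leads to these, with r = mu + nu
    possibly negative. *)
Definition weightK (r m : int) f := regular f /\
  forall gam z w, gam \in unitmx -> moebius_rel gam z w ->
    f w = fpsC (evA (\det gam) ^ (- m) * autJ gam z ^ r) * f z.

Lemma hol12_zXz (r : int) : hol12 (fun z => fpsC (sval z ^ r)).
Proof.
apply: (hol12_scalar); case: r => n; first exact/holX/hol_id.
have H : holomorphic (fun z => (sval z)^-1 ^+ n.+1).
  by apply: holX => //; exact: (hol_Oinv (@hol_id F R C)).
by apply: hol_ext H => z; rewrite NegzE -exprnN exprVn.
Qed.

(** The transformation under z -> 1 / z shows that f s_2^-n s_1^n is f(1 / z) up to a constant and a
    power of z, hence has a radius in t uniform in z. So has f s_2^-n psi^(2n), and psi is a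
    constant unit divided by h. *)
Lemma div_s2_reg mu (n : nat) m f : Mhat_le pi 0 mu n m f ->
  weightK (mu + n) m (fun z => f z * (s2 z)^-1 ^+ n).
Proof.
move=> [rf [fs [rfs Hfs]]].
have Hf gam z w : gam \in unitmx -> moebius_rel gam z w ->
    f w = fpsC (evA (\det gam)) ^ (- m) * fpsC (autJ gam z) ^ mu * bJ gam z ^ n * f z.
  move=> ug gzw; rewrite (Hfs _ _ _ ug gzw); congr (_ * _).
  have id1 : (1%:M : 'M[{poly F}]_2) \in unitmx by rewrite unitmx1.
  have r1 : moebius_rel 1%:M z z.
    by rewrite /moebius_rel /autJ !mxE /= rmorph0 !rmorph1 mul0r addr0 add0r mul1r divr1.
  rewrite (Hfs _ _ _ id1 r1) det1 rmorph1 /autJ /bJ !mxE /= !rmorph0 !rmorph1 !mul0r !add0r.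
  rewrite rmorph1 !exp1rz !mul1r !big_ord1 /bL !mxE /= rmorph0 mul0r expr0 mulr1.
  by rewrite ?expr0 ?mulr1.
have /(regularE Ccomp Cclosed hpi)[f1 f2 f3] := rf.
split; last first.
  move=> gam z w ug gzw; rewrite (Hf _ _ _ ug gzw) (s2_bJ Ccomp hg ug gzw).
  have J0 := autJ_neq0 z ug; have uJ : fpsC (autJ gam z) \is a GRing.unit by rewrite fps_unitE fcoefC mulr1n.
  have ub := bJ_unit Ccomp hg z ug; have us := s2_unit Ccomp z.
  have d0 := det_neq0 C ug.
  have dE : fpsC (autJ gam z)^-1 = (fpsC (autJ gam z))^-1 by rewrite -fpsCVz.
  rewrite dE !invrM ?unitrM ?unitrV ?uJ ?ub // invrK -!exprnP !exprMn.
  rewrite [fpsC (_ * _)]rmorphM /= -!fpsC_Xz // exprzDr // -exprnP.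
  have := divrr (unitrX n ub); rewrite -exprVn.
  move=> dd; set bn := bJ gam z ^+ n in dd *; set bn' := (bJ gam z)^-1 ^+ n in dd *.
  clearbody bn bn'; move: (fpsC _ ^ (- m)) (fpsC _ ^ mu) (fpsC _ ^+ n) ((s2 z)^-1 ^+ n) (f z) => a b c e k.
  transitivity (bn * bn' * (a * (b * c) * (k * e))); first by ring.
  by rewrite dd mul1r.
apply/(regularE Ccomp Cclosed hpi); split; last first.
- by apply: uanM => //; apply: uanX => //; exact: (uan_s2V Ccomp Cclosed hpi).
- by move=> a z w e; rewrite (f2 a z w e) (per_s2 Ccomp hg e).
pose S : 'M[{poly F}]_2 := mx22 0 1 1 0.
have uS : S \in unitmx by apply: mx22_unit; rewrite mulr0 mulr1 sub0r unitrN unitr1.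
have hG : hol12 (fun z => f z * (s2 z)^-1 ^+ n * s1 z ^+ n).
  pose cS : fps C := fpsC (evA (\det S) ^ m).
  have h1 := hol12M Cclosed (hol12M Cclosed (hol12C (TposC _ : Tpos cS)) (hol12_zXz (- mu))) (hol12_Oinv f1).
  apply: hol12_ext h1 => z.
  have gz : moebius_rel S z (Oinv z).
    by apply/moebius_mx22; rewrite rmorph0 rmorph1 mul0r add0r mul1r addr0 ?div1r ?mul1r.
  have jz : autJ S z = sval z by rewrite /autJ !mxE /= rmorph0 rmorph1 mul1r addr0.
  have bz : bJ S z = s1 z / s2 z by rewrite /bJ !mxE /= rmorph0 rmorph1 mul1r addr0.
  have z0 := sval_neq0 z; have d0 := det_neq0 C uS.
  rewrite /= (Hf _ _ _ uS gz) jz bz /cS -exprnP exprMn !fpsC_Xz //.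
  have E1 : fpsC (evA (\det S) ^ m) * fpsC (evA (\det S) ^ (- m)) = 1.
    by rewrite -rmorphM -expfzDr // subrr expr0z rmorph1.
  have E2 : fpsC (sval z ^ (- mu)) * fpsC (sval z ^ mu) = 1.
    by rewrite -rmorphM -expfzDr // addrC subrr expr0z rmorph1.
  set a := fpsC (evA (\det S) ^ m) in E1 *; set a' := fpsC (evA (\det S) ^ (- m)) in E1 *.
  set b := fpsC (sval z ^ (- mu)) in E2 *; set b' := fpsC (sval z ^ mu) in E2 *.
  clearbody a a' b b'; move: (s1 z ^+ n) ((s2 z)^-1 ^+ n) (f z) => c d e.
  transitivity (a * a' * (b * b') * (e * d * c)); first by ring.
  by rewrite E1 E2 !mul1r.
have hF : hol12 (fun z => f z * (s2 z)^-1 ^+ n * psi z ^+ (n + n)).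
  (* In the binomial expansion of psi^(2n) the terms with i <= n contain s_1^n, and the others
     contain s_2^n, which cancels s_2^-n. *)
  have Hs : hol12 (fun z => \sum_(i < (n + n).+1) (if (i <= n)%N then
      f z * (s2 z)^-1 ^+ n * s1 z ^+ n * (s1 z ^+ (n - i) * twist 1 (s2 z) ^+ (n + n - i) * (- (twist 1 (s1 z) * s2 z)) ^+ i)
      else f z * (s2 z ^+ (i - n) * (- twist 1 (s1 z)) ^+ i * (s1 z * twist 1 (s2 z)) ^+ (n + n - i))) *+ 'C(n + n, i)).
    have hs1 := hol12_s1 Ccomp Cclosed; have hs2 := hol12_s2 Ccomp Cclosed.
    have ht1 := hol12_twist Cclosed 1 hs1; have ht2 := hol12_twist Cclosed 1 hs2.
    have hsum (I : Type) (s : seq I) (ff : I -> Omega -> fps C) : (forall i, hol12 (ff i)) -> hol12 (fun z => \sum_(i <- s) ff i z).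
      move=> hf; elim: s => [|i s IHs].
        by apply: hol12_ext (hol12C (Tpos0 C)) => z; rewrite big_nil.
      by apply: hol12_ext (hol12D (hf i) IHs) => z; rewrite big_cons.
    apply: hsum => i; have hnat k (ff : Omega -> fps C) : hol12 ff -> hol12 (fun z => ff z *+ k).
      move=> hf; elim: k => [|k IHk]; first by apply: hol12_ext (hol12C (Tpos0 C)) => z; rewrite mulr0n.
      by apply: hol12_ext (hol12D hf IHk) => z; rewrite mulrS.
    apply: hnat; case: (i <= n)%N.
      apply: (hol12M Cclosed) => //; apply: (hol12M Cclosed); first by apply: (hol12M Cclosed); apply: (hol12X Cclosed).
      by apply: (hol12X Cclosed) => //; apply: (hol12N Cclosed) => //; apply: (hol12M Cclosed).
    apply: (hol12M Cclosed) => //; apply: (hol12M Cclosed); first by apply: (hol12M Cclosed); apply: (hol12X Cclosed) => //; apply: (hol12N Cclosed).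
    by apply: (hol12X Cclosed) => //; apply: (hol12M Cclosed).
  apply: hol12_ext Hs => z; have us := s2_unit Ccomp z; rewrite /psi exprDn mulr_sumr.
  apply: eq_bigr => i _; rewrite mulrnAr; congr (_ *+ _).
  case: leqP => [ni|ni].
    have -> : (n + n - i = n + (n - i))%N by rewrite addnBA.
    rewrite [(s1 z * _) ^+ _]exprMn [s1 z ^+ (n + _)]exprD; ring.
  rewrite -mulNr [(- twist 1 (s1 z) * _) ^+ _]exprMn.
  have -> : s2 z ^+ i = s2 z ^+ n * s2 z ^+ (i - n) by rewrite -exprD subnKC // ltnW.
  have := divrr (unitrX n us); rewrite -exprVn => e1.
  move: (s2 z ^+ n) ((s2 z)^-1 ^+ n) e1 (s2 z ^+ _) (_ ^+ i) (_ ^+ (n + n - i)) (f z) => a b ab c d e k.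
  transitivity (a * b * (k * (c * d * e))); [by rewrite ab mul1r|ring].
have [f0 [Tf0 uf0 Hf0]] := hpsi_const Ccomp Cclosed hpi hg hh.
have hh12 := hol12X Cclosed (n + n) (hol12_scalar (hol_h hh)).
have Tf : Tpos (f0^-1 ^+ (n + n)) by apply/TposXn/TposV.
have := hol12M Cclosed hF (hol12M Cclosed (hol12C Tf) hh12).
apply: hol12_ext => z.
have E : psi z * (f0^-1 * fpsC (h z)) = 1 by rewrite mulrCA [psi z * _]mulrC Hf0 mulVr.
by rewrite /= -exprMn -mulrA -exprMn E expr1n mulr1.
Qed.

End Structure.

(** * The structure theorem *)

Section StructureTheorem.
Variables (F : finFieldType) (R : realType) (C : valuedField F R).
Local Notation q := #|F|.
Local Notation th := (theta C).
Local Notation scal := (@vf_scal F R C).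
Local Notation evA := (@evA F R C).
Local Notation Omega := (Omega C).
Local Notation s2 := (@s2 F R C).
Implicit Types (x y : C) (z w : Omega) (f : Omega -> fps C) (gam : 'M[{poly F}]_2).
Hypothesis Ccomp : Ccomplete C.
Hypothesis Cclosed : GRing.closed_field_axiom C.
Variable pi : C.
Hypothesis hpi : is_period pi.
Variables g Delta h : Omega -> C.
Hypothesis hg : is_g_Delta pi g Delta.
Hypothesis hh : is_h pi h.
Local Notation u := (upar pi).
Local Notation regular := (@regular F R C pi).
Local Notation Mhat := (@Mhat F R C pi).
Local Notation cuspval := (cuspval pi).
Local Notation weightK := (weightK pi).
Local Notation gens := (gens pi g h).
Local Notation gG := (gG pi g).

Lemma det_const gam : gam \in unitmx -> exists2 d : F, d != 0 & evA (\det gam) = scal d.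
Proof.
rewrite unitmxE poly_unitE => /andP[/size_poly1P[d d0 ->] _]; exists d => //.
by rewrite evAC.
Qed.

Lemma absv_det gam : gam \in unitmx -> absv (evA (\det gam)) = 1.
Proof. by case/det_const => d d0 ->; rewrite absv_scal d0. Qed.

(** For fixed small t the weights - (n + 1) of f and q + 1 of h balance in the product of f^(q+1)
    and h^(n+1), whose absolute value is therefore invariant. It tends to zero at the cusp because h
    does, and h has no zero in Omega. *)
Lemma neg_zero (r m : int) f : r < 0 -> weightK r m f -> forall z, f z = 0.
Proof.
case: r => // n _ [rf Hf] z0.
have /(regularE Ccomp Cclosed hpi)[[r r0 [ev Hev]] _ [c [B [c0 Hc]]]] := rf.
have B0 := uan_with_ge0 Hc.
have m0 : 0 < Num.min r c by rewrite lt_min r0.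
have mr : Num.min r c <= r by rewrite ge_min lexx.
have mc : Num.min r c <= c by rewrite ge_min lexx orbT.
move: (Num.min r c) m0 mr mc => c' m0 mr mc.
have key t : absv t < c' -> forall z, ev t z = 0.
  move=> tc; have [hol hev] := Hev t (lt_le_trans tc mr); have tcc := lt_le_trans tc mc.
  have evw gam z w : gam \in unitmx -> moebius_rel gam z w ->
      ev t w = evA (\det gam) ^ (- m) * autJ gam z ^ (Negz n) * ev t z.
    move=> ug gzw; apply: has_eval_unique (hev w) _; rewrite (Hf _ _ _ ug gzw).
    by apply: has_evalM; [exact: has_evalC|exact: hev].
  pose phi z := ev t z ^+ q.+1 * h z ^+ n.+1.
  have hphi : holomorphic phi.
    by apply: holM => //; [exact: holX|apply: holX => //; exact: (hol_h hh)].
  have inv : absGinv phi.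
    move=> gam z w ug gzw; have J0 := autJ_neq0 z ug.
    have A1 : absv (ev t w) = (absv (autJ gam z) ^+ n.+1)^-1 * absv (ev t z).
      rewrite (evw _ _ _ ug gzw) absvM (absvM (evA (\det gam) ^ _)) absvXz (absv_det ug) exp1rz mul1r.
      by rewrite NegzE -exprnN absvV absvX.
    have A2 : absv (h w) = absv (autJ gam z) ^+ q.+1 * absv (h z).
      rewrite (h_moebius hh ug gzw) absvM (absvM (autJ gam z ^+ _)) absvX absvV (absv_det ug).
      by rewrite invr1 mulr1.
    rewrite /phi (absvM (ev t w ^+ _)) (absvM (ev t z ^+ _)) !absvX A1 A2 !exprMn mulrACA exprVn -!exprM.
    by rewrite [(q.+1 * n.+1)%N]mulnC mulVf ?mul1r // expf_neq0 // absv_eq0.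
  have lim (eps : R) : 0 < eps -> exists n0 : nat, forall (k : nat) z, (n0 <= k)%N ->
      Gs 0 (th ^+ k) (sval z) -> absv (phi z) <= eps.
    move=> e0; have [_ _ [_ [_ ch0 _]]] := ub_h Ccomp Cclosed hpi hh.
    have BB : 0 < B ^+ q.+1 + 1 by rewrite ltr_wpDl // exprn_ge0.
    have e1 : 0 < Num.min 1 (eps / (B ^+ q.+1 + 1)) by rewrite lt_min ltr01 divr_gt0.
    have [d d0 Hd] := ch0 _ e1; have md : 0 < Num.min d c by rewrite lt_min d0.
    have [n0 Hn0] := u_G_small Ccomp Cclosed hpi md; exists n0 => k z nk Gz.
    have := Hn0 k z nk Gz; rewrite lt_min => /andP[/Hd + uc]; rewrite subr0 lt_min => /andP[h1 he].
    have fz : pbound c B (f z).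
      move=> i; rewrite -ler_pdivlMr ?exprn_gt0 //; exact: (ub_near c0 (Hc i) uc).
    have evB := has_eval_le (hev z) (ltW tcc) fz.
    rewrite /phi (absvM (ev t z ^+ _)) !absvX.
    apply: (@le_trans _ _ (B ^+ q.+1 * (eps / (B ^+ q.+1 + 1)))).
      apply: ler_pM; rewrite ?exprn_ge0 ?absv_ge0 //.
        by rewrite lerXn2r ?nnegrE ?absv_ge0.
      apply: le_trans (ltW he); rewrite exprS ler_piMr ?absv_ge0 // exprn_ile1 ?absv_ge0 //; exact: ltW.
    by rewrite mulrCA ger_pMr // ler_pdivrMr // mul1r lerDl ler01.
  move=> z; have /eqP := liouville_zero Cclosed hphi inv lim z.
  rewrite /phi mulf_eq0 !expf_eq0 /= (negPf (h_neq0 Ccomp Cclosed hpi hg hh z)) orbF => /eqP //.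
have [t1 nt1 t1c] := ex_small C m0.
have [B1 HB1] := has_eval_pbound ((Hev t1 (lt_le_trans t1c mr)).2 z0).
apply: (fps_identity _ HB1) => [|eps e0]; first by rewrite absv_gt0.
have me : 0 < Num.min eps c' by rewrite lt_min e0.
have [t nt] := ex_small C me; rewrite lt_min => /andP[te tc].
by exists t; split=> //; rewrite -(key t tc z0); apply: (Hev t (lt_le_trans tc mr)).2.
Qed.

Lemma wK_div (r m : int) f : weightK r m f -> (forall n, cuspval (fun z => fcoef (f z) n) 0) ->
  weightK (r - q.+1%:Z) (m - 1) (fun z => fpsC (h z)^-1 * f z).
Proof.
move=> [rf Hf] c0; split; first exact: (reg_divh Ccomp Cclosed hpi hg hh rf c0).
move=> gam z w ug gzw; rewrite (Hf _ _ _ ug gzw) (h_moebius hh ug gzw) !mulrA -!rmorphM.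
congr (fpsC _ * _); have J0 := autJ_neq0 z ug; have d0 := det_neq0 C ug.
have -> : evA (\det gam) ^ (- (m - 1)) = evA (\det gam) ^ (- m) * evA (\det gam).
  by rewrite opprB [1 - m]addrC expfzDr // expr1z.
have -> : autJ gam z ^ (r - q.+1%:Z) = autJ gam z ^ r / autJ gam z ^+ q.+1 by rewrite expfzDr // -exprnN.
move: (autJ gam z ^+ q.+1) (autJ gam z ^ r) (evA (\det gam) ^ (- m)) (evA (\det gam)) (h z) => a b d e k.
rewrite !invfM invrK; ring.
Qed.

Lemma Talg_g : Talg gens (fun z => fpsC (g z)).
Proof. by apply: Talg_sub; left. Qed.

Lemma Talg_hs i : (i <= q)%N -> Talg gens (fun z => fpsC (h z) * s2 z ^+ i).
Proof.
move=> iq; have H : Talg gens (hvec pi h i) by apply: Talg_sub; right; exists i.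
have Tk := Tpos_kap Ccomp Cclosed hpi; have uk := kap_unit Ccomp Cclosed hpi.
have := TalgZ (TposV Ccomp (TposXn i Tk)) H; apply: Talg_ext => z.
by rewrite hvecE mulKr // unitrX.
Qed.

Lemma Talg_h : Talg gens (fun z => fpsC (h z)).
Proof. by apply: Talg_ext (Talg_hs (leq0n q)) => z; rewrite expr0 mulr1. Qed.

Lemma Talg_gG : Talg gens (fun z => fpsC (gG z)).
Proof.
have := TalgZ (TposC (pi ^+ (q - 1))) Talg_g.
by apply: Talg_ext => z; rewrite -[in LHS]rmorphM.
Qed.

(** Distributes the n factors s_2 over the N factors h, at most q on each. *)
Lemma Talg_hN N n : (n <= q * N)%N -> Talg gens (fun z => fpsC (h z) ^+ N * s2 z ^+ n).
Proof.
elim: N n => [|N IHN] n.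
  rewrite muln0 leqn0 => /eqP->; have := @TalgC _ _ _ gens _ (Tpos1 C).
  by apply: Talg_ext => z; rewrite !expr0 mulr1.
rewrite mulnS => nq; have iq : (minn q n <= q)%N := geq_minl q n.
have le : (n - minn q n <= q * N)%N.
  case: (leqP q n) => qn; last by rewrite subnn.
  by rewrite leq_subLR.
have nE : (minn q n + (n - minn q n) = n)%N by rewrite subnKC // geq_minr.
apply: Talg_ext (TalgM (Talg_hs iq) (IHN _ le)) => z.
by rewrite -[in RHS]nE exprD exprS mulrACA.
Qed.

(** The twist raises t-coefficients to q-th powers. While q j < n, that is q (j + 1) < n + q, the
    remaining factor h^(n - q j) makes these powers, hence the coefficients themselves, vanish at
    the cusp, and one more division by h is allowed. *)
Lemma wK_ord (r m : int) f (n : nat) (H : Omega -> fps C) : weightK r m f -> regular H ->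
  (forall z, twist 1 (f z) = fpsC (h z) ^+ n * H z) -> forall j : nat, (q * j < n + q)%N ->
  exists2 f', weightK (r - (q.+1 * j)%:Z) (m - j%:Z) f' & forall z, f z = fpsC (h z) ^+ j * f' z.
Proof.
move=> wf rH E; elim=> [|j IHj] jn.
  by exists f; [rewrite muln0 !subr0|move=> z; rewrite expr0 mul1r].
have jn' : (q * j < n)%N by rewrite mulnS addnC ltn_add2r in jn.
have [f' wf' Ef] := IHj (ltn_addr q jn').
have tw z : twist 1 (f' z) = fpsC (h z) ^+ (n - q * j) * H z.
  have h0 : fpsC (h z) ^+ (q * j) != 0.
    have uh : fpsC (h z) \is a GRing.unit.
      by rewrite fps_unitE fcoefC mulr1n (h_neq0 Ccomp Cclosed hpi hg hh).
    by rewrite expf_neq0 //; apply: contraTneq uh => ->; rewrite unitr0.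
  apply: (mulfI h0); rewrite mulrA -exprD subnKC ?(ltnW jn') // -E Ef rmorphM rmorphXn /=.
  by rewrite twistC expn1 rmorphXn -exprM.
have [rf' _] := wf'; have /(regularE Ccomp Cclosed hpi)[_ _ uf'] := rf'.
have /(regularE Ccomp Cclosed hpi)[_ _ uH] := rH.
have [x Tx Hx] := uan_cusp Ccomp uf'; have [y Ty Hy] := uan_cusp Ccomp uH.
have [_ _ [_ [_ ch0 _]]] := ub_h Ccomp Cclosed hpi hh.
have x0 i : fcoef x i = 0.
  have c1 := cuspvalX q (Hx i).
  have c2 := cuspvalM (cuspvalX (n - q * j) ch0) (Hy i).
  have c3 : cuspval (fun z => fcoef (f' z) i ^+ q) (0 ^+ (n - q * j) * fcoef y i).
    apply: cuspval_ext c2 => z; have := congr1 (fun v => fcoef v i) (tw z).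
    by rewrite -rmorphXn fcoefCM /= expn1.
  have := cuspval_unique Ccomp Cclosed hpi c1 c3.
  rewrite expr0n subn_eq0 leqNgt jn' mul0r => /eqP.
  by rewrite expf_eq0 => /andP[_ /eqP].
have c0 i : cuspval (fun z => fcoef (f' z) i) 0 by rewrite -(x0 i); apply: Hx.
exists (fun z => fpsC (h z)^-1 * f' z).
  have := wK_div wf' c0; rewrite mulnS addnC PoszD opprD addrA -[j.+1]addn1 PoszD opprD addrA //.
move=> z; rewrite Ef exprSr -mulrA [fpsC (h z) * (_ * _)]mulrA -rmorphM divff ?rmorph1 ?mul1r //.
exact: (h_neq0 Ccomp Cclosed hpi hg hh).
Qed.

(** Otherwise X^r - 1, with r the positive remainder of n modulo q - 1, would have all q - 1 units
    of F as roots. *)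
Lemma unit_order_dvd (n : nat) : (forall d : F, d != 0 -> d ^+ n = 1) -> (q - 1 %| n)%N.
Proof.
move=> H; rewrite /dvdn -leqn0 leqNgt; apply/negP => r0; set r := (n %% (q - 1))%N in r0.
have q1 : (0 < q - 1)%N by rewrite subn_gt0 q_gt1.
have rr (d : F) : d != 0 -> d ^+ r = 1.
  move=> d0; have := H d d0; rewrite (divn_eq n (q - 1)) exprD mulnC exprM.
  have -> : d ^+ (q - 1) = 1.
    by apply: (mulfI d0); rewrite -exprS subn1 prednK ?q_gt0 // expf_card mulr1.
  by rewrite expr1n mul1r.
have p0 : ('X^r - 1%:P : {poly F}) != 0 by rewrite -size_poly_gt0 size_XnsubC.
have ar : all (root ('X^r - 1%:P : {poly F})) (enum (predC1 (0 : F))).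
  apply/allP => d; rewrite mem_enum => d0.
  by rewrite /root hornerD hornerN hornerXn hornerC rr ?subrr.
have := max_poly_roots p0 ar (enum_uniq _).
rewrite size_XnsubC // -cardE cardC1 ltnS leqNgt -subn1 => /negP; apply.
exact: ltn_pmod.
Qed.

(** Induction on the weight. A form vanishing at the cusp is h times a form of weight lower by q +
    1, which is zero if that weight is negative. Otherwise diagonal matrices force the determinant
    character to be trivial and q - 1 to divide the weight, so a multiple of a power of g has the
    same cusp value. *)
Lemma struct (n : nat) : forall m f, weightK n m f -> Talg gens f.
Proof.
elim/ltn_ind: n => n IH m f wf.
have zero_case f' m' : weightK n m' f' -> (forall i, cuspval (fun z => fcoef (f' z) i) 0) -> Talg gens f'.
  move=> wf' c0; have wd := wK_div wf' c0.
  have Td : Talg gens (fun z => fpsC (h z)^-1 * f' z).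
    case: (leqP q.+1 n) => [le|lt].
      apply: (IH (n - q.+1)%N _ (m' - 1)); first by rewrite ltn_subrL (leq_trans _ le).
      by rewrite -subzn.
    have z0 : forall z, fpsC (h z)^-1 * f' z = 0 by apply: neg_zero wd; rewrite subr_lt0.
    by have := @TalgC _ _ _ gens _ (Tpos0 C); apply: Talg_ext => z; rewrite z0.
  apply: Talg_ext (TalgM Talg_h Td) => z.
  by rewrite mulrA -rmorphM divff ?rmorph1 ?mul1r // (h_neq0 Ccomp Cclosed hpi hg hh).
have [rf Hf] := wf; have /(regularE Ccomp Cclosed hpi)[_ _ uf] := rf.
have [x Tx Hx] := uan_cusp Ccomp uf.
have [[i xi]|nx] := pselect (exists i, fcoef x i != 0); last first.
  apply: (zero_case f m wf) => i; have := Hx i; suff -> : fcoef x i = 0 by [].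
  by apply/eqP/negPn/negP => xi; apply: nx; exists i.
(* A diagonal matrix multiplies z by a constant of F_q and preserves |u|, so the nonzero cusp value
   is reproduced up to the factor [l], which must be one. *)
have lam (al de : F) : al != 0 -> de != 0 -> scal (al * de) ^ (- m) * scal de ^ n = 1.
  move=> al0 de0; pose gam : 'M[{poly F}]_2 := mx22 al%:P 0 0 de%:P.
  have dE : \det gam = (al * de)%:P by rewrite det_mx22 !mxE /= mulr0 subr0 polyCM.
  have ug : gam \in unitmx by rewrite unitmxE dE poly_unitE size_polyC mulf_neq0 //= coefC unitfE mulf_neq0.
  have JE z : autJ gam z = scal de by rewrite /autJ !mxE /= rmorph0 mul0r add0r evAC.
  set l := _ * _; apply/eqP; rewrite -subr_eq0 -(mulIr_eq0 _ (mulIf xi)); apply/eqP.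
  have l1 : absv l = 1 by rewrite absvM !absvXz !absv_scal mulf_neq0 // de0 !exp1rz mulr1.
  apply: absv_small => eps e0; have [d d0 Hd] := Hx i _ e0.
  have [z uz] := u_pt Ccomp Cclosed hpi d0; have [w gzw] := moebius_ex z ug.
  have uw : absv (u w) < d.
    have wE : sval w = scal (al / de) * sval z.
      rewrite gzw JE !mxE /= rmorph0 addr0 evAC fmorph_div; ring.
    move: uz; rewrite !(uE Ccomp Cclosed hpi) wE (eAZ Ccomp) !absvV !absvM absv_scal.
    by rewrite mulf_neq0 ?invr_neq0 // mul1r.
  have fw : fcoef (f w) i = l * fcoef (f z) i.
    by rewrite (Hf _ _ _ ug gzw) fcoefCM dE evAC JE.
  have -> : (l - 1) * fcoef x i = (fcoef (f w) i - fcoef x i) - l * (fcoef (f z) i - fcoef x i).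
    by rewrite fw; ring.
  by apply: absvB_lt; [exact: Hd|rewrite absvM l1 mul1r; exact: Hd].
have alm (d : F) : d != 0 -> scal d ^ (- m) = 1.
  by move=> d0; have := lam d 1 d0 (oner_neq0 _); rewrite mulr1 rmorph1 exp1rz mulr1.
have den (d : F) : d != 0 -> d ^+ n = 1.
  move=> d0; have := lam 1 d (oner_neq0 _) d0; rewrite mul1r alm // mul1r -exprnP -rmorphXn => e.
  by apply: (fmorph_inj scal); rewrite e rmorph1.
have nE : ((q - 1) * (n %/ (q - 1)) = n)%N by rewrite mulnC divnK // unit_order_dvd.
set k := (n %/ (q - 1))%N in nE.
have [cg [Bg [xg [cg0 ug Hg xg0]]]] := gG_cusp Ccomp Cclosed hpi hg hh.
pose y : fps C := x * fpsC (xg^-1 ^+ k).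
have Ty : Tpos y by apply: TposM => //; exact: TposC.
have wf0 : weightK n m (fun z => f z - y * fpsC (gG z) ^+ k).
  split.
    apply: (regD Ccomp Cclosed hpi rf); apply: (regN Ccomp Cclosed hpi).
    apply: (regM Ccomp Cclosed hpi (regC Ccomp Cclosed hpi Ty)).
    by apply: (regX Ccomp Cclosed hpi); exact: (reg_gG Ccomp Cclosed hpi hg hh).
  move=> gam z w ugam gzw; rewrite (Hf _ _ _ ugam gzw) (gG_moebius Ccomp hg ugam gzw).
  have [d d0 ->] := det_const ugam; rewrite alm // mul1r rmorphM rmorphXn exprMn -exprM nE.
  rewrite -exprnP rmorphXn; move: (fpsC _ ^+ n) (fpsC _ ^+ k) (f z) => a b e; ring.
have c0 j : cuspval (fun z => fcoef (f z - y * fpsC (gG z) ^+ k) j) 0.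
  have H1 := cuspvalD (Hx j) (cuspvalN (cuspvalM (cuspvalC pi (fcoef x j * xg^-1 ^+ k)) (cuspvalX k Hg))).
  have E0 : fcoef x j + - (fcoef x j * xg^-1 ^+ k * xg ^+ k) = 0.
    by rewrite -mulrA -exprMn mulVf // expr1n mulr1 subrr.
  rewrite E0 in H1; apply: cuspval_ext H1 => z; rewrite fcoefB; congr (_ - _).
  move: (gG z) => G.
  have -> : y * fpsC G ^+ k = fpsC (xg^-1 ^+ k * G ^+ k) * x.
    have -> : fpsC G ^+ k = fpsC (G ^+ k) by rewrite rmorphXn.
    have -> : fpsC (xg^-1 ^+ k * G ^+ k) = fpsC (xg^-1 ^+ k) * fpsC (G ^+ k) by rewrite rmorphM.
    by rewrite /y -mulrA mulrC.
  by rewrite fcoefCM -mulrA mulrC.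
have T0 := zero_case _ _ wf0 c0.
apply: Talg_ext (TalgD T0 (TalgZ Ty (TalgX k Talg_gG))) => z.
by rewrite subrK.
Qed.

Lemma Amod_gens (mu nu m : int) f : A_modular_form pi mu nu m f -> Talg gens f.
Proof.
move=> [Hf HM]; have M1 := HM 1%N.
case: nu Hf => n Hf; last first.
  have z0 := Amod_neg Ccomp Cclosed hpi hg hh Hf M1 (isT : Negz n < 0).
  by have := @TalgC _ _ _ gens _ (Tpos0 C); apply: Talg_ext => z; rewrite z0.
have rH := Amod_reg Ccomp Cclosed hpi hg hh Hf M1.
have wF := div_s2_reg Ccomp Cclosed hpi hg hh Hf.
set H := (fun z => _) in rH; set f1 := (fun z => _) in wF.
have E z : twist 1 (f1 z) = fpsC (h z) ^+ n * H z.
  have us := s2_unit Ccomp z.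
  rewrite /f1 /H rmorphM rmorphXn rmorphV //= mulrA -exprMn -rmorphM divff ?(h_neq0 Ccomp Cclosed hpi hg hh) //.
  by rewrite rmorph1 expr1n mul1r mulrC.
(* The ceiling of n / q: small enough for [wK_ord], which asks q N < n + q, and large enough for
   [Talg_hN], which asks n <= q N. *)
pose N := ((n + q.-1) %/ q)%N; have q0 := q_gt0 F.
have N1 : (q * N < n + q)%N.
  by rewrite mulnC (leq_ltn_trans (leq_trunc_div _ _)) // ltn_add2l prednK.
have N2 : (n <= q * N)%N.
  have aux (a b c : nat) : a.+1 = b -> (n + a < b + c)%N -> (n <= c)%N by clear; lia.
  by apply: (aux _ _ _ (prednK q0)); rewrite [(q * N)%N]mulnC -mulSn; exact: ltn_ceil.
have [f2 w2 E2] := wK_ord wF rH E N1.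
have T2 : Talg gens f2.
  case: (mu + n - (q.+1 * N)%:Z) w2 => [r|r] w2; first exact: struct w2.
  have z0 := neg_zero (isT : Negz r < 0) w2.
  by have := @TalgC _ _ _ gens _ (Tpos0 C); apply: Talg_ext => z; rewrite z0.
apply: Talg_ext (TalgM (Talg_hN N2) T2) => z.
rewrite mulrAC -E2 /f1 -mulrA -exprMn mulVr ?expr1n ?mulr1 //; exact: (s2_unit Ccomp).
Qed.

Lemma MM_gens : MM pi = Talg gens.
Proof.
apply/seteqP; split.
  by apply: Talg_mono => f [mu [nu [m]]]; apply: Amod_gens.
apply: Talg_mono => f [->|[i iq <-]]; apply: Talg_sub.
  by exists (q - 1)%N, 0, 0; exact: (g_Amod Ccomp Cclosed hpi hg hh).
by exists (q.+1 - i)%N, i, 1; exact: (hvec_Amod Ccomp Cclosed hpi hg hh).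
Qed.

End StructureTheorem.

(** * Dimension three *)

Section LinearDependence.
Variable K : idomainType.
Variable S : K -> Prop.
Hypotheses (S0 : S 0) (S1 : S 1) (SD : forall a b, S a -> S b -> S (a + b))
  (SM : forall a b, S a -> S b -> S (a * b)) (SN : forall a, S a -> S (- a)).

Lemma S_sum (I : Type) (r : seq I) (f : I -> K) : (forall i, S (f i)) -> S (\sum_(i <- r) f i).
Proof. by move=> H; apply: big_ind. Qed.

(** Gaussian elimination by cross-multiplication with a pivot in column 0, so that all coefficients
    stay in the subring [S]. *)
Lemma fraction_free_dependence N (a : 'I_N.+1 -> nat -> K) : (forall i j, S (a i j)) ->
  exists v : 'I_N.+1 -> K, [/\ forall i, S (v i), exists i, v i != 0 &
    forall j, (j < N)%N -> \sum_i v i * a i j = 0].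
Proof.
elim: N a => [|N IHN] a Sa; first by exists (fun _ => 1); split=> //; exists ord0; exact: oner_neq0.
have [/existsP[p ap]|/existsPn na] := boolP [exists p, a p 0%N != 0].
  have [|v [Sv [i0 vi0] Hv]] := IHN (fun i j => a p 0%N * a (lift p i) j.+1 - a (lift p i) 0%N * a p j.+1).
    by move=> i j; apply: SD; [apply: SM|apply/SN/SM].
  pose y := - \sum_i v i * a (lift p i) 0%N.
  exists (fun i => if unlift p i is Some k then a p 0%N * v k else y); split.
  - move=> i; case: (unlift p i) => [k|]; first exact: SM.
    by apply/SN/S_sum => k; apply: SM.
  - by exists (lift p i0); rewrite liftK mulf_neq0.
  move=> j jN; rewrite (bigD1_ord p) //= unlift_none.
  under eq_bigr => i _ do rewrite liftK.
  case: j jN => [|j] jN.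
    rewrite /y mulNr mulr_suml addrC -sumrB; apply: big1 => i _; ring.
  have := Hv j jN; rewrite /=; under eq_bigr => i _ do rewrite mulrBr; rewrite sumrB => /eqP.
  rewrite subr_eq0 => /eqP E; rewrite /y mulNr mulr_suml.
  have -> : \sum_i v i * a (lift p i) 0%N * a p j.+1 = \sum_i v i * (a (lift p i) 0%N * a p j.+1).
    by apply: eq_bigr => i _; rewrite mulrA.
  by rewrite -E addrC -sumrB; apply: big1 => i _; ring.
have a0 i : a i 0%N = 0 by apply/eqP; have := na i; rewrite negbK.
have [|v [Sv [i0 vi0] Hv]] := IHN (fun i j => a (lift ord0 i) j.+1) => //.
exists (fun i => if unlift ord0 i is Some k then v k else 0); split.
- by move=> i; case: (unlift ord0 i).
- by exists (lift ord0 i0); rewrite liftK.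
move=> [|j] jN; first by apply: big1 => i _; rewrite a0 mulr0.
rewrite (bigD1_ord ord0) //= unlift_none mul0r add0r.
by under eq_bigr => i _ do rewrite liftK; apply: Hv.
Qed.

End LinearDependence.

Section Dimension.
Variables (F : finFieldType) (R : realType) (C : valuedField F R).
Local Notation q := #|F|.
Local Notation evA := (@evA F R C).
Local Notation bar := (@bar F R C).
Local Notation Omega := (Omega C).
Local Notation s1 := (@s1 F R C).
Local Notation s2 := (@s2 F R C).
Local Notation K := (fps C).
Local Notation p3 := {poly {poly {poly K}}}.
Implicit Types (z w : Omega) (f : Omega -> fps C) (P Q : p3).
Hypothesis Ccomp : Ccomplete C.
Hypothesis Cclosed : GRing.closed_field_axiom C.
Variable pi : C.
Hypothesis hpi : is_period pi.
Variables g Delta h : Omega -> C.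
Hypothesis hg : is_g_Delta pi g Delta.
Hypothesis hh : is_h pi h.
Local Notation gens := (gens pi g h).
Local Notation gG := (gG pi g).
Local Notation kap := (kap pi).

Definition tdeg_le (D : nat) P := forall i j k, (D < i + j + k)%N -> c3 P i j k = 0.
Definition T3 P := forall i j k, Tpos (c3 P i j k).
Let ev z P : K := ev3 (fpsC (g z)) (fpsC (h z)) (s2 z) P.

Lemma tdeg_leM D E P Q : tdeg_le D P -> tdeg_le E Q -> tdeg_le (D + E) (P * Q).
Proof.
move=> hP hQ i j k lt; rewrite c3M; apply: big1 => i1 _; apply: big1 => j1 _; apply: big1 => k1 _.
have := leq_ord i1; have := leq_ord j1; have := leq_ord k1.
move: (nat_of_ord i1) (nat_of_ord j1) (nat_of_ord k1) => {}i1 {}j1 {}k1 lk lj li.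
have [le|/hP->] := leqP (i1 + j1 + k1) D; last by rewrite mul0r.
rewrite (hQ (i - i1)%N (j - j1)%N (k - k1)%N) ?mulr0 //.
move: lt le lk lj li; clear; lia.
Qed.

Lemma tdeg_le_mono D E P : (D <= E)%N -> tdeg_le D P -> tdeg_le E P.
Proof. by move=> DE hP i j k /(leq_ltn_trans DE); apply: hP. Qed.

Lemma tdeg_le_monom (a : K) i j k : tdeg_le (i + j + k) (mono3 a i j k).
Proof.
move=> i' j' k' lt; rewrite c3_mono; case: and3P => [[/eqP e1 /eqP e2 /eqP e3]|_]; last by rewrite mulr0n.
by rewrite e1 e2 e3 ltnn in lt.
Qed.

Lemma T3_M P Q : T3 P -> T3 Q -> T3 (P * Q).
Proof.
move=> hP hQ i j k; rewrite c3M; apply: Tpos_sum => i1 _; apply: Tpos_sum => j1 _.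
by apply: Tpos_sum => k1 _; apply: TposM.
Qed.

Lemma T3_D P Q : T3 P -> T3 Q -> T3 (P + Q).
Proof. by move=> hP hQ i j k; rewrite c3D; apply: TposD. Qed.

Lemma T3_mono (a : K) i j k : Tpos a -> T3 (mono3 a i j k).
Proof. by move=> ha i' j' k'; rewrite c3_mono; case: (and3P) => _; [|exact: Tpos0]. Qed.

Lemma c3_1 i j k : c3 (1 : p3) i j k = [&& i == 0, j == 0 & k == 0]%N%:R.
Proof.
rewrite /c3 coef1; case: (i == 0)%N; last by rewrite !coef0.
rewrite [nat_of_bool _]/= mulr1n coef1; case: (j == 0)%N; last by rewrite coef0.
by rewrite [nat_of_bool _]/= mulr1n coef1.
Qed.

Lemma T3_1 : T3 1.
Proof. by move=> i j k; rewrite c3_1; case: (_ && _); [exact: Tpos1|exact: Tpos0]. Qed.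

Lemma tdeg_le_1 : tdeg_le 0 1.
Proof. by move=> [|i] [|j] [|k] // _; rewrite c3_1. Qed.

Lemma T3_X P n : T3 P -> T3 (P ^+ n).
Proof. by move=> hP; elim: n => [|n IHn]; [exact: T3_1|rewrite exprS; apply: T3_M]. Qed.

Lemma tdeg_leX D P n : tdeg_le D P -> tdeg_le (D * n) (P ^+ n).
Proof.
move=> hP; elim: n => [|n IHn]; first by rewrite muln0; exact: tdeg_le_1.
by rewrite exprS mulnS; apply: tdeg_leM.
Qed.

(** Polynomials in g, h and s_2 contain all generators, so for an upper bound only three variables
    have to be counted. *)
Definition polyform f := exists D P, [/\ tdeg_le D P, T3 P & forall z, f z = ev z P].

Lemma polyform_alg : Tsubalgebra polyform.
Proof.
split=> [a ha|f f' [D [P [h1 h2 h3]]] [D' [P' [h1' h2' h3']]]|f f' [D [P [h1 h2 h3]]] [D' [P' [h1' h2' h3']]]].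
- exists 0%N, (mono3 a 0 0 0); split; [exact: (@tdeg_le_monom a 0 0 0)|exact: T3_mono|move=> z].
  by rewrite /ev ev3_mono !expr0 !mulr1.
- exists (maxn D D'), (P + P'); split; last by move=> z; rewrite /ev ev3D -[(f + f') z]/(f z + f' z) h3 h3'.
    move=> i j k lt; rewrite c3D h1 ?h1' ?addr0 //.
      by apply: leq_ltn_trans lt; apply: leq_maxr.
    by apply: leq_ltn_trans lt; apply: leq_maxl.
  exact: T3_D.
- exists (D + D')%N, (P * P'); split; [exact: tdeg_leM|exact: T3_M|move=> z].
  by rewrite /ev ev3M -[(f * f') z]/(f z * f' z) h3 h3'.
Qed.

Lemma gens_polyform f : Talg gens f -> polyform f.
Proof.
apply: Talg_ind f; first exact: polyform_alg.
move=> f [->|[i _ <-]].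
  exists 1%N, (mono3 1 0 0 1); split; [exact: (@tdeg_le_monom 1 0 0 1)|exact/T3_mono/Tpos1|move=> z].
  by rewrite /ev ev3_mono !expr0 !mulr1 mul1r.
exists (i + 1 + 0)%N, (mono3 (kap ^+ i) i 1 0); split; first exact: tdeg_le_monom.
  exact/T3_mono/TposXn/(Tpos_kap Ccomp Cclosed hpi).
by move=> z; rewrite /ev ev3_mono expr0 mulr1 expr1 hvecE mulrA.
Qed.

Definition box (E : nat) : seq (nat * nat * nat) :=
  [seq (p, k) | p <- [seq (i, j) | i <- iota 0 E, j <- iota 0 E], k <- iota 0 E].

Lemma size_box E : size (box E) = (E ^ 3)%N.
Proof. by rewrite !size_allpairs !size_iota !expnS expn0 muln1 mulnA. Qed.

Lemma mem_box E i j k : (i < E)%N -> (j < E)%N -> (k < E)%N -> (i, j, k) \in box E.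
Proof.
move=> iE jE kE; apply/allpairsP; exists ((i, j), k); split=> //=; last by rewrite mem_iota.
by apply/allpairsP; exists (i, j); split; rewrite //= mem_iota.
Qed.

Lemma c3_scale (a : K) P i j k : c3 (mono3 a 0 0 0 * P) i j k = a * c3 P i j k.
Proof.
have -> : mono3 a 0 0 0 = a%:P%:P%:P by rewrite /mono3 !expr0 !mulr1.
by rewrite /c3 !coefCM.
Qed.

End Dimension.

Section UpperBound.
Variables (F : finFieldType) (R : realType) (C : valuedField F R).
Local Notation q := #|F|.
Local Notation evA := (@evA F R C).
Local Notation bar := (@bar F R C).
Local Notation Omega := (Omega C).
Local Notation s1 := (@s1 F R C).
Local Notation s2 := (@s2 F R C).
Local Notation K := (fps C).
Local Notation p3 := {poly {poly {poly K}}}.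
Implicit Types (z w : Omega) (f : Omega -> fps C) (P Q : p3).
Hypothesis Ccomp : Ccomplete C.
Hypothesis Cclosed : GRing.closed_field_axiom C.
Variable pi : C.
Hypothesis hpi : is_period pi.
Variables g Delta h : Omega -> C.
Hypothesis hg : is_g_Delta pi g Delta.
Hypothesis hh : is_h pi h.
Local Notation gens := (gens pi g h).
Local Notation gG := (gG pi g).
Local Notation kap := (kap pi).

Let ev z P : K := ev3 (fpsC (g z)) (fpsC (h z)) (s2 z) P.

(** For n >= 4 there are at least m^4 monomials in the x_i with exponents below m, while their
    expressions in g, h and s_2 have total degree at most n D m and thus at most (n D m + 1)^3
    coefficients. *)
Lemma dim_le n (x : 'I_n -> Omega -> fps C) : (forall i, Talg gens (x i)) -> alg_indep x -> (n <= 3)%N.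
Proof.
move=> hx ind; rewrite leqNgt; apply/negP => n4.
have /boolp.choice[P0 HP0] : forall i, exists P : p3, (exists D, tdeg_le D P) /\ T3 P /\ forall z, x i z = ev z P.
  by move=> i; have [D [P [h1 h2 h3]]] := gens_polyform Ccomp Cclosed hpi (hx i); exists P; split; [exists D|split].
have /boolp.choice[D0 HD0] : forall i, exists D, tdeg_le D (P0 i) by move=> i; case: (HP0 i).
pose D := (\max_i D0 i)%N.
have HD i : tdeg_le D (P0 i) by apply: tdeg_le_mono (HD0 i); apply: leq_bigmax.
(* With m above (n D + 1)^3 one gets E^3 <= (n D + 1)^3 m^3 < m^4. *)
pose m := ((n * D + 1) ^ 3).+1; pose E := (n * D * m + 1)%N.
pose Q (e : {ffun 'I_n -> 'I_m}) : p3 := \prod_i P0 i ^+ e i.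
have TQ e : T3 (Q e).
  by rewrite /Q; apply: (big_ind (@T3 F R C)) => [|A B|i _]; [exact: T3_1|exact: T3_M|apply: T3_X; case: (HP0 i) => _ []].
have dQ e : tdeg_le (n * D * m) (Q e).
  have : forall s : seq 'I_n, tdeg_le (size s * (D * m)) (\prod_(i <- s) P0 i ^+ e i).
    elim=> [|i s IHs].
      by rewrite big_nil mul0n; exact: tdeg_le_1.
    rewrite big_cons /= mulSn; apply: tdeg_leM IHs; have hi := tdeg_leX (n := e i) (HD i).
    by apply: tdeg_le_mono hi; rewrite leq_mul2l ltnW ?orbT.
  move=> /(_ (enum 'I_n)); rewrite size_enum_ord mulnA big_enum /Q.
  by rewrite (eq_bigl xpredT).
have zQ e i j k : c3 (Q e) i j k != 0 -> [&& i < E, j < E & k < E]%N.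
  apply: contraNT => nE; apply/eqP/(dQ e); move: nE; rewrite /E; clear; lia.
have card : (E ^ 3 < #|{ffun 'I_n -> 'I_m}|)%N.
  rewrite card_ffun !card_ord.
  have aux (a b : nat) : (a ^ 3 < b)%N -> ((a * b) ^ 3 < b ^ 4)%N.
    move=> ab; rewrite expnMn (expnSr b 3) mulnC ltn_pmul2l // expn_gt0.
    by rewrite (leq_ltn_trans (leq0n _) ab).
  have Em : (E <= (n * D + 1) * m)%N by rewrite /E mulnDl mul1n leq_add2l.
  apply: leq_trans (leq_pexp2l (ltn0Sn _) n4); apply: leq_ltn_trans (aux _ _ (ltnSn _)).
  by rewrite leq_exp2r.
pose e_ (r : 'I_(E ^ 3).+1) : {ffun 'I_n -> 'I_m} := enum_val (widen_ord card r).
have e_inj : injective e_ by move=> r r' /enum_val_inj/(congr1 val) /= /val_inj.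
have Sa r j : Tpos (let: (i, j, k) := nth (0, 0, 0)%N (box E) j in c3 (Q (e_ r)) i j k).
  by case: (nth _ _ _) => -[i j'] k; apply: TQ.
have [v [Tv [r0 vr0] Hv]] := @fraction_free_dependence _ (@Tpos F R C) (Tpos0 C) (Tpos1 C)
  (@TposD F R C) (@TposM F R C) (@TposN F R C) (E ^ 3) _ Sa.
have rel : \sum_r mono3 (v r) 0 0 0 * Q (e_ r) = 0.
  apply: c3P => i j k; rewrite c3_sum {2}/c3 !coef0.
  under eq_bigr => r _ do rewrite c3_scale.
  have [/and3P[iE jE kE]|nE] := boolP [&& i < E, j < E & k < E]%N; last first.
    by apply: big1 => r _; rewrite [c3 _ _ _ _](_ : _ = 0) ?mulr0 //; apply/eqP; apply: contraNT nE; apply: zQ.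
  have mb := mem_box iE jE kE.
  have ib : (index (i, j, k) (box E) < E ^ 3)%N by rewrite -size_box index_mem.
  by have := Hv _ ib; rewrite (nth_index _ mb).
pose mn (e : {ffun 'I_n -> 'I_m}) : mpoly.multinom n := mpoly.Multinom [tuple (e i : nat) | i < n].
have mnE e i : mn e i = e i by rewrite mpoly.mnmE.
pose Pm : mpoly.mpoly n K := \sum_r v r *: mpoly.mpolyX K (mn (e_ r)).
have cPm mon : mpoly.mcoeff mon Pm = \sum_r v r * (mn (e_ r) == mon)%:R.
  rewrite /Pm raddf_sum; apply: eq_bigr => r _.
  transitivity (v r * mpoly.mcoeff mon (mpoly.mpolyX K (mn (e_ r)))); first exact: mpoly.mcoeffZ.
  by rewrite mpoly.mcoeffX.
have : Pm = 0.
  apply: ind => [mon|z].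
    rewrite cPm; apply: Tpos_sum => r _; apply: TposM => //.
    by case: (_ == _); [exact: Tpos1|exact: Tpos0].
  have := congr1 (ev z) rel; rewrite /ev ev3_sum ev3_0 => <-.
  rewrite /Pm raddf_sum; apply: eq_bigr => r _.
  transitivity (v r * mpoly.meval (fun i => x i z) (mpoly.mpolyX K (mn (e_ r)))); first exact: mpoly.mevalZ.
  rewrite mpoly.mevalX.
  rewrite ev3M ev3_mono !expr0 !mulr1; congr (_ * _).
  rewrite /Q /ev3 !horner_prod; apply: eq_bigr => i _; rewrite mnE !horner_exp.
  by case: (HP0 i) => _ [_ ->].
move=> /(congr1 (mpoly.mcoeff (mn (e_ r0)))); rewrite cPm mpoly.mcoeff0.
rewrite (bigD1 r0) //= eqxx mulr1 big1 ?addr0 => [/eqP|r rr0]; first by rewrite (negPf vr0).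
case: eqP => [E1|_]; last by rewrite mulr0.
case/eqP: rr0; apply: e_inj; apply/ffunP => i; apply: val_inj.
by have := congr1 (fun t : mpoly.multinom n => t i) E1; rewrite !mnE.
Qed.

End UpperBound.

Section LowerBound.
Variables (F : finFieldType) (R : realType) (C : valuedField F R).
Local Notation q := #|F|.
Local Notation evA := (@evA F R C).
Local Notation bar := (@bar F R C).
Local Notation Omega := (Omega C).
Local Notation s1 := (@s1 F R C).
Local Notation s2 := (@s2 F R C).
Local Notation K := (fps C).
Local Notation p3 := {poly {poly {poly K}}}.
Implicit Types (z w : Omega) (f : Omega -> fps C) (P Q : p3).
Hypothesis Ccomp : Ccomplete C.
Hypothesis Cclosed : GRing.closed_field_axiom C.
Variable pi : C.
Hypothesis hpi : is_period pi.
Variables g Delta h : Omega -> C.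
Hypothesis hg : is_g_Delta pi g Delta.
Hypothesis hh : is_h pi h.
Local Notation gens := (gens pi g h).
Local Notation gG := (gG pi g).
Local Notation kap := (kap pi).

Definition basis3 (i : 'I_3) : Omega -> fps C :=
  if (i : nat) is k.+1 then hvec pi h k else fun z => fpsC (g z).

(** Gamma multiplies each monomial by a monomial in J and bold J, so a relation splits according to
    the two exponents. In one part the lowest power of h is divided out; at the cusp, where h
    vanishes and g does not, only the monomial with that power survives. *)
Lemma basis3_indep : alg_indep basis3.
Proof.
move=> P TP Pz; apply/eqP/negPn/negP => nP.
pose i0 : 'I_3 := ord0; pose i1 : 'I_3 := lift ord0 ord0; pose i2 : 'I_3 := ord_max.
(* The exponent of J: g, h_0 and h_1 have weights q - 1, q + 1 and q in J. *)
pose wt (mon : mpoly.multinom 3) := ((q - 1) * mon i0 + q.+1 * mon i1 + q * mon i2)%N.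
pose b3 z (mon : mpoly.multinom 3) : K := fpsC (g z) ^+ mon i0 * fpsC (h z) ^+ mon i1 * (kap * (fpsC (h z) * s2 z)) ^+ mon i2.
have prodE z (mon : mpoly.multinom 3) : \prod_i basis3 i z ^+ mon i = b3 z mon.
  rewrite !big_ord_recl big_ord0 mulr1 /b3 /basis3 /= !hvecE !expr0 expr1 mulr1 mul1r mulrA.
  by congr (_ * _ * _ ^+ mon _); apply: val_inj.
have key z (c k : nat) : \sum_(mon <- mpoly.msupp P | (mon i2 == c) && (wt mon == k)) mpoly.mcoeff mon P * b3 z mon = 0.
  have E : \sum_(mon <- mpoly.msupp P) mono3 (mpoly.mcoeff mon P * b3 z mon) 0 (mon i2) (wt mon) = 0.
    apply: (@J_Y_eq0 F R C z) => d e.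
    have ug := gck_unit d e; have [w gzw] := moebius_ex z ug.
    have := Pz w; rewrite mpoly.mevalE => <-; rewrite ev3_sum; apply: eq_bigr => mon _.
    rewrite prodE ev3_mono expr0 mulr1 -[_ * b3 z mon * _ * _]mulrA -[_ * b3 z mon * (_ * _)]mulrA; congr (_ * _).
    have h1 := hs2_moebius Ccomp hg hh (isT : (1 <= q.+1)%N) ug gzw.
    have h0 := h_moebius hh ug gzw; have g0 := g_moebius Ccomp Cclosed hpi hg ug gzw.
    rewrite !expr1 gck_det rmorph1 invr1 rmorph1 mul1r gck_J gck_Y subn1 /= in h1.
    rewrite gck_det rmorph1 invr1 mulr1 in h0.
    rewrite /b3 h1 h0 g0 !rmorphM !rmorphXn /= gck_J /wt.
    move: (fpsC (evA d * _ + _)) (bar d * _ + _) => J Y; move: kap => kp.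
    set hs := fpsC (h z) * s2 z; clearbody hs.
    move: (fpsC (g z)) (fpsC (h z)) (mon i0) (mon i1) (mon i2) => gz hz a b c'.
    rewrite (exprD J ((q - 1) * a + q.+1 * b)) (exprD J ((q - 1) * a)) !exprM !exprMn.
    move: (_ ^+ a) (_ ^+ b) (gz ^+ a) (hz ^+ b) (kp ^+ c') (hs ^+ c') (_ ^+ c') (Y ^+ c') => *; ring.
  have := congr1 (fun p => c3 p 0 c k) E; rewrite c3_sum {2}/c3 !coef0 => E'; rewrite -[RHS]E'.
  rewrite big_mkcond; apply: eq_bigr => mon _; rewrite c3_mono /= [c == _]eq_sym [k == _]eq_sym.
  by case: ifP.
have [m0 m0P] : exists mon : mpoly.multinom 3, mon \in mpoly.msupp P.
  case E : (mpoly.msupp P) => [|mon s]; last by exists mon; rewrite inE eqxx.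
  by case/eqP: nP; rewrite [P]mpoly.mpolyE E big_nil.
pose SS := [seq mon : mpoly.multinom 3 <- mpoly.msupp P | (mon i2 == m0 i2) && (wt mon == wt m0)].
have m0S : m0 \in SS by rewrite mem_filter !eqxx m0P.
have sS : SS != [::] by apply/eqP => E; rewrite E in m0S.
have [m1 m1S min1] := seq_argmin (fun mon : mpoly.multinom 3 => (mon i1)%:Z) sS.
have [cg [Bg [xg [cg0 ug Hg xg0]]]] := gG_cusp Ccomp Cclosed hpi hg hh.
have gE z : g z = (pi ^+ (q - 1))^-1 * gG z := gGg Ccomp Cclosed hpi g z.
have pi0 := pi_neq0 Ccomp Cclosed hpi.
pose y := (pi ^+ (q - 1))^-1 * xg.
have y0 : y != 0 by rewrite mulf_neq0 // invr_neq0 // expf_neq0.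
have Hgy : cuspval pi g y.
  by apply: cuspval_ext (cuspvalM (cuspvalC pi _) Hg) => z; rewrite gE.
have [_ _ [_ [_ ch0 _]]] := ub_h Ccomp Cclosed hpi hh.
have red z i : \sum_(mon <- SS) fcoef (mpoly.mcoeff mon P) i * (g z ^+ mon i0 * h z ^+ (mon i1 - m1 i1)) = 0.
  have := key z (m0 i2) (wt m0); rewrite -big_filter -/SS => E.
  have uh : fpsC (h z) \is a GRing.unit by rewrite fps_unitE fcoefC mulr1n (h_neq0 Ccomp Cclosed hpi hg hh).
  pose v := fpsC (h z) ^+ m1 i1 * (kap * (fpsC (h z) * s2 z)) ^+ m0 i2.
  have uv : v \is a GRing.unit.
    have uk := kap_unit Ccomp Cclosed hpi.
    have ut : kap * (fpsC (h z) * s2 z) \is a GRing.unit by rewrite unitrM uk unitrM uh (s2_unit Ccomp).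
    by rewrite /v unitrM (unitrX _ uh) (unitrX _ ut).
  have E2 : v * \sum_(mon <- SS) mpoly.mcoeff mon P * fpsC (g z ^+ mon i0 * h z ^+ (mon i1 - m1 i1)) = 0.
    rewrite -[RHS]E mulr_sumr; rewrite big_seq [RHS]big_seq; apply: eq_bigr => mon monS.
    have := min1 mon monS; rewrite lez_nat => le.
    move: monS; rewrite mem_filter => /andP[/andP[/eqP e2 _] _].
    have hE : fpsC (h z) ^+ mon i1 = fpsC (h z) ^+ m1 i1 * fpsC (h z) ^+ (mon i1 - m1 i1).
      by rewrite -exprD subnKC.
    have -> : fpsC (g z ^+ mon i0 * h z ^+ (mon i1 - m1 i1)) = fpsC (g z) ^+ mon i0 * fpsC (h z) ^+ (mon i1 - m1 i1).
      by rewrite rmorphM !rmorphXn.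
    rewrite /b3 e2 /v hE.
    set t := (kap * _) ^+ _; clearbody t.
    move: (fpsC (g z) ^+ _) (fpsC (h z) ^+ m1 i1) (fpsC (h z) ^+ (_ - _)) (mpoly.mcoeff _ _) => *; ring.
  have : \sum_(mon <- SS) mpoly.mcoeff mon P * fpsC (g z ^+ mon i0 * h z ^+ (mon i1 - m1 i1)) = 0.
    by apply: (mulrI uv); rewrite E2 mulr0.
  move=> /(congr1 (fun r => fcoef r i)); rewrite fcoef_sum fcoef0 => E3; rewrite -[RHS]E3.
  by apply: eq_bigr => mon _; rewrite [mpoly.mcoeff mon P * _]mulrC fcoefCM mulrC.
have csum i : forall s : seq (mpoly.multinom 3), cuspval pi
    (fun z => \sum_(mon <- s) fcoef (mpoly.mcoeff mon P) i * (g z ^+ mon i0 * h z ^+ (mon i1 - m1 i1)))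
    (\sum_(mon <- s) fcoef (mpoly.mcoeff mon P) i * (y ^+ mon i0 * 0 ^+ (mon i1 - m1 i1))).
  elim=> [|mon s IHs].
    by rewrite big_nil; apply: cuspval_ext (cuspvalC pi 0) => z; rewrite big_nil.
  rewrite big_cons; apply: cuspval_ext (cuspvalD (cuspvalM (cuspvalC pi (fcoef (mpoly.mcoeff mon P) i))
    (cuspvalM (cuspvalX (mon i0) Hgy) (cuspvalX (mon i1 - m1 i1) ch0))) IHs) => z.
  by rewrite big_cons.
have m1s : m1 \in mpoly.msupp P by move: m1S; rewrite mem_filter => /andP[].
move: (m1s); rewrite mpoly.mcoeff_msupp => /eqP; apply; apply: fpsP => i; rewrite fcoef0.
have c0 : cuspval pi (fun z => \sum_(mon <- SS) fcoef (mpoly.mcoeff mon P) i * (g z ^+ mon i0 * h z ^+ (mon i1 - m1 i1))) 0.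
  by apply: cuspval_ext (cuspvalC pi 0) => z; rewrite red.
have := cuspval_unique Ccomp Cclosed hpi (csum i SS) c0.
have uS : uniq SS by rewrite filter_uniq // mpoly.msupp_uniq.
rewrite (bigD1_seq m1) //= subnn expr0 mulr1 big_seq_cond big1 ?addr0 => [/eqP|mon /andP[monS nm]].
  by rewrite mulf_eq0 expf_eq0 (negPf y0) andbF orbF => /eqP.
have := min1 mon monS; rewrite lez_nat leq_eqVlt => /orP[/eqP e1|lt]; last first.
  by rewrite expr0n subn_eq0 leqNgt lt !mulr0.
case/eqP: nm; move: monS m1S; rewrite !mem_filter => /andP[/andP[/eqP a2 /eqP aw] _] /andP[/andP[/eqP b2 /eqP bw] _].
have q1 : (0 < q - 1)%N by rewrite subn_gt0 q_gt1.
(* With equal exponents of h_0 and h_1, equal weights leave equal multiples of q - 1 > 0. *)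
have e0 : mon i0 = m1 i0.
  have := etrans aw (esym bw); rewrite /wt a2 b2 e1 => /addIn/addIn/eqP.
  by rewrite eqn_pmul2l // => /eqP.
apply/mpoly.mnmP => j; have [->|[->|->]] : j = i0 \/ j = i1 \/ j = i2.
  by case: j => -[|[|[|//]]] lj; [left|right; left|right; right]; apply: val_inj.
- exact: e0.
- by rewrite e1.
- by rewrite a2 b2.
Qed.

End LowerBound.

(** * Finite generation and dimension of the algebra of A-modular forms *)

Section Conclusion.
Variables (F : finFieldType) (R : realType) (C : valuedField F R).
Local Notation q := #|F|.
Local Notation evA := (@evA F R C).
Local Notation bar := (@bar F R C).
Local Notation Omega := (Omega C).
Local Notation s1 := (@s1 F R C).
Local Notation s2 := (@s2 F R C).
Local Notation K := (fps C).
Local Notation p3 := {poly {poly {poly K}}}.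
Implicit Types (z w : Omega) (f : Omega -> fps C) (P Q : p3).
Hypothesis Ccomp : Ccomplete C.
Hypothesis Cclosed : GRing.closed_field_axiom C.
Variable pi : C.
Hypothesis hpi : is_period pi.
Variables g Delta h : Omega -> C.
Hypothesis hg : is_g_Delta pi g Delta.
Hypothesis hh : is_h pi h.
Local Notation gens := (gens pi g h).
Local Notation gG := (gG pi g).
Local Notation kap := (kap pi).

Hypothesis MMg : MM pi = Talg gens.

Lemma MM_dim : has_dim (MM pi) 3.
Proof.
rewrite MMg; split; last by move=> n x hx ind; apply: (dim_le Ccomp Cclosed hpi hx ind).
exists (basis3 pi g h); split; last exact: (basis3_indep Ccomp Cclosed hpi hg hh).
move=> [[|[|[|//]]] li]; apply: Talg_sub; first by left.
  by right; exists 0%N.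
by right; exists 1%N => //=; exact: q_gt0.
Qed.

Lemma MM_fin_gen : Tfin_gen (MM pi).
Proof.
exists gens; last exact: MMg.
rewrite finite_setU; split; first exact: finite_set1.
by apply: finite_image; apply: sub_finite_set (finite_II q.+1) => i.
Qed.

End Conclusion.

Theorem theorem4p11 (F : finFieldType) (R : realType) (C : valuedField F R)
    (hC : is_completed_closure C)
    (pi : C) (hpi : is_period pi)
    (g Delta h : Omega C -> C)
    (hg : is_g_Delta pi g Delta) (hh : is_h pi h) :
  [/\ Tfin_gen (MM pi),
      has_dim (MM pi) 3 &
      MM pi = Talg ([set (fun z => fpsC (g z))] `|`
                    [set hvec pi h i | i in [set i : nat | (i <= #|F|)%N]])].
Proof.
case: hC => Ccomp Cclosed _.
have MMg := MM_gens Ccomp Cclosed hpi hg hh.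
split; [exact: MM_fin_gen MMg|exact: (MM_dim Ccomp Cclosed hpi hg hh MMg)|exact: MMg].
Qed.
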